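(* Let $d\ge1$ and $1<p<\infty$. Then for every $\alpha$ with $0<\alpha<\frac{d+1}p$ there is a constant $C>0$ such that for any $f\in C_0^\infty(\mathbb R^{d+1})$, $$\big\||z|^{-\alpha}f(z)\big\|_{L^p(\mathbb R^{d+1})}\le C\,\|H_{\mathrm{par}}^{\alpha/2}f\|_{L^p(\mathbb R^{d+1})}.$$ In particular, when $1<p<d+1$, there is a constant $C>0$ such that for any $f\in C_0^\infty(\mathbb R^{d+1})$, $$\big\||z|^{-1}f(z)\big\|_{L^p(\mathbb R^{d+1})}\le C\,\|\nabla_{H_{\mathrm{par}}}f\|_{L^p(\mathbb R^{d+1})}.$$
   Context: Write $z=(\rho,x)\in\mathbb R\times\mathbb R^d$. The partial harmonic oscillator is $H_{\mathrm{par}}=-\partial_\rho^2-\Delta_x+|x|^2$ on $\mathbb R^{d+1}$. For $s\in\mathbb R$ and $f\in C_0^\infty(\mathbb R^{d+1})$, $H_{\mathrm{par}}^{s}f(\rho,x)=\sum_{k\ge0}\frac1{\sqrt{2\pi}}\int_{\mathbb R}e^{i\rho\tau}(\tau^2+2k+d)^{s}P_k(\mathcal F_\rho f)(\tau,x)\,d\tau$, where $\mathcal F_\rho f(\tau,x)=(2\pi)^{-1/2}\int_{\mathbb R}e^{-i\rho\tau}f(\rho,x)\,d\rho$ and $P_k$ is the spectral projection (in $x$) of $-\Delta_x+|x|^2$ on $L^2(\mathbb R^d)$ onto its eigenspace with eigenvalue $2k+d$. First order operators: $A_0=-\partial_\rho$, and for $1\le j\le d$, $A_j=-\partial_{x_j}+x_j$,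 $A_{-j}=A_j^*=\partial_{x_j}+x_j$. The associated gradient is $\nabla_{H_{\mathrm{par}}}f=(A_0f,A_1f,\dots,A_df,A_{-1}f,\dots,A_{-d}f)$, and $\|\nabla_{H_{\mathrm{par}}}f\|_{L^p}=\sum_{-d\le j\le d}\|A_jf\|_{L^p}$. *)

(* Defs.v *)
From HB Require Import structures.
From mathcomp Require Import all_boot all_order all_algebra.
From mathcomp Require Import complex.
From mathcomp Require Import all_classical all_reals all_analysis.

Set Implicit Arguments.
Unset Strict Implicit.
Unset Printing Implicit Defensive.

Import Order.TTheory GRing.Theory Num.Theory.
Import numFieldNormedType.Exports.

Local Open Scope classical_set_scope.
Local Open Scope ring_scope.
Local Open Scope complex_scope.

Section tuple_measure.
Local Open Scope ereal_scope.
Context d (T : measurableType d) (R : realType).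
Variable m : {sigma_finite_measure set T -> \bar R}.

Definition tcons n (u : T * n.-tuple T) : n.+1.-tuple T :=
  [tuple of u.1 :: u.2].

Lemma measurable_tcons n : measurable_fun [set: T * n.-tuple T] (@tcons n).
Proof. exact: measurable_cons. Qed.

Section step.
Context n (mu : {sigma_finite_measure set (n.-tuple T) -> \bar R}).

Definition cons_measure : set (n.+1.-tuple T) -> \bar R :=
  pushforward (m \x mu) (@tcons n).

Let cons_measure0 : cons_measure set0 = 0.
Proof. by rewrite /cons_measure /pushforward preimage_set0 measure0. Qed.

Let cons_measure_ge0 A : 0 <= cons_measure A.
Proof. by rewrite /cons_measure /pushforward; exact: measure_ge0. Qed.

Let cons_measure_sigma_additive : semi_sigma_additive cons_measure.
Proof.
move=> F mF tF mUF; rewrite /cons_measure /pushforward preimage_bigcup.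
have mtF B : measurable B -> measurable (@tcons n @^-1` B).
  by move=> mB; rewrite -[X in measurable X]setTI; exact: measurable_tcons.
apply: measure_semi_sigma_additive => [i||]; first exact: mtF.
- apply/trivIsetP => /= i j _ _ ij; rewrite -preimage_setI.
  by move/trivIsetP : tF => /(_ _ _ _ _ ij) ->//; rewrite preimage_set0.
- by rewrite -preimage_bigcup; exact: mtF.
Qed.

HB.instance Definition _ := isMeasure.Build _ _ _
  cons_measure cons_measure0 cons_measure_ge0 cons_measure_sigma_additive.

Let cons_measure_sigma_finite : sigma_finite setT cons_measure.
Proof.
have /sigma_finiteP[F [TF ndF mF]] := sigma_finiteT m.
have /sigma_finiteP[G [TG ndG mG]] := sigma_finiteT mu.
pose g (t : n.+1.-tuple T) : T * n.-tuple T := (thead t, [tuple of behead t]).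
have mg : measurable_fun setT g.
  apply: measurable_fun_pair; first exact: measurable_tnth.
  exact: measurable_behead.
have tconsK : g \o @tcons n = id.
  apply/funext => -[x t]; rewrite /g /tcons /= theadE.
  by congr pair; exact/val_inj.
exists (fun i => g @^-1` (F i `*` G i)).
  rewrite -preimage_bigcup (_ : \bigcup_i _ = setT) ?preimage_setT//.
  apply/seteqP; split => // -[x t] _.
  have [i _ Fx] : (\bigcup_i F i) x by rewrite -TF.
  have [j _ Gt] : (\bigcup_i G i) t by rewrite -TG.
  exists (maxn i j) => //; split.
  - by move: x Fx; exact/subsetPset/ndF/leq_maxl.
  - by move: t Gt; exact/subsetPset/ndG/leq_maxr.
move=> i; have [mFi Fioo] := mF i; have [mGi Gioo] := mG i; split.
  by rewrite -[X in measurable X]setTI; apply: mg => //; exact: measurableX.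
rewrite /cons_measure /pushforward -comp_preimage tconsK preimage_id.
by rewrite product_measure1E// lte_mul_pinfty// ge0_fin_numE.
Qed.

HB.instance Definition _ := Measure_isSigmaFinite.Build _ _ _
  cons_measure cons_measure_sigma_finite.

End step.

Fixpoint tuple_measure n : {sigma_finite_measure set (n.-tuple T) -> \bar R} :=
  match n with
  | 0%N => @dirac _ (0.-tuple T) [tuple] R
  | k.+1 => cons_measure (tuple_measure k)
  end.

End tuple_measure.

Section smooth.
Context {R : realType} {V : normedModType R}.

Definition iter_derive (vs : seq V) (f : V -> R) : V -> R :=
  foldr (fun v g => 'D_v g) f vs.

Definition smooth (f : V -> R) : Prop :=
  forall vs : seq V, continuous (iter_derive vs f) /\
    forall z v, derivable (iter_derive vs f) z v.

Definition csmooth (f : V -> R[i]) : Prop :=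
  smooth (fun z => complex.Re (f z)) /\ smooth (fun z => complex.Im (f z)).

Definition test_function (f : V -> R[i]) : Prop :=
  csmooth f /\ compact (closure [set z | f z != 0]).

Definition cderive (v : V) (f : V -> R[i]) (z : V) : R[i] :=
  'D_v (fun z => complex.Re (f z)) z +i* 'D_v (fun z => complex.Im (f z)) z.

End smooth.

Section complex_analysis.
Context {R : realType}.

(* the modulus as a real number (the norm of R[i] is R[i]-valued) *)
Definition cmod (z : R[i]) : R := complex.Re `|z|.

Definition cis (t : R) : R[i] := cos t +i* sin t.

Definition cintegral d (T : measurableType d) (mu : {measure set T -> \bar R})
    (f : T -> R[i]) : R[i] :=
  (\int[mu]_x complex.Re (f x)) +i* (\int[mu]_x complex.Im (f x)).

Definition climn (u : nat -> R[i]) : R[i] :=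
  limn (fun n => complex.Re (u n)) +i* limn (fun n => complex.Im (u n)).

End complex_analysis.

Section euclidean.
Context {R : realType} (d : nat).
Local Notation MR := (measurableTypeR R).

(* Lebesgue measure lives on tuples, differential calculus on row vectors;
   row_of_tuple transports functions from the latter to the former. *)
Definition row_of_tuple (t : d.-tuple MR) : 'rV[R]_d :=
  \row_(i < d) (tnth t i : R).

Definition leb : {measure set (d.-tuple MR) -> \bar R} :=
  tuple_measure (@lebesgue_measure R) d.

Definition leb_prod : {measure set (MR * d.-tuple MR) -> \bar R} :=
  (@lebesgue_measure R \x leb)%E.

(* squared Euclidean norm: the library norm on 'rV_d is the sup norm *)
Definition sqnorm (x : 'rV[R]_d) : R := \sum_(j < d) x 0 j ^+ 2.

Definition znorm (z : R * 'rV[R]_d) : R := Num.sqrt (z.1 ^+ 2 + sqnorm z.2).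

Definition Lp (p : R) (f : R * 'rV[R]_d -> R[i]) : \bar R :=
  Lnorm leb_prod p%:E (fun t => (cmod (f (t.1, row_of_tuple t.2)))%:E).

End euclidean.

Section hermite_projection.
Context {R : realType} (d : nat).
Implicit Types (u g h : 'rV[R]_d -> R[i]) (x : 'rV[R]_d).

Definition L2 u : Prop :=
  (Lnorm (leb d) 2%:E (fun t => (cmod (u (row_of_tuple t)))%:E) < +oo)%E.

Definition inner g h : R[i] :=
  cintegral (leb d) (fun t => g (row_of_tuple t) * (h (row_of_tuple t))^*).

Definition laplacian u x : R[i] :=
  \sum_(j < d) cderive (delta_mx 0 j) (cderive (delta_mx 0 j) u) x.

Definition hermite_op u x : R[i] := - laplacian u x + (sqnorm x)%:C * u x.

(* By elliptic regularity every L^2 eigenfunction has a smooth representative,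
   so eigenspaces are taken among smooth functions; this makes the pointwise
   values of spectral_proj k g meaningful. *)
Definition eigenspace_hermite (k : nat) : set ('rV[R]_d -> R[i]) :=
  [set u | [/\ csmooth u, L2 u &
    forall x, hermite_op u x = (2 * k + d)%:R * u x]].

(* Orthogonal projection of g onto the (finite-dimensional) eigenspace: the
   unique h in it such that g - h is orthogonal to it. *)
Definition spectral_proj (k : nat) g : 'rV[R]_d -> R[i] :=
  xget (fun=> 0) [set h | eigenspace_hermite k h /\
    forall u, eigenspace_hermite k u -> inner (fun x => g x - h x) u = 0].

End hermite_projection.

Section partial_harmonic_oscillator.
Context {R : realType} (d : nat).
Implicit Types (f : R * 'rV[R]_d -> R[i]) (z : R * 'rV[R]_d).

Definition fourier_rho f (tau : R) (x : 'rV[R]_d) : R[i] :=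
  ((Num.sqrt (2 * pi))^-1)%:C *
  cintegral (@lebesgue_measure R) (fun rho => cis (- (rho * tau)) * f (rho, x)).

Definition Hpar_pow (s : R) f z : R[i] :=
  climn (fun n => \sum_(0 <= k < n)
    ((Num.sqrt (2 * pi))^-1)%:C *
    cintegral (@lebesgue_measure R) (fun tau =>
      cis (z.1 * tau) * ((tau ^+ 2 + (2 * k + d)%:R) `^ s)%:C *
      spectral_proj k (fourier_rho f tau) z.2)).

Definition A_zero f z : R[i] := - cderive ((1, 0) : R * 'rV[R]_d) f z.

Definition A_plus (j : 'I_d) f z : R[i] :=
  - cderive ((0, delta_mx 0 j) : R * 'rV[R]_d) f z + (z.2 0 j)%:C * f z.

Definition A_minus (j : 'I_d) f z : R[i] :=
  cderive ((0, delta_mx 0 j) : R * 'rV[R]_d) f z + (z.2 0 j)%:C * f z.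

Definition Lp_grad (p : R) f : \bar R :=
  (Lp p (A_zero f) + \sum_(j < d) Lp p (A_plus j f)
                   + \sum_(j < d) Lp p (A_minus j f))%E.

End partial_harmonic_oscillator.

(* Main.v *)
(* Let heat t be the kernel of exp(- t^2 H_par / 4).  By Mehler's formula it is
   a positive product of one-variable kernels dominated by the Gaussian
   Gam t (z - w), and it multiplies the spectral component of eigenvalue
   lambda by exp(- t^2 lambda / 4).  Integrating in t,
     K lambda^(- alpha / 2) = int_0^oo t^(alpha - 1) exp(- t^2 lambda / 4) dt,
   so |f| <= C I_alpha |H_par^(alpha/2) f|, where I_alpha, the Gaussians
   averaged against t^(alpha - 1) dt, is a multiple of the Riesz kernel
   |z|^(alpha - d - 1).  All series and integrals converge absolutely for a test
   function, because powers of H_par can be moved onto it by parts and Hermite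
   functions grow only polynomially in their degree.

   Averaging f(z) = - int_0^oo D_w f(z + s w) ds over w against a Gaussian gives
   likewise |f| <= C I_1 |grad f|, and every partial derivative is a combination
   of A_j and A_-j.

   Both inequalities thus reduce to the L^p boundedness of |z|^(- alpha) I_alpha
   for alpha p < d + 1 (Stein-Weiss): a Schur test with power weights, in which
   I_alpha * I_gamma = B I_(alpha + gamma) follows from the convolution of
   Gaussians. *)

From HB Require Import structures.
Require Import Defs.
From mathcomp Require Import all_boot all_order all_algebra.
From mathcomp Require Import complex.
From mathcomp Require Import all_classical all_reals all_analysis.
From mathcomp Require Import measurable_realfun.
From mathcomp Require Import ring lra.

Set Implicit Arguments.
Unset Strict Implicit.
Unset Printing Implicit Defensive.

Import Order.TTheory GRing.Theory Num.Theory.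
Import numFieldNormedType.Exports.

Local Open Scope classical_set_scope.
Local Open Scope ring_scope.

(** * Integration *)

(** [spectral_proj] is defined by choice among arbitrary smooth square integrable eigenfunctions, so
    its value must be pinned down without knowing that the Hermite functions exhaust an eigenspace.
    Two facts replace completeness: an eigenfunction is orthogonal to every Hermite function of
    another level (Green's identity with a cut-off, as the eigenfunction itself comes with no
    pointwise decay), and the Mehler kernel is an approximate identity. Testing the heat flow of a
    function against an eigenfunction leaves a single level, and letting the time tend to 0 gives
    the orthogonality that characterizes the projection. The same limit yields the inversion of the
    spectral expansion of a test function; neither Plancherel's theorem nor a functional calculus
    enters. The time t^2 / 4 is adapted to the Gaussian: [gauss t] is a normalized exp(- y^2 / t^2),
    its Fourier transform is exp(- t^2 tau^2 / 4), and widths add in squares under convolution.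
    Complex functions are split into real and imaginary parts, and complex exponentials into cosines
    with a phase. *)

Section Lebesgue_integrable_functions.
Context {dd : measure_display} {T : measurableType dd} {R : realType}.
Variable mu : {measure set T -> \bar R}.
Implicit Types F G : T -> R.

Definition L1 F := mu.-integrable setT (EFin \o F).

Lemma L1_meas F : L1 F -> measurable_fun setT F.
Proof. by case/integrableP => /measurable_EFinP. Qed.

Lemma L1_le F G : measurable_fun setT F -> L1 G -> (forall x, `|F x| <= G x) -> L1 F.
Proof.
move=> mF iG FG; apply: le_integrable iG => //; first exact/measurable_EFinP.
by move=> x _ /=; rewrite lee_fin (le_trans (FG x))// ler_norm.
Qed.

Lemma L1_ext F G : F =1 G -> L1 F -> L1 G.
Proof. by move/funext => ->. Qed.

Lemma L1_0 : L1 (fun=> 0).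
Proof. exact: integrable0. Qed.

Lemma L1D F G : L1 F -> L1 G -> L1 (fun x => F x + G x).
Proof. by move=> iF iG; apply: eq_integrable (integrableD _ iF iG). Qed.

Lemma L1Z c F : L1 F -> L1 (fun x => c * F x).
Proof. by move=> iF; apply: eq_integrable (integrableZl _ c iF). Qed.

Lemma L1N F : L1 F -> L1 (fun x => - F x).
Proof. by move=> iF; apply: eq_integrable (integrableN iF). Qed.

Lemma L1B F G : L1 F -> L1 G -> L1 (fun x => F x - G x).
Proof. by move=> iF iG; apply: L1D => //; exact: L1N. Qed.

Lemma L1_sum I (s : seq I) (P : pred I) (F : I -> T -> R) :
  (forall i, P i -> L1 (F i)) -> L1 (fun x => \sum_(i <- s | P i) F i x).
Proof.
move=> iF; elim: s => [|i s IH].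
  by apply: L1_ext L1_0 => x; rewrite big_nil.
have [Pi|Pi] := boolP (P i).
  by apply: L1_ext (L1D (iF i Pi) IH) => x; rewrite big_cons Pi.
by apply: L1_ext IH => x; rewrite big_cons (negbTE Pi).
Qed.

Lemma L1_norm F : L1 F -> L1 (fun x => `|F x|).
Proof. by move=> /integrable_norm. Qed.

Lemma L1_ltoo F : measurable_fun setT F ->
  (\int[mu]_x `|F x|%:E < +oo)%E -> L1 F.
Proof. by move=> mF h; apply/integrableP; split => //; exact/measurable_EFinP. Qed.

Lemma intE F : L1 F -> (\int[mu]_x F x)%:E = (\int[mu]_x (F x)%:E)%E.
Proof. by move=> iF; rewrite /Rintegral fineK//; exact: integrable_fin_num. Qed.

Lemma intD F G : L1 F -> L1 G ->
  \int[mu]_x (F x + G x) = \int[mu]_x F x + \int[mu]_x G x.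
Proof. by move=> iF iG; rewrite RintegralD. Qed.

Lemma intB F G : L1 F -> L1 G ->
  \int[mu]_x (F x - G x) = \int[mu]_x F x - \int[mu]_x G x.
Proof. by move=> iF iG; rewrite RintegralB. Qed.

Lemma intZ c F : L1 F -> \int[mu]_x (c * F x) = c * \int[mu]_x F x.
Proof. by move=> iF; rewrite RintegralZl. Qed.

Lemma intN F : L1 F -> \int[mu]_x (- F x) = - \int[mu]_x F x.
Proof.
move=> iF; rewrite -mulN1r -intZ//; congr fine.
by apply: eq_integral => x _; rewrite mulN1r.
Qed.

Lemma int_ext F G : F =1 G -> \int[mu]_x F x = \int[mu]_x G x.
Proof. by move/funext => ->. Qed.

Lemma int0 : \int[mu]_x (0 : R) = 0.
Proof. by rewrite /Rintegral integral0. Qed.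

Lemma int_sum I (s : seq I) (P : pred I) (F : I -> T -> R) :
  (forall i, P i -> L1 (F i)) ->
  \int[mu]_x (\sum_(i <- s | P i) F i x) = \sum_(i <- s | P i) \int[mu]_x F i x.
Proof.
move=> iF; elim: s => [|i s IH].
  by rewrite big_nil -[RHS]int0; apply: int_ext => x; rewrite big_nil.
rewrite big_cons; case: ifPn => Pi.
  rewrite -IH -intD; [|exact: iF|exact: L1_sum].
  by apply: int_ext => x; rewrite big_cons Pi.
by rewrite -IH; apply: int_ext => x; rewrite big_cons (negbTE Pi).
Qed.

Lemma int_le F G : L1 F -> L1 G -> (forall x, F x <= G x) ->
  \int[mu]_x F x <= \int[mu]_x G x.
Proof. by move=> iF iG FG; apply: le_Rintegral. Qed.

Lemma int_abs_le F G : measurable_fun setT F -> L1 G -> (forall x, `|F x| <= G x) ->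
  `|\int[mu]_x F x| <= \int[mu]_x G x.
Proof.
move=> mF iG FG; have iF := L1_le mF iG FG.
by apply: le_trans (le_normr_Rintegral _ iF) _ => //; apply: int_le => //; exact: L1_norm.
Qed.

Lemma dominated_convergence_L1 (F_ : nat -> T -> R) F G :
  (forall n, measurable_fun setT (F_ n)) ->
  (forall x, F_ ^~ x @ \oo --> F x) -> L1 G ->
  (forall n x, `|F_ n x| <= G x) ->
  L1 F /\ (fun n => \int[mu]_x F_ n x) @ \oo --> \int[mu]_x F x.
Proof.
move=> mF F_F iG FG.
have mFlim : measurable_fun setT F by apply: (measurable_fun_cvg mF) => x _; exact: F_F.
have iF : L1 F.
  apply: (L1_le mFlim iG) => x.
  have : (fun n => `|F_ n x|) @ \oo --> `|F x| by apply: cvg_norm; exact: F_F.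
  move=> cn; rewrite -(cvg_lim _ cn)//; apply: limr_le; first exact: cvgP cn.
  exact: nearW.
split => //.
have iFn n : L1 (F_ n) by apply: (L1_le (mF n) iG).
apply: fine_cvg; rewrite intE//.
apply: (@dominated_cvg _ _ _ mu setT _ (fun n x => (F_ n x)%:E) _ (fun x => (G x)%:E)) => //.
- by move=> n; exact/measurable_EFinP.
- by move=> x _; apply: cvg_EFin; [exact: nearW|exact: F_F].
- by move=> n x _; rewrite lee_fin.
Qed.

End Lebesgue_integrable_functions.

Section product_integrals.
Context {d1 d2 : measure_display} {T1 : measurableType d1} {T2 : measurableType d2}.
Context {R : realType}.
Variables (m1 : {sigma_finite_measure set T1 -> \bar R})
          (m2 : {sigma_finite_measure set T2 -> \bar R}).

(** No integrability is assumed: the integrals of the positive and negative parts are measurable by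
    Tonelli, and the finite part of their difference is measurable whatever values occur. *)
Lemma measurable_param_int (F : T1 * T2 -> R) : measurable_fun setT F ->
  measurable_fun setT (fun x => \int[m2]_y F (x, y)).
Proof.
move=> mF; rewrite /Rintegral; apply: measurableT_comp => //.
have mE : measurable_fun setT (EFin \o F) by exact/measurable_EFinP.
rewrite (_ : (fun _ => _) = (fun x => \int[m2]_y (EFin \o F)^\+ (x, y) -
    \int[m2]_y (EFin \o F)^\- (x, y))%E); last first.
  apply/funext => x; rewrite integralE; congr (_ - _)%E;
  by apply: eq_integral => y _; rewrite ?funeposE ?funenegE.
apply: emeasurable_funB; apply: measurable_fun_fubini_tonelli_F => //.
  exact: measurable_funepos.
exact: measurable_funeneg.
Qed.

Section dominated.
Variables (F : T1 * T2 -> R) (a : T1 -> R) (b : T2 -> R).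
Hypotheses (mF : measurable_fun setT F) (ia : L1 m1 a) (ib : L1 m2 b).
Hypothesis Fab : forall x y, `|F (x, y)| <= a x * b y.

Let mE : measurable_fun setT (EFin \o F : T1 * T2 -> \bar R). Proof. exact/measurable_EFinP. Qed.

(** A majorant of product form, rather than bare integrability, makes every slice integrable and not
    just almost every one, so that the iterated real integrals can be exchanged without exceptional
    sets. *)
Lemma L1_prod : L1 (m1 \x m2)%E F.
Proof.
apply/integrable12ltyP => //=.
have h1 : (\int[m1]_x \int[m2]_y `|(F (x, y))%:E| <=
    \int[m1]_x ((`|a x|)%:E * \int[m2]_y `|(b y)%:E|))%E.
  apply: ge0_le_integral => //.
  - move=> x _; exact: integral_ge0.
  - apply: (@measurable_fun_fubini_tonelli_F _ _ _ _ _ m2 (fun z => `|(F z)%:E|%E)) => //.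
    exact: measurableT_comp.
  - apply: emeasurable_funM => //; apply/measurable_EFinP.
    by apply: measurableT_comp => //; exact: L1_meas ia.
  move=> x _; rewrite -ge0_integralZl//; last first.
    by apply: measurableT_comp => //; apply/measurable_EFinP; exact: L1_meas ib.
  apply: ge0_le_integral => //.
  - apply: measurableT_comp => //; apply: (measurableT_comp mE).
    exact: pair1_measurable.
  - apply: emeasurable_funM => //; apply: measurableT_comp => //.
    apply/measurable_EFinP; exact: L1_meas ib.
  by move=> y _; rewrite /= -EFinM lee_fin -normrM (le_trans (Fab x y))// ler_norm.
apply: (le_lt_trans h1).
have fb : (\int[m2]_y `|(b y)%:E| < +oo)%E by case/integrableP : ib.
have fa : (\int[m1]_y `|(a y)%:E| < +oo)%E by case/integrableP : ia.
rewrite ge0_integralZr//; last 2 first.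
- apply/measurable_EFinP; apply: measurableT_comp => //; exact: L1_meas ia.
- exact: integral_ge0.
by apply: lte_mul_pinfty => //; [exact: integral_ge0|rewrite ge0_fin_numE// integral_ge0].
Qed.

Lemma L1_inner x : L1 m2 (fun y => F (x, y)).
Proof.
apply: (@L1_le _ _ _ m2 _ (fun y => a x * b y)) => //; last exact: L1Z.
by apply: (measurableT_comp mF); exact: pair1_measurable.
Qed.

Lemma L1_inner2 y : L1 m1 (fun x => F (x, y)).
Proof.
apply: (@L1_le _ _ _ m1 _ (fun x => b y * a x)) => //.
- by apply: (measurableT_comp mF); exact: pair2_measurable.
- exact: L1Z.
- by move=> x; rewrite mulrC.
Qed.

Lemma L1_int : L1 m1 (fun x => \int[m2]_y F (x, y)).
Proof.
apply: (@L1_le _ _ _ m1 _ (fun x => (\int[m2]_y `|b y|) * `|a x|)).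
- exact: measurable_param_int.
- by apply: L1Z; exact: L1_norm.
move=> x; rewrite mulrC -intZ; last exact: L1_norm.
apply: int_abs_le.
- by apply: (measurableT_comp mF); exact: pair1_measurable.
- by apply: L1Z; exact: L1_norm.
by move=> y; rewrite -normrM (le_trans (Fab x y))// ler_norm.
Qed.

Lemma int_prod : \int[(m1 \x m2)%E]_z F z = \int[m1]_x \int[m2]_y F (x, y).
Proof.
rewrite {1}/Rintegral -integral12_prod_meas1; last exact: L1_prod.
by congr fine; apply: eq_integral => x _; rewrite /fubini_F intE//; exact: L1_inner.
Qed.

Lemma int_prod2 : \int[(m1 \x m2)%E]_z F z = \int[m2]_y \int[m1]_x F (x, y).
Proof.
rewrite {1}/Rintegral -integral21_prod_meas1; last exact: L1_prod.
by congr fine; apply: eq_integral => x _; rewrite /fubini_G intE//; exact: L1_inner2.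
Qed.

Lemma int_swap : \int[m1]_x \int[m2]_y F (x, y) = \int[m2]_y \int[m1]_x F (x, y).
Proof. by rewrite -int_prod int_prod2. Qed.

End dominated.

Section tensor.
Variables (a : T1 -> R) (b : T2 -> R).
Hypotheses (ia : L1 m1 a) (ib : L1 m2 b).

Let mab : measurable_fun setT (fun z : T1 * T2 => a z.1 * b z.2).
Proof.
apply: measurable_funM.
- by apply: (measurableT_comp (L1_meas ia)); exact: measurable_fst.
- by apply: (measurableT_comp (L1_meas ib)); exact: measurable_snd.
Qed.

Lemma L1_tensor : L1 (m1 \x m2)%E (fun z => a z.1 * b z.2).
Proof.
apply: (@L1_prod _ (fun x => `|a x|) (fun x => `|b x|)) => //=; try exact: L1_norm.
by move=> x y; rewrite normrM.
Qed.

Lemma int_tensor :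
  \int[(m1 \x m2)%E]_z (a z.1 * b z.2) = (\int[m1]_x a x) * (\int[m2]_y b y).
Proof.
rewrite (@int_prod _ (fun x => `|a x|) (fun x => `|b x|)) //=; try exact: L1_norm.
  rewrite mulrC -intZ//; apply: int_ext => x.
  by rewrite mulrC -intZ.
by move=> x y; rewrite normrM.
Qed.

End tensor.
End product_integrals.

(** * Measure-preserving maps and affine substitutions *)

Section measure_preserving_maps.
Context {dd : measure_display} {T : measurableType dd} {R : realType}.
Variable mu : {measure set T -> \bar R}.

(** Invariance is expressed through nonnegative integrals instead of measures of sets, so that it
    passes to products directly by Tonelli. *)
Definition mpres (th : T -> T) := measurable_fun setT th /\
  forall F : T -> \bar R, measurable_fun setT F -> (forall x, 0 <= F x)%E ->
  (\int[mu]_x F (th x) = \int[mu]_x F x)%E.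

Lemma mpres_integral th (F : T -> \bar R) : mpres th -> measurable_fun setT F ->
  (\int[mu]_x F (th x) = \int[mu]_x F x)%E.
Proof.
move=> [mth th_pres] mF; rewrite integralE [in RHS]integralE; congr (_ - _)%E.
  rewrite -(th_pres _ (measurable_funepos mF) (funepos_ge0 F)).
  by apply: eq_integral => x _; rewrite !funeposE.
rewrite -(th_pres _ (measurable_funeneg mF) (funeneg_ge0 F)).
by apply: eq_integral => x _; rewrite !funenegE.
Qed.

Lemma mpres_L1 th (F : T -> R) : mpres th -> L1 mu F -> L1 mu (F \o th).
Proof.
move=> mth iF; have mF := L1_meas iF.
apply: L1_ltoo; first exact: (measurableT_comp mF mth.1).
rewrite (mpres_integral (F := fun x => `|F x|%:E) mth).
  by case/integrableP : iF.
by apply/measurable_EFinP; apply: measurableT_comp.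
Qed.

Lemma mpres_int th (F : T -> R) : mpres th -> measurable_fun setT F ->
  \int[mu]_x F (th x) = \int[mu]_x F x.
Proof.
move=> mth mF; congr fine; rewrite (mpres_integral (F := EFin \o F))//.
exact/measurable_EFinP.
Qed.

End measure_preserving_maps.

Section affine_line.
Context {R : realType}.
Notation MR := (measurableTypeR R).
Notation lam := (@lebesgue_measure R).

Lemma measurable_affine (a b : R) : measurable_fun [set: R] (fun x : R => a * x + b).
Proof. exact: measurable_funD. Qed.

Let aff (a b : R) : MR -> MR := fun x => a * x + b.
Let maff a b : measurable_fun setT (aff a b). Proof. exact: measurable_affine. Qed.

(** The push-forward of Lebesgue measure under the affine map, rescaled by |a|, agrees with Lebesgue
    measure on half-open intervals, hence on all measurable sets by uniqueness. *)
Lemma ge0_integral_affine (a b : R) (F : R -> \bar R) : a != 0 ->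
  measurable_fun [set: R] F -> (forall x, 0 <= F x)%E ->
  (\int[lam]_x F (a * x + b)%R = `|a|^-1%:E * \int[lam]_x F x)%E.
Proof.
move=> a0 mF F0.
have na0 : 0 < `|a| by rewrite normr_gt0.
pose nna : {nonneg R} := NngNum (ltW na0).
pose nu : {measure set MR -> \bar R} := mscale nna (pushforward lam (aff a b)).
pose mu' := nu (maff a b).
have E (X : set R) : ocitv X -> lam X = mu' X.
  case=> -[c e] /= ce <-.
  rewrite /mu' /nu /mscale/= /pushforward.
  (* A negative slope exchanges the open and the closed end. *)
  have -> : aff a b @^-1` `]c, e]%classic =
      if 0 < a then `](c - b) / a, (e - b) / a]%classic else `[(e - b) / a, (c - b) / a[%classic.
    apply/seteqP; case: ifPn => [ap|ap]; split => x /=; rewrite /aff !in_itv/= => /andP[h1 h2];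
    apply/andP; split.
    - by rewrite ltr_pdivrMr// ltrBlDr mulrC.
    - by rewrite ler_pdivlMr// lerBrDr mulrC.
    - by move: h1; rewrite ltr_pdivrMr// ltrBlDr mulrC.
    - by move: h2; rewrite ler_pdivlMr// lerBrDr mulrC.
    - have {}ap : a < 0 by rewrite lt_neqAle a0 leNgt.
      by rewrite ler_ndivrMr// lerBrDr mulrC.
    - have {}ap : a < 0 by rewrite lt_neqAle a0 leNgt.
      by rewrite ltr_ndivlMr// ltrBlDr mulrC.
    - have {}ap : a < 0 by rewrite lt_neqAle a0 leNgt.
      by move: h2; rewrite ltr_ndivlMr// ltrBlDr mulrC.
    - have {}ap : a < 0 by rewrite lt_neqAle a0 leNgt.
      by move: h1; rewrite ler_ndivrMr// lerBrDr mulrC.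
  case: ifPn => [ap|ap].
    rewrite !lebesgue_measure_itv/= !lte_fin.
    rewrite ltr_pM2r ?invr_gt0// ltrD2r; case: ifPn => _; last by rewrite mule0.
    rewrite -!EFinB -EFinM; congr EFin.
    by rewrite gtr0_norm//; field.
  have {}ap : a < 0 by rewrite lt_neqAle a0 leNgt.
  rewrite !lebesgue_measure_itv/= !lte_fin.
  rewrite ltr_nM2r ?invr_lt0// ltrD2r; case: ifPn => _; last by rewrite mule0.
  rewrite -!EFinB -EFinM; congr EFin.
  by rewrite ltr0_norm//; field.
rewrite [in RHS](eq_measure_integral mu'); last by move=> A mA _; exact: lebesgue_measure_unique.
rewrite ge0_integral_mscale//= muleA -EFinM mulVf ?gt_eqF// mul1e.
rewrite ge0_integral_pushforward//.
Qed.

Lemma mpres_shift (b : R) : mpres lam (fun x : MR => x + b : MR).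
Proof.
split; first by move: (measurable_affine 1 b); congr measurable_fun; apply/funext => x; rewrite mul1r.
move=> F mF F0; under eq_integral do rewrite -[X in X + b]mul1r.
by rewrite ge0_integral_affine ?oner_eq0// normr1 invr1 mul1e.
Qed.

Lemma mpres_opp : mpres lam (fun x : MR => - x : MR).
Proof.
split.
  move: (@measurable_affine (-1) 0); congr measurable_fun.
  by apply/funext => x; rewrite mulN1r addr0.
move=> F mF F0; under eq_integral do rewrite -[X in F X]addr0 -mulN1r.
by rewrite ge0_integral_affine ?oppr_eq0 ?oner_eq0// normrN normr1 invr1 mul1e.
Qed.

End affine_line.

Section tuples.
Context {R : realType}.
Notation MR := (measurableTypeR R).
Notation lam := (@lebesgue_measure R).

Lemma tnth_tcons0 d (x : MR) (t : d.-tuple MR) : tnth (tcons (x, t)) ord0 = x.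
Proof. by []. Qed.

Lemma tnth_tconsS d (x : MR) (t : d.-tuple MR) j :
  tnth (tcons (x, t)) (lift ord0 j) = tnth t j.
Proof. exact: tnthS. Qed.

Lemma leb_ge0_cons d (F : d.+1.-tuple MR -> \bar R) :
  measurable_fun setT F -> (forall x, 0 <= F x)%E ->
  (\int[leb d.+1]_t F t = \int[lam \x leb d]_z F (tcons z))%E.
Proof.
move=> mF F0; rewrite [LHS](ge0_integral_pushforward (@measurable_tcons _ MR d))//.
Qed.

Lemma leb_ge0_cons2 d (F : d.+1.-tuple MR -> \bar R) :
  measurable_fun setT F -> (forall x, 0 <= F x)%E ->
  (\int[leb d.+1]_t F t = \int[lam]_x \int[leb d]_t F (tcons (x, t)))%E.
Proof.
move=> mF F0; rewrite leb_ge0_cons//.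
rewrite (@fubini_tonelli1 _ _ _ _ _ lam (leb d) (F \o @tcons _ MR d))//.
  by apply: (measurableT_comp mF); exact: measurable_tcons.
by move=> z; exact: F0.
Qed.

Lemma leb_L1_cons d (F : d.+1.-tuple MR -> R) : measurable_fun setT F ->
  L1 (lam \x leb d)%E (fun z => F (tcons z)) -> L1 (leb d.+1) F.
Proof.
move=> mF iF; apply: L1_ltoo => //; rewrite leb_ge0_cons//.
  by case/integrableP : iF.
by apply/measurable_EFinP; apply: measurableT_comp.
Qed.

Lemma leb_int_cons d (F : d.+1.-tuple MR -> R) : measurable_fun setT F ->
  \int[leb d.+1]_t F t = \int[(lam \x leb d)%E]_z F (tcons z).
Proof.
move=> mF; congr fine; rewrite integralE [in RHS]integralE.
have mE : measurable_fun setT (EFin \o F) by exact/measurable_EFinP.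
congr (_ - _)%E.
  etransitivity; first exact: (leb_ge0_cons (measurable_funepos mE) (funepos_ge0 _)).
  by apply: eq_integral => x _; rewrite !funeposE.
etransitivity; first exact: (leb_ge0_cons (measurable_funeneg mE) (funeneg_ge0 _)).
by apply: eq_integral => x _; rewrite !funenegE.
Qed.

Lemma leb0E (F : 0.-tuple MR -> \bar R) : (\int[leb 0]_t F t = F [tuple])%E.
Proof.
rewrite (_ : F = cst (F [tuple])); last by apply/funext => t; rewrite tuple0.
rewrite integral_cst// [X in (_ * X)%E](_ : _ = 1%E) ?mule1//.
by rewrite [LHS]/= diracT.
Qed.

Lemma measurable_prod_coords d (F : 'I_d -> R -> R) :
  (forall j, measurable_fun [set: R] (F j)) ->
  measurable_fun setT (fun t : d.-tuple MR => \prod_(j < d) F j (tnth t j)).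
Proof.
move=> mF; apply: measurable_prod => j _.
by apply: (measurableT_comp (mF j)); exact: measurable_tnth.
Qed.

Lemma prod_coords d (F : 'I_d -> R -> R) : (forall j, L1 lam (F j)) ->
  L1 (leb d) (fun t => \prod_(j < d) F j (tnth t j)) /\
  \int[leb d]_t (\prod_(j < d) F j (tnth t j)) = \prod_(j < d) \int[lam]_x F j x.
Proof.
elim: d F => [|d IH] F iF.
  split.
    apply: L1_ltoo.
      by apply: measurable_prod_coords => -[].
    by rewrite leb0E big_ord0 ltry.
  by rewrite /Rintegral leb0E !big_ord0.
have [IH1 IH2] := IH (fun j => F (lift ord0 j)) (fun j => iF _).
have mF : measurable_fun setT (fun t : d.+1.-tuple MR => \prod_(j < d.+1) F j (tnth t j)).
  by apply: measurable_prod_coords => j; exact: L1_meas (iF j).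
have E (z : MR * d.-tuple MR) : \prod_(j < d.+1) F j (tnth (tcons z) j) =
    F ord0 z.1 * \prod_(j < d) F (lift ord0 j) (tnth z.2 j) :> R.
  case: z => x t; rewrite big_ord_recl tnth_tcons0; congr (_ * _).
  by apply: eq_bigr => j _; rewrite tnth_tconsS.
split.
  apply: leb_L1_cons => //; apply: L1_ext (L1_tensor (iF ord0) IH1) => z.
  by rewrite E.
rewrite leb_int_cons//; etransitivity; first exact: (int_ext _ E).
by rewrite (int_tensor (iF ord0) IH1) big_ord_recl IH2.
Qed.

Definition taff d (a : R) (b : d.-tuple MR) (t : d.-tuple MR) : d.-tuple MR :=
  [tuple (a * tnth t i + tnth b i : MR) | i < d].

Lemma measurable_taff d a (b : d.-tuple MR) : measurable_fun setT (taff a b).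
Proof.
apply/measurable_fun_tnthP => i.
rewrite (_ : _ \o _ = fun t => a * (tnth t i : R) + tnth b i); last first.
  by apply/funext => t /=; rewrite tnth_mktuple.
by apply: measurable_funD => //; apply: measurable_funM => //; exact: measurable_tnth.
Qed.

Lemma ge0_integral_taff d (a : R) (b : d.-tuple MR) (F : d.-tuple MR -> \bar R) :
  a != 0 -> measurable_fun setT F -> (forall x, 0 <= F x)%E ->
  (\int[leb d]_t F (taff a b t) = (`|a| ^- d)%:E * \int[leb d]_t F t)%E.
Proof.
move=> a0; elim: d b F => [|d IH] b F mF F0.
  by rewrite !leb0E expr0 invr1 mul1e; congr F; exact: tuple0.
have mFa : measurable_fun setT (F \o taff a b).
  by apply: (measurableT_comp mF); exact: measurable_taff.
rewrite (leb_ge0_cons2 mFa)//= leb_ge0_cons2//.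
have [b0 [b' bE]] : exists b0 b', b = tcons (b0, b').
  exists (thead b), [tuple of behead b]; rewrite [LHS]tuple_eta; exact/val_inj.
have E x t : taff a b (tcons (x, t)) = tcons (a * (x : R) + b0 : MR, taff a b' t).
  apply: eq_from_tnth => i; rewrite tnth_mktuple bE.
  case: (unliftP ord0 i) => [j ->|->]; last by rewrite !tnth_tcons0.
  by rewrite !tnth_tconsS tnth_mktuple.
have mFx x : measurable_fun setT (fun t => F (tcons (x, t))).
  apply: (measurableT_comp mF); apply: (measurableT_comp (@measurable_tcons _ MR d)).
  exact: pair1_measurable.
transitivity (\int[lam]_x ((`|a| ^- d)%:E * \int[leb d]_t F (tcons ((a * (x:R) + b0)%R : MR, t))))%E.
  apply: eq_integral => x _; under eq_integral do rewrite E.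
  by rewrite (IH b' (fun t => F (tcons ((a * (x:R) + b0)%R : MR, t))))//.
have mI : measurable_fun setT (fun x : MR => \int[leb d]_t F (tcons (x, t)))%E.
  apply: (@measurable_fun_fubini_tonelli_F _ _ _ _ _ (leb d) (F \o @tcons _ MR d))%E => //.
    by apply: (measurableT_comp mF); exact: measurable_tcons.
  by move=> z; exact: F0.
rewrite (@ge0_integralZl_EFin _ _ _ lam setT measurableT); last 3 first.
- by move=> x _; exact: integral_ge0.
- exact: (measurableT_comp mI (measurable_affine a b0)).
- by rewrite invr_ge0 exprn_ge0.
rewrite (ge0_integral_affine b0 a0 mI); last by move=> x; exact: integral_ge0.
by rewrite muleA -EFinM exprS invfM mulrC.
Qed.

Lemma mpres_taff d (b : d.-tuple MR) : mpres (leb d) (taff 1 b).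
Proof.
split; first exact: measurable_taff.
by move=> F mF F0; rewrite ge0_integral_taff ?oner_eq0// normr1 expr1n invr1 mul1e.
Qed.

End tuples.

Section row_vectors.
Context {R : realType} {d : nat}.
Implicit Type x : 'rV[R]_d.

Lemma le_coord_norm x j : `|x 0 j| <= `|x|.
Proof.
rewrite [leRHS]mx_normrE.
exact: (@le_bigmax _ _ _ 0 (fun ij : 'I_1 * 'I_d => `|x ij.1 ij.2|) (0, j)).
Qed.

Lemma norm_le_coord x e : 0 <= e -> (forall j, `|x 0 j| <= e) -> `|x| <= e.
Proof.
move=> e0 xe; rewrite [leLHS]mx_normrE; apply: bigmax_le => //= -[i j] _ /=.
by rewrite ord1.
Qed.

Lemma continuous_coord (j : 'I_d) : continuous (fun x : 'rV[R]_d => x 0 j).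
Proof. by move=> x; exact: coord_continuous. Qed.

End row_vectors.

(** * Measurability of continuous functions of tuples *)

Section continuous_measurable.
Context {R : realType}.
Notation MR := (measurableTypeR R).
Notation lam := (@lebesgue_measure R).

(** With countably many values, measurability of the level sets is enough and [F] may be
    arbitrary. *)
Lemma measurable_countable_code {dd} {T : measurableType dd} {C : countType}
    (c : T -> C) (F : C -> R) : (forall k, measurable (c @^-1` [set k])) ->
  measurable_fun setT (F \o c).
Proof.
move=> mc _ Y mY; rewrite setTI.
have -> : (F \o c) @^-1` Y = \bigcup_k (if `[< Y (F k) >] then c @^-1` [set k] else set0).
  apply/seteqP; split => [t /= Yt|t [k _]].
    by exists (c t) => //; case: ifPn => // /asboolP.
  by case: ifPn => // /asboolP YFk /= ck; rewrite /= ck.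
by apply: countable_bigcupT_measurable => // k; case: ifPn.
Qed.

Let fl (n : nat) (x : R) : int := Num.floor (x * n.+1%:R).

Lemma measurable_floor_fiber {dd} {T : measurableType dd} (g : T -> R) n k :
  measurable_fun setT g -> measurable ((fun t => fl n (g t)) @^-1` [set k]).
Proof.
move=> mg.
have mg' : measurable_fun setT (fun t => g t * n.+1%:R) by exact: measurable_funM.
have -> : (fun t => fl n (g t)) @^-1` [set k] =
    setT `&` (fun t => g t * n.+1%:R) @^-1` `[k%:~R, (k + 1)%:~R[%classic.
  rewrite setTI; apply/seteqP; split => t /=; rewrite in_itv/=.
    by move=> <-; exact: floor_itv.
  by move=> h; apply: floor_def.
exact: mg'.
Qed.

Let round n (x : R) : R := (fl n x)%:~R / n.+1%:R.

Let round_le n x : `|round n x - x| <= n.+1%:R^-1.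
Proof.
rewrite /round /fl; have /andP[h1 h2] := floor_itv (x * n.+1%:R).
have np : 0 < n.+1%:R :> R by rewrite ltr0Sn.
rewrite ler_norml; apply/andP; split.
  rewrite -(ler_pM2r np) mulNr mulVf ?gt_eqF// mulrBl divfK ?gt_eqF//.
  by move: h2; rewrite intrD; lra.
rewrite -(ler_pM2r np) mulVf ?gt_eqF// mulrBl divfK ?gt_eqF//.
by move: h1; lra.
Qed.

Lemma cvg_norm_harmonic (V : normedModType R) (u : nat -> V) (v : V) :
  (forall n, `|u n - v| <= n.+1%:R^-1) -> u @ \oo --> v.
Proof.
move=> h; apply/cvgrPdist_le => e e0.
have : \forall n \near \oo, harmonic n <= e :> R.
  have /cvgrPdist_le/(_ _ e0) := @cvg_harmonic R.
  by apply: filterS => n; rewrite sub0r normrN; apply: le_trans; rewrite ler_norm.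
by apply: filterS => n hn; rewrite distrC (le_trans (h n)).
Qed.

(** Rounding every coordinate down to a multiple of 1/(n+1) makes [F] factor through a countable
    set, and continuity lets the rounded functions converge to [F]. This avoids comparing the Borel
    sets of row vectors with the product sigma-algebra of tuples. *)
Lemma measurable_continuous_tuple d (F : 'rV[R]_d -> R) : continuous F ->
  measurable_fun setT (fun t : d.-tuple MR => F (row_of_tuple t)).
Proof.
move=> cF.
pose c n (t : d.-tuple MR) : {ffun 'I_d -> int} := [ffun i => fl n (tnth t i)].
pose D n (k : {ffun 'I_d -> int}) : 'rV[R]_d := \row_i ((k i)%:~R / n.+1%:R).
apply: (@measurable_fun_cvg _ _ _ _ (fun n => F \o D n \o c n)).
  move=> n; apply: (measurable_countable_code (F \o D n)) => k.
  have -> : c n @^-1` [set k] = \bigcap_(i in [set: 'I_d])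
      ((fun t : d.-tuple MR => fl n (tnth t i)) @^-1` [set k i]).
    apply/seteqP; split => t.
      by move=> /= <- i _ /=; rewrite ffunE.
    by move=> h; apply/ffunP => i; rewrite ffunE; exact: h.
  apply: fin_bigcap_measurable => [|i _]; first exact: finite_finset.
  by apply: measurable_floor_fiber; exact: measurable_tnth.
move=> t _; apply: (cvg_comp _ F); last exact: cF.
apply: cvg_norm_harmonic => n.
apply: norm_le_coord => [|j]; first by rewrite invr_ge0.
by rewrite !mxE ffunE; exact: round_le.
Qed.

Definition iota d (z : MR * d.-tuple MR) : R * 'rV[R]_d := (z.1 : R, row_of_tuple z.2).

Lemma measurable_continuous_prod d (F : R * 'rV[R]_d -> R) : continuous F ->
  measurable_fun setT (F \o @iota d).
Proof.
move=> cF.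
pose c n (z : MR * d.-tuple MR) : int * {ffun 'I_d -> int} :=
  (fl n z.1, [ffun i => fl n (tnth z.2 i)]).
pose D n (k : int * {ffun 'I_d -> int}) : R * 'rV[R]_d :=
  (k.1%:~R / n.+1%:R, \row_i ((k.2 i)%:~R / n.+1%:R)).
apply: (@measurable_fun_cvg _ _ _ _ (fun n => F \o D n \o c n)).
  move=> n; apply: (measurable_countable_code (F \o D n)) => k.
  have -> : c n @^-1` [set k] = ((fun z : MR * d.-tuple MR => fl n z.1) @^-1` [set k.1]) `&`
     \bigcap_(i in [set: 'I_d])
      ((fun z : MR * d.-tuple MR => fl n (tnth z.2 i)) @^-1` [set k.2 i]).
    apply/seteqP; split => t.
      by move=> /= <-; split => // i _ /=; rewrite ffunE.
    move=> [/= h1 h]; rewrite [k]surjective_pairing -h1; congr pair.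
    by apply/ffunP => i; rewrite ffunE; exact: h.
  apply: measurableI; first by apply: measurable_floor_fiber; exact: measurable_fst.
  apply: fin_bigcap_measurable => [|i _]; first exact: finite_finset.
  apply: measurable_floor_fiber.
  exact: (measurableT_comp (measurable_tnth i) measurable_snd).
move=> t _; apply: (cvg_comp _ F); last exact: cF.
apply: cvg_norm_harmonic => n.
rewrite prod_normE ge_max /=; apply/andP; split; first exact: round_le.
apply: norm_le_coord => [|j]; first by rewrite invr_ge0.
by rewrite !mxE ffunE; exact: round_le.
Qed.

End continuous_measurable.

(** * Integration by parts *)

Section euclidean_embedding.
Context {dd : measure_display} {T : measurableType dd} {R : realType}.
Variables (mu : {measure set T -> \bar R}) (V : normedModType R) (emb : T -> V).

(* What integration by parts needs from a pair (measure space, normed space):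
   Borel measurability, locally finite measure, local compactness and
   translation invariance. *)
Definition euclid := [/\
  (forall F : V -> R, continuous F -> measurable_fun setT (F \o emb)),
  (forall r, exists2 W : T -> R, L1 mu W & forall t, `|emb t| <= r -> 1 <= W t /\ 0 <= W t),
  (forall (F : V -> R) r, continuous F -> exists C, forall z, `|z| <= r -> `|F z| <= C) &
  (forall (v : V), exists2 th, mpres mu th & forall t, emb (th t) = emb t + v)].

Definition bsupp (F : V -> R) := exists r, forall z, r < `|z| -> F z = 0.
End euclidean_embedding.

Section bsupp_theory.
Context {R : realType} {V : normedModType R}.
Implicit Types F G : V -> R.

Lemma bsuppMl F G : bsupp F -> bsupp (fun z => G z * F z).
Proof. by case=> r h; exists r => z /h ->; rewrite mulr0. Qed.
Lemma bsuppD F G : bsupp F -> bsupp G -> bsupp (fun z => F z + G z).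
Proof.
case=> r h [r' h']; exists (Num.max r r') => z; rewrite gt_max => /andP[/h -> /h' ->].
by rewrite addr0.
Qed.
Lemma bsuppN F : bsupp F -> bsupp (fun z => - F z).
Proof. by case=> r h; exists r => z /h ->; rewrite oppr0. Qed.
Lemma bsupp_derive F v : bsupp F -> bsupp ('D_v F).
Proof.
case=> r h; exists r => z rz.
have e0 : 0 < `|z| - r by rewrite subr_gt0.
have /cvgrPdist_lt/(_ _ e0) H := @cvg_id _ (nbhs z).
rewrite (near_eq_derive (g := cst 0)) ?derive_cst//.
near=> y; apply: h.
have h1 : `|z| - `|y| <= `|z - y| by rewrite lerB_dist.
suff : `|z - y| < `|z| - r by lra.
near: y; exact: H.
Unshelve. all: by end_near. Qed.
End bsupp_theory.

Section integration_by_parts.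
Context {dd : measure_display} {T : measurableType dd} {R : realType}.
Variables (mu : {measure set T -> \bar R}) (V : normedModType R) (emb : T -> V).
Hypothesis emb_euclid : euclid mu emb.

Lemma L1_bsupp (F : V -> R) : continuous F -> bsupp F -> L1 mu (F \o emb).
Proof.
move=> cF [r Fr]; have [H1 H2 H3 _] := emb_euclid.
have [W iW W1] := H2 r; have [C hC] := H3 F r cF.
apply: (L1_le (H1 _ cF) (L1Z `|C| (L1_norm iW))) => t /=.
have [tr|tr] := leP `|emb t| r; last by rewrite Fr// normr0 mulr_ge0.
have [W1t W0t] := W1 t tr.
rewrite (le_trans (hC _ tr))// (le_trans (ler_norm _))// ler_peMr//.
by rewrite ger0_norm.
Qed.

Lemma is_derive_line (G : V -> R) (z v : V) (h : R) : derivable G (z + h *: v) v ->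
  is_derive h 1 (fun k : R => G (z + k *: v)) ('D_v G (z + h *: v)).
Proof.
have E : (fun k : R => k^-1 *: (((fun k : R => G (z + k *: v)) \o shift h) (k *: 1) - G (z + h *: v))) =
    (fun k => k^-1 *: ((G \o shift (z + h *: v)) (k *: v) - G (z + h *: v))).
  apply/funext => k; congr (_ *: (G _ - _)); rewrite /shift/=.
  by rewrite [k *: 1]mulr1 scalerDl addrCA addrC -addrA.
move=> dG; split; first by rewrite /derivable E.
by rewrite /derive E.
Qed.

(* Translation invariance makes the integral of every difference quotient
   vanish; let the step tend to 0. *)
Lemma int_derive0 (G : V -> R) (v : V) (W : T -> R) :
  (forall z, derivable G z v) -> continuous G -> L1 mu (G \o emb) -> L1 mu W ->
  (forall t h, 0 <= h <= 1 -> `|'D_v G (emb t + h *: v)| <= W t) ->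
  \int[mu]_t 'D_v G (emb t) = 0.
Proof.
move=> dG cG iG iW hW; have [H1 H2 H3 H4] := emb_euclid.
pose h n : R := n.+1%:R^-1.
have h0 n : 0 < h n by rewrite invr_gt0.
have h1 n : h n <= 1 by rewrite invf_le1// ler1n.
pose q n t := (h n)^-1 * (G (emb t + h n *: v) - G (emb t)).
have cGs n : continuous (fun z => G (z + h n *: v)).
  move=> z; apply: (cvg_comp (fun z => z + h n *: v) G); last exact: cG.
  by apply: cvgD; [exact: cvg_id|exact: cvg_cst].
have iGs n : L1 mu (fun t => G (emb t + h n *: v)) /\
    \int[mu]_t G (emb t + h n *: v) = \int[mu]_t G (emb t).
  have [th mth thE] := H4 (h n *: v); split.
    by apply: L1_ext (mpres_L1 mth iG) => t /=; rewrite thE.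
  rewrite -(mpres_int mth (L1_meas iG)).
  by apply: int_ext => t /=; rewrite thE.
have iq n : \int[mu]_t q n t = 0.
  rewrite intZ; last by apply: L1B => //; exact: (iGs n).1.
  by rewrite intB ?(iGs n).2 ?subrr ?mulr0//; exact: (iGs n).1.
have [] := @dominated_convergence_L1 _ _ _ mu q (fun t => 'D_v G (emb t)) W _ _ iW _.
- move=> n; apply: measurable_funM => //; apply: measurable_funB; last exact: L1_meas iG.
  exact: L1_meas (iGs n).1.
- move=> t; have /cvg_ex[l hl] := dG (emb t).
  rewrite /derive (cvg_lim _ hl)//.
  have := (cvgr_dnbhsP _ _ _).1 hl h (conj (fun n => negbT (gt_eqF (h0 n))) cvg_harmonic).
  have -> : (fun n => q n t) =
      (fun n => (h n)^-1 *: ((G \o shift (emb t)) (h n *: v) - G (emb t))).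
    by apply/funext => n; rewrite /q /= [_ + emb t]addrC.
  exact.
(* The mean value theorem turns the quotient into the derivative at a point shifted by at most one
   [v]; hence the majorant is required for all shifts in [0, 1]. *)
- move=> n t; rewrite /q normrM normfV (gtr0_norm (h0 n)).
  have [||c /andP[]] := @MVT_segment R (fun k : R => G (emb t + k *: v))
     (fun k => 'D_v G (emb t + k *: v)) 0 (h n) (ltW (h0 n)).
  + by move=> x _; apply: is_derive_line; exact: dG.
  + apply: derivable_within_continuous => x _.
    by apply: ex_derive; apply: is_derive_line; exact: dG.
  rewrite !bnd_simp => c0 ch; rewrite scale0r addr0 subr0 => ->.
  rewrite normrM (gtr0_norm (h0 n)) mulrC mulfK ?gt_eqF//.
  by apply: hW; rewrite c0 (le_trans ch).
move=> _; rewrite (_ : (fun n => \int[mu]_x q n x) = fun=> 0); last by apply/funext.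
by move=> /(cvg_lim (@Rhausdorff R)) <-; rewrite lim_cst.
Qed.

Lemma int_derive0_bsupp (G : V -> R) (v : V) : (forall z, derivable G z v) ->
  continuous G -> continuous ('D_v G) -> bsupp G -> \int[mu]_t 'D_v G (emb t) = 0.
Proof.
move=> dG cG cDG bG; have [r hr] := bsupp_derive v bG.
have [H1 H2 H3 H4] := emb_euclid.
(* The shifts by [h *: v] enlarge the support by at most [|v|]. *)
have [W iW W1] := H2 (r + `|v|); have [C hC] := H3 _ r cDG.
apply: (@int_derive0 _ _ (fun t => `|C| * `|W t|) dG cG) => //.
- exact: L1_bsupp.
- by apply: L1Z; exact: L1_norm.
move=> t h /andP[h0 h1].
have [tr|tr] := leP `|emb t + h *: v| r; last by rewrite hr// normr0 mulr_ge0.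
have [W1t W0t] : 1 <= W t /\ 0 <= W t.
  apply: W1; have -> : emb t = (emb t + h *: v) - h *: v by rewrite addrK.
  rewrite (le_trans (ler_normB _ _))// lerD// normrZ ger0_norm//.
  by rewrite ler_piMl.
rewrite (le_trans (hC _ tr))// (le_trans (ler_norm _))// ler_peMr//.
by rewrite ger0_norm.
Qed.

End integration_by_parts.

Section euclid_instances.
Context {R : realType}.
Notation MR := (measurableTypeR R).
Notation lam := (@lebesgue_measure R).

Lemma mpres_prod {d1 d2} {T1 : measurableType d1} {T2 : measurableType d2}
    (m1 : {sigma_finite_measure set T1 -> \bar R})
    (m2 : {sigma_finite_measure set T2 -> \bar R}) th1 th2 :
  mpres m1 th1 -> mpres m2 th2 ->
  mpres (m1 \x m2)%E (fun z => (th1 z.1, th2 z.2)).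
Proof.
move=> [mth1 p1] [mth2 p2].
have mth : measurable_fun setT (fun z : T1 * T2 => (th1 z.1, th2 z.2)).
  apply: measurable_fun_pair.
    exact: (measurableT_comp mth1 measurable_fst).
  exact: (measurableT_comp mth2 measurable_snd).
split => // F mF F0.
have mFth := measurableT_comp mF mth.
rewrite (fubini_tonelli1 _ mFth); last by move=> z; exact: F0.
rewrite (fubini_tonelli1 _ mF)// -[RHS]p1; last 2 first.
- exact: measurable_fun_fubini_tonelli_F.
- by move=> x; exact: integral_ge0.
apply: eq_integral => x _; rewrite /fubini_F/= -(p2 (fun y => F (th1 x, y)))//.
by apply: (measurableT_comp mF); exact: pair1_measurable.
Qed.

Definition bx (r : R) : R -> R := \1_(`[- r, r]%classic).

Lemma bx_ge0 r x : 0 <= bx r x. Proof. by rewrite /bx indicE. Qed.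
Lemma bx1 r x : `|x| <= r -> bx r x = 1.
Proof. by rewrite ler_norml => xr; rewrite /bx indicE mem_set. Qed.
Lemma L1_bx r : L1 lam (bx r). Proof. exact: integrable_indic_itv. Qed.

Lemma row_of_tuple_taff d (t : d.-tuple MR) (b : 'rV[R]_d) :
  row_of_tuple (taff 1 [tuple (b 0 i : MR) | i < d] t) = row_of_tuple t + b.
Proof. by apply/rowP => j; rewrite !mxE !tnth_mktuple mul1r. Qed.

Lemma continuous_bounded_rV d (F : 'rV[R]_d -> R) r : continuous F ->
  exists C, forall z, `|z| <= r -> `|F z| <= C.
Proof.
move=> cF.
have cK : compact [set v : 'rV[R]_d | forall i, `[- r, r]%classic (v ord0 i)].
  by apply: (@rV_compact _ _ (fun=> `[- r, r]%classic)) => i; exact: segment_compact.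
have [M [_ hM]] : bounded_set [set F x | x in [set v : 'rV[R]_d | forall i, `[- r, r]%classic (v ord0 i)]].
  apply: compact_bounded; apply: continuous_compact => //.
  exact: continuous_subspaceT.
exists (M + 1) => z zr; apply: (hM (M + 1)); first by rewrite ltrDl.
exists z => // i /=; rewrite in_itv/= -ler_norml.
by apply: le_trans zr; exact: le_coord_norm.
Qed.

Lemma euclid_tuple d : euclid (leb d) (@row_of_tuple R d).
Proof.
split.
- exact: measurable_continuous_tuple.
- move=> r; have [h _] := prod_coords (fun j : 'I_d => L1_bx r).
  exists (fun t => \prod_(j < d) bx r (tnth t j)) => // t tr.
  rewrite big1 ?ler01// => j _; apply: bx1.
  by apply: le_trans tr; have := le_coord_norm (row_of_tuple t) j; rewrite mxE.
- by move=> F r cF; exact: continuous_bounded_rV.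
- move=> b; exists (taff 1 [tuple (b 0 i : MR) | i < d]); first exact: mpres_taff.
  by move=> t; rewrite row_of_tuple_taff.
Qed.

Lemma euclid_prod d : euclid (@leb_prod R d) (@iota R d).
Proof.
split.
- exact: measurable_continuous_prod.
- move=> r; have [h _] := prod_coords (fun j : 'I_d => L1_bx r).
  exists (fun z => bx r z.1 * \prod_(j < d) bx r (tnth z.2 j)).
    exact: (L1_tensor (L1_bx r) h).
  move=> t; rewrite prod_normE ge_max /= => /andP[t1 t2].
  rewrite bx1// mul1r big1 ?ler01// => j _; apply: bx1.
  by apply: le_trans t2; have := le_coord_norm (row_of_tuple t.2) j; rewrite mxE.
- move=> F r cF.
  pose K := `[- r, r]%classic `*` [set v : 'rV[R]_d | forall i, `[- r, r]%classic (v ord0 i)].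
  have cK : compact K.
    apply: compact_setX; first exact: segment_compact.
    by apply: (@rV_compact _ _ (fun=> `[- r, r]%classic)) => i; exact: segment_compact.
  have [M [_ hM]] : bounded_set [set F x | x in K].
    apply: compact_bounded; apply: continuous_compact => //.
    exact: continuous_subspaceT.
  exists (M + 1) => z; rewrite prod_normE ge_max => /andP[z1 z2].
  apply: (hM (M + 1)); first by rewrite ltrDl.
  exists z => //; split; first by rewrite /= in_itv/= -ler_norml.
  move=> i /=; rewrite in_itv/= -ler_norml.
  by apply: le_trans z2; exact: le_coord_norm.
- move=> [a b]; exists (fun z => (z.1 + a : MR, taff 1 [tuple (b 0 i : MR) | i < d] z.2)).
    exact: (mpres_prod (mpres_shift a) (mpres_taff _)).
  by move=> z; rewrite /iota/= row_of_tuple_taff.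
Qed.

Lemma euclid_line : euclid lam (fun x : MR => x : R).
Proof.
split.
- by move=> F cF; exact: continuous_measurable_fun.
- move=> r; exists (bx r); first exact: L1_bx.
  by move=> t tr; rewrite bx1.
- move=> F r cF.
  have [M [_ hM]] : bounded_set [set F x | x in `[- r, r]%classic].
    apply: compact_bounded; apply: continuous_compact => //; last exact: segment_compact.
    exact: continuous_subspaceT.
  exists (M + 1) => z zr; apply: (hM (M + 1)); first by rewrite ltrDl.
  by exists z => //=; rewrite in_itv/= -ler_norml.
- by move=> v; exists (fun x : MR => x + v : MR); first exact: mpres_shift.
Qed.
End euclid_instances.

(** * Gaussian integrals *)

Section gaussian.
Context {R : realType}.
Notation lam := (@lebesgue_measure R).

Lemma int_expR_sqr (a m : R) : 0 < a ->
  L1 lam (fun y => expR (- a * (y - m) ^+ 2)) /\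
  \int[lam]_y expR (- a * (y - m) ^+ 2) = Num.sqrt (pi / a).
Proof.
move=> a0.
pose s := Num.sqrt (2 * a)^-1.
have s2 : s ^+ 2 = (2 * a)^-1 by rewrite sqr_sqrtr// invr_ge0 mulr_ge0// ltW.
have s0 : s != 0 by rewrite gt_eqF// sqrtr_gt0 invr_gt0 mulr_gt0.
have E y : normal_pdf m s y = (Num.sqrt (pi / a))^-1 * expR (- a * (y - m) ^+ 2).
  rewrite normal_pdfE// /normal_peak /normal_fun s2.
  congr (_^-1 * expR _).
    by congr Num.sqrt; field; rewrite gt_eqF.
  by field; rewrite gt_eqF.
have sp : 0 < Num.sqrt (pi / a) by rewrite sqrtr_gt0 divr_gt0 ?pi_gt0.
have iN : L1 lam (normal_pdf m s) by exact: integrable_normal_pdf.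
have E2 y : expR (- a * (y - m) ^+ 2) = Num.sqrt (pi / a) * normal_pdf m s y.
  by rewrite E mulVKf ?gt_eqF.
split; first by apply: L1_ext (L1Z (Num.sqrt (pi / a)) iN) => y; rewrite E2.
rewrite (int_ext lam E2) intZ// /Rintegral integral_normal_pdf/= mulr1//.
Qed.

(** The heat kernel of the second derivative at time t^2 / 4, a probability density of variance t^2
    / 2. *)
Definition gauss (t x : R) := locked ((Num.sqrt pi * t)^-1 * expR (- (x ^+ 2) / t ^+ 2)).

Lemma gaussE t x : gauss t x = (Num.sqrt pi * t)^-1 * expR (- (x ^+ 2) / t ^+ 2).
Proof. by rewrite /gauss -lock. Qed.

Lemma gauss_ge0 t x : 0 < t -> 0 <= gauss t x.
Proof. by move=> t0; rewrite gaussE mulr_ge0 ?expR_ge0// invr_ge0 mulr_ge0 ?sqrtr_ge0 ?ltW. Qed.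

Let spi : 0 < Num.sqrt pi :> R. Proof. by rewrite sqrtr_gt0 pi_gt0. Qed.
Let spin : Num.sqrt pi != 0 :> R. Proof. by rewrite gt_eqF. Qed.

Lemma int_gauss t m : 0 < t ->
  L1 lam (fun y => gauss t (y - m)) /\ \int[lam]_y gauss t (y - m) = 1.
Proof.
move=> t0; have [] := @int_expR_sqr (t ^- 2) m; first by rewrite invr_gt0 exprn_gt0.
move=> i1 i2.
have E y : gauss t (y - m) = (Num.sqrt pi * t)^-1 * expR (- t ^- 2 * (y - m) ^+ 2).
  by rewrite gaussE; congr (_ * expR _); rewrite !mulNr mulrC.
split; first by apply: L1_ext (L1Z _ i1) => y; rewrite E.
rewrite (int_ext lam E) intZ// i2 invrK sqrtrM ?pi_ge0// sqrtr_sqr gtr0_norm//.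
by rewrite mulVf// mulf_neq0// gt_eqF.
Qed.

Lemma gauss_conv s t z : 0 < s -> 0 < t ->
  \int[lam]_y (gauss t (z - y) * gauss s y) = gauss (Num.sqrt (s ^+ 2 + t ^+ 2)) z /\
  L1 lam (fun y => gauss t (z - y) * gauss s y).
Proof.
move=> s0 t0.
pose u := Num.sqrt (s ^+ 2 + t ^+ 2).
have u2 : u ^+ 2 = s ^+ 2 + t ^+ 2 by rewrite sqr_sqrtr// addr_ge0 ?sqr_ge0.
have u0 : 0 < u by rewrite sqrtr_gt0 addr_gt0 ?exprn_gt0.
(* Rate [a] and centre [m] of the Gaussian in [y] that remains after completing the square. *)
pose a := s ^- 2 + t ^- 2; have a0 : 0 < a by rewrite addr_gt0 ?invr_gt0 ?exprn_gt0.
pose m := z * s ^+ 2 / u ^+ 2.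
have [i1 i2] := int_expR_sqr m a0.
have st : s ^+ 2 + t ^+ 2 != 0 by rewrite gt_eqF// addr_gt0 ?exprn_gt0.
have E y : gauss t (z - y) * gauss s y =
   ((Num.sqrt pi * t)^-1 * (Num.sqrt pi * s)^-1 * expR (- z ^+ 2 / u ^+ 2)) * expR (- a * (y - m) ^+ 2).
  rewrite !gaussE mulrACA -expRD -!mulrA -expRD; congr (_ * (_ * expR _)).
  rewrite /a /m u2; field; by rewrite st !gt_eqF.
have sa : Num.sqrt (pi / a) = Num.sqrt pi * (s * t / u).
  rewrite -[s * t / u]gtr0_norm ?divr_gt0 ?mulr_gt0// -sqrtr_sqr -sqrtrM ?pi_ge0//.
  congr Num.sqrt; congr (_ * _); rewrite /a expr_div_n u2; field.
  by rewrite st !gt_eqF //= addr_gt0 ?exprn_gt0.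
split; last by apply: L1_ext (L1Z _ i1) => y; rewrite E.
rewrite (int_ext lam E) intZ// i2 sa gaussE -/u; field.
by rewrite !gt_eqF.
Qed.

End gaussian.

(** * Hermite functions and the Mehler kernel *)

Section real_line_estimates.
Context {R : realType}.
Notation lam := (@lebesgue_measure R).

Lemma exprn_le_expR (k : nat) (y : R) : 0 <= y -> y ^+ k <= k`!%:R * expR y.
Proof.
move=> y0; case: k => [|k]; first by rewrite expr0 fact0 mul1r; have := expR_ge1Dx y; lra.
have := expR_ge1Dxn k y0; have fp : 0 < (k.+1)`!%:R :> R by rewrite ltr0n fact_gt0.
rewrite -ler_pdivrMl// mulrC => h; apply: le_trans h; lra.
Qed.

(** The Japanese bracket to the power -2: the common integrable majorant of Hermite functions,
    Gaussians and spectral coefficients. *)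
Definition jap (x : R) := (1 + x ^+ 2)^-1.

Lemma jap_gt0 x : 0 < jap x.
Proof. by rewrite invr_gt0 ltr_pwDl// sqr_ge0. Qed.
Lemma jap_ge0 x : 0 <= jap x. Proof. exact/ltW/jap_gt0. Qed.
Lemma jap_le1 x : jap x <= 1.
Proof. by rewrite invf_le1 ?lerDl ?sqr_ge0// ltr_pwDl// sqr_ge0. Qed.
Lemma jap_le (x a b : R) : a * (1 + x ^+ 2) <= b -> a <= b * jap x.
Proof. by move=> h; rewrite ler_pdivlMr// ltr_pwDl// sqr_ge0. Qed.
Lemma jap_shift (x h : R) : 0 <= h <= 1 -> jap (x + h) <= 3 * jap x.
Proof.
move=> /andP[h0 h1]; apply: jap_le; rewrite mulrC ler_pdivrMr ?ltr_pwDl ?sqr_ge0//.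
have h2 : h ^+ 2 <= 1 by rewrite expr_le1.
have := sqr_ge0 (x + 2 * h); have := sqr_ge0 (x + h); nra.
Qed.

Lemma continuous_jap : continuous jap.
Proof. exact: (@continuous_oneDsqrV R). Qed.

Lemma L1_jap : L1 lam jap.
Proof.
have mj : measurable_fun setT jap by apply: continuous_measurable_fun; exact: continuous_jap.
apply: L1_ltoo => //.
under eq_integral do rewrite ger0_norm ?jap_ge0//.
rewrite ge0_symfun_integralT.
- rewrite (_ : [set x : R | 0 <= x] = `[0%R, +oo[%classic); last first.
    by apply/seteqP; split=> x /=; rewrite in_itv/= andbT.
  by rewrite integral0y_oneDsqr -EFinM ltry.
- by move=> x; exact: jap_ge0.
- exact: continuous_jap.
- by move=> x; rewrite /jap/= sqrrN.
Qed.

(* The constant absorbs the unit shift of the difference quotients. *)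
Lemma int_derive_line0 (G dG : R -> R) C : (forall x : R, is_derive x 1 G (dG x)) ->
  (forall x, `|G x| <= C * jap x) -> (forall x, `|dG x| <= C * jap x) ->
  \int[lam]_x dG x = 0.
Proof.
move=> dGE G_le dG_le.
have C0 : 0 <= C.
  have := le_trans (normr_ge0 _) (G_le 0); rewrite /jap expr0n/= addr0 invr1 mulr1//.
have cG : continuous G.
  by move=> x; apply: differentiable_continuous; apply/derivable1_diffP; exact: ex_derive.
have E x : dG x = 'D_1 G x by rewrite derive_val.
rewrite (int_ext lam E).
apply: (@int_derive0 _ _ _ lam _ _ euclid_line G 1 (fun x => 3 * C * jap x)) => //.
- apply: (L1_le _ (L1Z C L1_jap)) => //.
  exact: continuous_measurable_fun.
- exact: L1Z L1_jap.
move=> t h hh; rewrite -E (le_trans (dG_le _))// [3 * C]mulrC -[leRHS]mulrA ler_wpM2l//.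
by rewrite [h *: 1]mulr1 jap_shift.
Qed.

Lemma series_dominated_cvg (u v : nat -> R) : (forall n, `|u n| <= v n) ->
  cvgn (series v) -> cvgn (series u).
Proof.
move=> uv cv; apply: normed_cvg; apply: (series_le_cvg _ _ _ cv) => // n; first exact: normr_ge0.
exact: le_trans (uv n).
Qed.

Lemma cvg_series_geom (q C : R) : 0 <= q < 1 -> cvgn (series (fun n => C * q ^+ n)).
Proof.
move=> /andP[q0 q1]; apply: (@is_cvg_geometric_series R C q).
by rewrite ger0_norm.
Qed.

Lemma poly_geom_bound k (q : R) : 0 < q < 1 ->
  exists2 C, 0 < C & forall n, n.+1%:R ^+ k * q ^+ n <= C.
Proof.
move=> /andP[q0 q1]; pose l := - ln q.
have l0 : 0 < l by rewrite oppr_gt0 ln_lt0// q0 q1.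
have qE n : q ^+ n = expR (- (n%:R * l)).
  by rewrite /l mulrN opprK expRM_natl lnK.
exists (k`!%:R * expR l / l ^+ k) => [|n].
  by rewrite divr_gt0 ?exprn_gt0// mulr_gt0 ?expR_gt0// ltr0n fact_gt0.
rewrite ler_pdivlMr ?exprn_gt0// mulrAC -exprMn.
have y0 : 0 <= n.+1%:R * l by rewrite mulr_ge0// ltW.
rewrite qE (le_trans (ler_wpM2r (expR_ge0 _) (exprn_le_expR k y0)))//.
rewrite -mulrA -expRD ler_wpM2l//.
by rewrite ler_expR -natr1; lra.
Qed.

(** Writing r as q^2 leaves one factor q^n to absorb the polynomial and another one to converge. *)
Lemma poly_geom_bound2 k (r : R) : 0 < r < 1 ->
  exists2 C, 0 < C & exists2 q, 0 < q < 1 & forall n, n.+1%:R ^+ k * r ^+ n <= C * q ^+ n.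
Proof.
move=> /andP[r0 r1]; pose q := Num.sqrt r.
have q0 : 0 < q by rewrite sqrtr_gt0.
have q2 : r = q ^+ 2 by rewrite sqr_sqrtr// ltW.
have q1 : q < 1.
  by rewrite -(ltr_pXn2r (n := 2)) ?nnegrE ?ltW// -q2 expr1n.
have qq : 0 < q < 1 by rewrite q0 q1.
have [C C0 hC] := poly_geom_bound k qq.
exists C => //; exists q => // n.
rewrite q2 -exprM mul2n -addnn exprD mulrA ler_wpM2r//.
by rewrite exprn_ge0// ltW.
Qed.

Lemma cvg_series_poly_geom k (C r : R) : 0 < r < 1 ->
  cvgn (series (fun n => C * (n.+1%:R ^+ k * r ^+ n))).
Proof.
move=> r01; have [K K0 [q q01 hq]] := poly_geom_bound2 k r01.
apply: (@series_dominated_cvg _ (fun n => `|C| * K * q ^+ n)).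
  have /andP[r0 _] := r01.
  move=> n; rewrite normrM -[leRHS]mulrA ler_wpM2l// ger0_norm ?hq//.
  by rewrite mulr_ge0// exprn_ge0// ltW.
by apply: cvg_series_geom; case/andP: q01 => q0 ->; rewrite ltW.
Qed.

Lemma poly_geom_cvg0 k (C r : R) : 0 < r < 1 ->
  (fun n => C * (n.+1%:R ^+ k * r ^+ n)) @ \oo --> 0.
Proof. by move=> r01; apply: cvg_series_cvg_0; exact: cvg_series_poly_geom. Qed.

End real_line_estimates.

Section hermite_functions.
Context {R : realType}.
Notation lam := (@lebesgue_measure R).

(** The physicists' Hermite polynomials, generated by the raising operator. *)
Fixpoint hpoly n : {poly R} :=
  if n is m.+1 then 'X * hpoly m *+ 2 - (hpoly m)^`() else 1.

Lemma deriv_hpoly n : (hpoly n.+1)^`() = hpoly n *+ (2 * n.+1).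
Proof.
elim: n => [|n IH].
  by rewrite /= derivC subr0 mulr1 derivMn derivX.
rewrite [in LHS]/= -/(hpoly n.+1) derivB derivMn derivM derivX mul1r.
rewrite IH derivMn.
have -> : (hpoly n)^`() = 'X * hpoly n *+ 2 - hpoly n.+1 by rewrite /= opprB addrC subrK.
ring.
Qed.

Definition gs (x : R) := expR (- (x ^+ 2 / 2)).
(** The squared L^2 norm of the n-th Hermite polynomial times exp(- x^2 / 2). *)
Definition hnorm n : R := 2 ^+ n * n`!%:R * Num.sqrt pi.
Definition her n (x : R) : R := locked ((Num.sqrt (hnorm n))^-1 * ((hpoly n).[x] * gs x)).
Lemma herE n x : her n x = (Num.sqrt (hnorm n))^-1 * ((hpoly n).[x] * gs x).
Proof. by rewrite /her -lock. Qed.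
(** The ladder coefficient. It vanishes at 0, so the value of [her n.-1] at [n = 0], which is
    [her 0] and not a lower state, is always multiplied by 0. *)
Definition an n : R := Num.sqrt (2 * n%:R).

Lemma hnorm_gt0 n : 0 < hnorm n.
Proof. by rewrite /hnorm !mulr_gt0 ?exprn_gt0 ?sqrtr_gt0 ?pi_gt0// ltr0n fact_gt0. Qed.

Lemma an0 : an 0 = 0. Proof. by rewrite /an mulr0 sqrtr0. Qed.
Lemma an_ge0 n : 0 <= an n. Proof. exact: sqrtr_ge0. Qed.
Lemma an_gt0 n : 0 < an n.+1. Proof. by rewrite sqrtr_gt0 mulr_gt0. Qed.
Lemma an_sqr n : an n ^+ 2 = 2 * n%:R. Proof. by rewrite sqr_sqrtr// mulr_ge0. Qed.
Lemma an_le n m : (n <= m)%N -> an n <= an m.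
Proof. by move=> nm; rewrite ler_wsqrtr// ler_pM2l// ler_nat. Qed.
Lemma an_le2 n : an n <= 2 * n%:R.
Proof.
case: n => [|n]; first by rewrite an0 mulr0.
have h : 1 <= an n.+1.
  rewrite -[leLHS](sqrtr1) ler_wsqrtr// -natrM ler1n.
  by rewrite muln_gt0.
by rewrite -an_sqr expr2 ler_peMl// an_ge0.
Qed.

Lemma sqrt_hnormS n : Num.sqrt (hnorm n.+1) = an n.+1 * Num.sqrt (hnorm n).
Proof.
rewrite /an -sqrtrM ?mulr_ge0//; congr Num.sqrt.
by rewrite /hnorm exprS factS natrM; ring.
Qed.

Let sh n : Num.sqrt (hnorm n) != 0.
Proof. by rewrite gt_eqF// sqrtr_gt0 hnorm_gt0. Qed.

Lemma is_derive_gs (x : R) : is_derive x 1 gs (- x * gs x).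
Proof.
have h : is_derive x 1 (fun y : R => - (y ^+ 2 / 2)) (- x).
  have -> : (fun y : R => - (y ^+ 2 / 2)) = horner ((- 2^-1) *: 'X^2).
    by apply/funext => y; rewrite hornerZ hornerXn; field.
  have -> : - x = ((- 2^-1) *: 'X^2)^`().[x].
    by rewrite derivZ derivXn hornerZ hornerMn expr1 hornerX; field.
  exact: is_derive_poly.
by have := is_derive1_comp (is_derive_expR _) h; rewrite mulrC.
Qed.

Lemma is_derive_pgs (p : {poly R}) (x : R) :
  is_derive x 1 (fun x => p.[x] * gs x) ((p^`().[x] - x * p.[x]) * gs x).
Proof.
have := is_deriveM (is_derive_poly p x) (is_derive_gs x).
move=> h; apply: (is_derive_eq h).
by rewrite /GRing.scale/=; ring.
Qed.

Lemma her0E x : her 0 x = (Num.sqrt (hnorm 0))^-1 * gs x.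
Proof. by rewrite herE /= hornerC mul1r. Qed.

Lemma hpoly_recE n x : (hpoly n.+1).[x] = 2 * x * (hpoly n).[x] - (hpoly n)^`().[x].
Proof. by rewrite /= hornerD hornerN hornerMn hornerM hornerX -mulr_natl; ring. Qed.

Lemma her_lower n x : (Num.sqrt (hnorm n))^-1 * ((hpoly n)^`().[x] * gs x) = an n * her n.-1 x.
Proof.
case: n => [|n]; first by rewrite an0 mul0r derivC horner0 mul0r mulr0.
rewrite deriv_hpoly hornerMn -mulr_natl natrM -an_sqr herE sqrt_hnormS.
by field; rewrite sh gt_eqF// an_gt0.
Qed.

Lemma is_derive_her n (x : R) : is_derive x 1 (her n) (an n * her n.-1 x - x * her n x).
Proof.
have := is_deriveZ (Num.sqrt (hnorm n))^-1 (is_derive_pgs (hpoly n) x).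
rewrite (_ : _ \*: _ = her n); last by apply/funext => y; rewrite herE.
by move=> h; apply: (is_derive_eq h); rewrite -her_lower herE /GRing.scale/=; ring.
Qed.

Lemma her_rec n x : 2 * x * her n x = an n * her n.-1 x + an n.+1 * her n.+1 x.
Proof.
rewrite -her_lower !herE hpoly_recE sqrt_hnormS.
by field; rewrite sh gt_eqF// an_gt0.
Qed.

Lemma is_derive_her2 n (x : R) :
  is_derive x 1 (her n) ((an n * her n.-1 x - an n.+1 * her n.+1 x) / 2).
Proof.
apply: (is_derive_eq (is_derive_her n x)).
have -> : an n.+1 * her n.+1 x = 2 * x * her n x - an n * her n.-1 x by rewrite her_rec addrC addKr.
by field.
Qed.

Lemma continuous_her n : continuous (her n).
Proof.
move=> x; apply: differentiable_continuous; apply/derivable1_diffP.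
by have := is_derive_her n x => h; exact: ex_derive.
Qed.

Lemma measurable_her n : measurable_fun [set: R] (her n).
Proof. by apply: continuous_measurable_fun; exact: continuous_her. Qed.

Let pgs_bound (p : {poly R}) k : exists C, forall x, `|x| ^+ k * `|p.[x] * gs x| <= C.
Proof.
elim/poly_ind: p k => [|p c IH] k.
  by exists 0 => x; rewrite horner0 mul0r normr0 mulr0.
have [C hC] := IH k.+1.
exists (C + `|c| * (1 + k`!%:R * 2 ^+ k)) => x.
have xk : `|x| ^+ k * gs x <= 1 + k`!%:R * 2 ^+ k.
  have g1 : gs x <= 1 by rewrite -expR0 ler_expR oppr_le0 divr_ge0// sqr_ge0.
  have [x1|x1] := leP `|x| 1.
    rewrite (@le_trans _ _ 1)//; last by rewrite lerDl mulr_ge0// exprn_ge0.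
    by rewrite mulr_ile1 ?exprn_ge0 ?expR_ge0// exprn_ile1.
  have h0 : 0 <= x ^+ 2 / 2 by rewrite divr_ge0// sqr_ge0.
  have := exprn_le_expR k h0.
  have -> : (x ^+ 2 / 2) ^+ k = (`|x| ^+ k) ^+ 2 / 2 ^+ k.
    by rewrite expr_div_n -[x ^+ 2]real_normK ?num_real// exprAC.
  rewrite ler_pdivrMr ?exprn_gt0// => h.
  rewrite /gs expRN ler_pdivrMr ?expR_gt0//.
  have x1k : `|x| ^+ k <= (`|x| ^+ k) ^+ 2.
    by rewrite expr2 ler_peMl ?exprn_ge0// exprn_ege1// ltW.
  rewrite (le_trans x1k)// (le_trans h)// mulrAC ler_wpM2r ?expR_ge0// lerDr//.
rewrite hornerMXaddC mulrDl (le_trans (ler_wpM2l _ (ler_normD _ _))) ?exprn_ge0//.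
rewrite mulrDr lerD//.
  have -> : `|x| ^+ k * `|p.[x] * x * gs x| = `|x| ^+ k.+1 * `|p.[x] * gs x|.
    by rewrite !normrM exprS; ring.
  exact: hC.
rewrite normrM mulrCA ler_wpM2l// ger0_norm ?expR_ge0//.
Qed.

Lemma her_jap0 n : exists C, forall x, `|her n x| <= C * jap x.
Proof.
have [C0 h0] := pgs_bound (hpoly n) 0; have [C2 h2] := pgs_bound (hpoly n) 2.
exists ((Num.sqrt (hnorm n))^-1 * (C0 + C2)) => x.
rewrite herE normrM ger0_norm ?invr_ge0 ?sqrtr_ge0// -mulrA ler_wpM2l ?invr_ge0 ?sqrtr_ge0//.
apply: jap_le; rewrite mulrDr mulr1 lerD//; first by have := h0 x; rewrite expr0 mul1r.
by rewrite mulrC -[x ^+ 2]real_normK ?num_real.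
Qed.

Lemma her_bounded0 n : exists2 C, 0 <= C & forall x, `|her n x| <= C * jap x /\ `|her n x| <= C.
Proof.
have [C hC] := her_jap0 n.
have C0 : 0 <= C by have := le_trans (normr_ge0 _) (hC 0); rewrite /jap expr0n addr0 invr1 mulr1.
exists C => // x; split => //; rewrite (le_trans (hC x))// ler_piMr// jap_le1//.
Qed.

Lemma L1_her n : L1 lam (her n).
Proof.
have [C hC] := her_jap0 n.
by apply: (L1_le _ (L1Z C L1_jap)) => //; exact: measurable_her.
Qed.

Lemma L1_her2 n m : L1 lam (fun x => her n x * her m x).
Proof.
have [C _ hC] := her_bounded0 n; have [D D0 hD] := her_bounded0 m.
apply: (L1_le _ (L1Z (D * C) L1_jap)).
  by apply: measurable_funM; exact: measurable_her.
move=> x; rewrite normrM mulrC -mulrA ler_pM//; first exact: (hD x).2.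
exact: (hC x).1.
Qed.

(** The raising and lowering operators are adjoint: the difference of the two sides is the integral
    of the derivative of [her n * her m], up to sign. *)
Lemma her_adj n m : an m.+1 * \int[lam]_x (her n x * her m.+1 x) =
  an n * \int[lam]_x (her n.-1 x * her m x).
Proof.
have i1 := L1Z (an m.+1) (L1_her2 n m.+1); have i2 := L1Z (an n) (L1_her2 n.-1 m).
rewrite -!intZ; [|exact: L1_her2|exact: L1_her2].
apply/eqP; rewrite -subr_eq0 -intB// -oppr_eq0 -intN; last exact: L1B.
have [C C0 hC] := her_bounded0 n; have [D D0 hD] := her_bounded0 m.
have [C' C'0 hC'] := her_bounded0 n.-1; have [D' D'0 hD'] := her_bounded0 m.+1.
pose K := C * D + an m.+1 * (C * D') + an n * (C' * D).
have b (a1 a2 b1 b2 x : R) : 0 <= a1 -> `|b1| <= a1 -> `|b2| <= a2 * jap x -> `|b1 * b2| <= a1 * a2 * jap x.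
  by move=> a10 h1 h2; rewrite normrM -mulrA ler_pM.
apply/eqP; apply: (@int_derive_line0 _ (fun x => her n x * her m x) _ K).
- move=> x; have := is_deriveM (is_derive_her n x) (is_derive_her m x).
  move=> h; apply: (is_derive_eq h); rewrite /GRing.scale/=.
  have -> : an m.+1 * (her n x * her m.+1 x) = her n x * (2 * x * her m x - an m * her m.-1 x).
    by rewrite her_rec addrC addKr; ring.
  by ring.
- move=> x; rewrite (le_trans (b C D _ _ x C0 (hC x).2 (hD x).1))// ler_wpM2r ?jap_ge0//.
  by rewrite /K -addrA lerDl !(addr_ge0, mulr_ge0) ?an_ge0.
move=> x; rewrite normrN (le_trans (ler_normB _ _))// /K -addrA mulrDl.
rewrite ler_wpDl ?mulr_ge0 ?jap_ge0// mulrDl lerD// normrM (ger0_norm (an_ge0 _)) -[leRHS]mulrA.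
  by rewrite ler_wpM2l ?an_ge0//; apply: b => //; [exact: (hC x).2|exact: (hD' x).1].
by rewrite ler_wpM2l ?an_ge0//; apply: b => //; [exact: (hC' x).2|exact: (hD x).1].
Qed.

(** Adjointness lowers both indices at once, so the recursion ends either in the Gaussian integral
    or in a factor [an 0]. *)
Lemma her_orthonormal n m : \int[lam]_x (her n x * her m x) = (n == m)%:R.
Proof.
elim: n m => [|n IH] [|m].
- have E x : her 0 x * her 0 x = (hnorm 0)^-1 * expR (- 1 * (x - 0) ^+ 2).
    rewrite her0E mulrACA -expr2 exprVn sqr_sqrtr ?ltW ?hnorm_gt0//.
    by congr (_ * _); rewrite /gs -expRD; congr expR; field.
  have [i1 i2] := @int_expR_sqr R 1 0 ltr01.
  rewrite (int_ext lam E) intZ// i2 divr1 /hnorm expr0 fact0 !mul1r mulVf//.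
  by rewrite gt_eqF// sqrtr_gt0 pi_gt0.
- have := her_adj 0 m; rewrite an0 mul0r => /eqP.
  by rewrite mulf_eq0 gt_eqF ?an_gt0//= => /eqP ->.
- have E x : her n.+1 x * her 0 x = her 0 x * her n.+1 x by rewrite mulrC.
  have := her_adj 0 n; rewrite an0 mul0r => /eqP.
  by rewrite mulf_eq0 gt_eqF ?an_gt0//= (int_ext lam E) => /eqP ->.
have := her_adj n.+1 m; rewrite /= IH eqSS; case: eqP => [->|_].
  move=> h; apply: (mulfI _ h); by rewrite gt_eqF ?an_gt0.
by rewrite mulr0 => /eqP; rewrite mulf_eq0 gt_eqF ?an_gt0//= => /eqP.
Qed.

(* [f(x)^2 - f(a)^2 = int_a^x 2 f f'], and f' is a combination of neighbours *)
Lemma her_sup n x : `|her n x| <= 2 * n.+1%:R.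
Proof.
pose G x := her n x ^+ 2.
pose dG x := her n x * (an n * her n.-1 x - an n.+1 * her n.+1 x).
have dGE (y : R) : is_derive y 1 G (dG y).
  have := is_deriveM (is_derive_her2 n y) (is_derive_her2 n y).
  move=> h; rewrite (_ : G = her n * her n); last by apply/funext => z; rewrite /G expr2.
  by apply: (is_derive_eq h); rewrite /dG /GRing.scale/=; field.
have cG : continuous G.
  by move=> y; apply: differentiable_continuous; apply/derivable1_diffP; exact: ex_derive.
have cdG : continuous dG.
  move=> y; apply: continuousM; first exact: continuous_her.
  by apply: continuousB; apply: continuousM; (exact: cst_continuous || exact: continuous_her).
have idG : L1 lam dG.
  apply: L1_ext (L1B (L1Z (an n) (L1_her2 n n.-1)) (L1Z (an n.+1) (L1_her2 n n.+1))) => y.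
  by rewrite /dG; ring.
(* By the inequality of arithmetic and geometric means the integrand lies below a combination of
   squares of three neighbouring Hermite functions, each of integral 1. *)
have M : \int[lam]_y `|dG y| <= 4 * n.+1%:R.
  pose H y := an n / 2 * (her n y * her n y) + an n / 2 * (her n.-1 y * her n.-1 y) +
     (an n.+1 / 2 * (her n y * her n y) + an n.+1 / 2 * (her n.+1 y * her n.+1 y)).
  have i c m := L1Z c (L1_her2 m m).
  have iH : L1 lam H by do ![apply: L1D | exact: i].
  have -> : 4 * n.+1%:R = 2 * n.+1%:R + 2 * n.+1%:R :> R by ring.
  apply: (@le_trans _ _ (\int[lam]_y H y)).
    apply: int_le => //; first exact: L1_norm.
    move=> y; rewrite /dG /H mulrBr (le_trans (ler_normB _ _))//.
    have amgm (a u v : R) : 0 <= a -> `|u * (a * v)| <= a / 2 * (u * u) + a / 2 * (v * v).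
      move=> a0; have -> : u * (a * v) = a * (u * v) by ring.
      rewrite normrM ger0_norm// -mulrDr -mulrA ler_wpM2l// ler_norml.
      by apply/andP; split; have := sqr_ge0 (u + v); have := sqr_ge0 (u - v); lra.
    by rewrite lerD// amgm ?an_ge0.
  rewrite intD; [|by apply: L1D; exact: i|by apply: L1D; exact: i].
  rewrite !intD; try exact: i.
  rewrite !intZ; try exact: L1_her2.
  rewrite !her_orthonormal !eqxx !mulr1 -!splitr.
  by rewrite lerD// (le_trans (an_le2 _))// ler_wpM2l// ler_nat.
have [C C0 hC] := her_bounded0 n.
have key a : a < x -> G x <= 4 * n.+1%:R + G a.
  move=> ax; have := @continuous_FTC2 R dG G a x ax (continuous_subspaceT cdG).
  have h1 : derivable_oo_LRcontinuous G a x.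
    split; first by move=> y _; apply: ex_derive.
      by apply: cvg_at_right_filter; exact: cG.
    by apply: cvg_at_left_filter; exact: cG.
  have h2 : {in `]a, x[, derive1 G =1 dG} by move=> y _; rewrite derive1E derive_val.
  move=> /(_ h1 h2) E.
  suff : G x - G a <= 4 * n.+1%:R by lra.
  rewrite -lee_fin EFinB -E; apply: (@le_trans _ _ (\int[lam]_y `|dG y|)%:E); last by rewrite lee_fin.
  rewrite intE; last exact: L1_norm.
  have mdG : measurable_fun setT (EFin \o dG) by apply/measurable_EFinP; exact: L1_meas idG.
  apply: (@le_trans _ _ (\int[lam]_(y in `[a, x]) `|(dG y)%:E|)%E).
    apply: (le_trans (lee_abs _)); apply: le_abse_integral => //.
    exact: measurable_funTS.
  apply: ge0_subset_integral => //.
  exact: measurableT_comp.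
have G_le : G x <= 4 * n.+1%:R.
  apply/ler_addgt0Pr => e e0.
  (* The base point is moved to minus infinity: beyond [- b] the bound [C ^+ 2 * jap a] is below
     [e]. *)
  pose b := C ^+ 2 / e + 1; pose a := Num.min (x - 1) (- b).
  have b1 : 1 <= b by rewrite lerDr divr_ge0 ?exprn_ge0// ltW.
  have ax : a < x by rewrite gt_min; apply/orP; left; lra.
  apply: (le_trans (key _ ax)); rewrite lerD2l /G.
  have ab : b <= - a by rewrite lerNr ge_min lexx orbT.
  have : `|her n a| ^+ 2 <= C * (C * jap a).
    by rewrite expr2 ler_pM//; [exact: (hC a).2|exact: (hC a).1].
  rewrite real_normK ?num_real// => /le_trans; apply.
  rewrite mulrA -expr2 /jap ler_pdivrMr ?ltr_pwDl ?sqr_ge0//.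
  have : C ^+ 2 = e * (b - 1) by rewrite /b addrK mulrCA mulfV ?mulr1// gt_eqF.
  move=> ->; rewrite ler_wpM2l ?ltW//; nra.
rewrite -(ler_pXn2r (n := 2)) ?nnegrE// ?mulr_ge0// real_normK ?num_real//.
rewrite (le_trans G_le)// expr2.
have : 1 <= n.+1%:R :> R by rewrite ler1n.
nra.
Qed.

(* sealed, so that no tactic evaluates the unary numeral *)
Fact hermite_const_subproof : exists2 c : R, 0 < c & 300 <= c.
Proof. by exists 300; rewrite ?ltr0n. Qed.
Definition hK : R := s2val (cid2 hermite_const_subproof).
Lemma hK_gt0 : 0 < hK. Proof. exact: (s2valP (cid2 hermite_const_subproof)). Qed.
Lemma hK_ge : 300 <= hK. Proof. exact: (s2valP' (cid2 hermite_const_subproof)). Qed.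
Definition hb (n : nat) : R := locked (hK * n.+1%:R ^+ 3).
Lemma hbE n : hb n = hK * n.+1%:R ^+ 3. Proof. by rewrite /hb -lock. Qed.
Lemma hb_ge0 n : 0 <= hb n.
Proof. by rewrite hbE mulr_ge0 ?exprn_ge0 ?ler0n// ltW// hK_gt0. Qed.

(** The three-term recurrence trades a factor x for a shift of the degree at the cost of a factor
    linear in the degree. Two uses control x^2 times the function, with a bound polynomial in n. *)
Lemma her_jap n x : `|her n x| <= hb n * jap x.
Proof.
have rec (m : nat) (u : R) : `|x * u * her m x| <= an m.+1 / 2 * (`|u * her m.-1 x| + `|u * her m.+1 x|).
  have -> : x * u * her m x = 2^-1 * (an m * (u * her m.-1 x) + an m.+1 * (u * her m.+1 x)).
    have := her_rec m x => h; transitivity (2^-1 * (u * (2 * x * her m x))); first by field.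
    by rewrite h; ring.
  rewrite normrM ger0_norm// [leRHS](_ : _ = 2^-1 * (an m.+1 * (`|u * her m.-1 x| + `|u * her m.+1 x|))); last by field.
  rewrite ler_wpM2l//.
  rewrite (le_trans (ler_normD _ _))// mulrDr !normrM !(ger0_norm (an_ge0 _)).
  rewrite lerD// ler_wpM2r ?mulr_ge0//; exact: an_le.
have mp m : m.-1.+1%:R <= m.+1%:R :> R by rewrite ler_nat; case: m.
have x1 m : `|x * her m x| <= 4 * m.+2%:R ^+ 2.
  have := rec m 1; rewrite mulr1 !mul1r => /le_trans; apply.
  have a1 := an_le2 m.+1; have a0 := an_ge0 m.+1; have h1 := her_sup m.-1 x; have h2 := her_sup m.+1 x.
  have m1 := mp m; have E1 : m.+2%:R = m.+1%:R + 1 :> R by rewrite -[in LHS]natr1.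
  have m0 : 0 <= m.+1%:R :> R by [].
  have n1 := normr_ge0 (her m.-1 x); have n2 := normr_ge0 (her m.+1 x).
  have S : `|her m.-1 x| + `|her m.+1 x| <= 4 * m.+2%:R by rewrite E1; rewrite E1 in h2; lra.
  have A : an m.+1 / 2 <= m.+2%:R by rewrite E1; lra.
  rewrite (le_trans (ler_pM _ _ A S))// ?divr_ge0 ?addr_ge0//.
  by rewrite mulrCA -expr2.
have x2 m : `|x * x * her m x| <= 8 * m.+3%:R ^+ 3.
  have := rec m x => /le_trans; apply.
  have a1 := an_le2 m.+1; have a0 := an_ge0 m.+1; have h1 := x1 m.-1; have h2 := x1 m.+1.
  have E1 : m.+3%:R = m.+1%:R + 2 :> R by rewrite -addn2 natrD.
  have m0 : 0 <= m.+1%:R :> R by [].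
  have hp : m.-1.+2%:R ^+ 2 <= m.+3%:R ^+ 2 :> R.
    by rewrite lerXn2r ?nnegrE ?ler0n// ler_nat !ltnS (leq_trans (leq_pred m)).
  have S : `|x * her m.-1 x| + `|x * her m.+1 x| <= 8 * m.+3%:R ^+ 2 by lra.
  have A : an m.+1 / 2 <= m.+3%:R by rewrite E1; lra.
  rewrite (le_trans (ler_pM _ _ A S))// ?divr_ge0 ?addr_ge0//.
  by rewrite mulrCA -exprS.
apply: jap_le; rewrite mulrDr mulr1.
have := x2 n; rewrite -expr2 normrM (ger0_norm (sqr_ge0 x)) mulrC => h2.
have h1 := her_sup n x.
rewrite (le_trans (lerD h1 h2))// hbE.
have E1 : n.+3%:R = n.+1%:R + 2 :> R by rewrite -addn2 natrD.
rewrite E1.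
have : 1 <= n.+1%:R :> R by rewrite ler1n.
set u := n.+1%:R => u1.
have u2 : u <= u ^+ 2 by rewrite expr2; nra.
have u3 : u ^+ 2 <= u ^+ 3 by rewrite [leRHS]exprS; nra.
have -> : (u + 2) ^+ 3 = u ^+ 3 + 6 * u ^+ 2 + 12 * u + 8 by ring.
(* As u is at least 1, the sum 2 u + 8 (u + 2)^3 is at most 218 u^3; this is the origin of the
   numerical constant behind [hK]. *)
have : 300 * u ^+ 3 <= hK * u ^+ 3 by rewrite ler_wpM2r ?hK_ge// exprn_ge0.
lra.
Qed.

Lemma hb2 n : hb n * hb n = hK ^+ 2 * n.+1%:R ^+ 6.
Proof. by rewrite hbE; ring. Qed.

Lemma hb_le m n : (m <= n)%N -> hb m <= hb n.
Proof.
by move=> mn; rewrite !hbE ler_wpM2l ?(ltW hK_gt0)// lerXn2r ?nnegrE ?ler0n// ler_nat.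
Qed.

Lemma her_le_hb n x : `|her n x| <= hb n.
Proof. by rewrite (le_trans (her_jap n x))// ler_piMr ?hb_ge0// jap_le1. Qed.

End hermite_functions.

(** * Mehler's formula in one variable *)

Section mehler_kernel.
Context {R : realType}.
Notation lam := (@lebesgue_measure R).

Lemma mean_value_bound (f df : R -> R) (K x : R) : (forall c : R, is_derive c 1 f (df c)) ->
  (forall c, `|c| <= `|x| -> `|df c| <= K) -> `|f x - f 0| <= K * `|x|.
Proof.
move=> fdf hK.
have cf : continuous f.
  by move=> y; apply: differentiable_continuous; apply/derivable1_diffP; exact: ex_derive.
have [x0|x0] := leP 0 x.
  have [c /andP[]] := MVT_segment x0 (fun y _ => fdf y) (continuous_subspaceT cf).
  rewrite !bnd_simp subr0 => c0 cx ->.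
  by rewrite normrM ler_wpM2r// hK// !ger0_norm// (le_trans c0).
have [c /andP[]] := MVT_segment (ltW x0) (fun y _ => fdf y) (continuous_subspaceT cf).
rewrite !bnd_simp sub0r => cx c0 E.
rewrite distrC E normrM normrN ler_wpM2r// hK// !ler0_norm ?lerN2// ltW//.
Qed.

(** The exponent of Mehler's kernel for the series with ratio [r]. The factor r^(1/2) of the
    oscillator semigroup is left out and reappears as exp(- t^2 / 4) in [heat]. *)
Definition mexp (r x y : R) := ((1 + r ^+ 2) * (x ^+ 2 + y ^+ 2) - 4 * r * x * y) / (2 * (1 - r ^+ 2)).
Definition mker (r x y : R) := locked ((Num.sqrt (pi * (1 - r ^+ 2)))^-1 * expR (- mexp r x y)).
Lemma mkerE r x y : mker r x y = (Num.sqrt (pi * (1 - r ^+ 2)))^-1 * expR (- mexp r x y).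
Proof. by rewrite /mker -lock. Qed.
Definition mser (r x y : R) n := r ^+ n * (her n x * her n y).

Lemma mexpC r x y : mexp r x y = mexp r y x.
Proof. by rewrite /mexp; congr (_ / _); ring. Qed.
Lemma mserC r x y : mser r x y = mser r y x.
Proof. by apply/funext => n; rewrite /mser [her n x * _]mulrC. Qed.

Lemma is_derive_mexp r (x y : R) : is_derive x 1 (fun x => expR (mexp r x y))
  (expR (mexp r x y) * (((1 + r ^+ 2) * x - 2 * r * y) / (1 - r ^+ 2))).
Proof.
apply: (is_derive1_comp (is_derive_expR _)).
pose K := (2 * (1 - r ^+ 2))^-1.
pose P : {poly R} := (K * (1 + r ^+ 2)) *: 'X^2 - (K * (4 * r * y)) *: 'X + (K * ((1 + r ^+ 2) * y ^+ 2))%:P.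
have -> : mexp r ^~ y = horner P.
  apply/funext => z; rewrite /mexp /P -/K !(hornerD, hornerN) !hornerZ hornerXn hornerX hornerC.
  ring.
have -> : ((1 + r ^+ 2) * x - 2 * r * y) / (1 - r ^+ 2) = P^`().[x].
  have E : (1 - r ^+ 2)^-1 = 2 * K by rewrite /K invfM mulrA mulfV ?mul1r.
  rewrite E.
  rewrite /P derivD derivB !derivZ derivXn derivX derivC addr0 hornerD hornerN !hornerZ hornerMn expr1 hornerX hornerC; ring.
exact: is_derive_poly.
Qed.

Section ratio.
Variable r : R.
Hypothesis r01 : 0 < r < 1.
Let r0 : 0 < r. Proof. by case/andP: r01. Qed.
Let r1 : r < 1. Proof. by case/andP: r01. Qed.
Let r2 : 0 < 1 - r ^+ 2. Proof. by rewrite subr_gt0 expr_lt1// ltW. Qed.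
Let r2n : 1 - r ^+ 2 != 0. Proof. by rewrite gt_eqF. Qed.

Let err (N : nat) (x y : R) := r ^+ N * an N * (r * her N x * her N.-1 y - her N.-1 x * her N y).

(* The ladder relations in x and y make the partial sums satisfy the first
   order equation of the Mehler kernel up to a boundary term. *)
Let is_derive_partial N (x y : R) : is_derive x 1 (fun x => series (mser r x y) N)
  (((2 * r * y - (1 + r ^+ 2) * x) * series (mser r x y) N + err N x y) / (1 - r ^+ 2)).
Proof.
elim: N => [|N IH].
  have -> : (fun x => series (mser r x y) 0) = cst 0.
    by apply/funext => z; rewrite /series/= big_geq.
  apply: (is_derive_eq (is_derive_cst _ _ _)).
  by rewrite /series/= big_geq// /err an0 !(mulr0, mul0r, addr0).
have -> : (fun x => series (mser r x y) N.+1) =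
    (fun x => series (mser r x y) N) + (r ^+ N * her N y) *: her N.
  apply/funext => z; rewrite seriesSr/= /mser; congr (_ + _).
  by transitivity ((r ^+ N * her N y) * her N z); [ring|].
have := is_deriveD IH (is_deriveZ (r ^+ N * her N y) (is_derive_her N x)).
move=> h; apply: (is_derive_eq h); rewrite seriesSr /GRing.scale/= /err.
have e (z : R) : an N.+1 * her N.+1 z = 2 * z * her N z - an N * her N.-1 z by rewrite her_rec addrC addKr.
rewrite /= -[r ^+ N.+1 * an N.+1 * _]mulrA.
have -> : an N.+1 * (r * her N.+1 x * her N y - her N x * her N.+1 y) =
   r * (an N.+1 * her N.+1 x) * her N y - her N x * (an N.+1 * her N.+1 y) by ring.
rewrite !e [r ^+ N.+1]exprS [mser r x y N]/mser; move: (series _ _) => S; field.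
by rewrite r2n.
Qed.

(** The inverse of the Mehler exponential is an integrating factor: only the boundary term survives,
    and it decays like a polynomial times r^N. *)
Let is_derive_ratio N (x y : R) : is_derive x 1 (fun x => series (mser r x y) N * expR (mexp r x y))
  (err N x y * expR (mexp r x y) / (1 - r ^+ 2)).
Proof.
have := is_deriveM (is_derive_partial N x y) (is_derive_mexp r x y).
move=> h; apply: (is_derive_eq h); rewrite /GRing.scale/=; field.
by rewrite r2n.
Qed.

Let err_bound N x y : `|err N x y| <= 4 * hK ^+ 2 * (N.+1%:R ^+ 7 * r ^+ N).
Proof.
rewrite /err normrM ger0_norm ?mulr_ge0 ?an_ge0 ?exprn_ge0 ?(ltW r0)//.
have a m (z : R) : (m <= N)%N -> `|her m z| <= hb N.
  by move=> mN; rewrite (le_trans (her_le_hb m z))// hb_le.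
have S : `|r * her N x * her N.-1 y - her N.-1 x * her N y| <= 2 * hb N ^+ 2.
  rewrite (_ : 2 * hb N ^+ 2 = hb N ^+ 2 + hb N ^+ 2); last by ring.
  rewrite (le_trans (ler_normB _ _))//.
  rewrite lerD// !normrM expr2.
    rewrite ler_pM ?mulr_ge0 ?a ?leq_pred//.
    by rewrite -[leRHS]mul1r ler_pM ?a// gtr0_norm ?(ltW r1)//.
  by rewrite ler_pM ?a ?leq_pred.
have A : r ^+ N * an N <= r ^+ N * (2 * N.+1%:R).
  rewrite ler_wpM2l ?exprn_ge0 ?(ltW r0)// (le_trans (an_le2 N))// ler_wpM2l// ler_nat//.
rewrite (le_trans (ler_pM _ _ A S)) ?mulr_ge0 ?an_ge0 ?exprn_ge0 ?(ltW r0)//.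
rewrite expr2 hb2 le_eqVlt; apply/orP; left; apply/eqP; ring.
Qed.

Let ratio_cvg x y : (fun N => series (mser r x y) N * expR (mexp r x y) -
  series (mser r 0 y) N * expR (mexp r 0 y)) @ \oo --> 0.
Proof.
pose I := expR (((1 + r ^+ 2) * (x ^+ 2 + y ^+ 2) + 4 * r * `|x| * `|y|) / (2 * (1 - r ^+ 2))).
pose K N := 4 * hK ^+ 2 * (N.+1%:R ^+ 7 * r ^+ N) * I / (1 - r ^+ 2).
have I_le c : `|c| <= `|x| -> expR (mexp r c y) <= I.
  move=> cx; rewrite ler_expR /mexp ler_pM2r ?invr_gt0 ?mulr_gt0//.
  rewrite lerD//.
    rewrite ler_wpM2l ?addr_ge0 ?sqr_ge0// lerD2r.
    by rewrite -[leLHS]real_normK ?num_real// -[leRHS]real_normK ?num_real// lerXn2r ?nnegrE.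
  rewrite (le_trans (ler_norm _))// normrN !normrM ger0_norm// (gtr0_norm r0).
  by rewrite ler_wpM2r// ler_wpM2l// mulr_ge0// ltW.
have b N : `|series (mser r x y) N * expR (mexp r x y) -
  series (mser r 0 y) N * expR (mexp r 0 y)| <= K N * `|x|.
  apply: (mean_value_bound (is_derive_ratio N ^~ y)) => c cx.
  rewrite 2!normrM normfV (gtr0_norm r2) (gtr0_norm (expR_gt0 _)) /K.
  rewrite ler_wpM2r ?invr_ge0 ?(ltW r2)// ler_pM ?expR_ge0// ?err_bound ?I_le//.
apply/norm_cvg0P.
apply: (@squeeze_cvgr _ _ _ _ (fun=> 0) (fun N => K N * `|x|)).
- by apply: nearW => N; rewrite normr_ge0 b.
- exact: cvg_cst.
have -> : (fun N => K N * `|x|) = (fun N => (4 * hK ^+ 2 * I / (1 - r ^+ 2) * `|x|) * (N.+1%:R ^+ 7 * r ^+ N)).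
  by apply/funext => N; rewrite /K; ring.
exact: poly_geom_cvg0.
Qed.

Lemma mser_bound x y n : `|mser r x y n| <= hK ^+ 2 * (n.+1%:R ^+ 6 * r ^+ n).
Proof.
have -> : hK ^+ 2 * (n.+1%:R ^+ 6 * r ^+ n) = r ^+ n * (hb n * hb n) by rewrite hb2; ring.
rewrite /mser normrM ger0_norm ?exprn_ge0 ?(ltW r0)// ler_wpM2l ?exprn_ge0 ?(ltW r0)//.
by rewrite normrM ler_pM// her_le_hb.
Qed.

Lemma is_cvg_mser x y : cvgn (series (mser r x y)).
Proof.
apply: (series_dominated_cvg (@mser_bound x y)).
exact: cvg_series_poly_geom.
Qed.

Let L := limn (series (mser r 0 0)).

(** The ratio of the series to the exponential does not depend on x in the limit, nor on y by
    symmetry. One unknown constant is left, the value at the origin. *)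
Let mser_cvgL x y : series (mser r x y) @ \oo --> L * expR (- mexp r x y).
Proof.
have h0 : (fun N => series (mser r 0 0) N * expR (mexp r 0 0)) @ \oo --> L.
  rewrite /mexp !(expr0n, addr0, mulr0, subrr, mul0r) expR0.
  under eq_fun do rewrite mulr1.
  exact: is_cvg_mser.
have -> : L * expR (- mexp r x y) = (0 + (0 + L)) * expR (- mexp r x y) by rewrite !add0r.
have -> : series (mser r x y) = (fun N => ((series (mser r x y) N * expR (mexp r x y) -
  series (mser r 0 y) N * expR (mexp r 0 y)) + ((series (mser r y 0) N * expR (mexp r y 0) -
  series (mser r 0 0) N * expR (mexp r 0 0)) + series (mser r 0 0) N * expR (mexp r 0 0))) *
  expR (- mexp r x y)).
  apply/funext => N; rewrite (mserC r 0 y) (mexpC r 0 y) !subrK expRN mulfK//.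
  by rewrite gt_eqF ?expR_gt0.
apply: cvgM; last exact: cvg_cst.
apply: cvgD; first exact: ratio_cvg.
by apply: cvgD; first exact: ratio_cvg.
Qed.

Definition mbound : R := limn (series (fun n => hK ^+ 2 * (n.+1%:R ^+ 6 * r ^+ n))).

Lemma mser_abs_bound x y N : \sum_(0 <= n < N) `|mser r x y n| <= mbound.
Proof.
apply: (@le_trans _ _ (series (fun n => hK ^+ 2 * (n.+1%:R ^+ 6 * r ^+ n)) N)).
  by rewrite /series/= ler_sum// => n _; exact: mser_bound.
apply: nondecreasing_cvgn_le; last exact: cvg_series_poly_geom.
apply/nondecreasing_seqP => n; rewrite seriesSr lerDl.
by rewrite mulr_ge0 ?exprn_ge0 ?(ltW hK_gt0)// mulr_ge0 ?exprn_ge0 ?ler0n ?(ltW r0).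
Qed.

Lemma mser_partial_bound x y N : `|series (mser r x y) N| <= mbound.
Proof. by rewrite (le_trans (ler_norm_sum _ _ _))// mser_abs_bound. Qed.

Let mser_int n x (N : nat) : \int[lam]_y (series (mser r x y) N * her n y) =
  if (n < N)%N then r ^+ n * her n x else 0.
Proof.
have E y : series (mser r x y) N * her n y =
    \sum_(0 <= m < N) (r ^+ m * her m x) * (her m y * her n y).
  by rewrite /series/= mulr_suml; apply: eq_bigr => m _; rewrite /mser; ring.
rewrite (int_ext lam E) int_sum; last by move=> m _; apply: L1Z; exact: L1_her2.
transitivity (\sum_(0 <= m < N) (r ^+ m * her m x) * (m == n)%:R).
  by apply: eq_bigr => m _; rewrite intZ ?her_orthonormal//; exact: L1_her2.
case: ifPn => nN.
  rewrite (bigD1_seq n) ?iota_uniq ?mem_index_iota//= eqxx mulr1 big1 ?addr0// => m /negbTE ->.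
  by rewrite mulr0.
rewrite big_nat big1// => m /= mN; case: eqP => [mn|_]; last by rewrite mulr0.
by move: nN; rewrite -mn mN.
Qed.

Let mser_int_cvg n x :
  \int[lam]_y (L * expR (- mexp r x y) * her n y) = r ^+ n * her n x /\
  L1 lam (fun y => L * expR (- mexp r x y) * her n y).
Proof.
have [] := @dominated_convergence_L1 _ _ _ lam (fun N y => series (mser r x y) N * her n y)
  (fun y => L * expR (- mexp r x y) * her n y) (fun y => mbound * `|her n y|) _ _ _ _.
- move=> N; apply: measurable_funM; last exact: measurable_her.
  apply: measurable_sum => m; apply: measurable_funM => //.
  by apply: measurable_funM => //; exact: measurable_her.
- move=> y; apply: cvgM; [exact: mser_cvgL|exact: cvg_cst].
- apply: L1Z; apply: L1_norm; exact: L1_her.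
- by move=> N y; rewrite normrM ler_wpM2r// mser_partial_bound.
move=> i /cvg_lim <- //; split => //; apply: lim_near_cst => //.
by exists n.+1 => // N /= nN; rewrite mser_int nN.
Qed.

(** The constant is found by integrating the kernel at x = 0 against the ground state: termwise this
    gives the ground state back, directly it is a Gaussian integral. *)
Let L_E : L = (Num.sqrt (pi * (1 - r ^+ 2)))^-1.
Proof.
have [+ _] := mser_int_cvg 0 0; rewrite expr0 mul1r.
pose c := (Num.sqrt (hnorm 0))^-1 : R.
have [|i1 i2] := @int_expR_sqr R (1 - r ^+ 2)^-1 0; first by rewrite invr_gt0.
have E y : L * expR (- mexp r 0 y) * her 0 y = (L * c) * expR (- (1 - r ^+ 2)^-1 * (y - 0) ^+ 2).
  rewrite her0E -/c mulrACA /gs -expRD; congr (_ * expR _); rewrite /mexp; field.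
  by rewrite r2n.
rewrite (int_ext lam E) intZ// i2 invrK her0E /gs expr0n/= mul0r oppr0 expR0 mulr1 -/c.
have c0 : c != 0 by rewrite invr_neq0// gt_eqF// sqrtr_gt0 hnorm_gt0.
rewrite mulrAC -[RHS]mul1r => /(mulIf c0) h.
apply: (mulIf (x := Num.sqrt (pi * (1 - r ^+ 2)))).
  by rewrite gt_eqF// sqrtr_gt0 mulr_gt0// pi_gt0.
by rewrite h mulVf// gt_eqF// sqrtr_gt0 mulr_gt0// pi_gt0.
Qed.

Lemma mehler1 x y : series (mser r x y) @ \oo --> mker r x y.
Proof. by rewrite mkerE -L_E; exact: mser_cvgL. Qed.

Lemma int_mker_her n x : \int[lam]_y (mker r x y * her n y) = r ^+ n * her n x /\
  L1 lam (fun y => mker r x y * her n y).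
Proof.
have := mser_int_cvg n x; rewrite L_E; congr (_ = _ /\ L1 lam _).
  by apply: int_ext => y; rewrite mkerE.
by apply/funext => y; rewrite mkerE.
Qed.

Lemma mker_gt0 x y : 0 < mker r x y.
Proof. by rewrite mkerE mulr_gt0 ?expR_gt0// invr_gt0 sqrtr_gt0 mulr_gt0// pi_gt0. Qed.

Lemma continuous_mker x : continuous (mker r x).
Proof.
move=> y; rewrite (_ : mker r x = fun y => (Num.sqrt (pi * (1 - r ^+ 2)))^-1 * expR (- mexp r x y)); last first.
  by apply/funext => z; rewrite mkerE.
apply: (@continuousM R R (fun=> (Num.sqrt (pi * (1 - r ^+ 2)))^-1) (fun y => expR (- mexp r x y))).
  exact: cst_continuous.
rewrite (_ : (fun y => expR (- mexp r x y)) = (fun y => (expR (mexp r y x))^-1)); last first.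
  by apply/funext => z; rewrite expRN mexpC.
apply: continuousV; first by rewrite gt_eqF ?expR_gt0.
apply: differentiable_continuous; apply/derivable1_diffP.
by have := is_derive_mexp r y x => h; exact: ex_derive.
Qed.

Lemma measurable_mker x : measurable_fun [set: R] (mker r x).
Proof. by apply: continuous_measurable_fun; exact: continuous_mker. Qed.

Lemma int_mker x : L1 lam (mker r x) /\
  \int[lam]_y mker r x y = Num.sqrt (2 / (1 + r ^+ 2)) *
    expR (- ((1 - r ^+ 2) / (2 * (1 + r ^+ 2)) * x ^+ 2)).
Proof.
pose a := (1 + r ^+ 2) / (2 * (1 - r ^+ 2)).
have rp : 0 < 1 + r ^+ 2 by rewrite ltr_pwDl// sqr_ge0.
have a0 : 0 < a by rewrite divr_gt0// mulr_gt0.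
have [i1 i2] := @int_expR_sqr R a (2 * r * x / (1 + r ^+ 2)) a0.
pose C := (Num.sqrt (pi * (1 - r ^+ 2)))^-1 * expR (- ((1 - r ^+ 2) / (2 * (1 + r ^+ 2)) * x ^+ 2)).
have E y : mker r x y = C * expR (- a * (y - 2 * r * x / (1 + r ^+ 2)) ^+ 2).
  rewrite mkerE /C -mulrA -expRD; congr (_ * expR _); rewrite /mexp /a; field.
  by rewrite r2n gt_eqF.
split; first by apply: L1_ext (L1Z C i1) => y; rewrite E.
rewrite (int_ext lam E) intZ// i2 /C mulrAC; congr (_ * _).
rewrite -sqrtrV ?mulr_ge0 ?pi_ge0 ?ltW// -sqrtrM ?invr_ge0 ?mulr_ge0 ?pi_ge0 ?ltW//.
congr Num.sqrt; rewrite /a; move: (@pi R) (pi_gt0 R) => P P0; field.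
by rewrite r2n !gt_eqF.
Qed.
End ratio.

(* sinh 2u >= 2u and tanh u <= u *)
Lemma mker_le_gauss (t x y : R) : 0 < t ->
  expR (- (t ^+ 2 / 4)) * mker (expR (- (t ^+ 2 / 2))) x y <= gauss t (x - y).
Proof.
move=> t0; pose u := t ^+ 2 / 4; have u0 : 0 < u by rewrite divr_gt0 ?exprn_gt0.
pose r := expR (- (2 * u)).
have -> : expR (- (t ^+ 2 / 2)) = r by congr expR; rewrite /u; field.
have r0 : 0 < r by exact: expR_gt0.
have r1 : r < 1 by rewrite -expR0 ltr_expR oppr_lt0 mulr_gt0.
have r2 : 0 < 1 - r ^+ 2 by rewrite subr_gt0 expr_lt1// ltW.
have mono (f df : R -> R) : (forall c : R, is_derive c 1 f (df c)) -> (forall c, 0 <= c -> 0 <= df c) ->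
    f 0 = 0 -> 0 <= f u.
  move=> fdf d0 f0.
  have cf : continuous f.
    by move=> z; apply: differentiable_continuous; apply/derivable1_diffP; exact: ex_derive.
  have [c /andP[]] := MVT_segment (ltW u0) (fun z _ => fdf z) (continuous_subspaceT cf).
  rewrite !bnd_simp f0 !subr0 => c0 cu ->.
  by rewrite mulr_ge0// ?d0// ltW.
have dexp (k c : R) : is_derive c 1 (fun z => expR (k * z)) (expR (k * c) * k).
  apply: (is_derive1_comp (is_derive_expR _)).
  have := is_deriveZ k (is_derive_id c (1 : R)) => h; apply: (is_derive_eq h).
  by rewrite /GRing.scale/= mulr1.
have dcst (k c : R) : is_derive c 1 (fun z => k * z) k.
  have := is_deriveZ k (is_derive_id c (1 : R)) => h; apply: (is_derive_eq h).
  by rewrite /GRing.scale/= mulr1.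
have tanh_le : 1 - r <= u * (1 + r).
  have := mono (fun z => z * (1 + expR (- 2 * z)) - 1 + expR (- 2 * z))
    (fun z => 1 - expR (- 2 * z) * (1 + 2 * z)).
  have -> : r = expR (- 2 * u) by rewrite /r mulNr.
  move=> h; suff : 0 <= u * (1 + expR (- 2 * u)) - 1 + expR (- 2 * u) by lra.
  refine (h _ _ _).
  - move=> c.
    have d1 := is_deriveD (is_derive_cst (1 : R) c (1 : R)) (dexp (- 2) c).
    have d2 := is_deriveM (is_derive_id c (1:R)) d1.
    have d3 := is_deriveD (is_deriveB d2 (is_derive_cst (1 : R) c (1 : R))) (dexp (- 2) c).
    by apply: (is_derive_eq d3); rewrite /GRing.scale/= ?fctE/=; ring.
  - move=> c c0; have := expR_ge1Dx (2 * c).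
    rewrite mulNr expRN => hc; rewrite subr_ge0 mulrC ler_pdivrMr ?expR_gt0// mul1r//.
  - by rewrite mulr0 expR0; ring.
have sinh_ge : 4 * u * (r * r) <= r * (1 - r ^+ 2).
  have rE : r = expR (- 2 * u) by rewrite /r mulNr.
  have rV : expR (2 * u) * r = 1 by rewrite /r expRN mulfV// gt_eqF ?expR_gt0.
  pose F (z : R) := expR (2 * z) - expR (- 2 * z) - 4 * z.
  pose dF (z : R) := 2 * expR (2 * z) + 2 * expR (- 2 * z) - 4.
  have P1 (c : R) : is_derive c 1 F (dF c).
    have d3 := is_deriveB (is_deriveB (dexp 2 c) (dexp (- 2) c)) (dcst 4 c).
    by apply: (is_derive_eq d3); rewrite /dF; ring.
  have P2 c : 0 <= c -> 0 <= dF c.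
    move=> c0; rewrite /dF; set e := expR (2 * c).
    have e0 : 0 < e by exact: expR_gt0.
    rewrite mulNr expRN -/e.
    have -> : 2 * e + 2 * e^-1 - 4 = 2 * (e - 1) ^+ 2 / e by field; rewrite gt_eqF.
    by rewrite divr_ge0 ?(ltW e0)// mulr_ge0 ?sqr_ge0.
  have P3 : F 0 = 0 by rewrite /F !mulr0 expR0; ring.
  have h := mono F dF P1 P2 P3; rewrite /F in h.
  rewrite -rE in h.
  have : 0 <= (expR (2 * u) - r - 4 * u) * (r * r) by rewrite mulr_ge0// mulr_ge0// ltW.
  have -> : (expR (2 * u) - r - 4 * u) * (r * r) = (expR (2 * u) * r) * r - r * r * r - 4 * u * (r * r) by ring.
  rewrite rV; lra.
have spi : 0 < Num.sqrt pi :> R by rewrite sqrtr_gt0 pi_gt0.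
rewrite mkerE gaussE mulrA ler_pM ?expR_ge0//.
- rewrite ler_pdivrMr ?sqrtr_gt0 ?mulr_gt0 ?pi_gt0//.
  rewrite [leRHS]mulrC ler_pdivlMr ?mulr_gt0// sqrtrM ?pi_ge0// mulrCA ler_pM2l//.
  have st : 0 <= expR (- (t ^+ 2 / 4)) * t by rewrite mulr_ge0 ?expR_ge0// ltW.
  rewrite -(ler_pXn2r (n := 2)) ?nnegrE ?sqrtr_ge0//.
  rewrite sqr_sqrtr ?(ltW r2)// exprMn -expRM_natl.
  have -> : expR (2%:R * - (t ^+ 2 / 4)) = r by congr expR; rewrite /u; field.
  have -> : t ^+ 2 = 4 * u by rewrite /u; field.
  have : 4 * u * r <= 1 - r ^+ 2.
    by rewrite -(ler_pM2l r0) mulrCA.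
  by rewrite mulrC.
rewrite ler_expR /mexp.
have -> : t ^+ 2 = 4 * u by rewrite /u; field.
rewrite mulNr lerN2.
rewrite ler_pdivrMr ?mulr_gt0// mulrAC ler_pdivlMr ?mulr_gt0//.
have h1 : (1 - r) * (1 - r) <= u * (1 + r) * (1 - r) by rewrite ler_wpM2r// subr_ge0 ltW.
(* In x + y and x - y the difference of the exponents is diagonal. The first coefficient is visibly
   nonnegative, the second one by [tanh_le]; [sinh_ge] served for the prefactors. *)
have E : ((1 + r ^+ 2) * (x ^+ 2 + y ^+ 2) - 4 * r * x * y) * (4 * u) - (x - y) ^+ 2 * (2 * (1 - r ^+ 2)) =
  2 * (u * (1 - r) ^+ 2) * (x + y) ^+ 2 + 2 * (1 + r) * (u * (1 + r) - (1 - r)) * (x - y) ^+ 2 by ring.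
have nn2 (a b : R) : 0 <= a -> 0 <= 2 * a * b ^+ 2 by move=> a0; rewrite mulr_ge0 ?sqr_ge0 ?mulr_ge0.
rewrite -subr_ge0 E addr_ge0//; last first.
  by rewrite -[2 * (1 + r) * _]mulrA nn2// mulr_ge0 ?subr_ge0// addr_ge0// ltW.
by apply: nn2; rewrite mulr_ge0 ?sqr_ge0// ltW.
Qed.

End mehler_kernel.

Lemma cvg_bigprod {R : realType} I (s : seq I) (f : I -> nat -> R) (l : I -> R) :
  (forall i, f i @ \oo --> l i) ->
  (fun n => \prod_(i <- s) f i n) @ \oo --> \prod_(i <- s) l i.
Proof.
move=> fl; elim: s => [|i s IH].
  rewrite big_nil; under eq_fun do rewrite big_nil; exact: cvg_cst.
rewrite big_cons; under eq_fun do rewrite big_cons; exact: cvgM.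
Qed.

(** * Hermite functions and Mehler's formula in several variables *)

Section hermite_multiindex.
Context {R : realType} (d : nat).
Notation lam := (@lebesgue_measure R).
Notation MR := (measurableTypeR R).
Implicit Types (x y : 'rV[R]_d) (b : 'I_d -> nat).

Definition idx N (b : {ffun 'I_d -> 'I_N}) : 'I_d -> nat := fun j => b j.

Definition Phi b x := \prod_(j < d) her (b j) (x 0 j).
Definition Jap x := \prod_(j < d) jap (x 0 j).
Definition Mehler r x y := \prod_(j < d) mker r (x 0 j) (y 0 j).

(* kernel of the projection on the eigenspace with eigenvalue 2k + d *)
Definition Kproj k x y :=
  \sum_(b : {ffun 'I_d -> 'I_k.+1} | (\sum_j b j == k)%N) Phi (idx b) x * Phi (idx b) y.

Lemma Jap_ge0 x : 0 <= Jap x.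
Proof. by apply: prodr_ge0 => j _; exact: jap_ge0. Qed.
Lemma Jap_le1 x : Jap x <= 1.
Proof. by apply: prodr_ile1 => j _; rewrite jap_ge0 jap_le1. Qed.

Lemma Phi_bound b k x : (forall j, (b j <= k)%N) -> `|Phi b x| <= hb k ^+ d * Jap x.
Proof.
move=> bk; rewrite /Phi /Jap normr_prod -[d in _ ^+ d]card_ord -prodr_const -big_split/=.
apply: ler_prod => j _; rewrite normr_ge0/= (le_trans (her_jap _ _))// ler_wpM2r ?jap_ge0//.
exact: hb_le.
Qed.

(** In the exponent, 6 per coordinate comes from two factors [hb k], and 1 per coordinate from
    counting the multi-indices bounded by [k]. *)
Definition KB k : R := (hK ^+ 2) ^+ d * k.+1%:R ^+ (7 * d).
Lemma KB_ge0 k : 0 <= KB k.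
Proof. by rewrite /KB mulr_ge0// exprn_ge0// exprn_ge0// ltW// hK_gt0. Qed.

Lemma level_coord_le N (b : {ffun 'I_d -> 'I_N}) j : (b j <= \sum_j b j)%N.
Proof. by rewrite (bigD1 j)//= leq_addr. Qed.

Lemma Kproj_bound k x y : `|Kproj k x y| <= KB k * (Jap x * Jap y).
Proof.
pose c := (hb k ^+ d * Jap x) * (hb k ^+ d * Jap y).
rewrite (le_trans (ler_norm_sum _ _ _))//.
apply: (@le_trans _ _ (\sum_(b : {ffun 'I_d -> 'I_k.+1}) c)).
  rewrite [leRHS](bigID (fun b : {ffun 'I_d -> 'I_k.+1} => (\sum_j b j == k)%N))/=.
  rewrite -[leLHS]addr0 lerD//; last first.
    apply: sumr_ge0 => b _.
    by rewrite !mulr_ge0 ?Jap_ge0// exprn_ge0// hb_ge0.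
  apply: ler_sum => b _; rewrite normrM ler_pM// Phi_bound// => j; exact: leq_ord.
rewrite sumr_const card_ffun !card_ord /c -mulr_natr natrX /KB.
rewrite (_ : _ * _ ^+ d = (hb k * hb k) ^+ d * k.+1%:R ^+ d * (Jap x * Jap y)); last first.
  by rewrite exprMn; ring.
have -> : k.+1%:R ^+ (7 * d) = (k.+1%:R ^+ 6) ^+ d * k.+1%:R ^+ d :> R.
  by rewrite -exprM -exprD -mulSnr.
by rewrite hb2 exprMn mulrA.
Qed.

Lemma Phi_prodE r N x y :
  \prod_(j < d) series (mser r (x 0 j) (y 0 j)) N =
  \sum_(b : {ffun 'I_d -> 'I_N}) r ^+ (\sum_j b j)%N * (Phi (idx b) x * Phi (idx b) y).
Proof.
under eq_bigr do rewrite /series/= big_mkord.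
rewrite bigA_distr_bigA/=; apply: eq_bigr => b _.
by rewrite /Phi -big_split/= -prodrXr -big_split.
Qed.

Lemma level_reindex k N (G : ('I_d -> nat) -> R) : (k < N)%N ->
  (forall b b', b =1 b' -> G b = G b') ->
  \sum_(b : {ffun 'I_d -> 'I_k.+1} | (\sum_j b j == k)%N) G (idx b) =
  \sum_(b : {ffun 'I_d -> 'I_N} | (\sum_j b j == k)%N) G (idx b).
Proof.
move=> kN extG.
pose f (b : {ffun 'I_d -> 'I_N}) : {ffun 'I_d -> 'I_k.+1} := [ffun j => inord (b j)].
pose g (b : {ffun 'I_d -> 'I_k.+1}) : {ffun 'I_d -> 'I_N} := [ffun j => widen_ord kN (b j)].
rewrite (reindex_onto g f)/=; last first.
  move=> b /eqP bk; apply/ffunP => j; rewrite !ffunE; apply: val_inj => /=.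
  by rewrite inordK// ltnS -bk level_coord_le.
apply: eq_big => [b|b _]; last by apply: extG => j; rewrite /idx !ffunE.
have -> : (\sum_j g b j = \sum_j b j)%N by apply: eq_bigr => j _; rewrite ffunE.
have -> : f (g b) = b.
  by apply/ffunP => j; rewrite !ffunE; apply: val_inj; rewrite /= inordK.
by rewrite eqxx andbT.
Qed.

Lemma sum_levels r N x y : \sum_(0 <= k < N) r ^+ k * Kproj k x y =
  \sum_(b : {ffun 'I_d -> 'I_N} | (\sum_j b j < N)%N) r ^+ (\sum_j b j)%N * (Phi (idx b) x * Phi (idx b) y).
Proof.
rewrite big_mkord.
transitivity (\sum_(k < N) \sum_(b : {ffun 'I_d -> 'I_N} | (\sum_j b j == k)%N)
    r ^+ (\sum_j b j)%N * (Phi (idx b) x * Phi (idx b) y)).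
  apply: eq_bigr => k _; rewrite /Kproj (level_reindex (N := N) (G := fun b => Phi b x * Phi b y)) ?ltn_ord//; last first.
    by move=> b b' bb'; rewrite /Phi; congr (_ * _); apply: eq_bigr => j _; rewrite bb'.
  by rewrite mulr_sumr; apply: eq_bigr => b /eqP ->.
rewrite (exchange_big_dep (fun b : {ffun 'I_d -> 'I_N} => (\sum_j b j < N)%N))/=; last first.
  by move=> k b _ /eqP ->.
apply: eq_bigr => b bN; rewrite (big_pred1 (Ordinal bN))// => k /=.
Qed.

(** The product of the one-dimensional partial sums runs over a cube of multi-indices, the levels
    over a simplex inside it. Outside the simplex the degree is at least N, so writing r as q^2
    gains q^N over the absolutely convergent series with ratio q. *)
Lemma mehler_sum r x y : 0 < r < 1 ->
  (fun N => \sum_(0 <= k < N) r ^+ k * Kproj k x y) @ \oo --> Mehler r x y.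
Proof.
move=> r01; have /andP[r0 r1] := r01.
pose q := Num.sqrt r.
have q0 : 0 < q by rewrite sqrtr_gt0.
have q2 : r = q ^+ 2 by rewrite sqr_sqrtr// ltW.
have q1 : q < 1 by rewrite -(ltr_pXn2r (n := 2)) ?nnegrE ?(ltW q0)// -q2 expr1n.
have q01 : 0 < q < 1 by rewrite q0 q1.
pose cube N := \prod_(j < d) series (mser r (x 0 j) (y 0 j)) N.
have cube_cvg : cube @ \oo --> Mehler r x y.
  by apply: cvg_bigprod => j; exact: mehler1.
have diff_cvg : (fun N => cube N - \sum_(0 <= k < N) r ^+ k * Kproj k x y) @ \oo --> 0.
  apply/norm_cvg0P.
  apply: (@squeeze_cvgr _ _ _ _ (fun=> 0) (fun N => mbound q ^+ d * q ^+ N)); last 2 first.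
  - exact: cvg_cst.
  - rewrite -(mulr0 (mbound q ^+ d)); apply: cvgM; first exact: cvg_cst.
    by apply: cvg_expr; rewrite gtr0_norm.
  apply: nearW => N; rewrite normr_ge0/= /cube Phi_prodE sum_levels.
  rewrite [X in X - _](bigID (fun b : {ffun 'I_d -> 'I_N} => (\sum_j b j < N)%N))/=.
  rewrite [X in X - _]addrC addrK.
  rewrite (le_trans (ler_norm_sum _ _ _))//.
  apply: (@le_trans _ _ (\sum_(b : {ffun 'I_d -> 'I_N}) q ^+ N * \prod_(j < d) `|mser q (x 0 j) (y 0 j) (b j)|)).
    rewrite [leRHS](bigID (fun b : {ffun 'I_d -> 'I_N} => (\sum_j b j < N)%N))/=.
    rewrite -[leLHS]add0r lerD//.
      apply: sumr_ge0 => b _; rewrite mulr_ge0 ?exprn_ge0 ?(ltW q0)//.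
      by apply: prodr_ge0.
    apply: ler_sum => b; rewrite -leqNgt => Nb.
    have -> : \prod_(j < d) `|mser q (x 0 j) (y 0 j) (b j)| = q ^+ (\sum_j b j)%N * `|Phi (idx b) x * Phi (idx b) y|.
      rewrite -prodrXr /Phi -big_split/= normr_prod -big_split/=.
      apply: eq_bigr => j _.
      by rewrite /mser normrM (ger0_norm (exprn_ge0 _ (ltW q0))).
    rewrite normrM mulrA ler_wpM2r// ger0_norm ?exprn_ge0 ?(ltW r0)//.
    rewrite q2 -exprM mul2n -addnn exprD ler_wpM2r ?exprn_ge0 ?(ltW q0)//.
    by rewrite ler_wiXn2l// ltW.
  rewrite -mulr_sumr mulrC ler_wpM2r ?exprn_ge0 ?(ltW q0)//.
  rewrite -(bigA_distr_bigA (fun j (m : 'I_N) => `|mser q (x 0 j) (y 0 j) m|))/=.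
  rewrite -[d in _ ^+ d]card_ord -prodr_const; apply: ler_prod => j _.
  rewrite sumr_ge0//= -(big_mkord xpredT (fun m => `|mser q (x 0 j) (y 0 j) m|)).
  exact: mser_abs_bound.
have -> : Mehler r x y = Mehler r x y - 0 by rewrite subr0.
have -> : (fun N => \sum_(0 <= k < N) r ^+ k * Kproj k x y) =
   (fun N => cube N - (cube N - \sum_(0 <= k < N) r ^+ k * Kproj k x y)).
  by apply/funext => N; rewrite opprB addrC subrK.
exact: cvgB.
Qed.

Lemma L1_Jap : L1 (leb d) (Jap \o @row_of_tuple R d).
Proof.
have [h _] := prod_coords (fun j : 'I_d => @L1_jap R).
by apply: L1_ext h => t; apply: eq_bigr => j _; rewrite mxE.
Qed.

Lemma int_Mehler_Phi r b x : 0 < r < 1 ->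
  L1 (leb d) (fun t => Mehler r x (row_of_tuple t) * Phi b (row_of_tuple t)) /\
  \int[leb d]_t (Mehler r x (row_of_tuple t) * Phi b (row_of_tuple t)) =
    r ^+ (\sum_j b j)%N * Phi b x.
Proof.
move=> r01.
have E t : Mehler r x (row_of_tuple t) * Phi b (row_of_tuple t) =
    \prod_(j < d) (mker r (x 0 j) (tnth t j) * her (b j) (tnth t j)).
  by rewrite /Mehler /Phi -big_split; apply: eq_bigr => j _; rewrite !mxE.
have [h1 h2] := prod_coords (fun j : 'I_d => (int_mker_her r01 (b j) (x 0 j)).2).
split; first by apply: L1_ext h1 => t; rewrite E.
rewrite (int_ext (leb d) E) h2 -prodrXr /Phi -big_split; apply: eq_bigr => j _.
by have [-> _] := int_mker_her r01 (b j) (x 0 j).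
Qed.

Lemma int_Mehler_Kproj r k x y : 0 < r < 1 ->
  L1 (leb d) (fun t => Mehler r x (row_of_tuple t) * Kproj k (row_of_tuple t) y) /\
  \int[leb d]_t (Mehler r x (row_of_tuple t) * Kproj k (row_of_tuple t) y) = r ^+ k * Kproj k x y.
Proof.
move=> r01.
have E t : Mehler r x (row_of_tuple t) * Kproj k (row_of_tuple t) y =
  \sum_(b : {ffun 'I_d -> 'I_k.+1} | (\sum_j b j == k)%N)
    Phi (idx b) y * (Mehler r x (row_of_tuple t) * Phi (idx b) (row_of_tuple t)).
  by rewrite mulr_sumr; apply: eq_bigr => b _; ring.
have i (b : {ffun 'I_d -> 'I_k.+1}) := L1Z (Phi (idx b) y) (int_Mehler_Phi (idx b) x r01).1.
split.
  rewrite (_ : (fun t => _) = (fun t => \sum_(b : {ffun 'I_d -> 'I_k.+1} | (\sum_j b j == k)%N)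
    Phi (idx b) y * (Mehler r x (row_of_tuple t) * Phi (idx b) (row_of_tuple t)))).
    by apply: L1_sum => b _; exact: i.
  by apply/funext => t; exact: E.
rewrite (int_ext (leb d) E) int_sum; last by move=> b _; exact: i.
rewrite mulr_sumr; apply: eq_bigr => b /eqP bk.
rewrite intZ; last exact: (int_Mehler_Phi (idx b) x r01).1.
rewrite (int_Mehler_Phi (idx b) x r01).2 bk; ring.
Qed.

End hermite_multiindex.

(** * Calculus of directional derivatives *)

Section continuity.
Context {R : realType} {T : topologicalType}.
Implicit Types f g : T -> R.

Lemma cont_cst (c : R) : continuous (fun _ : T => c).
Proof. exact: cst_continuous. Qed.
Lemma contM f g : continuous f -> continuous g -> continuous (fun x => f x * g x).
Proof. by move=> cf cg x; apply: continuousM; [exact: cf|exact: cg]. Qed.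
Lemma contD f g : continuous f -> continuous g -> continuous (fun x => f x + g x).
Proof. by move=> cf cg x; apply: continuousD; [exact: cf|exact: cg]. Qed.
Lemma contB f g : continuous f -> continuous g -> continuous (fun x => f x - g x).
Proof. by move=> cf cg x; apply: continuousB; [exact: cf|exact: cg]. Qed.
Lemma contX f n : continuous f -> continuous (fun x => f x ^+ n).
Proof. by move=> cf x; apply: (@continuous_comp _ _ _ f (fun y => y ^+ n)); [exact: cf|exact: exprn_continuous]. Qed.
Lemma cont_comp (h : R -> R) f : continuous h -> continuous f -> continuous (fun x => h (f x)).
Proof. by move=> ch cf x; apply: (@continuous_comp _ _ _ f h); [exact: cf|exact: ch]. Qed.
Lemma cont_sum I (s : seq I) (P : pred I) (F : I -> T -> R) : (forall i, continuous (F i)) ->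
  continuous (fun x => \sum_(i <- s | P i) F i x).
Proof. by move=> cF; apply: continuous_big => [|i _]; [exact: add_continuous|exact: cF]. Qed.
Lemma cont_prod I (s : seq I) (P : pred I) (F : I -> T -> R) : (forall i, continuous (F i)) ->
  continuous (fun x => \prod_(i <- s | P i) F i x).
Proof. by move=> cF; apply: continuous_big => [|i _]; [exact: mul_continuous|exact: cF]. Qed.
Lemma cont_id : continuous (fun x : R => x).
Proof. by move=> x; exact: cvg_id. Qed.

End continuity.

Section directional_derivatives.
Context {R : realType} {V : normedModType R}.
Implicit Types (f g : V -> R) (z v : V).

(** Reduces directional derivatives to derivatives on the line, where the chain rule for one
    variable applies. *)
Lemma is_derive_lineP f z v (D : R) :
  is_derive (0 : R) 1 (fun h : R => f (z + h *: v)) D -> is_derive z v f D.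
Proof.
have E : (fun h : R => h^-1 *: (((fun h : R => f (z + h *: v)) \o shift 0) (h *: 1) - f (z + 0 *: v))) =
    (fun h => h^-1 *: ((f \o shift z) (h *: v) - f z)).
  apply/funext => h; rewrite /shift/= scale0r !addr0.
  by congr (_ *: (f _ - _)); rewrite [h *: 1]mulr1 addrC.
move=> [h1 h2]; split; first by move: h1; rewrite /derivable E.
by rewrite -h2 /derive E.
Qed.

Lemma is_derive_line0 f z v (D : R) : is_derive z v f D ->
  is_derive (0 : R) 1 (fun h : R => f (z + h *: v)) D.
Proof.
move=> fD; have := @is_derive_line R V f z v 0; rewrite scale0r addr0 derive_val.
apply; exact: ex_derive.
Qed.

Lemma is_derive_chain (F : R -> R) f z v (a b : R) :
  is_derive (f z) 1 F a -> is_derive z v f b -> is_derive z v (fun z => F (f z)) (a * b).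
Proof.
move=> Fa fb; apply: is_derive_lineP.
apply: (@is_derive1_comp R F (fun h => f (z + h *: v))); last exact: is_derive_line0.
by rewrite scale0r addr0.
Qed.

Lemma is_deriveMr f g z v (a b : R) : is_derive z v f a -> is_derive z v g b ->
  is_derive z v (fun z => f z * g z) (a * g z + f z * b).
Proof.
move=> fa gb; have := is_deriveM fa gb => h; apply: (is_derive_eq h).
by rewrite /GRing.scale/=; ring.
Qed.

Lemma is_deriveDr f g z v (a b : R) : is_derive z v f a -> is_derive z v g b ->
  is_derive z v (fun z => f z + g z) (a + b).
Proof. by move=> fa gb; exact: (is_deriveD fa gb). Qed.

Lemma is_deriveBr f g z v (a b : R) : is_derive z v f a -> is_derive z v g b ->
  is_derive z v (fun z => f z - g z) (a - b).
Proof. by move=> fa gb; exact: (is_deriveB fa gb). Qed.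

Lemma is_deriveZr f z v (c a : R) : is_derive z v f a ->
  is_derive z v (fun z => c * f z) (c * a).
Proof. by move=> fa; exact: (is_deriveZ c fa). Qed.

Lemma is_derive_cstr z v (c : R) : is_derive z v (fun=> c) 0.
Proof. exact: is_derive_cst. Qed.

Lemma is_derive_sumr I (s : seq I) (F : I -> V -> R) (dF : I -> R) z v :
  (forall i, is_derive z v (F i) (dF i)) ->
  is_derive z v (fun z => \sum_(i <- s) F i z) (\sum_(i <- s) dF i).
Proof.
move=> h; elim: s => [|i s IH].
  by rewrite big_nil; under eq_fun do rewrite big_nil; exact: is_derive_cst.
by rewrite big_cons; under eq_fun do rewrite big_cons; exact: is_deriveDr.
Qed.

Lemma derive_funE f v (df : V -> R) : (forall z, is_derive z v f (df z)) -> 'D_v f = df.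
Proof. by move=> h; apply/funext => z; rewrite derive_val. Qed.

End directional_derivatives.

Section smooth_classes.
Context {R : realType} {V : normedModType R}.
Variables (L B : set (V -> R)).

(** [L] consists of linear forms. If the derivatives of the base functions stay in the class, then
    so do all iterated derivatives, which gives smoothness from one differentiation. The class
    serves for polynomials times a Gaussian, and for polynomials times derivatives of a test
    function. *)
Inductive cls : (V -> R) -> Prop :=
| cls_base f : B f -> cls f
| cls_mul l f : L l -> cls f -> cls (fun z => l z * f z)
| cls_add f g : cls f -> cls g -> cls (fun z => f z + g z)
| cls_scale (c : R) f : cls f -> cls (fun z => c * f z).

Hypothesis HL : forall l, L l -> continuous l /\ forall z v, is_derive z v l (l v).
Hypothesis HB : forall f, B f -> continuous f /\ forall v, (forall z, derivable f z v) /\ cls ('D_v f).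

Lemma cls_props f : cls f ->
  continuous f /\ forall v, (forall z, derivable f z v) /\ cls ('D_v f).
Proof.
elim=> {f} [f /HB//|l f /[dup] lL /HL[cl dl] fcls [cf df]|f g _ [cf df] _ [cg dg]|c f _ [cf df]].
- split; first by move=> z; apply: continuousM; [exact: cl|exact: cf].
  move=> v; have [df1 df2] := df v.
  have D z : is_derive z v (fun z => l z * f z) (l v * f z + l z * 'D_v f z).
    exact: (is_deriveMr (dl z v) (derivableP (df1 z))).
  split; first by move=> z; have := D z => Dz; exact: ex_derive.
  by rewrite (derive_funE D); apply: cls_add; [exact: cls_scale|exact: cls_mul].
- split; first by move=> z; apply: continuousD; [exact: cf|exact: cg].
  move=> v; have [df1 df2] := df v; have [dg1 dg2] := dg v.
  have D z : is_derive z v (fun z => f z + g z) ('D_v f z + 'D_v g z).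
    exact: (is_deriveDr (derivableP (df1 z)) (derivableP (dg1 z))).
  split; first by move=> z; have := D z => Dz; exact: ex_derive.
  by rewrite (derive_funE D); exact: cls_add.
- split; first by move=> z; apply: continuousM; [exact: cvg_cst|exact: cf].
  move=> v; have [df1 df2] := df v.
  have D z : is_derive z v (fun z => c * f z) (c * 'D_v f z).
    exact: (is_deriveZr c (derivableP (df1 z))).
  split; first by move=> z; have := D z => Dz; exact: ex_derive.
  by rewrite (derive_funE D); exact: cls_scale.
Qed.

Lemma cls_smooth f : cls f -> smooth f.
Proof.
move=> fcls vs.
have h : cls (iter_derive vs f) by elim: vs => [//|v vs IH] /=; exact: ((cls_props IH).2 v).2.
have [h1 h2] := cls_props h; split => // z v; exact: (h2 v).1.
Qed.

Lemma cls_ext f g : f =1 g -> cls f -> cls g.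
Proof. by move/funext => ->. Qed.

Lemma cls_sum I (s : seq I) (P : pred I) (F : I -> V -> R) f0 : cls f0 ->
  (forall i, P i -> cls (F i)) -> cls (fun z => \sum_(i <- s | P i) F i z).
Proof.
move=> c0 h; elim: s => [|i s IH].
  by apply: cls_ext (cls_scale 0 c0) => z; rewrite big_nil mul0r.
have [Pi|Pi] := boolP (P i).
  by apply: cls_ext (cls_add (h i Pi) IH) => z; rewrite big_cons Pi.
by apply: cls_ext IH => z; rewrite big_cons (negbTE Pi).
Qed.

Lemma cls_poly (p : {poly R}) l f : L l -> cls f -> cls (fun z => p.[l z] * f z).
Proof.
move=> Ll cf; elim/poly_ind: p => [|p c IH].
  by apply: cls_ext (cls_scale 0 cf) => z; rewrite horner0.
apply: cls_ext (cls_add (cls_mul Ll IH) (cls_scale c cf)) => z.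
by rewrite hornerMXaddC; ring.
Qed.

End smooth_classes.

Section smooth_theory.
Context {R : realType} {V : normedModType R}.
Implicit Types f g : V -> R.

Lemma iter_derive_cat vs ws f : iter_derive vs (iter_derive ws f) = iter_derive (vs ++ ws) f.
Proof. by rewrite /iter_derive foldr_cat. Qed.
Lemma smooth_iter vs f : smooth f -> smooth (iter_derive vs f).
Proof. by move=> sf ws; rewrite iter_derive_cat; exact: sf. Qed.
Lemma smooth_derive v f : smooth f -> smooth ('D_v f).
Proof. exact: (@smooth_iter [:: v]). Qed.

End smooth_theory.

Section green.
Context {dd : measure_display} {T : measurableType dd} {R : realType}.
Variables (mu : {measure set T -> \bar R}) (V : normedModType R) (emb : T -> V).
Hypothesis emb_euclid : euclid mu emb.

(** Regularity along a single direction, weaker than [smooth], because Green's identity is also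
    applied to cut-off Hermite functions, which are only twice continuously differentiable. *)
Definition C2 (v : V) (f : V -> R) := [/\ forall z, derivable f z v, continuous f,
  forall z, derivable ('D_v f) z v, continuous ('D_v f) & continuous ('D_v ('D_v f))].

Lemma smooth_C2 v f : smooth f -> C2 v f.
Proof.
move=> sf; have s1 := smooth_derive v sf; have s2 := smooth_derive v s1.
have [c0 d0] := sf [::]; have [c1 d1] := s1 [::]; have [c2 _] := s2 [::].
exact: (And5 (fun z => d0 z v) c0 (fun z => d1 z v) c1 c2).
Qed.

Lemma L1_bsuppM (g f : V -> R) : continuous g -> continuous f -> bsupp f ->
  L1 mu (fun t => g (emb t) * f (emb t)).
Proof.
move=> cg cf bf; have h : continuous (fun z => g z * f z).
  by move=> z; apply: continuousM; [exact: cg|exact: cf].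
exact: (@L1_bsupp _ _ _ mu V emb emb_euclid (fun z => g z * f z) h (bsuppMl g bf)).
Qed.

Lemma green (v : V) (f g : V -> R) : C2 v f -> C2 v g -> bsupp f ->
  \int[mu]_t (g (emb t) * 'D_v ('D_v f) (emb t)) =
  \int[mu]_t ('D_v ('D_v g) (emb t) * f (emb t)).
Proof.
move=> [df cf ddf cdf cddf] [dg cg ddg cdg cddg] bf.
have bdf := bsupp_derive v bf; have bddf := bsupp_derive v bdf.
have i1 := L1_bsuppM cg cddf bddf.
have i2 := L1_bsuppM cddg cf bf.
pose G z := g z * 'D_v f z - 'D_v g z * f z.
have DG z : is_derive z v G (g z * 'D_v ('D_v f) z - 'D_v ('D_v g) z * f z).
  have h1 : is_derive z v (fun z => g z * 'D_v f z) ('D_v g z * 'D_v f z + g z * 'D_v ('D_v f) z).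
    exact: (is_deriveMr (derivableP (dg z)) (derivableP (ddf z))).
  have h2 : is_derive z v (fun z => 'D_v g z * f z) ('D_v g z * 'D_v f z + 'D_v ('D_v g) z * f z).
    by rewrite addrC; exact: (is_deriveMr (derivableP (ddg z)) (derivableP (df z))).
  by apply: (is_derive_eq (is_deriveBr h1 h2)); rewrite opprD addrACA subrr add0r.
apply/eqP; rewrite -subr_eq0 -intB//; apply/eqP.
have /funeqP DGE := derive_funE DG.
rewrite -(int_ext mu (fun t => DGE (emb t))).
apply: (int_derive0_bsupp emb_euclid).
- by move=> z; have := DG z => h; exact: ex_derive.
- exact: (contB (contM cg cdf) (contM cdg cf)).
- by rewrite (derive_funE DG); exact: (contB (contM cg cddf) (contM cddg cf)).
- exact: (bsuppD (bsuppMl g bdf) (bsuppN (bsuppMl ('D_v g) bf))).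
Qed.

End green.

Section coordinates.
Context {R : realType} {d : nat}.
Implicit Types (x v : 'rV[R]_d).

Lemma is_derive_coord j x v : is_derive x v (fun y : 'rV[R]_d => y 0 j) (v 0 j).
Proof.
apply: is_derive_lineP.
have -> : (fun h : R => (x + h *: v) 0 j) = (fun h : R => x 0 j + v 0 j * h).
  by apply/funext => h; rewrite !mxE mulrC.
apply: (is_derive_eq (is_deriveDr (is_derive_cstr _ _ _) (is_deriveZr (v 0 j) (is_derive_id (0:R) (1:R))))).
by rewrite add0r mulr1.
Qed.

(* only the j-th factor of a product of one-variable functions is differentiated *)
Lemma is_derive_prod_coord (F : 'I_d -> R -> R) j x (D : R) :
  is_derive (x 0 j) 1 (F j) D ->
  is_derive x (delta_mx 0 j) (fun y : 'rV[R]_d => \prod_i F i (y 0 i))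
    (D * \prod_(i | i != j) F i (x 0 i)).
Proof.
move=> FD; apply: is_derive_lineP.
have -> : (fun h : R => \prod_i F i ((x + h *: delta_mx 0 j) 0 i)) =
    (fun h : R => (\prod_(i | i != j) F i (x 0 i)) * F j (x 0 j + h)).
  apply/funext => h; rewrite (bigD1 j)//= mulrC !mxE !eqxx mulr1; congr (_ * _).
  by apply: eq_bigr => i ij; rewrite !mxE (negbTE ij) andbF mulr0 addr0.
rewrite mulrC; apply: is_deriveZr.
have := @is_derive1_comp R (F j) (fun h => x 0 j + h) 0 D 1.
rewrite mulr1; apply; first by rewrite addr0.
have := is_deriveDr (is_derive_cstr (0:R) (1:R) (x 0 j)) (is_derive_id (0:R) (1:R)).
by move=> h; apply: (is_derive_eq h); rewrite add0r.
Qed.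

End coordinates.

(** * Hermite functions as eigenfunctions *)

Section hermite_derivatives.
Context {R : realType}.

Definition dher n (x : R) := an n * her n.-1 x - x * her n x.

Lemma is_derive_dher n (x : R) :
  is_derive x 1 (dher n) ((x ^+ 2 - (2 * n + 1)%:R) * her n x).
Proof.
have h := is_deriveBr (is_deriveZr (an n) (is_derive_her n.-1 x))
  (is_deriveMr (is_derive_id x (1:R)) (is_derive_her n x)).
apply: (is_derive_eq h).
have E : an n * (an n.-1 * her n.-2 x) = an n * (2 * x * her n.-1 x) - an n ^+ 2 * her n x.
  case: n {h} => [|n]; first by rewrite an0; ring.
  by rewrite (her_rec n x) /=; ring.
rewrite mulrBr E an_sqr natrD natrM; ring.
Qed.

Lemma dher_bound n : exists2 C : R, 0 <= C & forall x, `|dher n x| <= C * jap x.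
Proof.
exists ((an n * hb n.-1 + an n.+1 * hb n.+1) / 2).
  by rewrite divr_ge0// addr_ge0// mulr_ge0 ?an_ge0 ?hb_ge0.
move=> x; have -> : dher n x = (an n * her n.-1 x - an n.+1 * her n.+1 x) / 2.
  rewrite /dher; have -> : an n.+1 * her n.+1 x = 2 * x * her n x - an n * her n.-1 x.
    by rewrite her_rec addrC addKr.
  by field.
rewrite normrM normfV (ger0_norm (ler0n _ 2)) mulrAC ler_wpM2r// mulrDl.
rewrite (le_trans (ler_normB _ _))// !normrM !(ger0_norm (an_ge0 _)) -!mulrA.
by rewrite lerD// ler_wpM2l ?an_ge0// her_jap.
Qed.

Lemma derive_continuous (f df : R -> R) : (forall x : R, is_derive x 1 f (df x)) -> continuous f.
Proof.
by move=> h y; apply: differentiable_continuous; apply/derivable1_diffP; exact: ex_derive.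
Qed.

Definition ddher n (x : R) := (x ^+ 2 - (2 * n + 1)%:R) * her n x.

Lemma continuous_ddher n : continuous (ddher n).
Proof.
exact (contM (contB (contX (n := 2) (@cont_id R)) (@cont_cst R R _)) (@continuous_her R n)).
Qed.

End hermite_derivatives.

Section hermite_eigenfunctions.
Context {R : realType} {d : nat}.
Implicit Types (x : 'rV[R]_d) (b : 'I_d -> nat).

Section product.
Variables F F1 F2 : 'I_d -> R -> R.
Hypotheses (dF : forall i (x : R), is_derive x 1 (F i) (F1 i x))
  (dF1 : forall i (x : R), is_derive x 1 (F1 i) (F2 i x)) (cF2 : forall i, continuous (F2 i)).
Variable j : 'I_d.

Let P (f : R -> R) (x : 'rV[R]_d) := f (x 0 j) * \prod_(i | i != j) F i (x 0 i).

Let cP f : continuous f -> continuous (P f).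
Proof.
move=> cf; apply: contM; first exact: (cont_comp cf (@continuous_coord R d j)).
by apply: cont_prod => i; exact: (cont_comp (derive_continuous (dF i)) (@continuous_coord R d i)).
Qed.

Let dP (f df : R -> R) : (forall x : R, is_derive x 1 f (df x)) ->
  forall x, is_derive x (delta_mx 0 j) (P f) (P df x).
Proof.
move=> h x; pose G i := if i == j then f else F i.
have Gi (y : 'rV[R]_d) : \prod_(i | i != j) G i (y 0 i) = \prod_(i | i != j) F i (y 0 i).
  by apply: eq_bigr => i ij; rewrite /G (negbTE ij).
have -> : P f = (fun y : 'rV[R]_d => \prod_i G i (y 0 i)).
  by apply/funext => y; rewrite /P [in RHS](bigD1 j)//= Gi /G eqxx.
have := @is_derive_prod_coord R d G j x (df (x 0 j)).
by rewrite {1}/G eqxx => /(_ (h _)) h'; apply: (is_derive_eq h'); rewrite Gi.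
Qed.

Let PE : (fun x : 'rV[R]_d => \prod_i F i (x 0 i)) = P (F j).
Proof. by apply/funext => x; rewrite (bigD1 j). Qed.

Lemma derive2_prod : 'D_(delta_mx 0 j) ('D_(delta_mx 0 j) (fun x : 'rV[R]_d => \prod_i F i (x 0 i))) =
  fun x : 'rV[R]_d => F2 j (x 0 j) * \prod_(i | i != j) F i (x 0 i).
Proof. by rewrite PE (derive_funE (dP (dF j))) (derive_funE (dP (dF1 j))). Qed.

Lemma C2_prod : C2 (delta_mx 0 j) (fun x : 'rV[R]_d => \prod_i F i (x 0 i)).
Proof.
have d1 := dP (dF j); have d2 := dP (dF1 j).
split; rewrite ?derive2_prod; first last.
- exact: (cP (@cF2 j)).
- rewrite PE (derive_funE d1); apply: cP; exact: (derive_continuous (dF1 j)).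
- by rewrite PE (derive_funE d1) => z; have := d2 z => h; exact: ex_derive.
- by rewrite PE; apply: cP; exact: (derive_continuous (dF j)).
- by rewrite PE => z; have := d1 z => h; exact: ex_derive.
Qed.

End product.

Lemma C2_Phi b j : C2 (delta_mx 0 j) (Phi b : 'rV[R]_d -> R).
Proof.
exact: (@C2_prod (fun i => her (b i)) (fun i => dher (b i)) (fun i => ddher (b i))
  (fun i => is_derive_her (b i)) (fun i => is_derive_dher (b i)) (fun i => @continuous_ddher R (b i))).
Qed.

Lemma derive2_Phi b j : 'D_(delta_mx 0 j) ('D_(delta_mx 0 j) (Phi b)) =
  fun x : 'rV[R]_d => (x 0 j ^+ 2 - (2 * b j + 1)%:R) * Phi b x.
Proof.
rewrite (@derive2_prod (fun i => her (b i)) (fun i => dher (b i)) (fun i => ddher (b i))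
  (fun i => is_derive_her (b i)) (fun i => is_derive_dher (b i))).
by apply/funext => x; rewrite /Phi [in RHS](bigD1 j)//= mulrA.
Qed.

Lemma sum_derive2_Phi b x : \sum_j 'D_(delta_mx 0 j) ('D_(delta_mx 0 j) (Phi b)) x =
  (sqnorm x - (2 * (\sum_j b j) + d)%:R) * Phi b x.
Proof.
have E (j : 'I_d) : 'D_(delta_mx 0 j) ('D_(delta_mx 0 j) (Phi b)) x = (x 0 j ^+ 2 - (2 * b j + 1)%:R) * Phi b x.
  exact: (congr1 (fun f => f x) (derive2_Phi b j)).
rewrite (eq_bigr _ (fun j _ => E j)).
rewrite -mulr_suml sumrB; congr ((_ - _) * _).
rewrite natrD natrM natr_sum mulr_sumr -[X in _ = _ + X%:R](card_ord d) -sum1_card natr_sum -big_split/=.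
by apply: eq_bigr => j _; rewrite natrD natrM.
Qed.

Definition gaussn x := expR (- (sqnorm x / 2)).

Lemma is_derive_sqnorm x (v : 'rV[R]_d) :
  is_derive x v (@sqnorm R d) (\sum_j 2 * v 0 j * x 0 j).
Proof.
apply: is_derive_sumr => j.
have h := is_deriveMr (is_derive_coord j x v) (is_derive_coord j x v).
rewrite (_ : (fun z : 'rV[R]_d => z 0 j ^+ 2) = (fun z => z 0 j * z 0 j)); last first.
  by apply/funext => z; rewrite expr2.
by apply: (is_derive_eq h); ring.
Qed.

Lemma continuous_sqnorm : continuous (@sqnorm R d).
Proof. by apply: cont_sum => j; apply: contX; exact: continuous_coord. Qed.

Definition coords : set ('rV[R]_d -> R) := [set l | exists j, l = fun x => x 0 j].
Definition gauss_base : set ('rV[R]_d -> R) := [set gaussn].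

Lemma coords_props l : coords l -> continuous l /\ forall z v, is_derive z v l (l v).
Proof.
move=> [j ->]; split; first exact: continuous_coord.
by move=> z v; exact: is_derive_coord.
Qed.

Lemma gauss_base_props f : gauss_base f ->
  continuous f /\ forall v, (forall z, derivable f z v) /\ cls coords gauss_base ('D_v f).
Proof.
move=> ->; split.
  move=> x; rewrite /gaussn.
  apply: (@continuous_comp _ _ _ (fun x : 'rV[R]_d => - (sqnorm x / 2)) expR); last exact: continuous_expR.
  apply: continuousN; apply: (@continuousM _ _ (@sqnorm R d) (fun=> 2^-1)); last exact: cst_continuous.
  exact: continuous_sqnorm.
move=> v; have D z : is_derive z v gaussn (\sum_j (- v 0 j) * (z 0 j * gaussn z)).
  have h : is_derive z v (fun z : 'rV[R]_d => - (sqnorm z / 2)) (- 2^-1 * (\sum_j 2 * v 0 j * z 0 j)).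
    rewrite (_ : (fun z : 'rV[R]_d => - (sqnorm z / 2)) = (fun z => - 2^-1 * sqnorm z)); last first.
      by apply/funext => y; rewrite mulNr mulrC.
    by apply: is_deriveZr; exact: is_derive_sqnorm.
  apply: (is_derive_eq (is_derive_chain (is_derive_expR _) h)).
  rewrite mulrCA !mulr_sumr; by apply: eq_bigr => j _; rewrite /gaussn; field.
split; first by move=> z; have := D z => Dz; exact: ex_derive.
rewrite (derive_funE D); apply: (@cls_sum R _ coords gauss_base _ _ _ _ gaussn); first exact: cls_base.
move=> j _; apply: cls_scale; apply: (@cls_mul _ _ _ _ (fun x : 'rV[R]_d => x 0 j)).
  by exists j.
exact: cls_base.
Qed.

Lemma cls_Phi b : cls coords gauss_base (Phi b).
Proof.
pose c := \prod_(j < d) (Num.sqrt (hnorm (b j)))^-1 : R.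
suff h (s : seq 'I_d) : cls coords gauss_base
    (fun x => (\prod_(j <- s) (hpoly (b j)).[x 0 j]) * gaussn x).
  apply: cls_ext (cls_scale c (h (index_enum 'I_d))) => x.
  rewrite /Phi /c /gaussn /sqnorm mulr_suml -sumrN expR_sum -!big_split/=.
  by apply: eq_bigr => j _; rewrite herE.
elim: s => [|j s IH].
  by apply: cls_ext (@cls_base _ _ coords gauss_base gaussn erefl) => x; rewrite big_nil mul1r.
apply: cls_ext (@cls_poly _ _ coords gauss_base (hpoly (b j)) (fun x : 'rV[R]_d => x 0 j) _ _ IH).
  by move=> x; rewrite big_cons mulrA.
by exists j.
Qed.

Lemma smooth_Phi b : smooth (Phi b : 'rV[R]_d -> R).
Proof. exact: cls_smooth coords_props gauss_base_props _ (cls_Phi b). Qed.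

End hermite_eigenfunctions.

(** * Orthogonality of eigenfunctions by means of cut-offs *)

Section cutoff.
Context {R : realType}.

Lemma cvg0_le (u v : nat -> R) : (forall n, `|u n| <= v n) -> v @ \oo --> (0 : R) ->
  u @ \oo --> (0 : R).
Proof.
move=> h cv; apply/norm_cvg0P; apply: (squeeze_cvgr _ (cvg_cst 0) cv).
by near=> n; rewrite normr_ge0 h.
Unshelve. all: by end_near. Qed.

(** Treats the junction point of the truncated powers, near which neither of the two formulas holds
    on both sides. *)
Lemma is_derive_mul_id (g : R -> R) : {for 0, continuous g} ->
  is_derive (0 : R) 1 (fun x => x * g x) (g 0).
Proof.
move=> cg.
have h : (fun h : R => h^-1 *: (((fun x => x * g x) \o shift 0) (h *: 1) - 0 * g 0)) @ (0 : R)^' --> g 0.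
  apply: (@cvg_trans _ (g @ (0 : R)^')); last first.
    by apply: cvg_within_filter; exact: cg.
  apply: near_eq_cvg; near=> y.
  have y0 : y != 0 by near: y; exact: nbhs_dnbhs_neq.
  by rewrite /shift/= addr0 mul0r subr0 [y *: 1]mulr1 /GRing.scale/= mulrA mulVf// mul1r.
split; first by apply/cvg_ex; exists (g 0).
by apply/cvg_lim.
Unshelve. all: by end_near. Qed.

Definition ppow m (s : R) := Num.max s 0 ^+ m.

Lemma continuous_ppow m : continuous (ppow m).
Proof.
move=> s; apply: (@continuous_comp _ _ _ (fun s : R => Num.max s 0) (fun s => s ^+ m)).
  by apply: continuous_max; [exact: cvg_id|exact: cst_continuous].
exact: exprn_continuous.
Qed.

Lemma is_derive_ppow m (s : R) : is_derive s 1 (ppow m.+2) (m.+2%:R * ppow m.+1 s).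
Proof.
have [s0|s0|->] := ltgtP s 0.
- have E : \forall x \near s, cst 0 x = ppow m.+2 x.
    near=> x; have x0 : x < 0 by near: x; exact: lt_nbhsl.
    by rewrite /ppow max_r ?(ltW x0)// expr0n.
  have -> : m.+2%:R * ppow m.+1 s = 0 by rewrite /ppow max_r ?(ltW s0)// expr0n mulr0.
  exact: near_eq_is_derive E (is_derive_cst 0 s 1).
- have E : \forall x \near s, (fun x => x ^+ m.+2) x = ppow m.+2 x.
    near=> x; have x0 : 0 < x by near: x; exact: lt_nbhsr.
    by rewrite /ppow max_l ?(ltW x0).
  have -> : m.+2%:R * ppow m.+1 s = m.+2%:R * s ^+ m.+1 by rewrite /ppow max_l ?(ltW s0).
  apply: near_eq_is_derive E _.
  have h := is_derive_poly ('X^(m.+2) : {poly R}) s.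
  rewrite derivXn hornerMn hornerXn -mulr_natl in h.
  rewrite (_ : (fun x => x ^+ m.+2) = horner 'X^(m.+2))//.
  by apply/funext => x; rewrite hornerXn.
- have -> : ppow m.+2 = (fun x => x * ppow m.+1 x).
    apply/funext => x; rewrite /ppow exprS; case: (leP x 0) => x0 //.
    by rewrite [0 ^+ m.+1]expr0n !mulr0.
  have := is_derive_mul_id (@continuous_ppow m.+1 0).
  by rewrite /ppow maxxx [0 ^+ m.+1]expr0n mulr0.
Unshelve. all: by end_near. Qed.

(** The exponent 3 makes this piecewise polynomial twice continuously differentiable, and its
    derivatives are explicit and of order e, uniformly in x. *)
Definition cut (e x : R) := ppow 3 (1 - (e * x) ^+ 2).
Definition dcut (e x : R) := 3 * ppow 2 (1 - (e * x) ^+ 2) * (- 2 * e ^+ 2 * x).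
Definition ddcut (e x : R) := 6 * ppow 1 (1 - (e * x) ^+ 2) * (- 2 * e ^+ 2 * x) ^+ 2 -
  6 * e ^+ 2 * ppow 2 (1 - (e * x) ^+ 2).

Let is_derive_arg e (x : R) : is_derive x 1 (fun x => 1 - (e * x) ^+ 2) (- 2 * e ^+ 2 * x).
Proof.
have -> : (fun x => 1 - (e * x) ^+ 2) = (fun x => 1 - e ^+ 2 * (x * x)).
  by apply/funext => y; ring.
have i := is_derive_id x (1 : R).
have h := is_deriveBr (is_derive_cstr x (1:R) 1) (is_deriveZr (e ^+ 2) (is_deriveMr i i)).
by apply: (is_derive_eq h); ring.
Qed.

Lemma is_derive_cut e (x : R) : is_derive x 1 (cut e) (dcut e x).
Proof. exact: (is_derive_chain (is_derive_ppow 1 _) (is_derive_arg e x)). Qed.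

Lemma is_derive_dcut e (x : R) : is_derive x 1 (dcut e) (ddcut e x).
Proof.
have h1 := is_deriveZr 3 (is_derive_chain (is_derive_ppow 0 _) (is_derive_arg e x)).
have h2 := is_deriveZr (- 2 * e ^+ 2) (is_derive_id x (1 : R)).
by apply: (is_derive_eq (is_deriveMr h1 h2)); rewrite /ddcut; ring.
Qed.

Lemma continuous_cut_arg e : continuous (fun x : R => 1 - (e * x) ^+ 2).
Proof.
by move=> y; apply: differentiable_continuous; apply/derivable1_diffP;
  have := is_derive_arg e y => h; exact: ex_derive.
Qed.

Lemma continuous_ddcut e : continuous (ddcut e).
Proof.
have cp m : continuous (fun x => ppow m (1 - (e * x) ^+ 2)).
  by apply: cont_comp; [exact: continuous_ppow|exact: continuous_cut_arg].
have cq : continuous (fun x : R => (- 2 * e ^+ 2 * x) ^+ 2).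
  exact (contX (n := 2) (contM (@cont_cst R R (- 2 * e ^+ 2)) (@cont_id R))).
exact (contB (contM (contM (@cont_cst R R 6) (cp 1)) cq) (contM (@cont_cst R R (6 * e ^+ 2)) (cp 2))).
Qed.

Lemma ppow_ge0 m s : 0 <= ppow m s.
Proof. by rewrite /ppow exprn_ge0// le_max lexx orbT. Qed.

Section bounds.
Variable e : R.
Hypothesis e01 : 0 < e <= 1.
Let e0 : 0 < e. Proof. by case/andP: e01. Qed.
Let e1 : e <= 1. Proof. by case/andP: e01. Qed.

Lemma ppow_le1 m x : ppow m (1 - (e * x) ^+ 2) <= 1.
Proof.
by rewrite /ppow exprn_ile1// ?le_max ?lexx ?orbT// ge_max ler01 andbT lerBlDl lerDr sqr_ge0.
Qed.

Lemma ppow_out m x : e^-1 < `|x| -> ppow m.+1 (1 - (e * x) ^+ 2) = 0.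
Proof.
move=> xe; rewrite /ppow max_r ?expr0n// subr_le0.
have h : 1 <= `|e * x|.
  rewrite normrM (gtr0_norm e0) -(ler_pM2l (x := e^-1)) ?invr_gt0// mulr1 mulKf ?gt_eqF//.
  exact: ltW.
by rewrite -[leRHS]real_normK ?num_real// expr_ge1.
Qed.

Lemma cut_out x : e^-1 < `|x| -> cut e x = 0.
Proof. exact: ppow_out. Qed.

Lemma cut_le1 x : `|cut e x| <= 1.
Proof. by rewrite ger0_norm ?ppow_ge0// ppow_le1. Qed.

Let small x : `|x| <= e^-1 -> `|- 2 * e ^+ 2 * x| <= 2 * e.
Proof.
move=> xe; rewrite !normrM normrN (ger0_norm (ler0n _ 2)) (gtr0_norm e0).
by rewrite -!mulrA ler_pM2l// ler_piMr ?(ltW e0)// -ler_pdivlMl// mulr1.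
Qed.

Lemma dcut_bound x : `|dcut e x| <= 6 * e.
Proof.
rewrite /dcut; have [xe|xe] := leP `|x| e^-1; last first.
  by rewrite ppow_out// mulr0 mul0r normr0 mulr_ge0// ltW.
rewrite normrM; have -> : 6 * e = 3 * (2 * e) by ring.
rewrite ler_pM// ?small// ger0_norm; last by rewrite mulr_ge0// ppow_ge0.
by rewrite ler_piMr// ppow_le1.
Qed.

Lemma ddcut_bound x : `|ddcut e x| <= 30 * e.
Proof.
rewrite /ddcut; have [xe|xe] := leP `|x| e^-1; last first.
  by rewrite !ppow_out// !mulr0 mul0r subrr normr0 mulr_ge0// ltW.
have ee : e ^+ 2 <= e by rewrite expr2 ler_piMr// ltW.
have -> : 30 * e = 24 * e + 6 * e by ring.
rewrite (le_trans (ler_normB _ _))// lerD//.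
  have E2 : 6 * (2 * e) ^+ 2 = 24 * e ^+ 2 by ring.
  rewrite normrM (@le_trans _ _ (6 * (2 * e) ^+ 2))//; last by rewrite E2 ler_pM2l.
  rewrite ler_pM//.
    by rewrite ger0_norm ?mulr_ge0 ?ppow_ge0// ler_piMr// ppow_le1.
  by rewrite normrX ler_pXn2r ?nnegrE ?small// mulr_ge0// ltW.
rewrite ger0_norm; last by rewrite mulr_ge0 ?ppow_ge0// mulr_ge0// sqr_ge0.
rewrite -mulrA ler_pM2l//.
by rewrite (le_trans _ ee)// ler_piMr ?sqr_ge0// ppow_le1.
Qed.

End bounds.

Lemma cut_cvg (x : R) : (fun n => cut n.+1%:R^-1 x) @ \oo --> (1 : R).
Proof.
have h : (fun n => n.+1%:R^-1 * x) @ \oo --> (0 : R).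
  by rewrite -[X in _ --> X](mul0r x); apply: cvgM; [exact: cvg_harmonic|exact: cvg_cst].
have {}h : (fun n => 1 - (n.+1%:R^-1 * x) ^+ 2) @ \oo --> (1 : R).
  rewrite -[X in _ --> X](subr0 1); apply: cvgB; first exact: cvg_cst.
  under eq_fun do rewrite expr2.
  have h2 := @cvgM R nat \oo _ _ _ 0 0 h h; rewrite mulr0 in h2; exact: h2.
have E : ppow 3 1 = 1 by rewrite /ppow max_l// expr1n.
by have := cvg_comp _ _ h (@continuous_ppow 3 1); rewrite E.
Qed.

End cutoff.

Lemma L1_mul_Jap {R : realType} {d : nat} (w : 'rV[R]_d -> R) :
  measurable_fun setT (w \o @row_of_tuple R d) -> L1 (leb d) (fun t => w (row_of_tuple t) ^+ 2) ->
  L1 (leb d) (fun t => `|w (row_of_tuple t)| * Jap (row_of_tuple t)).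
Proof.
move=> mw iw; apply: (L1_le _ (L1D iw (@L1_Jap R d))).
  by apply: measurable_funM; [exact: measurableT_comp|exact: (L1_meas (@L1_Jap R d))].
move=> t; set x := row_of_tuple t; rewrite normrM normr_id (ger0_norm (Jap_ge0 _)) /comp -/x.
have J0 := Jap_ge0 x; have J1 := Jap_le1 x.
have -> : w x ^+ 2 = `|w x| ^+ 2 by rewrite real_normK ?num_real.
have := normr_ge0 (w x); set a := `|w x|; set J := Jap x in J0 J1 *.
move=> a0; have := sqr_ge0 (a - J); have := sqr_ge0 a; nra.
Qed.

Section orthogonality.
Context {R : realType} {d : nat}.
Implicit Types (x : 'rV[R]_d).
Variables (w : 'rV[R]_d -> R) (l : R) (b : 'I_d -> nat).
Hypotheses (sw : smooth w) (iw : L1 (leb d) (fun t => w (row_of_tuple t) ^+ 2)).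
Hypothesis w_eigen : forall x, \sum_j 'D_(delta_mx 0 j) ('D_(delta_mx 0 j) w) x = (sqnorm x - l) * w x.
Hypothesis lb : l != (2 * (\sum_j b j) + d)%:R.

Let F e i (t : R) := cut e t * her (b i) t.
(** The part of the second derivative of [F e i] in which the cut-off is differentiated. *)
Let E1 e i (t : R) := 2 * dcut e t * dher (b i) t + ddcut e t * her (b i) t.
Let F1 e i (t : R) := dcut e t * her (b i) t + cut e t * dher (b i) t.
Let F2 e i (t : R) := cut e t * ((t ^+ 2 - (2 * b i + 1)%:R) * her (b i) t) + E1 e i t.
Let f e x := \prod_i F e i (x 0 i).
Let E e x := \sum_j E1 e j (x 0 j) * \prod_(i | i != j) F e i (x 0 i).

Let dF e i (t : R) : is_derive t 1 (F e i) (F1 e i t).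
Proof. exact: (is_deriveMr (is_derive_cut e t) (is_derive_her _ t)). Qed.

Let dF1 e i (t : R) : is_derive t 1 (F1 e i) (F2 e i t).
Proof.
have h1 := is_deriveMr (is_derive_dcut e t) (is_derive_her (b i) t).
have h2 := is_deriveMr (is_derive_cut e t) (is_derive_dher (b i) t).
by apply: (is_derive_eq (is_deriveDr h1 h2)); rewrite /F2 /E1 -/(dher _ _); ring.
Qed.

Let cF2 e i : continuous (F2 e i).
Proof.
have ch : continuous (her (b i) : R -> R) by exact: continuous_her.
have cdh : continuous (dher (b i) : R -> R) := derive_continuous (is_derive_dher (b i)).
have cdc : continuous (dcut e) := derive_continuous (is_derive_dcut e).
have c : continuous (cut e) := derive_continuous (is_derive_cut e).
have cdd := @continuous_ddcut R e.
have cs := contB (contX (n := 2) (@cont_id R)) (@cont_cst R R (2 * b i + 1)%:R).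
exact (contD (contM c (contM cs ch)) (contD (contM (contM (@cont_cst R R 2) cdc) cdh) (contM cdd ch))).
Qed.

Let C2f e j : C2 (delta_mx 0 j) (f e).
Proof. exact: (C2_prod (dF e) (dF1 e) (@cF2 e)). Qed.

Let lap_f e x : \sum_j 'D_(delta_mx 0 j) ('D_(delta_mx 0 j) (f e)) x =
  (sqnorm x - (2 * (\sum_j b j) + d)%:R) * f e x + E e x.
Proof.
have D2 (j : 'I_d) : 'D_(delta_mx 0 j) ('D_(delta_mx 0 j) (f e)) x =
    (x 0 j ^+ 2 - (2 * b j + 1)%:R) * f e x + E1 e j (x 0 j) * \prod_(i | i != j) F e i (x 0 i).
  have -> : f e x = F e j (x 0 j) * \prod_(i | i != j) F e i (x 0 i) by rewrite /f (bigD1 j).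
  rewrite (congr1 (fun g => g x) (derive2_prod (dF e) (dF1 e) j)) /F2 mulrDl; congr (_ + _).
  by rewrite /F; ring.
rewrite (eq_bigr _ (fun j _ => D2 j)) big_split/=; congr (_ + _).
rewrite -mulr_suml sumrB; congr ((_ - _) * _).
rewrite natrD natrM natr_sum mulr_sumr -[X in _ = _ + X%:R](card_ord d) -sum1_card natr_sum -big_split/=.
by apply: eq_bigr => j _; rewrite natrD natrM.
Qed.

Let bsf e : 0 < e <= 1 -> bsupp (f e).
Proof.
move=> e01; exists e^-1 => x xe.
have [j xj] : exists j, e^-1 < `|x 0 j|.
  apply: contrapT => /forallNP h; move: xe; apply/negP; rewrite -leNgt.
  apply: norm_le_coord; first by case/andP: e01 => e0 _; rewrite invr_ge0 ltW.
  by move=> j; rewrite leNgt; apply/negP.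
by rewrite /f (bigD1 j)//= /F cut_out ?mul0r.
Qed.

Let emb := @euclid_tuple R d.
Let cw : continuous w. Proof. by have [] := sw [::]. Qed.
Let cf e : continuous (f e).
Proof.
by apply: cont_prod => i; exact: (cont_comp (derive_continuous (dF e i)) (@continuous_coord R d i)).
Qed.

Let r (t : d.-tuple (measurableTypeR R)) : 'rV[R]_d := row_of_tuple t.
Let lb' : R := (2 * (\sum_j b j) + d)%:R.

Let integral_identity e : 0 < e <= 1 ->
  [/\ L1 (leb d) (fun t => w (r t) * f e (r t)),
      L1 (leb d) (fun t => w (r t) * E e (r t)) &
  (l - lb') * \int[leb d]_t (w (r t) * f e (r t)) = - \int[leb d]_t (w (r t) * E e (r t))].
Proof.
move=> e01; have bf := bsf e01.
have i1 := L1_bsuppM emb cw (@cf e) bf.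
have i2 := L1_bsuppM emb (contM continuous_sqnorm cw) (@cf e) bf.
have iD (j : 'I_d) : L1 (leb d) (fun t => w (r t) * 'D_(delta_mx 0 j) ('D_(delta_mx 0 j) (f e)) (r t)).
  have [_ _ _ _ cdd] := C2f e j.
  exact: (L1_bsuppM emb cw cdd (bsupp_derive _ (bsupp_derive _ bf))).
have iD' (j : 'I_d) : L1 (leb d) (fun t => 'D_(delta_mx 0 j) ('D_(delta_mx 0 j) w) (r t) * f e (r t)).
  have [_ _ _ _ cdd] := smooth_C2 (delta_mx 0 j) sw.
  exact: (L1_bsuppM emb cdd (@cf e) bf).
have G (j : 'I_d) := green emb (C2f e j) (smooth_C2 (delta_mx 0 j) sw) bf.
have S1 : \int[leb d]_t (\sum_(j < d) w (r t) * 'D_(delta_mx 0 j) ('D_(delta_mx 0 j) (f e)) (r t)) =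
    \int[leb d]_t (\sum_(j < d) 'D_(delta_mx 0 j) ('D_(delta_mx 0 j) w) (r t) * f e (r t)).
  rewrite int_sum; last by move=> j _; exact: iD.
  rewrite int_sum; last by move=> j _; exact: iD'.
  by apply: eq_bigr => j _; exact: G.
have S2 t : \sum_(j < d) w (r t) * 'D_(delta_mx 0 j) ('D_(delta_mx 0 j) (f e)) (r t) =
    (sqnorm (r t) * w (r t) * f e (r t) - lb' * (w (r t) * f e (r t))) + w (r t) * E e (r t).
  by rewrite -mulr_sumr lap_f -/lb'; ring.
have S3 t : \sum_(j < d) 'D_(delta_mx 0 j) ('D_(delta_mx 0 j) w) (r t) * f e (r t) =
    sqnorm (r t) * w (r t) * f e (r t) - l * (w (r t) * f e (r t)).
  by rewrite -mulr_suml w_eigen; ring.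
have i3 : L1 (leb d) (fun t => w (r t) * E e (r t)).
  apply: (L1_ext _ (L1B (L1_sum (P := predT) (index_enum 'I_d) (fun j _ => iD j)) (L1B i2 (L1Z lb' i1)))) => t.
  by rewrite S2; ring.
split => //.
move: S1; rewrite (int_ext _ S2) (int_ext _ S3).
rewrite intD; [|exact: (L1B i2 (L1Z lb' i1))|by[]].
rewrite !intB; [|exact: i2|exact: (L1Z _ i1)|exact: i2|exact: (L1Z _ i1)].
rewrite !intZ; [|exact: i1..].
move=> h; rewrite mulrBl; lra.
Qed.

Let fB : exists2 C, 0 <= C & forall e x, 0 < e <= 1 -> `|f e x| <= C * Jap x.
Proof.
exists (\prod_i hb (b i)); first by apply: prodr_ge0 => i _; exact: hb_ge0.
move=> e x e01; rewrite /f /Jap normr_prod -big_split/=; apply: ler_prod => i _.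
rewrite normr_ge0/= /F normrM -[leRHS]mul1r ler_pM//; first exact: cut_le1.
exact: her_jap.
Qed.

Let EB : exists2 C, 0 <= C & forall e x, 0 < e <= 1 -> `|E e x| <= e * (C * Jap x).
Proof.
have hc (j : 'I_d) : exists C : R, 0 <= C /\ forall x : R, `|dher (b j) x| <= C * jap x.
  by have [C C0 hC] := @dher_bound R (b j); exists C.
have [Cd hCd] := choice hc.
pose c j := (12 * Cd j + 30 * hb (b j)) * \prod_(i | i != j) hb (b i).
have p0 j : 0 <= \prod_(i | i != j) hb (b i) :> R by apply: prodr_ge0 => i _; exact: hb_ge0.
have c0 j : 0 <= 12 * Cd j + 30 * hb (b j).
  by have [C0 _] := hCd j; rewrite addr_ge0 ?mulr_ge0 ?hb_ge0.
exists (\sum_j c j); first by apply: sumr_ge0 => j _; rewrite /c mulr_ge0.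
move=> e x e01; have /andP[e0 e1] := e01.
rewrite mulr_suml mulr_sumr (le_trans (ler_norm_sum _ _ _))//; apply: ler_sum => j _.
have -> : Jap x = jap (x 0 j) * \prod_(i | i != j) jap (x 0 i) by rewrite /Jap (bigD1 j).
have -> : e * (c j * (jap (x 0 j) * \prod_(i | i != j) jap (x 0 i))) =
  (e * ((12 * Cd j + 30 * hb (b j)) * jap (x 0 j))) * ((\prod_(i | i != j) hb (b i)) * \prod_(i | i != j) jap (x 0 i)).
  by rewrite /c; ring.
rewrite normrM ler_pM//; last first.
  rewrite normr_prod -big_split/=; apply: ler_prod => i _.
  rewrite normr_ge0/= /F normrM -[leRHS]mul1r ler_pM//; first exact: cut_le1.
  exact: her_jap.
have [C0 hd] := hCd j.
have -> : e * ((12 * Cd j + 30 * hb (b j)) * jap (x 0 j)) =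
  2 * (6 * e) * (Cd j * jap (x 0 j)) + (30 * e) * (hb (b j) * jap (x 0 j)) by ring.
rewrite (le_trans (ler_normD _ _))// lerD// normrM ler_pM//.
- by rewrite normrM (ger0_norm (ler0n _ 2)) ler_pM2l// dcut_bound.
- by rewrite ddcut_bound.
- exact: her_jap.
Qed.

Let iwJ := L1_mul_Jap (let: And4 mc _ _ _ := emb in mc _ cw) iw.

(** The oscillator is symmetric, but [w] is merely square integrable and its derivatives are not
    controlled. Green's identity therefore puts all derivatives on the cut-off Hermite function, and
    what falls on the cut-off is of order e times [Jap], which is integrable against [w]. In the
    limit the difference of the eigenvalues annihilates the integral. *)
Lemma eigen_orthogonal : \int[leb d]_t (Phi b (row_of_tuple t) * w (row_of_tuple t)) = 0.
Proof.
have [mc _ _ _] := emb.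
have mw := mc _ cw.
have [CF CF0 hF] := fB; have [CE CE0 hE] := EB.
pose e n : R := n.+1%:R^-1.
have e01 n : 0 < e n <= 1 by rewrite /e invr_gt0 ltr0n/= invf_le1// ler1n.
have e0 n : 0 <= e n by have /andP[/ltW] := e01 n.
have [||i c1] := @dominated_convergence_L1 _ _ _ (leb d) (fun n t => w (r t) * f (e n) (r t))
  (fun t => w (r t) * Phi b (r t)) (fun t => CF * (`|w (r t)| * Jap (r t)))
  (fun n => L1_meas (let: And3 h _ _ := integral_identity (e01 n) in h)) _ (L1Z CF iwJ) _.
- move=> t; apply: cvgM; first exact: cvg_cst.
  apply: cvg_bigprod => j; rewrite -[X in _ --> X]mul1r; apply: cvgM; last exact: cvg_cst.
  exact: cut_cvg.
- move=> n t; rewrite normrM mulrCA ler_wpM2l//; exact: hF.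
have c2 : (fun n => (l - lb') * \int[leb d]_t (w (r t) * f (e n) (r t))) @ \oo --> 0.
  set K := \int[leb d]_t (CE * (`|w (r t)| * Jap (r t))).
  have B n : `|(l - lb') * \int[leb d]_t (w (r t) * f (e n) (r t))| <= e n * K.
    have [_ i3 ->] := integral_identity (e01 n).
    rewrite normrN -intZ; last exact: L1Z.
    apply: int_abs_le; [exact: (L1_meas i3)|exact: (L1Z _ (L1Z _ iwJ))|].
    move=> t; rewrite normrM mulrCA (mulrCA CE) mulrCA.
    rewrite [leRHS](_ : _ = `|w (r t)| * (e n * (CE * Jap (r t)))); last by ring.
    by rewrite ler_wpM2l// hE.
  apply: (cvg0_le B).
  by rewrite -[X in _ --> X](mul0r K); apply: cvgM; [exact: cvg_harmonic|exact: cvg_cst].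
have c3 : (fun n => (l - lb') * \int[leb d]_t (w (r t) * f (e n) (r t))) @ \oo -->
    (l - lb') * \int[leb d]_x (w (r x) * Phi b (r x)).
  by apply: cvgM => //; exact: cvg_cst.
have h0 : (l - lb') * \int[leb d]_x (w (r x) * Phi b (r x)) = 0.
  by apply: (cvg_unique _ c3 c2).
move/eqP: h0.
rewrite mulf_eq0 subr_eq0 (negbTE lb)/= => /eqP h.
by rewrite -[RHS]h; apply: int_ext => t; rewrite mulrC.
Qed.

End orthogonality.

(** * The heat kernel as an approximate identity *)

Section heat_kernels.
Context {R : realType}.
Notation lam := (@lebesgue_measure R).
Notation MR := (measurableTypeR R).

(** Half of the exponent absorbs the factor |y| / t; the other half is a Gaussian wider by the
    factor sqrt 2. *)
Lemma gauss_moment (t y : R) : 0 < t -> `|y| * gauss t y <= Num.sqrt 2 * t * gauss (Num.sqrt 2 * t) y.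
Proof.
move=> t0; have s2 : 0 < Num.sqrt 2 :> R by rewrite sqrtr_gt0.
have sp : 0 < Num.sqrt pi :> R by rewrite sqrtr_gt0 pi_gt0.
rewrite !gaussE exprMn sqr_sqrtr//.
set e := expR (- y ^+ 2 / (2 * t ^+ 2)).
have -> : expR (- y ^+ 2 / t ^+ 2) = e * e.
  by rewrite /e -expRD; congr expR; field; rewrite gt_eqF.
have e0 : 0 < e by exact: expR_gt0.
have -> : Num.sqrt 2 * t * ((Num.sqrt pi * (Num.sqrt 2 * t))^-1 * e) = (Num.sqrt pi)^-1 * e.
  by field; rewrite !gt_eqF.
have -> : `|y| * ((Num.sqrt pi * t)^-1 * (e * e)) = (Num.sqrt pi)^-1 * e * (`|y| / t * e).
  by field; rewrite !gt_eqF.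
rewrite ler_piMr ?mulr_ge0 ?invr_ge0 ?(ltW sp) ?(ltW e0)//.
pose a := `|y| / t; have -> : e = (expR (a ^+ 2 / 2))^-1.
  rewrite -expRN /e; congr expR; rewrite /a exprMn real_normK ?num_real// exprVn; field.
  by rewrite gt_eqF.
rewrite -/a ler_pdivrMr ?expR_gt0// mul1r.
by apply: le_trans (expR_ge1Dx _); have := sqr_ge0 (a - 1); lra.
Qed.

Lemma gauss_widen (t y : R) : 0 < t -> gauss t y <= Num.sqrt 2 * gauss (Num.sqrt 2 * t) y.
Proof.
move=> t0; have s2 : 0 < Num.sqrt 2 :> R by rewrite sqrtr_gt0.
have sp : 0 < Num.sqrt pi :> R by rewrite sqrtr_gt0 pi_gt0.
rewrite !gaussE exprMn sqr_sqrtr//.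
have -> : Num.sqrt 2 * ((Num.sqrt pi * (Num.sqrt 2 * t))^-1 * expR (- y ^+ 2 / (2 * t ^+ 2))) =
  (Num.sqrt pi * t)^-1 * expR (- y ^+ 2 / (2 * t ^+ 2)) by field; rewrite !gt_eqF.
rewrite ler_wpM2l ?invr_ge0 ?mulr_ge0 ?(ltW sp) ?(ltW t0)//= ler_expR !mulNr lerN2 ler_wpM2l ?sqr_ge0//.
by rewrite lef_pV2 ?posrE ?mulr_gt0 ?exprn_gt0// ler_peMl ?ler1n// exprn_ge0// ltW.
Qed.

Lemma continuous_gauss (t : R) : continuous (gauss t).
Proof.
move=> y; rewrite (_ : gauss t = fun x => (Num.sqrt pi * t)^-1 * expR (- x ^+ 2 / t ^+ 2)); last first.
  by apply/funext => x; rewrite gaussE.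
have h := contM (contB (@cont_cst R R 0) (contX (n := 2) (@cont_id R))) (@cont_cst R R (t ^- 2)).
have := contM (@cont_cst R R (Num.sqrt pi * t)^-1) (cont_comp (@continuous_expR R) h).
by under eq_fun do rewrite sub0r; exact.
Qed.

Lemma measurable_gauss (t : R) : measurable_fun [set: R] (gauss t).
Proof. by apply: continuous_measurable_fun; exact: continuous_gauss. Qed.

Section approximate_identity.
Context {dd : measure_display} {T : measurableType dd}.
Variable mu : {measure set T -> \bar R}.
Variables (K : nat -> T -> R) (D : T -> R) (f : T -> R) (c : R).
Hypotheses (K0 : forall n t, 0 <= K n t) (iK : forall n, L1 mu (K n))
  (iKD : forall n, L1 mu (fun t => K n t * D t))
  (K1 : (fun n => \int[mu]_t K n t) @ \oo --> (1 : R))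
  (KD : (fun n => \int[mu]_t (K n t * D t)) @ \oo --> (0 : R))
  (mf : measurable_fun setT f) (fD : forall t, `|f t - c| <= D t).

Lemma approximate_identity : (fun n => \int[mu]_t (K n t * f t)) @ \oo --> c.
Proof.
have iKf n : L1 mu (fun t => K n t * (f t - c)).
  apply: (L1_le _ (iKD n)).
    apply: measurable_funM; first exact: (L1_meas (iK n)).
    by apply: measurable_funB => //; exact: measurable_cst.
  by move=> t; rewrite normrM ger0_norm ?K0// ler_wpM2l ?K0.
have E n : \int[mu]_t (K n t * f t) = \int[mu]_t (K n t * (f t - c)) + c * \int[mu]_t K n t.
  rewrite -intZ// -intD//; last exact: L1Z.
  by apply: int_ext => t; ring.
under eq_fun do rewrite E.
have -> : nbhs c = nbhs (0 + c * 1) by rewrite add0r mulr1.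
apply: cvgD; last by apply: cvgM => //; exact: cvg_cst.
apply: cvg0_le KD => n; apply: int_abs_le => //; first exact: (L1_meas (iKf n)).
by move=> t; rewrite normrM ger0_norm ?K0// ler_wpM2l ?K0.
Qed.

End approximate_identity.

Variable d : nat.
Local Notation V := (R * 'rV[R]_d)%type.
Local Notation Z := (MR * d.-tuple MR)%type.
Local Notation mu := (@leb_prod R d).
Implicit Types (z w : V) (v : Z).

Definition Gam t z := gauss t z.1 * \prod_(j < d) gauss t (z.2 0 j).
Definition heat t z w := gauss t (z.1 - w.1) *
  \prod_(j < d) (expR (- (t ^+ 2 / 4)) * mker (expR (- (t ^+ 2 / 2))) (z.2 0 j) (w.2 0 j)).

Lemma Gam_ge0 t z : 0 < t -> 0 <= Gam t z.
Proof.
by move=> t0; rewrite mulr_ge0 ?gauss_ge0//; apply: prodr_ge0 => j _; rewrite gauss_ge0.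
Qed.

Lemma exp_sqr01 (t : R) : 0 < t -> 0 < expR (- (t ^+ 2 / 2)) < 1.
Proof. by move=> t0; rewrite expR_gt0 -expR0 ltr_expR oppr_lt0 divr_gt0// exprn_gt0. Qed.

Lemma heat_ge0 t z w : 0 < t -> 0 <= heat t z w.
Proof.
move=> t0; rewrite mulr_ge0 ?gauss_ge0//; apply: prodr_ge0 => j _.
by rewrite mulr_ge0 ?expR_ge0// ltW// mker_gt0// exp_sqr01.
Qed.

Lemma heat_le t z w : 0 < t -> heat t z w <= Gam t (z - w).
Proof.
move=> t0; rewrite /heat /Gam ler_wpM2l ?gauss_ge0//.
apply: ler_prod => j _; apply/andP; split.
  by rewrite mulr_ge0 ?expR_ge0// ltW// mker_gt0// exp_sqr01.
by rewrite !mxE mker_le_gauss.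
Qed.

Lemma iotaE2 v j : (@iota R d v).2 0 j = tnth v.2 j. Proof. by rewrite mxE. Qed.

Lemma Gam_iota t z v : Gam t (z - iota v) = gauss t (z.1 - v.1) * \prod_(j < d) gauss t (z.2 0 j - tnth v.2 j).
Proof. by congr (_ * _); apply: eq_bigr => j _; rewrite !mxE. Qed.

Lemma gaussN t (y : R) : gauss t (- y) = gauss t y.
Proof. by rewrite !gaussE sqrrN. Qed.

Lemma GamN t z : Gam t (- z) = Gam t z.
Proof. by rewrite /Gam gaussN; congr (_ * _); apply: eq_bigr => j _; rewrite mxE gaussN. Qed.

Lemma int_Gam t z : 0 < t ->
  L1 mu (fun v => Gam t (z - iota v)) /\ \int[mu]_v Gam t (z - iota v) = 1.
Proof.
move=> t0.
have g (m : R) : L1 lam (fun y => gauss t (m - y)) /\ \int[lam]_y gauss t (m - y) = 1.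
  have := int_gauss m t0; rewrite (_ : (fun y => gauss t (y - m)) = (fun y => gauss t (m - y)))//.
  by apply/funext => y; rewrite -gaussN opprB.
have [i1 i2] := g z.1.
have [j1 j2] := prod_coords (fun j : 'I_d => (g (z.2 0 j)).1).
split.
  by apply: L1_ext (L1_tensor i1 j1) => v; rewrite Gam_iota.
rewrite (int_ext _ (Gam_iota t z)) (int_tensor i1 j1) i2 mul1r j2 big1// => j _.
by case: (g (z.2 0 j)).
Qed.

(** The l1 norm is used because first moments and directional derivatives split over the
    coordinates. *)
Definition cnorm z := `|z.1| + \sum_(j < d) `|z.2 0 j|.

(** Each summand of [cnorm] is absorbed by the Gaussian factor of its own coordinate, while the
    other factors are merely widened, each at the cost of sqrt 2. *)
Lemma Gam_moment t z : 0 < t ->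
  cnorm z * Gam t z <= (d.+1%:R * Num.sqrt 2 ^+ d.+1) * t * Gam (Num.sqrt 2 * t) z.
Proof.
move=> t0; pose g := gauss (Num.sqrt 2 * t).
have s2 : 0 < Num.sqrt 2 :> R by rewrite sqrtr_gt0.
have st0 : 0 < Num.sqrt 2 * t by rewrite mulr_gt0.
have g0 y : 0 <= g y by exact: gauss_ge0.
have P : \prod_(j < d) gauss t (z.2 0 j) <= Num.sqrt 2 ^+ d * \prod_(j < d) g (z.2 0 j).
  rewrite -[d in _ ^+ d]card_ord -prodr_const -big_split/=; apply: ler_prod => j _.
  by rewrite gauss_ge0//= gauss_widen.
have P0 : 0 <= \prod_(j < d) gauss t (z.2 0 j) by apply: prodr_ge0 => j _; exact: gauss_ge0.
set B := Num.sqrt 2 ^+ d.+1 * t * Gam (Num.sqrt 2 * t) z.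
have BE : B = (Num.sqrt 2 * t * g z.1) * (Num.sqrt 2 ^+ d * \prod_(j < d) g (z.2 0 j)).
  by rewrite /B /Gam -/g exprS; ring.
rewrite /cnorm mulrDl mulr_suml.
have -> : d.+1%:R * Num.sqrt 2 ^+ d.+1 * t * Gam (Num.sqrt 2 * t) z = B + \sum_(j < d) B.
  by rewrite sumr_const card_ord -mulr_natl /B -natr1; ring.
rewrite lerD//.
  have h := gauss_moment z.1 t0; rewrite BE /Gam [leLHS]mulrA.
  by apply: (ler_pM _ _ h P) => //; rewrite mulr_ge0// gauss_ge0.
apply: ler_sum => j _.
have PE (h : R -> R) : \prod_(i < d) h (z.2 0 i) = h (z.2 0 j) * \prod_(i < d | i != j) h (z.2 0 i).
  by rewrite (bigD1 j).
have -> : B = (Num.sqrt 2 * g z.1) * ((Num.sqrt 2 * t * g (z.2 0 j)) * (Num.sqrt 2 ^+ d.-1 * \prod_(i < d | i != j) g (z.2 0 i))).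
  have d0 : (0 < d)%N by exact: leq_ltn_trans (ltn_ord j).
  have sE : Num.sqrt 2 ^+ d.+1 = Num.sqrt 2 * (Num.sqrt 2 * Num.sqrt 2 ^+ d.-1) :> R.
    by rewrite -{1}(prednK d0) !exprS.
  by rewrite /B /Gam -/g (PE g) sE; ring.
rewrite /Gam PE mulrCA ler_pM ?mulr_ge0 ?gauss_ge0//.
- by apply: prodr_ge0 => i _; exact: gauss_ge0.
- exact: gauss_widen.
rewrite [leLHS]mulrA ler_pM ?mulr_ge0 ?gauss_ge0 ?gauss_moment//.
  by apply: prodr_ge0 => i _; exact: gauss_ge0.
have -> : Num.sqrt 2 ^+ d.-1 = \prod_(i < d | i != j) Num.sqrt 2 :> R.
  rewrite -[in LHS](card_ord d) -(cardC1 j) -prodr_const.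
  by apply: eq_bigl => i; rewrite inE.
rewrite -big_split/=; apply: ler_prod => i _.
by rewrite gauss_ge0//= gauss_widen.
Qed.

Lemma measurable_tnth_comp (h : R -> R) (j : 'I_d) : measurable_fun [set: R] h ->
  measurable_fun setT (fun v : Z => h (tnth v.2 j)).
Proof.
move=> mh; apply: (measurableT_comp mh).
by apply: (measurableT_comp (measurable_tnth j)); exact: measurable_snd.
Qed.

Lemma measurable_heat t z : 0 < t -> measurable_fun setT (fun v => heat t z (iota v)).
Proof.
move=> t0; apply: measurable_funM.
  apply: (measurableT_comp (@measurable_gauss t)).
  by apply: measurable_funB; [exact: measurable_cst|exact: measurable_fst].
apply: measurable_prod => j _; apply: measurable_funM; first exact: measurable_cst.
rewrite (_ : (fun _ => _) = (fun v : Z => mker (expR (- (t ^+ 2 / 2))) (z.2 0 j) (tnth v.2 j))); last first.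
  by apply/funext => v; rewrite iotaE2.
by apply: measurable_tnth_comp; apply: measurable_mker; exact: exp_sqr01.
Qed.

Lemma L1_heat t z : 0 < t -> L1 mu (fun v => heat t z (iota v)).
Proof.
move=> t0; apply: (L1_le (measurable_heat z t0) (int_Gam z t0).1) => v.
by rewrite ger0_norm ?heat_ge0// heat_le.
Qed.

Lemma int_heat t z : 0 < t -> \int[mu]_v heat t z (iota v) =
  \prod_(j < d) (expR (- (t ^+ 2 / 4)) * \int[lam]_y mker (expR (- (t ^+ 2 / 2))) (z.2 0 j) y).
Proof.
move=> t0; have [i1 i2] := int_gauss z.1 t0.
have r01 := exp_sqr01 t0.
pose F (j : 'I_d) y := expR (- (t ^+ 2 / 4)) * mker (expR (- (t ^+ 2 / 2))) (z.2 0 j) y.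
have iF j : L1 lam (F j) by apply: L1Z; case: (int_mker r01 (z.2 0 j)).
have [j1 j2] := prod_coords iF.
have E v : heat t z (iota v) = gauss t (v.1 - z.1) * \prod_(j < d) F j (tnth v.2 j).
  by rewrite /heat -gaussN opprB; congr (_ * _); apply: eq_bigr => j _; rewrite iotaE2.
rewrite (int_ext _ E) (int_tensor i1 j1) i2 mul1r j2; apply: eq_bigr => j _.
by rewrite /F intZ//; case: (int_mker r01 (z.2 0 j)).
Qed.

Definition tn n : R := n.+1%:R^-1.
Lemma tn_gt0 n : 0 < tn n. Proof. by rewrite invr_gt0. Qed.
Lemma tn_cvg : tn @ \oo --> 0. Proof. exact: cvg_harmonic. Qed.

Lemma tn_expR_cvg (c : R) : (fun n => expR (- (tn n ^+ 2 / c))) @ \oo --> (1 : R).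
Proof.
have h : (fun n => - (tn n ^+ 2 / c)) @ \oo --> (0 : R).
  rewrite -oppr0; apply: cvgN; rewrite -[X in _ --> X](mul0r c^-1).
  apply: cvgM; last exact: cvg_cst.
  by rewrite -[X in _ --> X](mulr0 (0 : R)); under eq_fun do rewrite expr2; apply: cvgM; exact: tn_cvg.
have := cvg_comp _ _ h (@continuous_expR R 0); rewrite expR0; exact.
Qed.

Lemma int_mker_cvg (x : R) :
  (fun n => \int[lam]_y mker (expR (- (tn n ^+ 2 / 2))) x y) @ \oo --> (1 : R).
Proof.
pose r n : R := expR (- (tn n ^+ 2 / 2)).
have E n : \int[lam]_y mker (expR (- (tn n ^+ 2 / 2))) x y =
    Num.sqrt (2 / (1 + r n * r n)) * expR (- ((1 - r n * r n) / (2 * (1 + r n * r n)) * x ^+ 2)).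
  by have [_ ->] := int_mker (exp_sqr01 (tn_gt0 n)) x; rewrite -/(r n) expr2.
under eq_fun do rewrite E.
have hr : r @ \oo --> (1 : R) := tn_expR_cvg 2.
have hr2 : (fun n => r n * r n) @ \oo --> (1 : R).
  by rewrite -[X in _ --> X](mulr1 1); exact: cvgM.
have h2 : (fun n => 1 + r n * r n) @ \oo --> (2 : R).
  by rewrite (_ : 2 = 1 + 1)//; apply: cvgD => //; exact: cvg_cst.
have h3 : (fun n => 2 / (1 + r n * r n)) @ \oo --> (1 : R).
  rewrite -[X in _ --> X](@divff _ (2 : R))//; apply: cvgM; first exact: cvg_cst.
  by apply: cvgV.
have h4 : (fun n => - ((1 - r n * r n) / (2 * (1 + r n * r n)) * x ^+ 2)) @ \oo --> (0 : R).
  rewrite -oppr0; apply: cvgN; rewrite -[X in _ --> X](mul0r (x ^+ 2)); apply: cvgM; last exact: cvg_cst.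
  rewrite -[X in _ --> X](mul0r (2 * 2)^-1); apply: cvgM.
    by rewrite -[X in _ --> X](subrr 1); apply: cvgB => //; exact: cvg_cst.
  by apply: cvgV; [rewrite mulf_neq0|apply: cvgM => //; exact: cvg_cst].
have h5 := cvg_comp _ _ h3 (@sqrt_continuous R 1).
have h6 := cvg_comp _ _ h4 (@continuous_expR R 0).
by have := cvgM h5 h6; rewrite sqrtr1 expR0 mulr1; exact.
Qed.

Lemma int_heat_cvg z : (fun n => \int[mu]_v heat (tn n) z (iota v)) @ \oo --> (1 : R).
Proof.
under eq_fun do rewrite int_heat ?tn_gt0//.
have -> : nbhs (1 : R) = nbhs (\prod_(j < d) (1 * 1) : R).
  by congr nbhs; rewrite big1// => j _; rewrite mulr1.
apply: cvg_bigprod => j; apply: cvgM; [exact: tn_expR_cvg|exact: int_mker_cvg].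
Qed.

Lemma L1_heat_cnorm t z : 0 < t -> L1 mu (fun v => heat t z (iota v) * cnorm (z - iota v)) /\
  \int[mu]_v (heat t z (iota v) * cnorm (z - iota v)) <= (d.+1%:R * Num.sqrt 2 ^+ d.+1) * t.
Proof.
move=> t0; have st0 : 0 < Num.sqrt 2 * t by rewrite mulr_gt0// sqrtr_gt0.
have [i1 i2] := int_Gam z st0.
have c0 w : 0 <= cnorm w by rewrite /cnorm addr_ge0// sumr_ge0.
have B v : heat t z (iota v) * cnorm (z - iota v) <=
    (d.+1%:R * Num.sqrt 2 ^+ d.+1) * t * Gam (Num.sqrt 2 * t) (z - iota v).
  by apply: le_trans (Gam_moment _ t0); rewrite mulrC ler_wpM2l// heat_le.
have m : measurable_fun setT (fun v => heat t z (iota v) * cnorm (z - iota v)).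
  apply: measurable_funM; first exact: measurable_heat.
  apply: measurable_funD.
    apply: measurableT_comp => //.
    by apply: measurable_funB; [exact: measurable_cst|exact: measurable_fst].
  apply: measurable_sum => j; rewrite (_ : (fun _ => _) = (fun v : Z => `|z.2 0 j - tnth v.2 j|)); last first.
    by apply/funext => v; rewrite !mxE.
  apply: (@measurable_tnth_comp (fun y => `|z.2 0 j - y|)).
  by apply: measurableT_comp => //; apply: measurable_funB => //; exact: measurable_cst.
have i : L1 mu (fun v => heat t z (iota v) * cnorm (z - iota v)).
  by apply: (L1_le m (L1Z _ i1)) => v; rewrite ger0_norm ?B// mulr_ge0 ?heat_ge0.
split => //; apply: (le_trans (int_le i (L1Z _ i1) B)).
by rewrite intZ// i2 mulr1.
Qed.

(** The Lipschitz bound at [z] holds globally, so no localization is required: the mass of the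
    kernel tends to 1 and its first moment is of order t. *)
Lemma heat_approx (f : V -> R) z L : measurable_fun setT (f \o @iota R d) ->
  (forall w, `|f w - f z| <= L * cnorm (z - w)) ->
  (fun n => \int[mu]_v (heat (tn n) z (iota v) * f (iota v))) @ \oo --> f z.
Proof.
move=> mf Lf; have c0 w : 0 <= cnorm w by rewrite /cnorm addr_ge0// sumr_ge0.
have i n := L1_heat_cnorm z (tn_gt0 n).
have i' n : L1 mu (fun v => heat (tn n) z (iota v) * (L * cnorm (z - iota v))).
  by apply: L1_ext (L1Z L (i n).1) => v; rewrite mulrCA.
apply: (@approximate_identity _ _ mu (fun n v => heat (tn n) z (iota v))
  (fun v => L * cnorm (z - iota v)) (f \o @iota R d)) => //.
- by move=> n v; rewrite heat_ge0// tn_gt0.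
- by move=> n; apply: L1_heat; exact: tn_gt0.
- exact: int_heat_cvg.
- apply: (@cvg0_le _ _ (fun n => `|L| * ((d.+1%:R * Num.sqrt 2 ^+ d.+1) * tn n))).
    move=> n; rewrite (_ : \int[mu]_v _ = L * \int[mu]_v (heat (tn n) z (iota v) * cnorm (z - iota v))); last first.
      by rewrite -intZ ?(i n).1//; apply: int_ext => v; rewrite mulrCA.
    rewrite normrM ler_wpM2l// ger0_norm ?(i n).2//.
    by apply: Rintegral_ge0 => v _; rewrite mulr_ge0 ?heat_ge0 ?tn_gt0.
  rewrite -[X in _ --> X](mulr0 `|L|); apply: cvgM; first exact: cvg_cst.
  rewrite -[X in _ --> X](mulr0 (d.+1%:R * Num.sqrt 2 ^+ d.+1)); apply: cvgM; first exact: cvg_cst.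
  exact: tn_cvg.
- by move=> v; exact: Lf.
Qed.

End heat_kernels.

(** * Spectral projections *)

Section real_projection.
Context {R : realType} {d : nat}.
Notation lam := (@lebesgue_measure R).
Notation MR := (measurableTypeR R).
Implicit Types (x y : 'rV[R]_d) (f w : 'rV[R]_d -> R).
Let r (t : d.-tuple MR) : 'rV[R]_d := row_of_tuple t.

(** The ground state. It is positive and reproduced by the Mehler kernel, so that a bound by one of
    its multiples survives the heat flow uniformly in time. *)
Definition Phi0 x := Phi (fun=> 0%N) x.

Lemma Phi0_gt0 x : 0 < Phi0 x.
Proof.
apply: prodr_gt0 => j _; rewrite her0E mulr_gt0 ?expR_gt0//.
by rewrite invr_gt0 sqrtr_gt0 hnorm_gt0.
Qed.

Definition Proj k f x := \int[leb d]_t (Kproj k x (r t) * f (r t)).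

(* the regularity of the slices of the partial Fourier transform *)
Definition slice f := [/\ measurable_fun setT (f \o r),
  exists2 C, 0 <= C & forall x, `|f x| <= C * Phi0 x &
  exists L, forall x y, `|f y - f x| <= L * \sum_j `|x 0 j - y 0 j|].

Lemma measurable_Phi b : measurable_fun setT (fun t => Phi b (r t)).
Proof.
rewrite (_ : (fun _ => _) = (fun t : d.-tuple MR => \prod_(j < d) her (b j) (tnth t j))); last first.
  by apply/funext => t; apply: eq_bigr => j _; rewrite mxE.
exact: (@measurable_prod_coords R d (fun j => her (b j)) (fun j => @measurable_her R (b j))).
Qed.

Lemma measurable_Kproj k x : measurable_fun setT (fun t => Kproj k x (r t)).
Proof.
rewrite /Kproj; under eq_fun do rewrite -big_filter.
apply: measurable_sum => b; apply: measurable_funM; first exact: measurable_cst.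
exact: measurable_Phi.
Qed.

Lemma Phi_Jap b : exists2 C, 0 <= C & forall x, `|Phi b x| <= C * Jap x.
Proof.
exists (hb (\sum_j b j) ^+ d); first by rewrite exprn_ge0// hb_ge0.
by move=> x; apply: Phi_bound => j; rewrite (bigD1 j)//= leq_addr.
Qed.

Lemma slice_Jap f : slice f -> exists2 C, 0 <= C & forall x, `|f x| <= C * Jap x.
Proof.
move=> [_ [C C0 hC] _]; have [C' C'0 hC'] := Phi_Jap (fun=> 0%N).
exists (C * C'); first exact: mulr_ge0.
move=> x; apply: (le_trans (hC x)); rewrite -mulrA ler_wpM2l//.
by rewrite (le_trans _ (hC' x))// ler_norm.
Qed.

Lemma slice_L1 f : slice f -> L1 (leb d) (f \o r).
Proof.
move=> sf; have [m _ _] := sf; have [C C0 hC] := slice_Jap sf.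
by apply: (L1_le m (L1Z C (@L1_Jap R d))) => t; exact: hC.
Qed.

Lemma L1_Phi_slice b f : slice f -> L1 (leb d) (fun t => Phi b (r t) * f (r t)).
Proof.
move=> sf; have [m _ _] := sf; have [C C0 hC] := slice_Jap sf; have [C' C'0 hC'] := Phi_Jap b.
apply: (L1_le _ (L1Z (C' * C) (@L1_Jap R d))).
  by apply: measurable_funM => //; exact: measurable_Phi.
move=> t; rewrite normrM /comp -/(r t); have J0 := Jap_ge0 (r t).
apply: (@le_trans _ _ ((C' * Jap (r t)) * (C * Jap (r t)))); first by rewrite ler_pM.
by rewrite mulrACA ler_wpM2l ?mulr_ge0// ler_piMr// Jap_le1.
Qed.

Lemma Proj_sum k f x : slice f -> Proj k f x =
  \sum_(b : {ffun 'I_d -> 'I_k.+1} | (\sum_j b j == k)%N)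
    (\int[leb d]_t (Phi (idx b) (r t) * f (r t))) * Phi (idx b) x.
Proof.
move=> sf; rewrite /Proj.
have E t : Kproj k x (r t) * f (r t) = \sum_(b : {ffun 'I_d -> 'I_k.+1} | (\sum_j b j == k)%N)
    Phi (idx b) x * (Phi (idx b) (r t) * f (r t)).
  by rewrite /Kproj mulr_suml; apply: eq_bigr => b _; rewrite mulrA.
rewrite (int_ext _ E) int_sum; last by move=> b _; apply: L1Z; exact: L1_Phi_slice.
by apply: eq_bigr => b _; rewrite intZ ?(mulrC _ (Phi _ x))//; exact: L1_Phi_slice.
Qed.

Lemma Proj_bound k f x : slice f -> `|Proj k f x| <= KB d k * Jap x * \int[leb d]_t `|f (r t)|.
Proof.
move=> sf; have i := slice_L1 sf.
have KJ0 : 0 <= KB d k * Jap x by rewrite mulr_ge0 ?KB_ge0 ?Jap_ge0.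
rewrite -intZ; last exact: L1_norm.
apply: int_abs_le; last 1 first.
- move=> t; rewrite normrM ler_wpM2r// (le_trans (Kproj_bound _ _ _))// mulrA.
  by rewrite ler_piMr// Jap_le1.
- by apply: measurable_funM; [exact: measurable_Kproj|exact: (L1_meas i)].
- by apply: L1Z; exact: L1_norm.
Qed.

Lemma smooth_meas w : smooth w -> measurable_fun setT (w \o r).
Proof. by move=> sw; have [c _] := sw [::]; have [mc _ _ _] := @euclid_tuple R d; exact: mc. Qed.

Section level.
Variables (k : nat) (c : {ffun 'I_d -> 'I_k.+1} -> R).
Let Q (b : {ffun 'I_d -> 'I_k.+1}) := (\sum_j b j == k)%N.
Let g x := \sum_(b | Q b) c b * Phi (idx b) x.

Lemma smooth_level : smooth g.
Proof.
apply: (cls_smooth coords_props (@gauss_base_props R d)).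
apply: (@cls_sum R _ coords gauss_base _ _ _ _ gaussn); first exact: cls_base.
by move=> b _; apply: cls_scale; exact: cls_Phi.
Qed.

Lemma level_eigen x :
  \sum_j 'D_(delta_mx 0 j) ('D_(delta_mx 0 j) g) x = (sqnorm x - (2 * k + d)%:R) * g x.
Proof.
have D2 (j : 'I_d) : 'D_(delta_mx 0 j) ('D_(delta_mx 0 j) g) =
    fun x => \sum_(b | Q b) c b * 'D_(delta_mx 0 j) ('D_(delta_mx 0 j) (Phi (idx b))) x.
  have step (G : {ffun 'I_d -> 'I_k.+1} -> 'rV[R]_d -> R) :
      (forall b x, derivable (G b) x (delta_mx 0 j)) ->
      'D_(delta_mx 0 j) (fun x => \sum_(b | Q b) c b * G b x) =
      fun x => \sum_(b | Q b) c b * 'D_(delta_mx 0 j) (G b) x.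
    move=> dG; apply: derive_funE => y.
    under eq_fun do rewrite -big_filter; rewrite -big_filter.
    by apply: is_derive_sumr => b; apply: is_deriveZr; apply/derivableP; exact: dG.
  have d1 (b : {ffun 'I_d -> 'I_k.+1}) y : derivable (Phi (idx b)) y (delta_mx 0 j).
    by have [] := @C2_Phi R d (idx b) j.
  have d2 (b : {ffun 'I_d -> 'I_k.+1}) y : derivable ('D_(delta_mx 0 j) (Phi (idx b))) y (delta_mx 0 j).
    by have [] := @C2_Phi R d (idx b) j.
  by rewrite (step (fun b => Phi (idx b)) d1) (step (fun b => 'D_(delta_mx 0 j) (Phi (idx b))) d2).
have -> : \sum_j 'D_(delta_mx 0 j) ('D_(delta_mx 0 j) g) x =
    \sum_(b | Q b) c b * \sum_j 'D_(delta_mx 0 j) ('D_(delta_mx 0 j) (Phi (idx b))) x.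
  transitivity (\sum_(j < d) \sum_(b | Q b) c b * 'D_(delta_mx 0 j) ('D_(delta_mx 0 j) (Phi (idx b))) x).
    by apply: eq_bigr => j _; exact: (congr1 (fun g => g x) (D2 j)).
  by rewrite exchange_big; apply: eq_bigr => b _; rewrite mulr_sumr.
rewrite mulr_sumr; apply: eq_bigr => b /eqP bk.
by rewrite sum_derive2_Phi bk; ring.
Qed.

End level.

Let Proj_level k f : slice f -> Proj k f = fun x =>
  \sum_(b : {ffun 'I_d -> 'I_k.+1} | (\sum_j b j == k)%N)
    (\int[leb d]_t (Phi (idx b) (r t) * f (r t))) * Phi (idx b) x.
Proof. by move=> sf; apply/funext => x; exact: Proj_sum. Qed.

Lemma smooth_Proj k f : slice f -> smooth (Proj k f).
Proof. by move=> sf; rewrite Proj_level//; exact: smooth_level. Qed.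

Lemma Proj_eigen k f x : slice f ->
  \sum_j 'D_(delta_mx 0 j) ('D_(delta_mx 0 j) (Proj k f)) x = (sqnorm x - (2 * k + d)%:R) * Proj k f x.
Proof. by move=> sf; rewrite Proj_level//; exact: level_eigen. Qed.

Section against_eigenfunction.
Variables (f w : 'rV[R]_d -> R) (k : nat).
Hypotheses (sf : slice f) (sw : smooth w) (iw : L1 (leb d) (fun t => w (r t) ^+ 2)).
Hypothesis w_eigen : forall x, \sum_j 'D_(delta_mx 0 j) ('D_(delta_mx 0 j) w) x =
  (sqnorm x - (2 * k + d)%:R) * w x.

Let mw := smooth_meas sw.
Let iwJ : L1 (leb d) (fun t => `|w (r t)| * Jap (r t)) := L1_mul_Jap mw iw.

Lemma L1_Jap_mul (g : 'rV[R]_d -> R) C : measurable_fun setT (g \o r) ->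
  (forall x, `|g x| <= C * Jap x) -> L1 (leb d) (fun t => g (r t) * w (r t)).
Proof.
move=> mg hg; apply: (L1_le _ (L1Z C iwJ)); first exact: measurable_funM.
by move=> t; rewrite normrM mulrC mulrCA ler_wpM2l.
Qed.

Lemma L1_Proj_mul j : L1 (leb d) (fun t => Proj j f (r t) * w (r t)).
Proof.
apply: (@L1_Jap_mul (Proj j f) (KB d j * \int[leb d]_t `|f (r t)|)); first exact: (smooth_meas (smooth_Proj j sf)).
by move=> x; rewrite mulrAC; exact: Proj_bound.
Qed.

Let int_Proj_mul j : j != k -> \int[leb d]_t (Proj j f (r t) * w (r t)) = 0.
Proof.
move=> jk.
have iP b : L1 (leb d) (fun t => Phi b (r t) * w (r t)).
  have [C C0 hC] := Phi_Jap b.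
  exact: (@L1_Jap_mul (Phi b) C (measurable_Phi b) hC).
have E t : Proj j f (r t) * w (r t) = \sum_(b : {ffun 'I_d -> 'I_j.+1} | (\sum_j b j == j)%N)
    (\int[leb d]_t (Phi (idx b) (r t) * f (r t))) * (Phi (idx b) (r t) * w (r t)).
  by rewrite Proj_sum// mulr_suml; apply: eq_bigr => b _; rewrite mulrA.
rewrite (int_ext _ E) int_sum; last by move=> b _; exact: L1Z.
apply: big1 => b /eqP bj; rewrite intZ// (eigen_orthogonal sw iw w_eigen) ?mulr0//.
by rewrite bj eqr_nat eqn_add2r eqn_pmul2l// eq_sym.
Qed.

Section ratio.
Variable q : R.
Hypothesis q01 : 0 < q < 1.
Let q0 : 0 <= q. Proof. by case/andP: q01 => /ltW. Qed.

Let S := limn (series (fun j => q ^+ j * KB d j)).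

Let cvgS : cvgn (series (fun j => q ^+ j * KB d j)).
Proof.
have c := @cvg_series_poly_geom R (7 * d) ((hK ^+ 2) ^+ d) q q01.
have b j : `|q ^+ j * KB d j| <= (hK ^+ 2) ^+ d * (j.+1%:R ^+ (7 * d) * q ^+ j).
  rewrite ger0_norm; last by rewrite mulr_ge0 ?KB_ge0// exprn_ge0.
  by rewrite /KB mulrCA [_ ^+ _ * q ^+ _]mulrC.
exact: (series_dominated_cvg b c).
Qed.

Let S_bound N : \sum_(0 <= j < N) q ^+ j * KB d j <= S.
Proof.
apply: (nondecreasing_cvgn_le _ cvgS N).
by apply/nondecreasing_seqP => n; rewrite seriesSr lerDl mulr_ge0 ?exprn_ge0 ?KB_ge0.
Qed.

Definition mehler_op f x := \int[leb d]_t (Mehler q x (r t) * f (r t)).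

Lemma mehler_partial_bound N x y : `|\sum_(0 <= j < N) q ^+ j * Kproj j x y| <= S * Jap x.
Proof.
rewrite (le_trans (ler_norm_sum _ _ _))//.
apply: (@le_trans _ _ ((\sum_(0 <= j < N) q ^+ j * KB d j) * Jap x)); last first.
  by rewrite ler_wpM2r ?Jap_ge0.
rewrite mulr_suml; apply: ler_sum => j _.
rewrite normrM ger0_norm ?exprn_ge0// -mulrA ler_wpM2l ?exprn_ge0//.
rewrite (le_trans (Kproj_bound _ _ _))// ler_wpM2l ?KB_ge0//.
by rewrite ler_piMr ?Jap_ge0// Jap_le1.
Qed.

Lemma mehler_op_series x : L1 (leb d) (fun t => Mehler q x (r t) * f (r t)) /\
  (fun N => \sum_(0 <= j < N) q ^+ j * Proj j f x) @ \oo --> mehler_op f x.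
Proof.
have iKf j : L1 (leb d) (fun t => Kproj j x (r t) * f (r t)).
  apply: (L1_le _ (L1Z (KB d j * Jap x) (L1_norm (slice_L1 sf)))).
    by apply: measurable_funM; [exact: measurable_Kproj|have [] := sf].
  move=> t; rewrite normrM ler_wpM2r// (le_trans (Kproj_bound _ _ _))// mulrA.
  by rewrite ler_piMr ?Jap_le1// mulr_ge0 ?KB_ge0 ?Jap_ge0.
have [||||i c] := @dominated_convergence_L1 _ _ _ (leb d) (fun N t => (\sum_(0 <= j < N) q ^+ j * Kproj j x (r t)) * f (r t))
  (fun t => Mehler q x (r t) * f (r t)) (fun t => S * Jap x * `|f (r t)|) _ _ _ _.
- move=> N; apply: measurable_funM; last by have [] := sf.
  by apply: measurable_sum => j; apply: measurable_funM => //; exact: measurable_Kproj.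
- move=> t; apply: cvgM; last exact: cvg_cst.
  exact: mehler_sum.
- by apply: L1Z; apply: L1_norm; exact: slice_L1.
- by move=> N t; rewrite normrM ler_wpM2r // mehler_partial_bound.
split => //.
suff E N : \int[leb d]_t ((\sum_(0 <= j < N) q ^+ j * Kproj j x (r t)) * f (r t)) =
    \sum_(0 <= j < N) q ^+ j * Proj j f x by under eq_fun do rewrite -E.
rewrite (int_ext _ (fun t => mulr_suml _ _ _ _)) int_sum.
  by apply: eq_bigr => j _; rewrite -intZ//; apply: int_ext => t; rewrite mulrA.
by move=> j _; apply: L1_ext (L1Z (q ^+ j) (iKf j)) => t; rewrite mulrA.
Qed.

(** All levels other than [k] are orthogonal to [w], so one term of the Mehler series is left. *)
Lemma int_mehler_op_mul : L1 (leb d) (fun t => mehler_op f (r t) * w (r t)) /\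
  \int[leb d]_t (mehler_op f (r t) * w (r t)) =
  q ^+ k * \int[leb d]_t (Proj k f (r t) * w (r t)).
Proof.
pose I := \int[leb d]_t `|f (r t)|.
have I0 : 0 <= I by apply: Rintegral_ge0.
have [||||i c] := @dominated_convergence_L1 _ _ _ (leb d) (fun N t => (\sum_(0 <= j < N) q ^+ j * Proj j f (r t)) * w (r t))
  (fun t => mehler_op f (r t) * w (r t)) (fun t => S * I * (`|w (r t)| * Jap (r t))) _ _ _ _.
- move=> N; apply: measurable_funM => //.
  apply: measurable_sum => j; apply: measurable_funM => //; exact: (smooth_meas (smooth_Proj j sf)).
- move=> t; apply: cvgM; last exact: cvg_cst.
  by case: (mehler_op_series (r t)).
- by apply: L1Z; exact: iwJ.
- move=> N t; rewrite normrM mulrC mulrCA ler_wpM2l//.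
  rewrite (le_trans (ler_norm_sum _ _ _))//.
  apply: (@le_trans _ _ ((\sum_(0 <= j < N) q ^+ j * KB d j) * I * Jap (r t))); last first.
    by rewrite ler_wpM2r ?Jap_ge0// ler_wpM2r.
  rewrite -mulrA mulr_suml; apply: ler_sum => j _.
  rewrite normrM ger0_norm ?exprn_ge0// -mulrA ler_wpM2l ?exprn_ge0//.
  by rewrite [I * _]mulrC mulrA; exact: Proj_bound.
split => //.
apply/esym; apply: (cvg_unique _ _ c) => //.
apply: cvg_near_cst; exists k.+1 => // N /= kN.
rewrite (int_ext _ (fun t => mulr_suml _ _ _ _)) int_sum; last first.
  by move=> j _; apply: L1_ext (L1Z (q ^+ j) (L1_Proj_mul j)) => t; rewrite mulrA.
transitivity (\sum_(0 <= j < N) q ^+ j * \int[leb d]_t (Proj j f (r t) * w (r t))).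
  apply: eq_bigr => j _; rewrite -intZ ?L1_Proj_mul//.
  by apply: int_ext => t; rewrite mulrA.
rewrite big_mkord (bigD1 (Ordinal kN))//= big1 ?addr0// => j jk.
by rewrite int_Proj_mul ?mulr0//; move: jk; rewrite -val_eqE.
Qed.

End ratio.

Let A n x := \int[leb d]_t ((\prod_(j < d) (expR (- (tn n ^+ 2 / 4)) * mker (expR (- (tn n ^+ 2 / 2))) (x 0 j) (tnth t j))) * f (r t)) : R.

Let q n : R := expR (- (tn n ^+ 2 / 2)).
Let c n : R := expR (- (tn n ^+ 2 / 4)) ^+ d.
Let q01 n : 0 < q n < 1. Proof. exact: exp_sqr01 (tn_gt0 n). Qed.
Let c01 n : 0 <= c n <= 1.
Proof.
rewrite /c exprn_ge0 ?expR_ge0// exprn_ile1 ?expR_ge0//.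
by rewrite -expR0 ler_expR oppr_le0 divr_ge0 ?sqr_ge0.
Qed.

Let AK n x t : \prod_(j < d) (expR (- (tn n ^+ 2 / 4)) * mker (expR (- (tn n ^+ 2 / 2))) (x 0 j) (tnth t j)) =
  c n * Mehler (q n) x (r t).
Proof.
rewrite big_split/= prodr_const card_ord; congr (_ * _).
by apply: eq_bigr => j _; rewrite mxE.
Qed.

Let L1A n x : L1 (leb d) (fun t => (\prod_(j < d) (expR (- (tn n ^+ 2 / 4)) *
  mker (expR (- (tn n ^+ 2 / 2))) (x 0 j) (tnth t j))) * f (r t)).
Proof.
by apply: L1_ext (L1Z (c n) (mehler_op_series (q01 n) x).1) => t; rewrite AK mulrA.
Qed.

Let AE n x : A n x = c n * mehler_op (q n) f x.
Proof.
rewrite -intZ; last by case: (mehler_op_series (q01 n) x).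
by apply: int_ext => t; rewrite AK mulrA.
Qed.

(** The function is extended to the product space independently of rho. The Gaussian in rho
    integrates to 1, and the approximate identity on the product space applies. *)
Let A_cvg x : A ^~ x @ \oo --> f x.
Proof.
have [mf _ [L hL]] := sf.
have h := @heat_approx R d (fun z => f z.2) (0, x) `|L|.
have E n : \int[@leb_prod R d]_v (heat (tn n) (0, x) (iota v) * f (iota v).2) = A n x.
  have [i1 i2] := int_gauss (0 : R) (@tn_gt0 R n).
  have := int_tensor i1 (L1A n x); rewrite i2 mul1r => E; refine (etrans _ E).
  apply: int_ext => v; rewrite /heat/= mulrA; congr (_ * _ * _).
    by rewrite sub0r gaussN subr0.
  by apply: eq_bigr => j _; rewrite mxE.
under eq_fun do rewrite -E.
apply: h.
- by apply: (measurableT_comp mf); exact: measurable_snd.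
- move=> z /=; apply: (le_trans (hL _ _)); rewrite /cnorm/= mulrDr.
  apply: (@le_trans _ _ (`|L| * \sum_j `|x 0 j - z.2 0 j|)).
    by rewrite ler_wpM2r ?ler_norm// sumr_ge0.
  rewrite -[leLHS]add0r lerD ?mulr_ge0// ler_wpM2l//.
  by apply: ler_sum => j _; rewrite !mxE.
Qed.

Let A_bound : exists C, forall n x, `|A n x| <= C * Jap x.
Proof.
have [mf [C C0 hC] _] := sf; have [C' C'0 hC'] := Phi_Jap (fun=> 0%N).
exists (C * C') => n x; rewrite AE normrM.
have /andP[c0 c1] := c01 n.
rewrite (ger0_norm c0) (le_trans (ler_piMl _ c1))//.
have [i1 i2] := int_Mehler_Phi (fun=> 0%N) x (q01 n).
have M0 t : 0 <= Mehler (q n) x (r t) by apply: prodr_ge0 => j _; exact/ltW/mker_gt0.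
apply: (@le_trans _ _ (C * Phi0 x)); last first.
  rewrite -mulrA ler_wpM2l//; apply: le_trans (hC' x); exact: ler_norm.
have -> : C * Phi0 x = \int[leb d]_t (C * (Mehler (q n) x (r t) * Phi0 (r t))).
  by rewrite intZ// i2 big1 ?expr0 ?mul1r.
apply: int_abs_le.
- exact: (L1_meas (mehler_op_series (q01 n) x).1).
- exact: L1Z.
- by move=> t; rewrite normrM (ger0_norm (M0 t)) mulrCA ler_wpM2l.
Qed.

(** This takes the place of completeness. The integral of [A n] against [w] tends to that of [f],
    but it also equals [c n * q n ^+ k] times the integral of [Proj k f] against [w], and this
    factor tends to 1. *)
Lemma proj_orthogonal : \int[leb d]_t ((f (r t) - Proj k f (r t)) * w (r t)) = 0.
Proof.
have [C hC] := A_bound; have [C' C'0 hC'] := slice_Jap sf; have [mf _ _] := sf.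
have mA n : measurable_fun setT (A n \o r).
  apply: (@measurable_fun_cvg _ _ _ _ (fun N t => c n * \sum_(0 <= j < N) q n ^+ j * Proj j f (r t))).
  - move=> N; apply: measurable_funM; first exact: measurable_cst.
    apply: measurable_sum => j; apply: measurable_funM; first exact: measurable_cst.
    exact: (smooth_meas (smooth_Proj j sf)).
  - move=> t _; rewrite /comp AE; apply: cvgM; first exact: cvg_cst.
    by case: (mehler_op_series (q01 n) (r t)).
have [||||i1 c1] := @dominated_convergence_L1 _ _ _ (leb d) (fun n t => A n (r t) * w (r t))
  (fun t => f (r t) * w (r t)) (fun t => C * (`|w (r t)| * Jap (r t))) _ _ _ _.
- by move=> n; apply: measurable_funM => //; exact: mA.
- by move=> t; apply: cvgM; [exact: A_cvg|exact: cvg_cst].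
- by apply: L1Z; exact: iwJ.
- by move=> n t; rewrite normrM mulrC mulrCA ler_wpM2l.
have i2 := L1_Proj_mul k.
have E n : \int[leb d]_t (A n (r t) * w (r t)) =
    c n * q n ^+ k * \int[leb d]_t (Proj k f (r t) * w (r t)).
  have [i3 i4] := int_mehler_op_mul (q01 n); rewrite -mulrA -i4 -intZ//.
  by apply: int_ext => t; rewrite AE mulrA.
have hX (u : nat -> R) m : u @ \oo --> (1 : R) -> (fun n => u n ^+ m) @ \oo --> (1 : R).
  by move=> hu; have := cvg_comp _ _ hu (@exprn_continuous R m 1); rewrite expr1n.
have c2 : (fun n => c n * q n ^+ k * \int[leb d]_t (Proj k f (r t) * w (r t))) @ \oo -->
    1 * 1 * \int[leb d]_t (Proj k f (r t) * w (r t)).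
  apply: cvgM; last exact: cvg_cst.
  by apply: cvgM; apply: hX; exact: tn_expR_cvg.
move: c1; under eq_fun do rewrite E; move=> c1.
have := cvg_unique _ c1 c2 => /(_ (@norm_hausdorff _ _)); rewrite !mul1r => h.
rewrite (int_ext _ (fun t => mulrBl _ _ _)) intB// h subrr//.
Qed.

End against_eigenfunction.

End real_projection.

Section spectral_projection.
Context {R : realType} {d : nat}.
Notation lam := (@lebesgue_measure R).
Notation MR := (measurableTypeR R).
Implicit Types (x y : 'rV[R]_d).
Let r (t : d.-tuple MR) : 'rV[R]_d := row_of_tuple t.
Local Notation re u := (fun x => complex.Re (u x)).
Local Notation im u := (fun x => complex.Im (u x)).

Lemma int_bx (e m : R) : 0 < e -> L1 lam (fun s : R => bx e (s - m)) /\
  \int[lam]_s bx e (s - m) = 2 * e.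
Proof.
move=> e0; have sh := mpres_shift (- m); split; first exact: (mpres_L1 sh (L1_bx e)).
rewrite (mpres_int sh (L1_meas (L1_bx e))) /Rintegral integral_indic// setIT.
have h : lebesgue_measure (`[- e, e]%classic : set R) = (2 * e)%:E.
  by rewrite lebesgue_measure_itv/= lte_fin gtrN// -EFinD; congr EFin; ring.
exact: (congr1 fine h).
Qed.

Lemma continuous_int_eq0 (F : 'rV[R]_d -> R) : continuous F -> (forall x, 0 <= F x) ->
  L1 (leb d) (F \o r) -> \int[leb d]_t F (r t) = 0 -> forall x, F x = 0.
Proof.
move=> cF F0 iF intF x; apply/eqP; rewrite eq_le F0 andbT leNgt; apply/negP => Fx.
have /cvgrPdist_lt/(_ (F x / 2)) := cF x.
rewrite divr_gt0// => /(_ isT)/nbhs_ballP[e/= e0 he].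
have e20 : 0 < e / 2 by rewrite divr_gt0.
have [i1 i2] := prod_coords (fun j : 'I_d => (int_bx (x 0 j) e20).1).
have h t : F x / 2 * \prod_(j < d) bx (e / 2) (tnth t j - x 0 j) <= F (r t).
  have [inb|/existsP[j]] := boolP [forall j, `|tnth t j - x 0 j| <= e / 2]; last first.
    rewrite -ltNge => jt; rewrite (bigD1 j)//= /bx indicE memNset ?mul0r ?mulr0//=.
    by apply/negP; rewrite in_itv/= -ler_norml -ltNge.
  rewrite big1 ?mulr1; last by move=> j _; apply: bx1; exact: (forallP inb).
  have : ball x e (r t).
    rewrite -ball_normE /ball_/= (@le_lt_trans _ _ (e / 2))//; last first.
      by rewrite ltr_pdivrMr// ltr_pMr// ltr1n.
    apply: norm_le_coord; first exact: ltW.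
    by move=> j; rewrite !mxE distrC; exact: (forallP inb).
  move/he => /=; rewrite ltr_norml => /andP[_]; lra.
have := int_le (L1Z (F x / 2) i1) iF h.
rewrite [X in _ <= X]intF intZ// i2 leNgt => /negP; apply; apply: mulr_gt0; first exact: divr_gt0.
apply: prodr_gt0 => j _; have [_ ->] := int_bx (x 0 j) e20.
by rewrite mulr_gt0.
Qed.

Lemma cmodE (z : R[i]) : cmod z = Num.sqrt (complex.Re z ^+ 2 + complex.Im z ^+ 2).
Proof. by rewrite /cmod normc_def. Qed.

Lemma L2P (u : 'rV[R]_d -> R[i]) : measurable_fun setT (re u \o r) -> measurable_fun setT (im u \o r) ->
  L2 u <-> L1 (leb d) (fun t => complex.Re (u (r t)) ^+ 2 + complex.Im (u (r t)) ^+ 2).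
Proof.
move=> m1 m2; pose G t := complex.Re (u (r t)) ^+ 2 + complex.Im (u (r t)) ^+ 2.
have G0 t : 0 <= G t by rewrite addr_ge0 ?sqr_ge0.
have mG : measurable_fun setT G.
  by apply: measurable_funD; exact: measurable_funX.
have E t : (`|(cmod (u (row_of_tuple t)))%:E| `^ 2 = `|(G t)%:E|)%E.
  rewrite cmodE abse_EFin ger0_norm ?sqrtr_ge0// poweR_EFin powR_mulrn ?sqrtr_ge0//.
  by rewrite sqr_sqrtr ?G0// abse_EFin ger0_norm.
have N2 : (Lnorm (leb d) 2%:E (fun t => (cmod (u (row_of_tuple t)))%:E) `^ 2 =
    \int[leb d]_t `|(G t)%:E|)%E.
  by rewrite poweR_Lnorm//; apply: eq_integral => t _; exact: E.
split=> [h|/integrableP[_ h]].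
  by apply: L1_ltoo => //; rewrite -N2 poweR_lty.
rewrite /L2 unlock; apply: poweR_lty.
by under eq_integral do rewrite E.
Qed.

Lemma L1_sq_split (f g : d.-tuple MR -> R) : measurable_fun setT f -> measurable_fun setT g ->
  L1 (leb d) (fun t => f t ^+ 2 + g t ^+ 2) ->
  L1 (leb d) (fun t => f t ^+ 2) /\ L1 (leb d) (fun t => g t ^+ 2).
Proof.
move=> mf mg i; split; apply: (L1_le _ i); try exact: measurable_funX.
  by move=> t; rewrite ger0_norm ?sqr_ge0// lerDl sqr_ge0.
by move=> t; rewrite ger0_norm ?sqr_ge0// lerDr sqr_ge0.
Qed.

Lemma L1_mul_sq (f g : d.-tuple MR -> R) : measurable_fun setT f -> measurable_fun setT g ->
  L1 (leb d) (fun t => f t ^+ 2) -> L1 (leb d) (fun t => g t ^+ 2) ->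
  L1 (leb d) (fun t => f t * g t).
Proof.
move=> mf mg i1 i2; apply: (L1_le _ (L1D i1 i2)); first exact: measurable_funM.
move=> t; rewrite normrM -[f t ^+ 2]real_normK ?num_real// -[g t ^+ 2]real_normK ?num_real//.
have := sqr_ge0 (`|f t| - `|g t|); have := sqr_ge0 `|f t|; have := sqr_ge0 `|g t|.
set a := `|f t|; set b := `|g t|; nra.
Qed.

Lemma complex_sum I (s : seq I) (f g : I -> R) :
  \sum_(i <- s) (f i +i* g i)%C = ((\sum_(i <- s) f i) +i* (\sum_(i <- s) g i))%C.
Proof.
elim: s => [|i s IH]; first by rewrite !big_nil.
by rewrite !big_cons IH.
Qed.

Lemma hermite_opP (u : 'rV[R]_d -> R[i]) x (n : nat) :
  hermite_op u x = n%:R * u x <->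
  \sum_j 'D_(delta_mx 0 j) ('D_(delta_mx 0 j) (re u)) x = (sqnorm x - n%:R) * complex.Re (u x) /\
  \sum_j 'D_(delta_mx 0 j) ('D_(delta_mx 0 j) (im u)) x = (sqnorm x - n%:R) * complex.Im (u x).
Proof.
have nE : n%:R = (n%:R : R)%:C%C :> R[i].
  exact: (esym (rmorph_nat (real_complex R) n)).
have gen (A B s m a b : R) : (- (A +i* B) + s%:C * (a +i* b) = m%:C * (a +i* b))%C <->
    A = (s - m) * a /\ B = (s - m) * b.
  split.
    move=> /eqP; rewrite eq_complex /= !mul0r !subr0 !addr0 => /andP[/eqP h1 /eqP h2].
    by split; lra.
  move=> [-> ->]; apply/eqP; rewrite eq_complex /= !mul0r !subr0 !addr0; apply/andP.
  by split; apply/eqP; ring.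
have E : (complex.Re (u x) +i* complex.Im (u x))%C = u x by case: (u x).
rewrite /hermite_op /laplacian complex_sum nE -{1 2}E.
exact: gen.
Qed.

Lemma inner_eq0P (g u : 'rV[R]_d -> R[i]) :
  L1 (leb d) (fun t => complex.Re (g (r t)) * complex.Re (u (r t))) ->
  L1 (leb d) (fun t => complex.Im (g (r t)) * complex.Im (u (r t))) ->
  L1 (leb d) (fun t => complex.Im (g (r t)) * complex.Re (u (r t))) ->
  L1 (leb d) (fun t => complex.Re (g (r t)) * complex.Im (u (r t))) ->
  inner g u = ((\int[leb d]_t (complex.Re (g (r t)) * complex.Re (u (r t))) +
                \int[leb d]_t (complex.Im (g (r t)) * complex.Im (u (r t)))) +i*
               (\int[leb d]_t (complex.Im (g (r t)) * complex.Re (u (r t))) -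
                \int[leb d]_t (complex.Re (g (r t)) * complex.Im (u (r t)))))%C.
Proof.
move=> i1 i2 i3 i4; rewrite /inner /cintegral -intD// -intB//.
congr (_ +i* _)%C; apply: int_ext => t; rewrite -/(r t).
  by case: (g (r t)) (u (r t)) => [a b] [a' b'] /=; ring.
by case: (g (r t)) (u (r t)) => [a b] [a' b'] /=; ring.
Qed.

Variables (k : nat) (g : 'rV[R]_d -> R[i]).
Hypotheses (s1 : slice (re g)) (s2 : slice (im g)).

Definition cProj x : R[i] := (Proj k (re g) x +i* Proj k (im g) x)%C.

Lemma slice_sq f : @slice R d f -> L1 (leb d) (fun t => f (r t) ^+ 2).
Proof.
move=> sf; have [m _ _] := sf; have [C C0 hC] := slice_Jap sf.
apply: (L1_le _ (L1Z (C ^+ 2) (@L1_Jap R d))); first exact: measurable_funX.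
move=> t; rewrite ger0_norm ?sqr_ge0// -[leLHS]real_normK ?num_real//.
apply: (@le_trans _ _ ((C * Jap (r t)) ^+ 2)).
  by rewrite ler_pXn2r ?nnegrE ?mulr_ge0 ?Jap_ge0.
rewrite exprMn ler_wpM2l ?sqr_ge0// expr2 ler_piMr ?Jap_ge0// Jap_le1//.
Qed.

Lemma Proj_sq f : @slice R d f -> L1 (leb d) (fun t => Proj k f (r t) ^+ 2).
Proof.
move=> sf; have m := smooth_meas (smooth_Proj k sf).
pose C := KB d k * \int[leb d]_t `|f (r t)|.
have C0 : 0 <= C by rewrite mulr_ge0 ?KB_ge0// Rintegral_ge0.
apply: (L1_le _ (L1Z (C ^+ 2) (@L1_Jap R d))); first exact: measurable_funX.
move=> t; rewrite ger0_norm ?sqr_ge0// -[leLHS]real_normK ?num_real//.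
have CJ : 0 <= C * Jap (r t) := mulr_ge0 C0 (Jap_ge0 _).
apply: (@le_trans _ _ ((C * Jap (r t)) ^+ 2)).
  rewrite ler_pXn2r ?nnegrE//.
  by rewrite /C mulrAC; exact: Proj_bound.
rewrite exprMn ler_wpM2l ?sqr_ge0// expr2 ler_piMr ?Jap_ge0// Jap_le1//.
Qed.

Lemma eigenspaceP (u : 'rV[R]_d -> R[i]) : eigenspace_hermite k u ->
  [/\ smooth (re u), smooth (im u), L1 (leb d) (fun t => complex.Re (u (r t)) ^+ 2),
      L1 (leb d) (fun t => complex.Im (u (r t)) ^+ 2) &
  forall x, \sum_j 'D_(delta_mx 0 j) ('D_(delta_mx 0 j) (re u)) x = (sqnorm x - (2 * k + d)%:R) * complex.Re (u x) /\
  \sum_j 'D_(delta_mx 0 j) ('D_(delta_mx 0 j) (im u)) x = (sqnorm x - (2 * k + d)%:R) * complex.Im (u x)].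
Proof.
move=> [[c1 c2] l2 he].
have [i1 i2] := L1_sq_split (smooth_meas c1) (smooth_meas c2) ((L2P (smooth_meas c1) (smooth_meas c2)).1 l2).
by split => // x; apply/hermite_opP; exact: he.
Qed.

Lemma cProj_eigenspace : eigenspace_hermite k cProj.
Proof.
have c1 := smooth_Proj k s1; have c2 := smooth_Proj k s2.
split; first exact: (conj c1 c2).
  by apply/(L2P (u := cProj) (smooth_meas c1) (smooth_meas c2)); apply: L1D; exact: Proj_sq.
by move=> x; apply/hermite_opP; split; exact: Proj_eigen.
Qed.

Lemma cProj_orthogonal u : eigenspace_hermite k u -> inner (fun x => g x - cProj x) u = 0.
Proof.
move=> /eigenspaceP[u1 u2 i1 i2 he].
have [m1 m2] := (smooth_meas u1, smooth_meas u2).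
have I f w : slice f -> smooth w -> L1 (leb d) (fun t => w (r t) ^+ 2) ->
    L1 (leb d) (fun t => (f (r t) - Proj k f (r t)) * w (r t)).
  move=> sf sw iw; have [mf _ _] := sf; have mP := smooth_meas (smooth_Proj k sf).
  apply: L1_ext (L1B (L1_mul_sq mf (smooth_meas sw) (slice_sq sf) iw)
    (L1_mul_sq mP (smooth_meas sw) (Proj_sq sf) iw)) => t.
  by rewrite mulrBl.
have o f w : slice f -> smooth w -> L1 (leb d) (fun t => w (r t) ^+ 2) ->
    (forall x, \sum_j 'D_(delta_mx 0 j) ('D_(delta_mx 0 j) w) x = (sqnorm x - (2 * k + d)%:R) * w x) ->
    \int[leb d]_t ((f (r t) - Proj k f (r t)) * w (r t)) = 0 by exact: proj_orthogonal.
have e1 x := (he x).1; have e2 x := (he x).2.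
have Re_sub t : complex.Re (g (r t) - cProj (r t)) = complex.Re (g (r t)) - Proj k (re g) (r t).
  by case: (g (r t)).
have Im_sub t : complex.Im (g (r t) - cProj (r t)) = complex.Im (g (r t)) - Proj k (im g) (r t).
  by case: (g (r t)).
have ER w t : complex.Re (g (r t) - cProj (r t)) * w (r t) = (complex.Re (g (r t)) - Proj k (re g) (r t)) * w (r t).
  by rewrite Re_sub.
have EI w t : complex.Im (g (r t) - cProj (r t)) * w (r t) = (complex.Im (g (r t)) - Proj k (im g) (r t)) * w (r t).
  by rewrite Im_sub.
rewrite inner_eq0P.
- rewrite (int_ext _ (ER (re u))) (int_ext _ (EI (im u))) (int_ext _ (EI (re u))) (int_ext _ (ER (im u))).
  rewrite (o _ _ s1 u1 i1 e1) (o _ _ s2 u2 i2 e2) (o _ _ s2 u1 i1 e1) (o _ _ s1 u2 i2 e2).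
  by rewrite addr0 subr0.
- by apply: L1_ext (I _ _ s1 u1 i1) => t; rewrite (ER (re u)).
- by apply: L1_ext (I _ _ s2 u2 i2) => t; rewrite (EI (im u)).
- by apply: L1_ext (I _ _ s2 u1 i1) => t; rewrite (EI (re u)).
- by apply: L1_ext (I _ _ s1 u2 i2) => t; rewrite (ER (im u)).
Qed.

(** If [h] is another candidate, the orthogonality of [g - h] and of [g - cProj] to both [h] and
    [cProj] gives four relations, whose alternating sum is the integral of |h - cProj|^2. It
    vanishes, and continuity of the eigenfunctions turns this into equality at every point. *)
Lemma spectral_projE : spectral_proj k g = cProj.
Proof.
apply: xget_unique; first by split; [exact: cProj_eigenspace|exact: cProj_orthogonal].
move=> h [hE ho].
have PE := cProj_eigenspace.
have [h1 h2 ih1 ih2 _] := eigenspaceP hE.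
have [p1 p2 ip1 ip2 _] := eigenspaceP PE.
have ig1 := slice_sq s1; have ig2 := slice_sq s2.
have [mg1 _ _] := s1; have [mg2 _ _] := s2.
have [[mh1 mh2] [mp1 mp2]] := ((smooth_meas h1, smooth_meas h2), (smooth_meas p1, smooth_meas p2)).
have Re_sub (a b : 'rV[R]_d -> R[i]) x : complex.Re (a x - b x) = complex.Re (a x) - complex.Re (b x).
  by case: (a x) (b x) => ? ? [].
have Im_sub (a b : 'rV[R]_d -> R[i]) x : complex.Im (a x - b x) = complex.Im (a x) - complex.Im (b x).
  by case: (a x) (b x) => ? ? [].
have key (a b : 'rV[R]_d -> R[i]) : measurable_fun setT (re a \o r) -> measurable_fun setT (im a \o r) ->
    measurable_fun setT (re b \o r) -> measurable_fun setT (im b \o r) ->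
    L1 (leb d) (fun t => complex.Re (a (r t)) ^+ 2) -> L1 (leb d) (fun t => complex.Im (a (r t)) ^+ 2) ->
    L1 (leb d) (fun t => complex.Re (b (r t)) ^+ 2) -> L1 (leb d) (fun t => complex.Im (b (r t)) ^+ 2) ->
    inner (fun x => g x - a x) b = 0 ->
    L1 (leb d) (fun t => (complex.Re (g (r t)) - complex.Re (a (r t))) * complex.Re (b (r t)) +
      (complex.Im (g (r t)) - complex.Im (a (r t))) * complex.Im (b (r t))) /\
    \int[leb d]_t ((complex.Re (g (r t)) - complex.Re (a (r t))) * complex.Re (b (r t)) +
      (complex.Im (g (r t)) - complex.Im (a (r t))) * complex.Im (b (r t))) = 0.
  move=> ma1 ma2 mb1 mb2 ia1 ia2 ib1 ib2.
  have M (f1 f2 f3 : d.-tuple MR -> R) : measurable_fun setT f1 -> measurable_fun setT f2 ->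
      measurable_fun setT f3 -> L1 (leb d) (fun t => f1 t ^+ 2) -> L1 (leb d) (fun t => f2 t ^+ 2) ->
      L1 (leb d) (fun t => f3 t ^+ 2) -> L1 (leb d) (fun t => (f1 t - f2 t) * f3 t).
    move=> m1 m2 m3 j1 j2 j3.
    by apply: L1_ext (L1B (L1_mul_sq m1 m3 j1 j3) (L1_mul_sq m2 m3 j2 j3)) => t; rewrite mulrBl.
  have j1 := M _ _ _ mg1 ma1 mb1 ig1 ia1 ib1; have j2 := M _ _ _ mg2 ma2 mb2 ig2 ia2 ib2.
  have j3 := M _ _ _ mg2 ma2 mb1 ig2 ia2 ib1; have j4 := M _ _ _ mg1 ma1 mb2 ig1 ia1 ib2.
  have ER (w : 'rV[R]_d -> R) t : complex.Re (g (r t) - a (r t)) * w (r t) =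
      (complex.Re (g (r t)) - complex.Re (a (r t))) * w (r t) by rewrite Re_sub.
  have EI (w : 'rV[R]_d -> R) t : complex.Im (g (r t) - a (r t)) * w (r t) =
      (complex.Im (g (r t)) - complex.Im (a (r t))) * w (r t) by rewrite Im_sub.
  rewrite inner_eq0P.
  - move=> /(congr1 (@complex.Re R)) /= E0; split; first exact: L1D.
    rewrite intD//; apply: etrans E0; congr (_ + _); apply: int_ext => t.
      by rewrite (ER (re b)).
    by rewrite (EI (im b)).
  - by apply: L1_ext j1 => t; rewrite (ER (re b)).
  - by apply: L1_ext j2 => t; rewrite (EI (im b)).
  - by apply: L1_ext j3 => t; rewrite (EI (re b)).
  - by apply: L1_ext j4 => t; rewrite (ER (im b)).
have [j1 e1] := key _ _ mp1 mp2 mh1 mh2 ip1 ip2 ih1 ih2 (cProj_orthogonal hE).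
have [j2 e2] := key _ _ mp1 mp2 mp1 mp2 ip1 ip2 ip1 ip2 (cProj_orthogonal PE).
have [j3 e3] := key _ _ mh1 mh2 mh1 mh2 ih1 ih2 ih1 ih2 (ho _ hE).
have [j4 e4] := key _ _ mh1 mh2 mp1 mp2 ih1 ih2 ip1 ip2 (ho _ PE).
pose F x := (complex.Re (h x) - complex.Re (cProj x)) ^+ 2 + (complex.Im (h x) - complex.Im (cProj x)) ^+ 2.
have jF := L1B (L1B j1 j2) (L1B j3 j4).
have FE t : F (r t) = _ := erefl.
have iF : L1 (leb d) (F \o r) by apply: L1_ext jF => t; rewrite /F /comp; ring.
have F0 : \int[leb d]_t F (r t) = 0.
  transitivity (0 - 0 - (0 - 0) : R); last by rewrite !subr0.
  rewrite -{1}e1 -{1}e2 -{1}e3 -e4 -!intB//; [|exact: L1B..].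
  by apply: int_ext => t; rewrite /F; ring.
have cF : continuous F.
  have [[ch1 _] [ch2 _]] := (h1 [::], h2 [::]).
  have [[cp1 _] [cp2 _]] := (p1 [::], p2 [::]).
  exact (contD (contX (n := 2) (contB ch1 cp1)) (contX (n := 2) (contB ch2 cp2))).
have Fge0 x : 0 <= F x by rewrite addr_ge0 ?sqr_ge0.
apply/funext => x; have := continuous_int_eq0 cF Fge0 iF F0 x.
move=> /eqP; rewrite paddr_eq0 ?sqr_ge0// !sqrf_eq0 !subr_eq0 => /andP[/eqP a /eqP b].
by move: a b; case: (h x) (cProj x) => ? ? [? ?] /= -> ->.
Qed.

End spectral_projection.

(** * Fourier transform of the Gaussian *)

Section gaussian_fourier.
Context {R : realType}.
Notation lam := (@lebesgue_measure R).
Implicit Types (t y tau : R).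

Lemma gauss_jap t : 0 < t -> exists2 C, 0 <= C & forall y, gauss t y <= C * jap y.
Proof.
move=> t0; have sp : 0 < Num.sqrt pi :> R by rewrite sqrtr_gt0 pi_gt0.
have c0 : 0 <= (Num.sqrt pi * t)^-1 by rewrite invr_ge0 mulr_ge0 ?(ltW sp) ?(ltW t0).
exists ((Num.sqrt pi * t)^-1 * (1 + t ^+ 2)); first by rewrite mulr_ge0// addr_ge0// sqr_ge0.
move=> y; rewrite gaussE -mulrA ler_wpM2l//; apply: jap_le.
rewrite mulNr expRN mulrC ler_pdivrMr ?expR_gt0//.
apply: (@le_trans _ _ ((1 + t ^+ 2) * (1 + y ^+ 2 / t ^+ 2))); last first.
  by rewrite ler_wpM2l ?expR_ge1Dx// addr_ge0// sqr_ge0.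
have -> : (1 + t ^+ 2) * (1 + y ^+ 2 / t ^+ 2) = 1 + y ^+ 2 + (t ^+ 2 + y ^+ 2 / t ^+ 2).
  by field; rewrite gt_eqF.
by rewrite lerDl addr_ge0 ?divr_ge0 ?sqr_ge0.
Qed.

Lemma gauss_moment_jap t : 0 < t -> exists2 C, 0 <= C & forall y, `|y| * gauss t y <= C * jap y.
Proof.
move=> t0; have st0 : 0 < Num.sqrt 2 * t by rewrite mulr_gt0// sqrtr_gt0.
have [C C0 hC] := gauss_jap st0.
exists (Num.sqrt 2 * t * C); first by rewrite mulr_ge0// ltW.
move=> y; apply: (le_trans (gauss_moment y t0)).
by rewrite -[leRHS]mulrA ler_wpM2l// ltW.
Qed.

Lemma is_derive_gauss t y : 0 < t -> is_derive y 1 (gauss t) (- (2 / t ^+ 2) * (y * gauss t y)).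
Proof.
move=> t0; rewrite (_ : gauss t = fun x => (Num.sqrt pi * t)^-1 * expR (- t ^- 2 * (x * x))); last first.
  by apply/funext => x; rewrite gaussE; congr (_ * expR _); rewrite mulNr mulrC mulNr expr2.
have i := is_derive_id y (1 : R).
have h := is_derive_chain (is_derive_expR _) (is_deriveZr (- t ^- 2) (is_deriveMr i i)).
by apply: (is_derive_eq (is_deriveZr (Num.sqrt pi * t)^-1 h)); ring.
Qed.

Let phi t tau := \int[lam]_y (gauss t y * cos (y * tau)).

Lemma L1_gauss_mul t (f : R -> R) : 0 < t -> measurable_fun [set: R] f -> (forall y, `|f y| <= 1) ->
  L1 lam (fun y => gauss t y * f y).
Proof.
move=> t0 mf hf; have [i _] := int_gauss (0 : R) t0.
apply: (L1_le _ i); first by apply: measurable_funM => //; exact: measurable_gauss.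
by move=> y; rewrite normrM subr0 (ger0_norm (gauss_ge0 _ t0)) ler_piMr ?gauss_ge0.
Qed.

Lemma measurable_cos_lin tau b : measurable_fun [set: R] (fun y : R => cos (y * tau + b)).
Proof.
apply: continuous_measurable_fun; apply: cont_comp; first exact: continuous_cos.
exact (contD (contM (@cont_id R) (@cont_cst R R tau)) (@cont_cst R R b)).
Qed.

Lemma measurable_sin_lin tau : measurable_fun [set: R] (fun y : R => sin (y * tau)).
Proof.
apply: continuous_measurable_fun; apply: cont_comp; first exact: continuous_sin.
exact (contM (@cont_id R) (@cont_cst R R tau)).
Qed.

Lemma is_derive_sin_lin tau y : is_derive y 1 (fun y => sin (y * tau)) (tau * cos (y * tau)).
Proof.
have h := is_derive_chain (is_derive_sin _) (is_deriveMr (is_derive_id y (1 : R)) (is_derive_cstr y (1 : R) tau)).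
by apply: (is_derive_eq h); ring.
Qed.

Lemma is_derive_cos_lin tau y : is_derive tau 1 (fun tau => cos (y * tau)) (- (y * sin (y * tau))).
Proof.
have h := is_derive_chain (is_derive_cos _) (is_deriveZr y (is_derive_id tau (1 : R))).
by apply: (is_derive_eq h); ring.
Qed.

Let by_parts t tau : 0 < t ->
  L1 lam (fun y => y * gauss t y * sin (y * tau)) /\
  \int[lam]_y (y * gauss t y * sin (y * tau)) = t ^+ 2 / 2 * tau * phi t tau.
Proof.
move=> t0; have [C C0 hC] := gauss_jap t0; have [C' C'0 hC'] := gauss_moment_jap t0.
have cosm : measurable_fun [set: R] (fun y : R => cos (y * tau)).
  by have := measurable_cos_lin tau 0; under eq_fun do rewrite addr0.
have i1 := L1_gauss_mul t0 cosm (fun y => cos_max _).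
have i2 : L1 lam (fun y => y * gauss t y * sin (y * tau)).
  apply: (L1_le _ (L1Z C' (@L1_jap R))).
    apply: measurable_funM; last exact: measurable_sin_lin.
    by apply: measurable_funM; [exact: measurable_id|exact: measurable_gauss].
  move=> y; rewrite normrM (le_trans _ (hC' y))// normrM (ger0_norm (gauss_ge0 _ t0)).
  by rewrite ler_piMr ?sin_max// mulr_ge0 ?gauss_ge0.
split => //.
have [D0 D1] : 0 <= `|tau| * C /\ 0 <= 2 / t ^+ 2 * C'.
  by split; rewrite mulr_ge0 ?divr_ge0 ?sqr_ge0.
have H1 : forall x : R, is_derive x 1 (fun y => gauss t y * sin (y * tau))
    (- (2 / t ^+ 2) * (x * gauss t x) * sin (x * tau) + gauss t x * (tau * cos (x * tau))).
  by move=> x; exact: (is_deriveMr (is_derive_gauss x t0) (is_derive_sin_lin tau x)).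
have H2 : forall x : R, `|gauss t x * sin (x * tau)| <= (C + (2 / t ^+ 2 * C' + `|tau| * C)) * jap x.
  move=> x; rewrite normrM (ger0_norm (gauss_ge0 _ t0)) mulrDl.
  apply: (@le_trans _ _ (C * jap x)); last by rewrite lerDl mulr_ge0 ?addr_ge0 ?jap_ge0.
  by rewrite (le_trans _ (hC x))// ler_piMr ?sin_max// gauss_ge0.
have H3 : forall x : R, `|- (2 / t ^+ 2) * (x * gauss t x) * sin (x * tau) + gauss t x * (tau * cos (x * tau))| <=
    (C + (2 / t ^+ 2 * C' + `|tau| * C)) * jap x.
  move=> x; rewrite [leRHS]mulrDl (le_trans (ler_normD _ _))//.
  apply: (@le_trans _ _ ((2 / t ^+ 2 * C' + `|tau| * C) * jap x)); last by rewrite lerDr mulr_ge0 ?jap_ge0.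
  rewrite [leRHS]mulrDl lerD//.
    rewrite normrM normrM normrN (@ger0_norm _ (2 / t ^+ 2)) ?divr_ge0 ?sqr_ge0//.
    rewrite -mulrA -[leRHS]mulrA ler_wpM2l ?divr_ge0 ?sqr_ge0//.
    rewrite (le_trans _ (hC' x))// normrM (ger0_norm (gauss_ge0 _ t0)).
    by rewrite ler_piMr ?sin_max// mulr_ge0 ?gauss_ge0.
  rewrite mulrCA normrM -mulrA ler_wpM2l// (le_trans _ (hC x))//.
  by rewrite normrM (ger0_norm (gauss_ge0 _ t0)) ler_piMr ?cos_max// gauss_ge0.
have E y : - (2 / t ^+ 2) * (y * gauss t y) * sin (y * tau) + gauss t y * (tau * cos (y * tau)) =
    - (2 / t ^+ 2) * (y * gauss t y * sin (y * tau)) + tau * (gauss t y * cos (y * tau)) by ring.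
have := int_derive_line0 H1 H2 H3.
rewrite (int_ext lam E) intD; [|exact: L1Z|exact: L1Z].
rewrite !intZ// -/(phi t tau) => h.
have -> : \int[lam]_y (y * gauss t y * sin (y * tau)) =
    - (t ^+ 2 / 2) * (- (2 / t ^+ 2) * \int[lam]_y (y * gauss t y * sin (y * tau))).
  by field; rewrite gt_eqF.
have -> : - (2 / t ^+ 2) * \int[lam]_y (y * gauss t y * sin (y * tau)) = - (tau * phi t tau) by lra.
by ring.
Qed.

Let is_derive_phi t tau : 0 < t -> is_derive tau 1 (phi t) (- (t ^+ 2 / 2 * tau) * phi t tau).
Proof.
move=> t0; have [C' C'0 hC'] := gauss_moment_jap t0.
pose f (s y : R) := gauss t y * cos (y * s).
have df (s y : R) : is_derive s 1 (f ^~ y) (- (y * gauss t y * sin (y * s))).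
  apply: (is_derive_eq (is_deriveZr (gauss t y) (is_derive_cos_lin s y))); ring.
have d1E s y : partial1of2 f s y = - (y * gauss t y * sin (y * s)).
  by rewrite partial1of2E; have := df s y => h; rewrite derive_val.
have cosm s : measurable_fun [set: R] (fun y : R => cos (y * s)).
  by have := measurable_cos_lin s 0; under eq_fun do rewrite addr0.
have tI : (`]tau - 1, tau + 1[%classic : set R) tau by rewrite /= in_itv/= ltrBlDr ltrDl ltr01.
have A1 : forall s, (`]tau - 1, tau + 1[%classic : set R) s -> L1 lam (f s).
  by move=> s _; exact: (L1_gauss_mul t0 (cosm s) (fun y => cos_max _)).
have A2 : forall s y, (`]tau - 1, tau + 1[%classic : set R) s -> [set: R] y -> derivable (f ^~ y) s 1.
  by move=> s y _ _; have := df s y => h; exact: ex_derive.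
have A3 y : 0 <= C' * jap y by rewrite mulr_ge0 ?jap_ge0.
have A4 : forall s y, (`]tau - 1, tau + 1[%classic : set R) s -> [set: R] y -> `|partial1of2 f s y| <= C' * jap y.
  move=> s y _ _; rewrite d1E normrN normrM (le_trans _ (hC' y))// normrM (ger0_norm (gauss_ge0 _ t0)).
  by rewrite ler_piMr ?sin_max// mulr_ge0 ?gauss_ge0.
have D := @derivable_under_integral R _ _ lam f setT measurableT tau _ _ tI A1 A2 _ A3 (L1Z C' (@L1_jap R)) A4.
have E := @differentiation_under_integral R _ _ lam f setT measurableT tau _ _ tI A1 A2 _ A3 (L1Z C' (@L1_jap R)) A4.
have [i1 i2] := by_parts tau t0.
split; first exact: D.
rewrite -derive1E E (int_ext lam (d1E tau)) intN// i2; ring.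
Qed.

(** Differentiation under the integral and an integration by parts show that the transform solves
    phi' = - (t^2 / 2) tau phi; multiplied by the inverse exponential it has derivative 0. *)
Lemma gauss_fourier t tau : 0 < t ->
  \int[lam]_y (gauss t y * cos (y * tau)) = expR (- (t ^+ 2 / 4 * tau ^+ 2)).
Proof.
move=> t0; pose G s := phi t s * expR (t ^+ 2 / 4 * (s * s)).
have dG (s : R) : is_derive s 1 G 0.
  have i := is_derive_id s (1 : R).
  have h := is_derive_chain (is_derive_expR _) (is_deriveZr (t ^+ 2 / 4) (is_deriveMr i i)).
  have h2 := is_deriveMr (is_derive_phi s t0) h.
  by apply: (is_derive_eq h2); set A := phi t s; set B := expR _; field.
have GE : G tau = G 0.
  apply/eqP; rewrite -subr_eq0 -normr_le0 -[leRHS](mul0r `|tau|).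
  by apply: (mean_value_bound dG) => c _; rewrite normr0.
have G0 : G 0 = 1.
  rewrite /G !mulr0 expR0 mulr1 /phi; have [_ h] := int_gauss (0 : R) t0; rewrite -[RHS]h.
  by apply: int_ext => y; rewrite mulr0 cos0 mulr1 subr0.
rewrite -/(phi t tau) expRN -[LHS](mulfK (_ : expR (t ^+ 2 / 4 * tau ^+ 2) != 0)) ?gt_eqF ?expR_gt0//.
have -> : phi t tau * expR (t ^+ 2 / 4 * tau ^+ 2) = G tau by rewrite /G expr2.
by rewrite GE G0 div1r.
Qed.

Lemma gauss_fourier_shift t tau m b : 0 < t ->
  L1 lam (fun y => gauss t (m - y) * cos (y * tau + b)) /\
  \int[lam]_y (gauss t (m - y) * cos (y * tau + b)) = expR (- (t ^+ 2 / 4 * tau ^+ 2)) * cos (m * tau + b).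
Proof.
move=> t0.
pose F (y : R) := gauss t y * cos (y * tau + (m * tau + b)).
have iF : L1 lam F by apply: L1_gauss_mul => //; [exact: measurable_cos_lin|move=> y; exact: cos_max].
have FE y : F (y - m) = gauss t (m - y) * cos (y * tau + b).
  by rewrite /F -gaussN opprB; congr (_ * cos _); ring.
have sh := mpres_shift (- m).
have cosm : measurable_fun [set: R] (fun y : R => cos (y * tau)).
  by have := measurable_cos_lin tau 0; under eq_fun do rewrite addr0.
have i1 := L1_gauss_mul t0 cosm (fun y => cos_max _).
have i2 := L1_gauss_mul t0 (measurable_sin_lin tau) (fun y => sin_max _).
split; first by apply: L1_ext (mpres_L1 sh iF) => y; rewrite /comp FE.
rewrite -(int_ext lam FE) (mpres_int sh (L1_meas iF)).
have E y : F y = cos (m * tau + b) * (gauss t y * cos (y * tau)) - sin (m * tau + b) * (gauss t y * sin (y * tau)).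
  by rewrite /F cosD; ring.
rewrite (int_ext lam E) intB; [|exact: L1Z|exact: L1Z].
rewrite !intZ// gauss_fourier//.
have -> : \int[lam]_y (gauss t y * sin (y * tau)) = 0.
  have h := mpres_int (@mpres_opp R) (L1_meas i2).
  have E2 y : gauss t (- y) * sin (- y * tau) = - (gauss t y * sin (y * tau)).
    by rewrite gaussN mulNr sinN mulrN.
  by move: h; rewrite (int_ext lam E2) intN//; lra.
by rewrite mulr0 subr0 mulrC.
Qed.

End gaussian_fourier.

Section series_estimates.
Context {R : realType}.

Lemma sum_inv_sq_le n : \sum_(0 <= k < n) (k.+1%:R ^- 2 : R) <= 2 * (1 - n.+1%:R^-1).
Proof.
elim: n => [|n IH]; first by rewrite big_nil invr1 subrr mulr0.
rewrite big_nat_recr//=; apply: (le_trans (lerD IH (lexx _))).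
have gen (a : R) : 1 <= a -> 2 * (1 - a^-1) + a ^- 2 <= 2 * (1 - (a + 1)^-1).
  move=> a1; have a0 : 0 < a by exact: lt_le_trans a1.
  rewrite -subr_ge0.
  have -> : 2 * (1 - (a + 1)^-1) - (2 * (1 - a^-1) + a ^- 2) = (a - 1) / (a ^+ 2 * (a + 1)).
    by field; rewrite (gt_eqF a0) gt_eqF// addr_gt0.
  by rewrite divr_ge0 ?subr_ge0// mulr_ge0 ?sqr_ge0// addr_ge0// ltW.
by have := gen n.+1%:R; rewrite ler1n natr1; apply.
Qed.

Lemma cvg_series_inv_sq (C : R) : 0 <= C -> cvgn (series (fun k => C * k.+1%:R ^- 2)).
Proof.
move=> C0; apply: nondecreasing_is_cvgn.
  by apply/nondecreasing_seqP => n; rewrite seriesSr lerDl mulr_ge0// invr_ge0 sqr_ge0.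
exists (C * 2) => _ [n _ <-]; rewrite /series/= -mulr_sumr ler_wpM2l//.
by apply: (le_trans (sum_inv_sq_le n)); rewrite ler_piMr// lerBlDr lerDl invr_ge0.
Qed.

(** Dominated convergence for series: up to a fixed index the sums are finite and converge, beyond
    it they are below the tail of [b] uniformly in n. *)
Lemma tannery (u : nat -> nat -> R) (v b : nat -> R) : (forall n k, `|u n k| <= b k) ->
  cvgn (series b) -> (forall k, u ^~ k @ \oo --> v k) ->
  cvgn (series v) /\ (fun n => limn (series (u n))) @ \oo --> limn (series v).
Proof.
move=> ub cb uv.
have b0 k : 0 <= b k by exact: le_trans (ub 0 k).
have vb k : `|v k| <= b k.
  have c : (fun n => `|u n k|) @ \oo --> `|v k| by apply: cvg_norm.
  by apply: (ler_cvg_to c (cvg_cst (b k))); near=> n; exact: ub.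
have cv := series_dominated_cvg vb cb.
have cu n := series_dominated_cvg (ub n) cb.
split => //.
have tail (w : nat -> R) N : (forall k, `|w k| <= b k) ->
    `|limn (series w) - series w N| <= limn (series b) - series b N.
  move=> wb; have cw := series_dominated_cvg wb cb.
  have c1 : (fun n => `|series w n - series w N|) @ \oo --> `|limn (series w) - series w N|.
    by apply: cvg_norm; apply: cvgB => //; exact: cvg_cst.
  have c2 : (fun n => series b n - series b N) @ \oo --> limn (series b) - series b N.
    by apply: cvgB => //; exact: cvg_cst.
  apply: (ler_cvg_to c1 c2); near=> n.
  have Nn : (N <= n)%N by near: n; exact: nbhs_infty_ge.
  rewrite !sub_series_geq// (le_trans (ler_norm_sum _ _ _))//.
  by apply: ler_sum => k _; exact: wb.
apply/cvgrPdist_le => e e0.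
have e4 : 0 < e / 4 by rewrite divr_gt0.
have /cvgrPdist_le/(_ _ e4) := cb => -[N _ hN].
have {}hN := hN N (leqnn N).
have tN : limn (series b) - series b N <= e / 4 by rewrite (le_trans _ hN)// ler_norm.
have c : (fun n => series (u n) N) @ \oo --> series v N.
  rewrite /series/=; apply: cvg_big => [|k _]; [exact: add_continuous|exact: uv].
have e2 : 0 < e / 2 by rewrite divr_gt0.
move/cvgrPdist_le/(_ _ e2) : c; apply: filterS => n hn.
have h1 := tail v N vb; have h2 := tail (u n) N (ub n).
have -> : limn (series v) - limn (series (u n)) = (limn (series v) - series v N) +
  (series v N - series (u n) N) - (limn (series (u n)) - series (u n) N) by ring.
rewrite (le_trans (ler_normB _ _))//.
have := ler_normD (limn (series v) - series v N) (series v N - series (u n) N).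
move: h1 h2 hn tN; set A := `|_|; set B := `|_|; set D := `|_|; set E := `|_ + _|; lra.
Unshelve. all: by end_near. Qed.

End series_estimates.

(** * Partial derivatives and slices of test functions *)

Section linear_derivatives.
Context {R : realType} {V : normedModType R}.
Implicit Types (f : V -> R) (z v w : V).

Lemma mean_value_dir f z v K : (forall y, derivable f y v) ->
  (forall y, `|'D_v f y| <= K) -> `|f (z + v) - f z| <= K.
Proof.
move=> df hK.
have := @mean_value_bound R (fun s => f (z + s *: v)) (fun s => 'D_v f (z + s *: v)) K 1.
rewrite scale1r scale0r addr0 normr1 mulr1; apply => // c; exact: is_derive_line.
Qed.

(** Smoothness is stated through directional derivatives, so additivity in the direction has to be
    proved. The increment along [w] starts from a moving point, and the mean value theorem with the
    continuity of the derivative along [w] controls it. *)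
Lemma is_derive_addv f z v w : (forall y, derivable f y v) -> (forall y, derivable f y w) ->
  continuous ('D_w f) -> is_derive z (v + w) f ('D_v f z + 'D_w f z).
Proof.
move=> dv dw cw; set b := 'D_w f z.
have c1 : (fun h : R => h^-1 *: (f (h *: v + z) - f z)) @ (0 : R)^' --> 'D_v f z by exact: dv.
have c2 : (fun h : R => h^-1 *: (f (h *: (v + w) + z) - f (h *: v + z))) @ (0 : R)^' --> b.
  apply/cvgrPdist_le => e e0.
  have /cvgrPdist_le/(_ _ e0)/nbhs_ballP[r/= r0 hr] := cw z.
  have s0 : 0 < r / (`|v| + `|w| + 1) by rewrite divr_gt0// ltr_wpDl// addr_ge0.
  have vw0 : 0 < `|v| + `|w| + 1 by rewrite ltr_wpDl// addr_ge0.
  near=> h.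
  have h0 : h != 0 by near: h; exact: nbhs_dnbhs_neq.
  have hs : `|h| < r / (`|v| + `|w| + 1).
    near: h; apply: dnbhs0_lt; exact: s0.
  pose y := h *: v + z.
  have M : `|(f (y + h *: w) - h * b) - (f (y + 0 *: w) - 0 * b)| <= e * `|h|.
    apply: (@mean_value_bound R (fun s => f (y + s *: w) - s * b) (fun s => 'D_w f (y + s *: w) - b)).
      move=> c; have h1 := is_derive_line (dw (y + c *: w)).
      have h2 := is_deriveMr (is_derive_id c (1 : R)) (is_derive_cstr c (1 : R) b).
      by apply: (is_derive_eq (is_deriveBr h1 h2)); ring.
    move=> c ch; rewrite distrC; apply: hr.
    have -> : y + c *: w = z + (h *: v + c *: w) by rewrite /y addrAC addrC.
    rewrite -ball_normE /ball_/= opprD addrA subrr add0r.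
    rewrite normrN (le_lt_trans (ler_normD _ _))// !normrZ.
    apply: (@le_lt_trans _ _ (`|h| * (`|v| + `|w| + 1))); last by rewrite -ltr_pdivlMr.
    rewrite mulrDr mulr1 mulrDr -addrA lerD// -[leLHS]addr0 lerD// ler_wpM2r//.
  rewrite scale0r addr0 mul0r subr0 in M.
  have -> : b - h^-1 *: (f (h *: (v + w) + z) - f (h *: v + z)) =
      - (h^-1 * (f (y + h *: w) - h * b - f y)).
    have -> : h *: (v + w) + z = y + h *: w by rewrite /y scalerDr addrAC.
    by rewrite /GRing.scale/= -/y; field.
  rewrite normrN normrM normfV mulrC ler_pdivrMr ?normr_gt0//.
split.
  apply/cvg_ex; exists ('D_v f z + b).
  apply: cvg_trans (cvgD c1 c2); apply: near_eq_cvg; near=> h.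
  transitivity (h^-1 *: (f (h *: v + z) - f z) + h^-1 *: (f (h *: (v + w) + z) - f (h *: v + z))).
  by [].
by rewrite -scalerDr [X in _ *: X]addrC subrKA.
rewrite /derive; apply/cvg_lim => //.
apply: cvg_trans (cvgD c1 c2); apply: near_eq_cvg; near=> h.
transitivity (h^-1 *: (f (h *: v + z) - f z) + h^-1 *: (f (h *: (v + w) + z) - f (h *: v + z))).
  by [].
by rewrite -scalerDr [X in _ *: X]addrC subrKA.
Unshelve. all: by end_near. Qed.

Lemma is_derive_scalev f z v (c : R) : derivable f z v -> is_derive z (c *: v) f (c * 'D_v f z).
Proof.
move=> df; apply: is_derive_lineP.
have -> : (fun h : R => f (z + h *: (c *: v))) = (fun h : R => f (z + (c * h) *: v)).
  by apply/funext => h; rewrite scalerA [h * c]mulrC.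
rewrite mulrC.
have h1 := is_derive_line0 (derivableP df).
have h2 := is_deriveZr c (is_derive_id (0 : R) (1 : R)).
have := @is_derive1_comp R (fun h => f (z + h *: v)) (fun h => c * h) 0 ('D_v f z) (c * 1).
by rewrite mulr0 mulr1 => /(_ h1); apply; rewrite -[X in is_derive _ _ _ X]mulr1.
Qed.

Lemma smooth_derive_lin f (s : seq (R * V)) z : smooth f ->
  is_derive z (\sum_(i <- s) i.1 *: i.2) f (\sum_(i <- s) i.1 * 'D_i.2 f z).
Proof.
move=> sf; have [c0 d0] := sf [::].
elim: s => [|i s IH] in z *.
  rewrite !big_nil; apply: is_derive_lineP.
  by under eq_fun do rewrite scaler0 addr0; exact: is_derive_cst.
rewrite !big_cons; set w := \sum_(j <- s) _.
have ds (y : V) : is_derive y (i.1 *: i.2) f (i.1 * 'D_i.2 f y).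
  by apply: is_derive_scalev; exact: d0.
have -> : i.1 * 'D_i.2 f z = 'D_(i.1 *: i.2) f z by rewrite [RHS]derive_val.
have -> : \sum_(j <- s) j.1 * 'D_j.2 f z = 'D_w f z by have := IH z => h; rewrite [RHS]derive_val.
have d0' : forall z v, derivable f z v := d0.
apply: (is_derive_addv z (fun y => d0' y _) (fun y => d0' y w)).
by have [] := sf [:: w].
Qed.

End linear_derivatives.

Section smooth_partial.
Context {R : realType} {d : nat}.
Local Notation V := (R * 'rV[R]_d)%type.
Implicit Types (u : V -> R) (z w : V).

Definition e0 : V := (1, 0).
Definition ev (j : 'I_d) : V := (0, delta_mx 0 j).

Lemma vec_decomp w : w = \sum_(i <- (w.1, e0) :: [seq (w.2 0 j, ev j) | j <- index_enum 'I_d]) i.1 *: i.2.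
Proof.
rewrite big_cons big_map /=.
have -> : \sum_(j <- index_enum 'I_d) w.2 0 j *: ev j = (0, \sum_j w.2 0 j *: delta_mx 0 j).
  elim/big_rec2: _ => [//|j y1 y2 _ ->].
  by rewrite /ev; congr pair; rewrite /= ?scaler0 ?addr0.
have -> : \sum_j w.2 0 j *: delta_mx 0 j = w.2 by rewrite -row_sum_delta.
by case: w => a b; rewrite /e0; congr pair; rewrite /= ?addr0 ?scaler0 ?add0r// [_ *: _]mulr1.
Qed.

Lemma smooth_deriveE u z w : smooth u ->
  'D_w u z = w.1 * 'D_e0 u z + \sum_j w.2 0 j * 'D_(ev j) u z.
Proof.
move=> su; have := smooth_derive_lin ((w.1, e0) :: [seq (w.2 0 j, ev j) | j <- index_enum 'I_d]) z su.
by rewrite -vec_decomp big_cons big_map => h; rewrite derive_val.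
Qed.

Lemma bsupp_bounded u : continuous u -> bsupp u -> exists2 C, 0 <= C & forall z, `|u z| <= C.
Proof.
move=> cu [r hr]; have [_ _ H _] := @euclid_prod R d; have [C hC] := H u r cu.
exists `|C| => // z; have [zr|zr] := leP `|z| r; first by rewrite (le_trans (hC z zr))// ler_norm.
by rewrite hr// normr0.
Qed.

Lemma smooth_lipschitz u : smooth u -> bsupp u ->
  exists2 L, 0 <= L & forall z w, `|u (z + w) - u z| <= L * cnorm w.
Proof.
move=> su bu.
have hb v : exists2 C, 0 <= C & forall z, `|'D_v u z| <= C.
  by apply: bsupp_bounded; [have [] := su [:: v]|exact: bsupp_derive].
have [C0 C00 hC0] := hb e0.
have hb' (j : 'I_d) : exists C, 0 <= C /\ forall z, `|'D_(ev j) u z| <= C.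
  by have [C ? ?] := hb (ev j); exists C.
have [Cj hCj] := choice hb'.
have Cj0 : 0 <= \sum_j Cj j by apply: sumr_ge0 => j _; case: (hCj j).
exists (C0 + \sum_j Cj j); first exact: addr_ge0.
move=> z w; apply: mean_value_dir => y; first by have [_] := su [::]; apply.
rewrite (smooth_deriveE _ _ su) (le_trans (ler_normD _ _))// /cnorm mulrDr lerD//.
  by rewrite normrM mulrC ler_wpM2r// (le_trans (hC0 y))// lerDl.
rewrite (le_trans (ler_norm_sum _ _ _))// mulr_sumr; apply: ler_sum => j _.
rewrite normrM mulrC ler_wpM2r//; have [_ h] := hCj j; apply: (le_trans (h y)).
rewrite (bigD1 j)//= addrCA lerDl addr_ge0// sumr_ge0// => i _; by case: (hCj i).
Qed.

(** Partial Fourier transform in rho, in real form: the phases 0 and - pi / 2 give the cosine and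
    the sine transform. *)
Definition cost u s tau (x : 'rV[R]_d) := \int[@lebesgue_measure R]_q (cos (q * tau + s) * u (q, x)).

(** The ground state is bounded away from 0 on the ball that contains the support, so a constant
    bound becomes a bound by a multiple of it. *)
Lemma bump_bound u : smooth u -> bsupp u ->
  exists r, exists2 C, 0 <= C & forall q x, `|u (q, x)| <= C * Phi0 x * bx r q.
Proof.
move=> su bu; have [cu _] := su [::].
have [M M0 hM] := bsupp_bounded cu bu; have [r hr] := bu.
have cP : continuous (fun x : 'rV[R]_d => (Phi0 x)^-1).
  move=> x; apply: continuousV; first by rewrite gt_eqF// Phi0_gt0.
  by have [_ c _ _ _] := smooth_C2 0 (@smooth_Phi R d (fun=> 0%N)); exact: c.
have [K hK] := continuous_bounded_rV r cP.
exists r; exists (M * `|K|); first exact: mulr_ge0.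
move=> q x; have P0 := Phi0_gt0 x.
have [|qx] := leP `|(q, x)| r; last first.
  by rewrite hr// normr0 mulr_ge0 ?bx_ge0// mulr_ge0 ?(ltW P0)// mulr_ge0.
rewrite prod_normE ge_max /= => /andP[qr xr].
rewrite bx1// mulr1 (le_trans (hM _))// -mulrA ler_peMr//.
rewrite -ler_pdivrMr// div1r (le_trans _ (ler_norm K))// (le_trans _ (hK x xr))//.
exact: ler_norm.
Qed.

Lemma measurable_bump u : smooth u -> measurable_fun setT (u \o @iota R d).
Proof. by move=> su; have [c _] := su [::]; exact: measurable_continuous_prod. Qed.

Lemma slice_cost u s tau : smooth u -> bsupp u -> slice (cost u s tau).
Proof.
move=> su bu; have [r [C C0 hC]] := bump_bound su bu; have [L L0 hL] := smooth_lipschitz su bu.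
have ir : L1 (@lebesgue_measure R) (bx r) := L1_bx r.
have mu (x : 'rV[R]_d) : measurable_fun [set: R] (fun q => u (q, x)).
  apply: continuous_measurable_fun => q.
  have [cu _] := su [::].
  apply: (@continuous_comp _ _ _ (fun q => (q, x)) u); last exact: cu.
  exact: (cvg_pair cvg_id (cvg_cst _)).
have mc x : measurable_fun [set: R] (fun q => cos (q * tau + s) * u (q, x)).
  by apply: measurable_funM; [exact: measurable_cos_lin|exact: mu].
have I0 : 0 <= \int[@lebesgue_measure R]_q bx r q by apply: Rintegral_ge0 => q _; exact: bx_ge0.
have Lc x : L1 (@lebesgue_measure R) (fun q => cos (q * tau + s) * u (q, x)).
  apply: (@L1_le _ _ _ (@lebesgue_measure R) (fun q => cos (q * tau + s) * u (q, x)) _ (mc x) (L1Z (C * Phi0 x) ir)) => q.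
  by rewrite normrM (le_trans (ler_piMl _ (cos_max _)))// hC.
split.
- have m : measurable_fun setT (fun z : d.-tuple (measurableTypeR R) * measurableTypeR R =>
      cos (z.2 * tau + s) * u (z.2, row_of_tuple z.1)).
    apply: measurable_funM.
      by apply: (measurableT_comp (measurable_cos_lin tau s)); exact: measurable_snd.
    have h : measurable_fun setT ((u \o @iota R d) \o (fun z : d.-tuple (measurableTypeR R) * measurableTypeR R => (z.2, z.1))).
      apply: measurableT_comp; first exact: measurable_bump.
      by apply: measurable_fun_pair; [exact: measurable_snd|exact: measurable_fst].
    exact: h.
  exact: (@measurable_param_int _ _ _ _ _ (@lebesgue_measure R) _ m).
- exists (C * \int[@lebesgue_measure R]_q bx r q); first exact: mulr_ge0.
  move=> x; rewrite mulrAC -intZ//; apply: (@int_abs_le _ _ _ (@lebesgue_measure R) (fun q => cos (q * tau + s) * u (q, x)) _ (mc x) (L1Z _ ir)) => q.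
  by rewrite normrM (le_trans (ler_piMl _ (cos_max _)))// hC.
- have ir2 : L1 (@lebesgue_measure R) (bx r) := L1_bx r.
  exists (L * \int[@lebesgue_measure R]_q bx r q) => x y.
  rewrite /cost -intB// mulrAC -intZ//; apply: (@int_abs_le _ _ _ (@lebesgue_measure R) _ _ (measurable_funB (mc y) (mc x)) (L1Z _ ir)) => q /=; rewrite -mulrBr normrM (le_trans (ler_piMl _ (cos_max _)))//.
  have [qr|qr] := leP `|q| r; last first.
    have bq0 : bx r q = 0 by rewrite /bx indicE memNset//= in_itv/= -ler_norml; apply/negP; rewrite -ltNge.
    have := hC q x; have := hC q y; rewrite bq0 !mulr0 !normr_le0 => /eqP -> /eqP ->.
    by rewrite subrr.
  rewrite bx1// mulr1; have := hL (q, x) (0, y - x).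
  have -> : (q, x) + (0, y - x) = (q, y) by congr pair; rewrite /= ?addr0// addrC subrK.
  move/le_trans; apply; rewrite /cnorm/= normr0 add0r ler_wpM2l//.
  by apply: ler_sum => j _; rewrite !mxE distrC.
Qed.

End smooth_partial.

(** * Decay of the spectral coefficients *)

Section oscillator.
Context {R : realType} {d : nat}.
Local Notation V := (R * 'rV[R]_d)%type.
Local Notation mu := (@leb_prod R d).
Implicit Types (f u : V -> R) (z w : V).
Let emb := @euclid_prod R d.

Definition Hop f z := sqnorm z.2 * f z - ('D_e0 ('D_e0 f) z + \sum_j 'D_(ev j) ('D_(ev j) f) z).

Section bump_class.
Variable u : V -> R.
Hypotheses (su : smooth u) (bu : bsupp u).

Definition pcoords : set (V -> R) := [set l | exists j : 'I_d, l = fun z => z.2 0 j].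
Definition pbase : set (V -> R) := [set f | exists vs, f = iter_derive vs u].
(** Combinations of monomials in the x coordinates times iterated derivatives of [u]: stable under
    [Hop], whose potential has polynomial coefficients, and with bounded support. *)
Definition bump := cls pcoords pbase.

Let HL l : pcoords l -> continuous l /\ forall z v, is_derive z v l (l v).
Proof.
move=> [j ->]; split.
  move=> z; apply: (@continuous_comp _ _ _ (fun z : V => z.2) (fun x : 'rV[R]_d => x 0 j)).
    exact: cvg_snd.
  exact: continuous_coord.
move=> z v; apply: is_derive_lineP.
have -> : (fun h : R => (z + h *: v).2 0 j) = (fun h => z.2 0 j + v.2 0 j * h).
  by apply/funext => h; rewrite /= !mxE mulrC.
apply: (is_derive_eq (is_deriveDr (is_derive_cstr _ _ _) (is_deriveZr (v.2 0 j) (is_derive_id (0:R) (1:R))))).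
by rewrite add0r mulr1.
Qed.

Let HB f : pbase f -> continuous f /\ forall v, (forall z, derivable f z v) /\ bump ('D_v f).
Proof.
move=> [vs ->]; have [c dr] := su vs; split => // v; split; first by move=> z; exact: dr.
by apply: cls_base; exists (v :: vs).
Qed.

Lemma bump_smooth f : bump f -> smooth f.
Proof. exact: (cls_smooth HL HB). Qed.

Lemma bump_bsupp f : bump f -> bsupp f.
Proof.
elim=> {f} [f [vs ->]|l f _ _ IH|f g _ h1 _ h2|c f _ h].
- by elim: vs => [//|v vs IH] /=; exact: bsupp_derive.
- exact: bsuppMl.
- exact: bsuppD.
- exact: bsuppMl.
Qed.

Lemma bump_derive f v : bump f -> bump ('D_v f).
Proof. by move=> bf; have [_ h] := cls_props HL HB bf; case: (h v). Qed.

Lemma bump_u : bump u.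
Proof. by apply: cls_base; exists [::]. Qed.

Lemma bump_Hop f : bump f -> bump (Hop f).
Proof.
move=> bf; have b0 := bump_derive e0 (bump_derive e0 bf).
have b1 : bump (fun z => \sum_j 'D_(ev j) ('D_(ev j) f) z).
  by apply: (@cls_sum R V pcoords pbase _ _ _ _ f bf) => j _; exact: (bump_derive _ (bump_derive _ bf)).
have b2 : bump (fun z => \sum_(j < d) z.2 0 j * (z.2 0 j * f z)).
  apply: (@cls_sum R V pcoords pbase _ _ _ _ f bf) => j _.
  by apply: (@cls_mul _ _ _ _ (fun z : V => z.2 0 j)); [exists j|apply: (@cls_mul _ _ _ _ (fun z : V => z.2 0 j)); [exists j|]].
apply: cls_ext (cls_add b2 (cls_scale (-1) (cls_add b0 b1))) => z.
rewrite /Hop /sqnorm mulr_suml mulN1r; congr (_ - _).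
by apply: eq_bigr => j _; rewrite expr2 mulrA.
Qed.

End bump_class.

Section products.
Variables (F F1 F2 : R -> R) (G : 'rV[R]_d -> R).
Hypotheses (dF : forall x : R, is_derive x 1 F (F1 x)) (dF1 : forall x : R, is_derive x 1 F1 (F2 x)).
Hypotheses (cF2 : continuous F2) (sG : smooth G).

Let cF := derive_continuous dF.
Let cF1 := derive_continuous dF1.

Let cP (f : R -> R) (g : 'rV[R]_d -> R) : continuous f -> continuous g ->
  continuous (fun z : V => f z.1 * g z.2).
Proof.
move=> cf cg; apply: contM.
  by move=> z; apply: (@continuous_comp _ _ _ (fun z : V => z.1) f); [exact: cvg_fst|exact: cf].
by move=> z; apply: (@continuous_comp _ _ _ (fun z : V => z.2) g); [exact: cvg_snd|exact: cg].
Qed.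

Let d1 (f df : R -> R) : (forall x : R, is_derive x 1 f (df x)) ->
  forall z, is_derive z e0 (fun z : V => f z.1 * G z.2) (df z.1 * G z.2).
Proof.
move=> h z; apply: is_derive_lineP.
have -> : (fun h : R => f (z + h *: e0).1 * G (z + h *: e0).2) = (fun h => G z.2 * f (z.1 + h)).
  by apply/funext => t; rewrite /= scaler0 addr0 [t *: 1]mulr1 mulrC.
rewrite mulrC; apply: is_deriveZr.
have := @is_derive1_comp R f (fun h => z.1 + h) 0 (df z.1) 1; rewrite mulr1; apply; first by rewrite addr0; exact: h.
have h' := is_deriveDr (is_derive_cstr (0:R) (1:R) z.1) (is_derive_id (0:R) (1:R)).
by apply: (is_derive_eq h'); rewrite add0r.
Qed.

Let d2 (f : R -> R) (g : 'rV[R]_d -> R) j : (forall x, derivable g x (delta_mx 0 j)) ->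
  forall z, is_derive z (ev j) (fun z : V => f z.1 * g z.2) (f z.1 * 'D_(delta_mx 0 j) g z.2).
Proof.
move=> h z; apply: is_derive_lineP.
have -> : (fun h : R => f (z + h *: ev j).1 * g (z + h *: ev j).2) = (fun h => f z.1 * g (z.2 + h *: delta_mx 0 j)).
  by apply/funext => t; rewrite /= scaler0 addr0.
by apply: is_deriveZr; apply: is_derive_line0; apply/derivableP; exact: h.
Qed.

Lemma C2_prod0 : C2 e0 (fun z : V => F z.1 * G z.2) /\
  'D_e0 ('D_e0 (fun z : V => F z.1 * G z.2)) = fun z => F2 z.1 * G z.2.
Proof.
have [cG _] := sG [::].
have E1 := derive_funE (d1 dF); have E2 := derive_funE (d1 dF1).
split; last by rewrite E1 E2.
split.
- by move=> z; have := d1 dF z => h; exact: ex_derive.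
- exact: (cP cF cG).
- by rewrite E1 => z; have := d1 dF1 z => h; exact: ex_derive.
- by rewrite E1; exact: (cP cF1 cG).
- by rewrite E1 E2; exact: (cP cF2 cG).
Qed.

Lemma C2_prodj j : C2 (ev j) (fun z : V => F z.1 * G z.2) /\
  'D_(ev j) ('D_(ev j) (fun z : V => F z.1 * G z.2)) =
  fun z => F z.1 * 'D_(delta_mx 0 j) ('D_(delta_mx 0 j) G) z.2.
Proof.
have [dG cG ddG cdG cddG] := smooth_C2 (delta_mx 0 j) sG.
have E1 := derive_funE (d2 F dG); have E2 := derive_funE (d2 F ddG).
split; last by rewrite E1 E2.
split.
- by move=> z; have := d2 F dG z => h; exact: ex_derive.
- exact: (cP cF cG).
- by rewrite E1 => z; have := d2 F ddG z => h; exact: ex_derive.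
- by rewrite E1; exact: (cP cF cdG).
- by rewrite E1 E2; exact: (cP cF cddG).
Qed.

End products.

(* s = - pi / 2 turns the cosine into a sine *)
Definition eigenwave s tau k z w := cos ((z.1 - w.1) * tau + s) * Kproj k z.2 w.2.
Definition lamb k (tau : R) : R := tau ^+ 2 + (2 * k + d)%:R.

Section wave.
Variables (s tau : R) (k : nat) (z : V).
Let F (x : R) := cos ((z.1 - x) * tau + s).
Let F1 (x : R) := tau * sin ((z.1 - x) * tau + s).
Let F2 (x : R) := - tau ^+ 2 * cos ((z.1 - x) * tau + s).
Let G (y : 'rV[R]_d) := Kproj k z.2 y.

Let darg (x : R) : is_derive x 1 (fun x => (z.1 - x) * tau + s) (- tau).
Proof.
have h := is_deriveDr (is_deriveMr (is_deriveBr (is_derive_cstr x (1 : R) z.1) (is_derive_id x (1 : R)))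
  (is_derive_cstr x (1 : R) tau)) (is_derive_cstr x (1 : R) s).
by apply: (is_derive_eq h); ring.
Qed.
Let dF (x : R) : is_derive x 1 F (F1 x).
Proof. by apply: (is_derive_eq (is_derive_chain (is_derive_cos _) (darg x))); rewrite /F1; ring. Qed.
Let dF1 (x : R) : is_derive x 1 F1 (F2 x).
Proof. by apply: (is_derive_eq (is_deriveZr tau (is_derive_chain (is_derive_sin _) (darg x)))); rewrite /F2; ring. Qed.
Let cF2 : continuous F2.
Proof. exact (contM (@cont_cst R R (- tau ^+ 2)) (derive_continuous dF)). Qed.
Let sG : smooth G. Proof. exact: (@smooth_level R d k (fun b => Phi (idx b) z.2)). Qed.

Let E (w : V) := F w.1 * G w.2.
Let EE : eigenwave s tau k z = E. Proof. by []. Qed.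
Let C20 : C2 e0 E /\ 'D_e0 ('D_e0 E) = fun w => F2 w.1 * G w.2.
Proof. exact: (C2_prod0 dF dF1 cF2 sG). Qed.
Let C2j j : C2 (ev j) E /\ 'D_(ev j) ('D_(ev j) E) =
  fun w => F w.1 * 'D_(delta_mx 0 j) ('D_(delta_mx 0 j) G) w.2.
Proof. exact: (C2_prodj dF sG). Qed.

Lemma continuous_eigenwave : continuous (eigenwave s tau k z).
Proof. by rewrite EE; have [[_ c _ _ _] _] := C20. Qed.

Lemma eigenwave_bound w : `|eigenwave s tau k z w| <= KB d k.
Proof.
rewrite /eigenwave normrM (le_trans (ler_piMl _ (cos_max _)))//.
rewrite (le_trans (Kproj_bound _ _ _))// ler_piMr ?KB_ge0//.
by rewrite mulr_ile1 ?Jap_ge0 ?Jap_le1.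
Qed.

Let E_eigen w : sqnorm w.2 * E w - ('D_e0 ('D_e0 E) w + \sum_j 'D_(ev j) ('D_(ev j) E) w) = lamb k tau * E w.
Proof.
have h0 := congr1 (fun g => g w) C20.2.
have hj j := congr1 (fun g => g w) (C2j j).2.
rewrite (eq_bigr _ (fun j _ => hj j)) h0 -mulr_sumr.
rewrite (@level_eigen R d k (fun b => Phi (idx b) z.2)) -/(Kproj k z.2 w.2).
by rewrite /E /F2 /F /G /lamb; ring.
Qed.

(** Green's identity along each coordinate. The bounded support of [f] makes the wave admissible
    although it does not decay in rho. *)
Lemma int_Hop u f : smooth u -> bsupp u -> bump u f ->
  \int[mu]_v (eigenwave s tau k z (iota v) * Hop f (iota v)) =
  lamb k tau * \int[mu]_v (eigenwave s tau k z (iota v) * f (iota v)).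
Proof.
move=> su bu bf; rewrite EE.
have sf := bump_smooth su bf; have [cf _] := sf [::]; have bsf := bump_bsupp bu bf.
have cE : continuous E by case: C20 => [[]].
have iEf : L1 mu (fun v => E (iota v) * f (iota v)) := L1_bsuppM emb cE cf bsf.
have csq : continuous (fun w : V => sqnorm w.2).
  move=> w; apply: (@continuous_comp _ _ _ (fun w : V => w.2) (@sqnorm R d)); first exact: cvg_snd.
  exact: continuous_sqnorm.
have iS : L1 mu (fun v => sqnorm (iota v).2 * E (iota v) * f (iota v)) := L1_bsuppM emb (contM csq cE) cf bsf.
have iD v : L1 mu (fun t => E (iota t) * 'D_v ('D_v f) (iota t)).
  have [_ _ _ _ c] := smooth_C2 v sf.
  exact: (L1_bsuppM emb cE c (bsupp_derive _ (bsupp_derive _ bsf))).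
have iD' v : C2 v E -> L1 mu (fun t => 'D_v ('D_v E) (iota t) * f (iota t)).
  by move=> [_ _ _ _ c]; exact: (L1_bsuppM emb c cf bsf).
have g0 := green emb (smooth_C2 e0 sf) C20.1 bsf.
have gj j := green emb (smooth_C2 (ev j) sf) (C2j j).1 bsf.
have E1 v : E (iota v) * Hop f (iota v) = sqnorm (iota v).2 * E (iota v) * f (iota v) -
    (E (iota v) * 'D_e0 ('D_e0 f) (iota v) + \sum_j E (iota v) * 'D_(ev j) ('D_(ev j) f) (iota v)).
  by rewrite /Hop -mulr_sumr; ring.
have E2 v : lamb k tau * (E (iota v) * f (iota v)) = sqnorm (iota v).2 * E (iota v) * f (iota v) -
    ('D_e0 ('D_e0 E) (iota v) * f (iota v) + \sum_j 'D_(ev j) ('D_(ev j) E) (iota v) * f (iota v)).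
  by rewrite mulrA -E_eigen -mulr_suml; ring.
have i1 : L1 mu (fun v => \sum_(j < d) E (iota v) * 'D_(ev j) ('D_(ev j) f) (iota v)).
  by apply: L1_sum => j _; exact: iD.
have i2 : L1 mu (fun v => \sum_(j < d) 'D_(ev j) ('D_(ev j) E) (iota v) * f (iota v)).
  by apply: L1_sum => j _; apply: iD'; case: (C2j j).
have i3 := iD' _ C20.1.
rewrite -intZ// (int_ext mu E1) (int_ext mu E2).
rewrite intB//; last exact: L1D.
rewrite [RHS]intB//; last exact: L1D.
congr (_ - _); rewrite intD// [RHS]intD//; congr (_ + _); first exact: g0.
rewrite int_sum; last by move=> j _; exact: iD.
rewrite int_sum; last by move=> j _; apply: iD'; case: (C2j j).
by apply: eq_bigr => j _; exact: gj.
Qed.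

End wave.

(** For the phase 0 and up to the factor 1 / (2 pi), the contribution of level [k] and frequency
    [tau] to the spectral expansion of [u] at [z]. *)
Definition acoef u s k tau z := \int[mu]_v (eigenwave s tau k z (iota v) * u (iota v)).

Lemma lamb_ge1 k tau : (0 < d)%N -> 1 <= lamb k tau.
Proof.
move=> d0; rewrite /lamb -[leLHS]add0r lerD ?sqr_ge0// ler1n.
by rewrite addn_gt0 d0 orbT.
Qed.

(** Multiplying the coefficient by a power of its eigenvalue amounts to applying the same power of
    [Hop] to [u], which keeps the integral bounded by a multiple of [KB d k]. *)
Lemma acoef_decay u m : (0 < d)%N -> smooth u -> bsupp u -> exists2 C, 0 <= C &
  forall s k tau z, lamb k tau ^+ m * `|acoef u s k tau z| <= C * k.+1%:R ^- 2 * jap tau.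
Proof.
(* Of the extra powers, 7 d compensate the growth of [KB], 2 make the series over k summable, and 1
   gives the integrable factor in tau; the eigenvalue dominates both k + 1 and 1 + tau^2. *)
move=> d0 su bu; pose N := (m + (7 * d + 3))%N.
have bN n : bump u (iter n Hop u) by elim: n => [|n IH]; [exact: bump_u|exact: bump_Hop].
have sN := bump_smooth su (bN N); have [cN _] := sN [::].
have iN : L1 mu (iter N Hop u \o @iota R d) := L1_bsupp emb cN (bump_bsupp bu (bN N)).
pose I := \int[mu]_v `|iter N Hop u (iota v)|.
have I0 : 0 <= I by apply: Rintegral_ge0.
exists ((hK ^+ 2) ^+ d * I); first by rewrite mulr_ge0// exprn_ge0// exprn_ge0// ltW// hK_gt0.
move=> s k tau z.
have l1 := lamb_ge1 k tau d0; have l0 : 0 <= lamb k tau by exact: le_trans l1.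
have powE n : lamb k tau ^+ n * acoef u s k tau z = \int[mu]_v (eigenwave s tau k z (iota v) * iter n Hop u (iota v)).
  elim: n => [|n IH]; first by rewrite expr0 mul1r.
  by rewrite exprS -mulrA IH /= (int_Hop s tau k z su bu (bN n)).
have B : lamb k tau ^+ N * `|acoef u s k tau z| <= KB d k * I.
  rewrite -[_ ^+ N]ger0_norm ?exprn_ge0// -normrM powE -intZ; last exact: L1_norm.
  apply: int_abs_le.
  - have := L1_bsuppM emb (@continuous_eigenwave s tau k z) cN (bump_bsupp bu (bN N)); exact: L1_meas.
  - by apply: L1Z; exact: L1_norm.
  - by move=> v; rewrite normrM ler_wpM2r// eigenwave_bound.
have k1 : k.+1%:R <= lamb k tau.
  rewrite /lamb -[leLHS]add0r lerD ?sqr_ge0// ler_nat -addn1 leq_add//.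
  by rewrite mul2n -addnn leq_addr.
have t1 : 1 + tau ^+ 2 <= lamb k tau.
  by rewrite /lamb addrC lerD2l ler1n addn_gt0 d0 orbT.
have P : k.+1%:R ^+ (7 * d + 2) * (1 + tau ^+ 2) <= lamb k tau ^+ (7 * d + 3).
  have -> : (7 * d + 3 = (7 * d + 2).+1)%N by rewrite -addnS.
  rewrite [leRHS]exprSr ler_pM//.
  - by rewrite addr_ge0// sqr_ge0.
  - by rewrite lerXn2r ?nnegrE.
rewrite /jap -mulrA; set a := `|acoef _ _ _ _ _| in B *.
have kp : 0 < k.+1%:R ^+ (7 * d + 2) * (1 + tau ^+ 2) :> R.
  by rewrite mulr_gt0 ?exprn_gt0// ltr_pwDl// sqr_ge0.
rewrite -(ler_pM2l kp).
have cancel (x y c J : R) n : x != 0 -> y != 0 ->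
    x ^+ (n + 2) * y * (c * J * (x ^- 2 * y^-1)) = c * x ^+ n * J.
  by move=> x0 y0; rewrite exprD; field; rewrite x0 y0.
have -> : k.+1%:R ^+ (7 * d + 2) * (1 + tau ^+ 2) * ((hK ^+ 2) ^+ d * I * (k.+1%:R ^- 2 * (1 + tau ^+ 2)^-1)) =
    KB d k * I.
  by rewrite cancel// gt_eqF// ltr_pwDl// sqr_ge0.
apply: le_trans B; rewrite mulrA [lamb k tau ^+ N](exprD _ m) [_ * lamb k tau ^+ m]mulrC -!mulrA.
rewrite ler_wpM2l ?exprn_ge0// mulrA ler_wpM2r//.
by rewrite /a.
Qed.

End oscillator.

(** * Integrals of powers *)

Section power_integrals.
Context {R : realType}.
Notation lam := (@lebesgue_measure R).
Implicit Types (a b c t : R).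

Lemma continuous_powR_pos c t : 0 < t -> {for t, continuous (fun x : R => x `^ c)}.
Proof.
move=> t0; apply: differentiable_continuous; apply/derivable1_diffP.
by apply: derivable_powR; rewrite in_itv/= t0.
Qed.

Lemma measurable_powR_l c : measurable_fun [set: R] (fun t => t `^ c).
Proof. exact: measurable_powR. Qed.

Lemma int_pow_itv a b c : 0 < a -> a < b -> c != 0 ->
  (\int[lam]_(t in `[a, b]) (t `^ (c - 1))%:E = ((b `^ c - a `^ c) / c)%:E)%E.
Proof.
move=> a0 ab c0; have b0 : 0 < b by exact: lt_trans ab.
have dF (t : R) : 0 < t -> is_derive t 1 (fun x => x `^ c / c) (t `^ (c - 1)).
  move=> t0; have d : derivable (fun x : R => x `^ c) t 1.
    by apply: derivable_powR; rewrite in_itv/= t0.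
  have h := is_deriveZr c^-1 (derivableP d).
  rewrite (_ : (fun x : R => x `^ c / c) = (fun x => c^-1 * x `^ c)); last first.
    by apply/funext => x; rewrite mulrC.
  apply: (is_derive_eq h); rewrite -derive1E powR_derive1 ?in_itv/= ?t0//.
  by rewrite mulKf.
rewrite (@continuous_FTC2 _ (fun t => t `^ (c - 1)) (fun x => x `^ c / c))//.
- by rewrite mulrBl EFinB.
- apply: continuous_in_subspaceT => t; rewrite inE/= in_itv/= => /andP[at_ _].
  by apply: continuous_powR_pos; exact: lt_le_trans at_.
- have cF t : 0 < t -> {for t, continuous (fun x : R => x `^ c / c)}.
    move=> t0; apply: differentiable_continuous; apply/derivable1_diffP.
    by have := dF t t0 => h; exact: ex_derive.
  split.
  + move=> t; rewrite in_itv/= => /andP[at_ _].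
    by have := dF t (lt_trans a0 at_) => h; exact: ex_derive.
  + by apply: cvg_at_right_filter; exact: cF.
  + by apply: cvg_at_left_filter; exact: cF.
- move=> t; rewrite in_itv/= => /andP[at_ _].
  by rewrite derive1E; have := dF t (lt_trans a0 at_) => h; rewrite derive_val.
Qed.

Lemma powRDp (x r s : R) : 0 < x -> x `^ (r + s) = x `^ r * x `^ s.
Proof. by move=> x0; rewrite powRD//; apply/implyP => _; rewrite gt_eqF. Qed.

Lemma L1_pow_bigcup (F : (set (measurableTypeR R))^nat) c M : nondecreasing_seq F -> (forall i, measurable (F i)) ->
  (forall i, (\int[lam]_(t in F i) (t `^ c)%:E <= M%:E)%E) ->
  L1 lam (fun t => \1_(\bigcup_i F i) t * t `^ c).
Proof.
move=> nF mF hM; have mU : measurable (\bigcup_i F i) by exact: bigcup_measurable.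
have mp : measurable_fun setT (fun t : R => (t `^ c)%:E) by apply/measurable_EFinP; exact: measurable_powR_l.
apply: L1_ltoo.
  by apply: measurable_funM; [exact: measurable_indic|exact: measurable_powR_l].
have -> : (\int[lam]_t `|\1_(\bigcup_i F i) t * t `^ c|%:E = \int[lam]_(t in \bigcup_i F i) (t `^ c)%:E)%E.
  rewrite [RHS]integral_mkcond; apply: eq_integral => t _.
  rewrite patchE indicE ger0_norm ?mulr_ge0 ?powR_ge0//; case: ifPn => ts /=.
    by rewrite mul1r.
  by rewrite mul0r.
apply: (@le_lt_trans _ _ M%:E); last exact: ltry.
have h := @ge0_nondecreasing_set_cvg_integral _ (measurableTypeR R) R F (fun t : R => (t `^ c)%:E) lam nF mF.
have {}h := h (fun i => measurable_funTS mp) (fun i t _ => powR_ge0 t c).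
rewrite -(cvg_lim _ h)//; apply: lime_le; first by apply/cvg_ex; eexists; exact: h.
exact: nearW.
Qed.

Lemma L1_pow01 a : 0 < a -> L1 lam (fun t => \1_(`]0, 1]%classic) t * t `^ (a - 1)).
Proof.
(* The offset 2 keeps the endpoints distinct, as [int_pow_itv] requires. *)
move=> a0; pose F (i : nat) : set (measurableTypeR R) := `[i.+2%:R^-1, 1]%classic.
have FE : \bigcup_i F i = `]0, 1]%classic.
  apply/seteqP; split => t /=.
    move=> [i _]; rewrite /F/= !in_itv/= => /andP[h ->]; rewrite andbT.
    by apply: lt_le_trans h; rewrite invr_gt0.
  rewrite in_itv/= => /andP[t0 t1]; have [i _ hi] := near_infty_natSinv_lt (PosNum t0).
  exists i => //; rewrite /F/= in_itv/= t1 andbT (le_trans _ (ltW (hi i _)))//=.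
  by rewrite lef_pV2 ?posrE// ler_nat.
rewrite -FE; apply: (@L1_pow_bigcup F _ a^-1).
- apply/nondecreasing_seqP => n; rewrite subsetEset => t; rewrite /F/= !in_itv/= => /andP[h ->].
  by rewrite andbT (le_trans _ h)// lef_pV2 ?posrE// ler_nat.
- by move=> i; exact: measurable_itv.
move=> i; rewrite int_pow_itv ?gt_eqF ?invr_gt0//; last by rewrite invf_lt1// ltr1n.
rewrite lee_fin powR1 mulrBl mul1r lerBlDr lerDl divr_ge0 ?powR_ge0// ltW//.
Qed.

Lemma L1_pow1y b : 0 < b -> L1 lam (fun t => \1_(`[1, +oo[%classic) t * t `^ (- b - 1)).
Proof.
move=> b0; pose F (i : nat) : set (measurableTypeR R) := `[1, i.+2%:R]%classic.
have FE : \bigcup_i F i = `[1, +oo[%classic.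
  apply/seteqP; split => t /=.
    by move=> [i _]; rewrite /F/= !in_itv/= => /andP[-> _].
  rewrite in_itv/= andbT => t1; exists (Num.truncn t) => //; rewrite /F/= in_itv/= t1/=.
  have t0 : 0 <= t by exact: le_trans t1.
  by rewrite (le_trans (ltW (truncnS_gt t)))// ler_nat.
rewrite -FE; apply: (@L1_pow_bigcup F _ b^-1).
- apply/nondecreasing_seqP => n; rewrite subsetEset => t; rewrite /F/= !in_itv/= => /andP[-> h].
  by rewrite (le_trans h)// ler_nat.
- by move=> i; exact: measurable_itv.
move=> i; rewrite int_pow_itv ?oppr_eq0 ?gt_eqF ?ltr1n//.
rewrite lee_fin powR1 invrN mulrN -mulNr opprB mulrBl mul1r lerBlDr lerDl divr_ge0 ?powR_ge0// ltW//.
Qed.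

Lemma L1_two_powers (g : R -> R) C a b : 0 < a -> 0 < b -> 0 <= C -> measurable_fun [set: R] g ->
  (forall t, t <= 0 -> g t = 0) ->
  (forall t, 0 < t <= 1 -> `|g t| <= C * t `^ (a - 1)) ->
  (forall t, 1 <= t -> `|g t| <= C * t `^ (- b - 1)) -> L1 lam g.
Proof.
move=> a0 b0 C0 mg g0 g1 g2.
apply: (@L1_le _ _ _ lam g _ mg (L1Z C (L1D (L1_pow01 a0) (L1_pow1y b0)))) => t.
have i1 (A : set R) : 0 <= \1_A t :> R by rewrite indicE.
have [t0|t0] := leP t 0.
  by rewrite g0// normr0 mulr_ge0// addr_ge0// mulr_ge0 ?powR_ge0.
have [t1|t1] := leP t 1.
  have -> : \1_(`]0, 1]%classic) t = 1 :> R by rewrite indicE mem_set//= in_itv/= t0.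
  by rewrite (le_trans (g1 t _)) ?t0// ler_wpM2l// mul1r lerDl mulr_ge0 ?powR_ge0.
have -> : \1_(`[1, +oo[%classic) t = 1 :> R by rewrite indicE mem_set//= in_itv/= (ltW t1).
by rewrite (le_trans (g2 t (ltW t1)))// ler_wpM2l// mul1r lerDr mulr_ge0 ?powR_ge0.
Qed.

(** The Mellin weight, extended by 0 so that all integrals over positive times run over the whole
    line. *)
Definition tw a t := if 0 < t then t `^ (a - 1) else 0.

Lemma tw_ge0 a t : 0 <= tw a t. Proof. by rewrite /tw; case: ifP => // _; rewrite powR_ge0. Qed.

Lemma measurable_tw a : measurable_fun [set: R] (tw a).
Proof.
apply: measurable_fun_ifT.
- by apply: measurable_fun_ltr => //; exact: measurable_cst.
- exact: measurable_powR_l.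
- exact: measurable_cst.
Qed.

Lemma powR_le_exp (c : R) : exists2 C, 0 <= C & forall t, 1 <= t -> t `^ c <= C * expR t.
Proof.
pose n := Num.truncn `|c|; exists (n.+1)`!%:R => // t t1.
have t0 : 0 < t by exact: lt_le_trans t1.
apply: (le_trans _ (exprn_le_expR n.+1 (ltW t0))).
rewrite -powR_mulrn ?(ltW t0)// ler_powR// (le_trans (ler_norm c))//.
exact/ltW/truncnS_gt.
Qed.

Lemma L1_tw_gauss a : 0 < a -> L1 lam (fun t => tw a t * expR (- (t ^+ 2 / 4))).
Proof.
move=> a0; have [C C0 hC] := powR_le_exp (a + 1).
apply: (@L1_two_powers _ (1 + C * expR 4) a 1) => //.
- by rewrite addr_ge0// mulr_ge0// expR_ge0.
- apply: measurable_funM; first exact: measurable_tw.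
  apply: continuous_measurable_fun; apply: cont_comp; first exact: continuous_expR.
  have h := contB (@cont_cst R R 0) (contM (contX (n := 2) (@cont_id R)) (@cont_cst R R 4^-1)).
  by under eq_fun do rewrite -sub0r; exact h.
- by move=> t t0; rewrite /tw ltNge t0/= mul0r.
- move=> t /andP[t0 t1]; rewrite /tw t0 ger0_norm ?mulr_ge0 ?powR_ge0 ?expR_ge0// mulrC.
  rewrite ler_wpM2r ?powR_ge0// -[leLHS]addr0 lerD ?mulr_ge0 ?expR_ge0//.
  by rewrite -expR0 ler_expR oppr_le0 divr_ge0 ?sqr_ge0.
- move=> t t1; have t0 : 0 < t by exact: lt_le_trans t1.
  rewrite /tw t0 ger0_norm ?mulr_ge0 ?powR_ge0 ?expR_ge0//.
  have -> : t `^ (a - 1) = t `^ (a + 1) * t `^ (-1 - 1).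
    by rewrite -powRDp//; congr (_ `^ _); ring.
  rewrite mulrAC ler_wpM2r ?powR_ge0//.
  apply: (@le_trans _ _ (C * expR t * expR (- (t ^+ 2 / 4)))); first by rewrite ler_wpM2r ?expR_ge0// hC.
  rewrite -mulrA -expRD -[leLHS]add0r lerD// ler_wpM2l// ler_expR.
  by have := sqr_ge0 (t - 2); have := sqr_ge0 t; nra.
Qed.

(** For positive [a] this is 2^(a - 1) Gamma(a / 2). *)
Definition Kint a := \int[lam]_t (tw a t * expR (- (t ^+ 2 / 4))).

Lemma tw_scale a c t : 0 < c -> tw a (c * t) = c `^ (a - 1) * tw a t.
Proof.
move=> c0; rewrite /tw pmulr_rgt0//; case: ifP => t0; last by rewrite mulr0.
by rewrite powRM// ltW.
Qed.

Lemma L1_affine (c b : R) (F : R -> R) : c != 0 -> (forall x, 0 <= F x) -> L1 lam F ->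
  L1 lam (fun x => F (c * x + b)) /\ \int[lam]_x F (c * x + b) = `|c|^-1 * \int[lam]_x F x.
Proof.
move=> c0 F0 iF; have mF := L1_meas iF.
have mE : measurable_fun [set: R] (fun x => (F x)%:E) by exact/measurable_EFinP.
have h := ge0_integral_affine b c0 mE F0.
have i : L1 lam (fun x => F (c * x + b)).
  apply: L1_ltoo; first exact: (measurableT_comp mF (measurable_affine c b)).
  under eq_integral do rewrite ger0_norm//.
  by rewrite h -intE// -EFinM ltry.
split => //; apply: EFin_inj; rewrite intE// h EFinM intE//.
Qed.

Lemma int_tw_gauss a l : 0 < a -> 0 < l ->
  L1 lam (fun t => tw a t * expR (- (t ^+ 2 / 4 * l))) /\
  \int[lam]_t (tw a t * expR (- (t ^+ 2 / 4 * l))) = Kint a * l `^ (- (a / 2)).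
Proof.
move=> a0 l0; pose c := Num.sqrt l; have c0 : 0 < c by rewrite sqrtr_gt0.
have iG := L1_tw_gauss a0.
pose G t := tw a t * expR (- (t ^+ 2 / 4)).
have GE t : tw a t * expR (- (t ^+ 2 / 4 * l)) = c `^ (1 - a) * G (c * t + 0).
  rewrite /G addr0 tw_scale// exprMn sqr_sqrtr ?(ltW l0)//.
  rewrite mulrA mulrA -powRDp// (_ : 1 - a + (a - 1) = 0) ?powRr0 ?mul1r; last by ring.
  by congr (_ * expR _); ring.
have G0 t : 0 <= G t by rewrite mulr_ge0 ?tw_ge0 ?expR_ge0.
have [i1 i2] := @L1_affine c 0 G (lt0r_neq0 c0) G0 iG.
split; first by apply: L1_ext (L1Z (c `^ (1 - a)) i1) => t; rewrite GE.
rewrite (int_ext lam GE) intZ// i2 -/(Kint a) gtr0_norm// mulrA mulrC; congr (_ * _).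
rewrite -[c^-1]powR_inv1 ?(ltW c0)// -powRDp// /c -powR12_sqrt ?(ltW l0)// -powRrM.
by congr (_ `^ _); field.
Qed.

Lemma Kint_gt0 a : 0 < a -> 0 < Kint a.
Proof.
move=> a0; pose N := `|a - 1|.
(* A lower bound of the integrand on [1, 2], where t^(a - 1) is at least 2^(- |a - 1|) and exp(- t^2
   / 4) at least exp(-1). *)
pose e := 2 `^ (- N) * expR (-1) : R.
have e0 : 0 < e by rewrite mulr_gt0 ?powR_gt0 ?expR_gt0.
have [i1 i2] := @int_bx R 2^-1 (3 / 2) (ltac:(by [])).
have h t : e * bx 2^-1 (t - 3 / 2) <= tw a t * expR (- (t ^+ 2 / 4)).
  have [ht|ht] := leP `|t - 3 / 2| 2^-1; last first.
    rewrite /bx indicE memNset ?mulr0 ?mulr_ge0 ?tw_ge0 ?expR_ge0//=.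
    by rewrite in_itv/= -ler_norml; apply/negP; rewrite -ltNge.
  rewrite bx1// mulr1; move: ht; rewrite ler_norml => /andP[h1 h2].
  have t1 : 1 <= t by lra.
  have t2 : t <= 2 by lra.
  have t0 : 0 < t by lra.
  rewrite /tw t0 ler_pM ?powR_ge0 ?expR_ge0//.
    apply: (@le_trans _ _ (t `^ (- N))).
      rewrite !powRN lef_pV2 ?posrE ?powR_gt0//.
      apply: (ge0_ler_powR (normr_ge0 (a - 1))) => //; rewrite nnegrE; exact: ltW.
    apply: ler_powR => //; rewrite lerNl /N -normrN; exact: ler_norm.
  rewrite ler_expR; nra.
have := int_le (L1Z e i1) (L1_tw_gauss a0) h.
rewrite intZ// i2 => h'; apply: lt_le_trans h'.
by rewrite mulr_gt0// divff.
Qed.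

End power_integrals.

Section sigma_finite_product.
Context {R : realType} {d : nat}.
Notation lam := (@lebesgue_measure R).
Notation MR := (measurableTypeR R).
Local Notation Z := (MR * d.-tuple MR)%type.

Let leb_prod_sigma_finite : sigma_finite setT (lam \x tuple_measure lam d)%E.
Proof.
have /sigma_finiteP[F [TF ndF Foo]] := sigma_finiteT lam.
have /sigma_finiteP[G [TG ndG Goo]] := sigma_finiteT (tuple_measure lam d).
exists (fun n => F n `*` G n).
  rewrite -setXTT TF TG predeqE => -[x y]; split.
    move=> [/= [n _ Fnx] [k _ Gky]]; exists (maxn n k) => //; split.
    - by move: x Fnx; exact/subsetPset/ndF/leq_maxl.
    - by move: y Gky; exact/subsetPset/ndG/leq_maxr.
  by move=> [n _ []/= ? ?]; split; exists n.
move=> k; have [? ?] := Foo k; have [? ?] := Goo k.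
split; first exact: measurableX.
by rewrite product_measure1E// lte_mul_pinfty// ge0_fin_numE.
Qed.

(* the library equips a product with a sigma-finite structure only when the factors are subprobabilities *)
Definition zleb : {sigma_finite_measure set Z -> \bar R} :=
  HB.pack (lam \x tuple_measure lam d)%E
    (Measure_isSigmaFinite.Build _ _ _ (lam \x tuple_measure lam d)%E leb_prod_sigma_finite).

End sigma_finite_product.

(** * Spectral synthesis with the heat kernel *)

Section heat_flow.
Context {R : realType} {d : nat}.
Notation lam := (@lebesgue_measure R).
Notation MR := (measurableTypeR R).
Local Notation V := (R * 'rV[R]_d)%type.
Local Notation Z := (MR * d.-tuple MR)%type.
Local Notation mu := (@leb_prod R d).
Implicit Types (z w : V) (v : Z) (t tau s : R).

Let q t := expR (- (t ^+ 2 / 2)).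

Lemma heatE t z v : heat t z (iota v) =
  gauss t (z.1 - v.1) * (expR (- (t ^+ 2 / 4)) ^+ d * Mehler (q t) z.2 (iota v).2).
Proof. by rewrite /heat big_split/= prodr_const card_ord. Qed.

Lemma exp_lamb t k tau : expR (- (t ^+ 2 / 4 * @lamb R d k tau)) =
  expR (- (t ^+ 2 / 4 * tau ^+ 2)) * (expR (- (t ^+ 2 / 4)) ^+ d * q t ^+ k).
Proof.
by rewrite /q -!expRM_natl -!expRD; congr expR; rewrite /lamb natrD natrM; field.
Qed.

Lemma measurable_Kproj2 k : measurable_fun setT
  (fun p : d.-tuple MR * d.-tuple MR => Kproj k (row_of_tuple p.1 : 'rV[R]_d) (row_of_tuple p.2)).
Proof.
rewrite /Kproj; under eq_fun do rewrite -big_filter.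
apply: measurable_sum => b; apply: measurable_funM.
  by apply: (measurableT_comp (measurable_Phi (idx b))); exact: measurable_fst.
by apply: (measurableT_comp (measurable_Phi (idx b))); exact: measurable_snd.
Qed.

Lemma measurable_cos_fun {dd} {T : measurableType dd} (f : T -> R) : measurable_fun setT f ->
  measurable_fun setT (fun x => cos (f x)).
Proof.
move=> mf; apply: (measurableT_comp _ mf); apply: continuous_measurable_fun; exact: continuous_cos.
Qed.

Lemma measurable_eigenwave s k : measurable_fun setT
  (fun p : (MR * Z) * Z => eigenwave s p.1.1 k (iota p.1.2) (iota p.2)).
Proof.
have m1 : measurable_fun setT (fun p : (MR * Z) * Z => p.1.1 : MR).
  by apply: (measurableT_comp (measurable_fst : measurable_fun setT (fst : MR * Z -> MR))); exact: measurable_fst.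
have m2 : measurable_fun setT (fun p : (MR * Z) * Z => p.1.2).
  by apply: (measurableT_comp (measurable_snd : measurable_fun setT (snd : MR * Z -> Z))); exact: measurable_fst.
have m3 : measurable_fun setT (fun p : (MR * Z) * Z => p.2) := measurable_snd.
have f (g : (MR * Z) * Z -> Z) : measurable_fun setT g -> measurable_fun setT (fun p => (g p).1).
  by move=> mg; apply: (measurableT_comp _ mg); exact: measurable_fst.
have h (g : (MR * Z) * Z -> Z) : measurable_fun setT g -> measurable_fun setT (fun p => (g p).2).
  by move=> mg; apply: (measurableT_comp _ mg); exact: measurable_snd.
apply: measurable_funM.
  apply: measurable_cos_fun; apply: measurable_funD; last exact: measurable_cst.
  by apply: measurable_funM => //; apply: measurable_funB; exact: f.
have e := measurableT_comp (measurable_Kproj2 k) (measurable_fun_pair (h _ m2) (h _ m3)).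
exact: e.
Qed.

(** The variables separate: the Fourier transform of the Gaussian acts in rho, the eigenrelation of
    the Mehler kernel in x. *)
Lemma int_heat_eigenwave t z s tau k w : 0 < t ->
  L1 mu (fun v => heat t z (iota v) * eigenwave s tau k (iota v) w) /\
  \int[mu]_v (heat t z (iota v) * eigenwave s tau k (iota v) w) =
  expR (- (t ^+ 2 / 4 * @lamb R d k tau)) * eigenwave s tau k z w.
Proof.
move=> t0; have [i1 i2] := gauss_fourier_shift tau z.1 (- w.1 * tau + s) t0.
have [j1 j2] := int_Mehler_Kproj k z.2 w.2 (exp_sqr01 t0).
have j1' := L1Z (expR (- (t ^+ 2 / 4)) ^+ d) j1.
have E v : heat t z (iota v) * eigenwave s tau k (iota v) w =
    (gauss t (z.1 - v.1) * cos (v.1 * tau + (- w.1 * tau + s))) *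
    (expR (- (t ^+ 2 / 4)) ^+ d * (Mehler (q t) z.2 (row_of_tuple v.2) * Kproj k (row_of_tuple v.2) w.2)).
  rewrite heatE /eigenwave /=.
  have -> : (v.1 - w.1) * tau + s = v.1 * tau + (- w.1 * tau + s) by ring.
  by ring.
split; first by apply: L1_ext (L1_tensor i1 j1') => v; rewrite E.
rewrite (int_ext mu E) (int_tensor i1 j1') i2 intZ// j2 exp_lamb /eigenwave.
have -> : z.1 * tau + (- w.1 * tau + s) = (z.1 - w.1) * tau + s by ring.
by rewrite /q; ring.
Qed.

Section bump_function.
Variable u : V -> R.
Hypotheses (su : smooth u) (bu : bsupp u).
Let mu_u := measurable_bump su.
Let iu : L1 mu (u \o @iota R d) := L1_bsupp (@euclid_prod R d) (let: conj c _ := su [::] in c) bu.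
Let U := \int[mu]_v `|u (iota v)|.

Lemma measurable_acoef s k : measurable_fun setT
  (fun p : MR * Z => acoef u s k p.1 (iota p.2)).
Proof.
have m : measurable_fun setT (fun p : (MR * Z) * Z => eigenwave s p.1.1 k (iota p.1.2) (iota p.2) * u (iota p.2)).
  apply: measurable_funM; first exact: measurable_eigenwave.
  by apply: (measurableT_comp mu_u); exact: measurable_snd.
rewrite /acoef.
exact: (@measurable_param_int _ _ _ _ _ (@zleb R d) _ m).
Qed.

Lemma measurable_acoef1 s k z : measurable_fun setT (fun tau : MR => acoef u s k tau z).
Proof.
(* The point [z] is lifted to the measurable space, so that the joint measurability in frequency and
   position can be specialized at it. *)
pose v : Z := (z.1 : MR, [tuple (z.2 0 j : MR) | j < d]).
have zE : iota v = z.
  rewrite /iota /v [RHS]surjective_pairing; congr pair.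
  by apply/rowP => j; rewrite mxE tnth_mktuple.
have m : measurable_fun setT (fun tau : MR => (tau, v)).
  by apply: measurable_fun_pair; [exact: measurable_id|exact: measurable_cst].
have := measurableT_comp (measurable_acoef s k) m.
by rewrite /comp /= zE.
Qed.

Lemma int_heat_acoef t z s tau k : 0 < t ->
  \int[mu]_v (heat t z (iota v) * acoef u s k tau (iota v)) =
  expR (- (t ^+ 2 / 4 * @lamb R d k tau)) * acoef u s k tau z.
Proof.
move=> t0.
have iH := L1_heat z t0.
have m : measurable_fun setT (fun p : Z * Z => heat t z (iota p.1) * (eigenwave s tau k (iota p.1) (iota p.2) * u (iota p.2))).
  apply: measurable_funM; first by apply: (measurableT_comp (L1_meas iH)); exact: measurable_fst.
  apply: measurable_funM; last by apply: (measurableT_comp mu_u); exact: measurable_snd.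
  have h : measurable_fun setT (fun p : Z * Z => ((tau : MR, p.1), p.2)).
    apply: measurable_fun_pair; last exact: measurable_snd.
    by apply: measurable_fun_pair; [exact: measurable_cst|exact: measurable_fst].
  exact: (measurableT_comp (measurable_eigenwave s k) h).
have B (v w : Z) : `|heat t z (iota v) * (eigenwave s tau k (iota v) (iota w) * u (iota w))| <=
    heat t z (iota v) * (KB d k * `|u (iota w)|).
  rewrite normrM (ger0_norm (heat_ge0 _ _ t0)) ler_wpM2l ?heat_ge0//.
  by rewrite normrM ler_wpM2r// eigenwave_bound.
have iB : L1 mu (fun w : Z => KB d k * `|u (iota w)|) by apply: L1Z; exact: L1_norm.
have ie v : L1 mu (fun w : Z => eigenwave s tau k (iota v) (iota w) * u (iota w)).
  exact: (L1_bsuppM (@euclid_prod R d) (@continuous_eigenwave R d s tau k (iota v)) (let: conj c _ := su [::] in c) bu).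
transitivity (\int[mu]_v \int[mu]_w (heat t z (iota v) * (eigenwave s tau k (iota v) (iota w) * u (iota w)))).
  by apply: int_ext => v; rewrite /acoef -intZ.
rewrite (@int_swap _ _ _ _ _ (@zleb R d) (@zleb R d) _ _ _ m iH iB B).
transitivity (\int[mu]_w (expR (- (t ^+ 2 / 4 * @lamb R d k tau)) * (eigenwave s tau k z (iota w) * u (iota w)))).
  apply: int_ext => w; have [i1 i2] := int_heat_eigenwave z s tau k (iota w) t0.
  rewrite mulrA -i2 mulrC -intZ//; apply: int_ext => v; ring.
rewrite intZ//.
exact: (L1_bsuppM (@euclid_prod R d) (@continuous_eigenwave R d s tau k z) (let: conj c _ := su [::] in c) bu).
Qed.

(** Fourier inversion for the Gaussian comes at no cost: its transform is again a Gaussian, of width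
    2 / t, to which [gauss_fourier] applies. *)
Lemma int_exp_cos t y : 0 < t ->
  L1 lam (fun tau => expR (- (t ^+ 2 / 4 * tau ^+ 2)) * cos (y * tau)) /\
  \int[lam]_tau (expR (- (t ^+ 2 / 4 * tau ^+ 2)) * cos (y * tau)) = 2 * pi * gauss t y.
Proof.
move=> t0; have t20 : 0 < 2 / t by rewrite divr_gt0.
have sp : 0 < Num.sqrt pi :> R by rewrite sqrtr_gt0 pi_gt0.
have E tau : expR (- (t ^+ 2 / 4 * tau ^+ 2)) * cos (y * tau) =
    Num.sqrt pi * (2 / t) * (gauss (2 / t) tau * cos (tau * y)).
  rewrite gaussE [y * tau]mulrC.
  have -> : - tau ^+ 2 / (2 / t) ^+ 2 = - (t ^+ 2 / 4 * tau ^+ 2) by field; rewrite gt_eqF.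
  by field; rewrite !gt_eqF.
have cosm : measurable_fun [set: R] (fun x : R => cos (x * y)).
  by have := measurable_cos_lin y 0; under eq_fun do rewrite addr0.
have i1 := L1_gauss_mul t20 cosm (fun y => cos_max _).
split; first by apply: L1_ext (L1Z _ i1) => tau; rewrite E.
rewrite (int_ext lam E) intZ// gauss_fourier// gaussE.
have -> : (2 / t) ^+ 2 / 4 * y ^+ 2 = y ^+ 2 / t ^+ 2 by field; rewrite gt_eqF.
have -> : 2 * pi = 2 * (Num.sqrt pi * Num.sqrt pi) :> R by rewrite -expr2 sqr_sqrtr// pi_ge0.
by rewrite mulNr; field; rewrite !gt_eqF.
Qed.

Lemma int_exp_acoef t z k : 0 < t ->
  \int[lam]_tau (expR (- (t ^+ 2 / 4 * @lamb R d k tau)) * acoef u 0 k tau z) =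
  2 * pi * \int[mu]_v (gauss t (z.1 - v.1) * (expR (- (t ^+ 2 / 4)) ^+ d * (q t ^+ k * Kproj k z.2 (iota v).2)) * u (iota v)).
Proof.
move=> t0; pose c := expR (- (t ^+ 2 / 4)) ^+ d * q t ^+ k.
have [iE _] := int_exp_cos 0 t0.
have {}iE : L1 lam (fun tau => expR (- (t ^+ 2 / 4 * tau ^+ 2))).
  by apply: L1_ext iE => tau; rewrite mul0r cos0 mulr1.
have e1 tau v : expR (- (t ^+ 2 / 4 * @lamb R d k tau)) * (eigenwave 0 tau k z (iota v) * u (iota v)) =
    c * Kproj k z.2 (iota v).2 * u (iota v) * (expR (- (t ^+ 2 / 4 * tau ^+ 2)) * cos ((z.1 - v.1) * tau)).
  by rewrite exp_lamb /eigenwave addr0 -/c; ring.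
have m : measurable_fun setT (fun p : MR * Z => expR (- (t ^+ 2 / 4 * @lamb R d k p.1)) * (eigenwave 0 p.1 k z (iota p.2) * u (iota p.2))).
  apply: measurable_funM.
    apply: (@measurableT_comp _ _ _ _ _ _ (fun tau : MR => expR (- (t ^+ 2 / 4 * @lamb R d k tau)) : R)); last exact: measurable_fst.
    under eq_fun do rewrite exp_lamb.
    by apply: measurable_funM; [exact: (L1_meas iE)|exact: measurable_cst].
  apply: measurable_funM; last by apply: (measurableT_comp mu_u); exact: measurable_snd.
  pose v0 : Z := (z.1 : MR, [tuple (z.2 0 j : MR) | j < d]).
  have zE : iota v0 = z.
    rewrite /iota /v0 [RHS]surjective_pairing; congr pair.
    by apply/rowP => j; rewrite mxE tnth_mktuple.
  have h : measurable_fun setT (fun p : MR * Z => ((p.1, v0), p.2)).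
    apply: measurable_fun_pair; last exact: measurable_snd.
    by apply: measurable_fun_pair; [exact: measurable_fst|exact: measurable_cst].
  by have := measurableT_comp (measurable_eigenwave 0 k) h; rewrite /comp /= zE.
have c0 : 0 <= c by rewrite mulr_ge0// exprn_ge0// expR_ge0.
have B tau v : `|expR (- (t ^+ 2 / 4 * @lamb R d k tau)) * (eigenwave 0 tau k z (iota v) * u (iota v))| <=
    expR (- (t ^+ 2 / 4 * tau ^+ 2)) * (c * (KB d k * `|u (iota v)|)).
  rewrite normrM ger0_norm ?expR_ge0// exp_lamb -/c -[leLHS]mulrA.
  rewrite ler_pM2l ?expR_gt0// ler_wpM2l// normrM.
  by rewrite ler_wpM2r// eigenwave_bound.
have iB : L1 mu (fun v => c * (KB d k * `|u (iota v)|)) by do 2!apply: L1Z; exact: L1_norm.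
have ie tau : L1 mu (fun w : Z => eigenwave 0 tau k z (iota w) * u (iota w)).
  exact: (L1_bsuppM (@euclid_prod R d) (@continuous_eigenwave R d 0 tau k z) (let: conj c _ := su [::] in c) bu).
transitivity (\int[lam]_tau \int[mu]_v (expR (- (t ^+ 2 / 4 * @lamb R d k tau)) * (eigenwave 0 tau k z (iota v) * u (iota v)))).
  by apply: int_ext => tau; rewrite /acoef -intZ.
rewrite (@int_swap _ _ _ _ _ lam (@zleb R d) _ _ _ m iE iB B) -intZ; last first.
  have [Cg Cg0 hg] := gauss_jap t0.
  apply: (L1_le _ (L1Z (Cg * (expR (- (t ^+ 2 / 4)) ^+ d * (q t ^+ k * KB d k))) (L1_norm iu))).
    apply: measurable_funM => //; apply: measurable_funM.
      by apply: (measurableT_comp (@measurable_gauss R t)); apply: measurable_funB; [exact: measurable_cst|exact: measurable_fst].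
    apply: measurable_funM; first exact: measurable_cst.
    apply: measurable_funM; first exact: measurable_cst.
    by apply: (measurableT_comp (measurable_Kproj k z.2)); exact: measurable_snd.
  move=> v; rewrite normrM ler_wpM2r// normrM ler_pM//.
    rewrite ger0_norm ?gauss_ge0// (le_trans (hg _))//.
    by rewrite ler_piMr// jap_le1.
  rewrite normrM (ger0_norm (exprn_ge0 _ (expR_ge0 _))) ler_wpM2l ?exprn_ge0 ?expR_ge0//.
  rewrite normrM (ger0_norm (exprn_ge0 _ (expR_ge0 _))) ler_wpM2l ?exprn_ge0 ?expR_ge0//.
  rewrite (le_trans (Kproj_bound _ _ _))// ler_piMr ?KB_ge0//.
  by rewrite mulr_ile1 ?Jap_ge0 ?Jap_le1.
apply: int_ext => v.
have [i1 i2] := int_exp_cos (z.1 - v.1) t0.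
rewrite (int_ext lam (fun tau => e1 tau v)) intZ// i2 /c; ring.
Qed.

(** The heat factor makes the frequency integral an explicit Gaussian and turns the sum over levels
    into the Mehler series, so the damped expansion is the heat kernel applied to [u]. *)
Lemma series_exp_acoef t z : 0 < t ->
  (fun n => \sum_(0 <= k < n) (2 * pi)^-1 *
    \int[lam]_tau (expR (- (t ^+ 2 / 4 * @lamb R d k tau)) * acoef u 0 k tau z)) @ \oo -->
  \int[mu]_v (heat t z (iota v) * u (iota v)).
Proof.
move=> t0; have q01 := exp_sqr01 t0; have /andP[q0 _] := q01.
have [Cg Cg0 hg] := gauss_jap t0.
pose S := limn (series (fun j => q t ^+ j * KB d j)).
pose E := expR (- (t ^+ 2 / 4)) ^+ d.
pose G k (v : Z) := gauss t (z.1 - v.1) * (E * (q t ^+ k * Kproj k z.2 (iota v).2)) * u (iota v).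
have mG k : measurable_fun setT (G k).
  apply: measurable_funM => //; apply: measurable_funM.
    by apply: (measurableT_comp (@measurable_gauss R t)); apply: measurable_funB; [exact: measurable_cst|exact: measurable_fst].
  apply: measurable_funM; first exact: measurable_cst.
  apply: measurable_funM; first exact: measurable_cst.
  by apply: (measurableT_comp (measurable_Kproj k z.2)); exact: measurable_snd.
have gb y : `|gauss t y| <= Cg.
  by rewrite ger0_norm ?gauss_ge0// (le_trans (hg _))// ler_piMr// jap_le1.
have E0 : 0 <= E by rewrite exprn_ge0// expR_ge0.
have iG k : L1 mu (G k).
  apply: (L1_le (mG k) (L1Z (Cg * (E * (q t ^+ k * KB d k))) (L1_norm iu))) => v.
  rewrite normrM ler_wpM2r// normrM ler_pM// normrM (ger0_norm E0) ler_wpM2l//.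
  rewrite normrM (ger0_norm (exprn_ge0 _ (expR_ge0 _))) ler_wpM2l ?exprn_ge0 ?expR_ge0//.
  rewrite (le_trans (Kproj_bound _ _ _))// ler_piMr ?KB_ge0//.
  by rewrite mulr_ile1 ?Jap_ge0 ?Jap_le1.
have [||||i c] := @dominated_convergence_L1 _ _ _ mu (fun N v => \sum_(0 <= k < N) G k v)
  (fun v => heat t z (iota v) * u (iota v)) (fun v => Cg * (E * (S * Jap z.2)) * `|u (iota v)|) _ _ _ _.
- by move=> N; apply: measurable_sum.
- move=> v; rewrite heatE.
  have -> : (fun N => \sum_(0 <= k < N) G k v) =
      fun N => gauss t (z.1 - v.1) * (E * (\sum_(0 <= k < N) q t ^+ k * Kproj k z.2 (iota v).2)) * u (iota v).
    by apply/funext => N; rewrite !mulr_sumr mulr_suml.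
  apply: cvgM; last exact: cvg_cst.
  apply: cvgM; first exact: cvg_cst.
  apply: cvgM; first exact: cvg_cst.
  exact: mehler_sum.
- by apply: L1Z; exact: L1_norm.
- move=> N v; rewrite /G -mulr_suml -!mulr_sumr normrM ler_wpM2r// normrM ler_pM//.
  rewrite normrM (ger0_norm E0) ler_wpM2l//.
  exact: mehler_partial_bound.
have E2 N : \int[mu]_v (\sum_(0 <= k < N) G k v) =
    \sum_(0 <= k < N) (2 * pi)^-1 * \int[lam]_tau (expR (- (t ^+ 2 / 4 * @lamb R d k tau)) * acoef u 0 k tau z).
  rewrite int_sum; last by move=> k _; exact: iG.
  apply: eq_bigr => k _; rewrite int_exp_acoef//.
  by rewrite mulKf// mulf_neq0// gt_eqF// pi_gt0.
by under eq_fun do rewrite -E2.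
Qed.

End bump_function.

End heat_flow.

(** * Fractional powers of the oscillator on real test functions *)

Section fractional_power.
Context {R : realType} {d : nat}.
Notation lam := (@lebesgue_measure R).
Notation MR := (measurableTypeR R).
Local Notation V := (R * 'rV[R]_d)%type.
Local Notation Z := (MR * d.-tuple MR)%type.
Local Notation mu := (@leb_prod R d).
Variables (u : V -> R) (sg : R).
Hypotheses (d0 : (0 < d)%N) (su : smooth u) (bu : bsupp u) (sg0 : 0 <= sg).
Implicit Types (z w : V) (v : Z) (t tau s : R) (k : nat).
Local Notation L := (@lamb R d).

Definition pcoef s k tau z := L k tau `^ sg * acoef u s k tau z.

Let L_gt0 k tau : 0 < L k tau.
Proof. exact: lt_le_trans (lamb_ge1 k tau d0). Qed.

Lemma measurable_lamb k : measurable_fun setT (fun tau : MR => L k tau : MR).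
Proof.
apply: continuous_measurable_fun.
exact (contD (contX (n := 2) (@cont_id R)) (@cont_cst R R _)).
Qed.

Lemma measurable_lamb_pow k c : measurable_fun setT (fun tau : MR => L k tau `^ c).
Proof. by apply: (measurableT_comp (measurable_powR_l c)); exact: measurable_lamb. Qed.

Lemma measurable_pcoef s k : measurable_fun setT (fun p : MR * Z => pcoef s k p.1 (iota p.2)).
Proof.
apply: measurable_funM; last exact: measurable_acoef.
by apply: (measurableT_comp (measurable_lamb_pow k sg)); exact: measurable_fst.
Qed.

Lemma measurable_pcoef1 s k z : measurable_fun setT (fun tau : MR => pcoef s k tau z).
Proof. by apply: measurable_funM; [exact: measurable_lamb_pow|exact: measurable_acoef1]. Qed.

Lemma pcoef_decay : exists2 C, 0 <= C &
  forall s k tau z, `|pcoef s k tau z| <= C * k.+1%:R ^- 2 * jap tau.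
Proof.
pose m := (Num.truncn `|sg|).+1.
have [C C0 hC] := @acoef_decay R d u m d0 su bu; exists C => // s k tau z.
apply: le_trans (hC s k tau z); rewrite normrM ger0_norm ?powR_ge0// ler_wpM2r//.
rewrite -powR_mulrn ?(ltW (L_gt0 k tau))// ler_powR ?lamb_ge1//.
by rewrite (le_trans (ler_norm _))// ltW// truncnS_gt.
Qed.

Lemma L1_pcoef s k z : L1 lam (fun tau => pcoef s k tau z).
Proof.
have [C C0 hC] := pcoef_decay.
exact: (L1_le (measurable_pcoef1 s k z) (L1Z (C * k.+1%:R ^- 2) (@L1_jap R)) (fun tau => hC s k tau z)).
Qed.

(** For real [u] the Fourier transform, the projection and the inverse transform merge into one
    cosine kernel. [Hpar_powE] identifies the limits with the two components of the spectral
    definition. *)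
Definition hpart n z := \sum_(0 <= k < n) (2 * pi)^-1 * \int[lam]_tau pcoef 0 k tau z.
Definition hlim z := limn (fun n => hpart n z).

Let pi20 : 0 < 2 * pi :> R. Proof. by rewrite mulr_gt0// pi_gt0. Qed.

(** A single bound covers every multiplier used in the limits: 1, heat factors, negative powers of
    the eigenvalue, and their products. *)
Lemma weighted_sum_bound : exists2 C, 0 <= C & forall (g : R -> R) (e : R) s k z,
  measurable_fun [set: R] g -> (forall tau, `|g tau| <= e) ->
  L1 lam (fun tau => g tau * pcoef s k tau z) /\
  `|(2 * pi)^-1 * \int[lam]_tau (g tau * pcoef s k tau z)| <= e * (C * k.+1%:R ^- 2).
Proof.
have [C C0 hC] := pcoef_decay; pose J := \int[lam]_tau (jap tau : R).
have J0 : 0 <= J by apply: Rintegral_ge0 => // x _; exact: jap_ge0.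
exists ((2 * pi)^-1 * (C * J)); first by rewrite mulr_ge0 ?invr_ge0 ?(ltW pi20)// mulr_ge0.
move=> g e s k z mg ge.
have e0 : 0 <= e by rewrite (le_trans _ (ge 0)).
have ij := L1Z (e * (C * k.+1%:R ^- 2)) (@L1_jap R).
have m : measurable_fun [set: R] (fun tau => g tau * pcoef s k tau z).
  by apply: measurable_funM => //; exact: measurable_pcoef1.
have B tau : `|g tau * pcoef s k tau z| <= e * (C * k.+1%:R ^- 2) * jap tau.
  by rewrite normrM -mulrA ler_pM// -mulrA mulrA; exact: hC.
split; first exact: (@L1_le _ _ _ lam _ _ m ij B).
rewrite normrM ger0_norm ?invr_ge0 ?(ltW pi20)//.
have -> : e * ((2 * pi)^-1 * (C * J) * k.+1%:R ^- 2) = (2 * pi)^-1 * (e * (C * k.+1%:R ^- 2) * J) by ring.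
rewrite ler_wpM2l ?invr_ge0 ?(ltW pi20)// -intZ; last exact: L1_jap.
exact: int_abs_le.
Qed.

Lemma term_bound : exists2 C, 0 <= C & forall k z,
  `|(2 * pi)^-1 * \int[lam]_tau pcoef 0 k tau z| <= C * k.+1%:R ^- 2.
Proof.
have [C C0 hC] := weighted_sum_bound; exists C => // k z.
have h1 (tau : R) : `|1| <= 1 :> R by rewrite normr1.
have [_] := hC (fun=> 1) 1 0 k z (measurable_cst _) h1.
by rewrite mul1r; under eq_Rintegral do rewrite mul1r.
Qed.

Let sum_le2 (C : R) n : 0 <= C -> \sum_(0 <= k < n) C * k.+1%:R ^- 2 <= C * 2.
Proof.
move=> C0; rewrite -mulr_sumr ler_wpM2l// (le_trans (sum_inv_sq_le _))//.
by rewrite ler_piMr// lerBlDr lerDl invr_ge0.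
Qed.

Lemma hpart_bound : exists2 C, 0 <= C & forall n z, `|hpart n z| <= C.
Proof.
have [C C0 hC] := term_bound; exists (C * 2); first by rewrite mulr_ge0.
move=> n z; rewrite (le_trans (ler_norm_sum _ _ _))// (le_trans _ (sum_le2 n C0))//.
by apply: ler_sum => k _; exact: hC.
Qed.

Lemma hpart_cvg z : (fun n => hpart n z) @ \oo --> hlim z.
Proof.
have [C C0 hC] := term_bound.
exact: (series_dominated_cvg (fun k => hC k z) (cvg_series_inv_sq C0)).
Qed.

Lemma measurable_hpart n : measurable_fun setT (fun v => hpart n (iota v)).
Proof.
apply: measurable_sum => k; apply: measurable_funM; first exact: measurable_cst.
have m : measurable_fun setT (fun p : Z * MR => pcoef 0 k p.2 (iota p.1)).
  have h : measurable_fun setT (fun p : Z * MR => (p.2, p.1)).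
    by apply: measurable_fun_pair; [exact: measurable_snd|exact: measurable_fst].
  exact: (measurableT_comp (measurable_pcoef 0 k) h).
exact: (@measurable_param_int _ _ _ _ _ lam _ m).
Qed.

Lemma measurable_hlim : measurable_fun setT (hlim \o @iota R d).
Proof.
apply: (measurable_fun_cvg measurable_hpart) => v _; exact: hpart_cvg.
Qed.

Lemma hlim_bound : exists2 C, 0 <= C & forall z, `|hlim z| <= C.
Proof.
have [C C0 hC] := hpart_bound; exists C => // z.
have c : (fun n => `|hpart n z|) @ \oo --> `|hlim z| by apply: cvg_norm; exact: hpart_cvg.
rewrite -(cvg_lim _ c)//; apply: limr_le; first exact: cvgP c.
exact: nearW.
Qed.

Lemma series_heat_hlim t z : 0 < t ->
  (fun n => \sum_(0 <= k < n) (2 * pi)^-1 *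
    \int[lam]_tau (expR (- (t ^+ 2 / 4 * L k tau)) * pcoef 0 k tau z)) @ \oo -->
  \int[mu]_v (heat t z (iota v) * hlim (iota v)).
Proof.
move=> t0; have [C C0 hC] := hpart_bound; have iH := L1_heat z t0.
have [||||i c] := @dominated_convergence_L1 _ _ _ mu (fun n v => heat t z (iota v) * hpart n (iota v))
  (fun v => heat t z (iota v) * hlim (iota v)) (fun v => C * heat t z (iota v)) _ _ _ _.
- by move=> n; apply: measurable_funM; [exact: (L1_meas iH)|exact: measurable_hpart].
- by move=> v; apply: cvgM; [exact: cvg_cst|exact: hpart_cvg].
- exact: L1Z.
- by move=> n v; rewrite normrM (ger0_norm (heat_ge0 _ _ t0)) mulrC ler_wpM2r ?heat_ge0.
have [D D0 hD] := pcoef_decay.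
have E k : L1 mu (fun v => heat t z (iota v) * \int[lam]_tau pcoef 0 k tau (iota v)) /\
    \int[mu]_v (heat t z (iota v) * \int[lam]_tau pcoef 0 k tau (iota v)) =
    \int[lam]_tau (expR (- (t ^+ 2 / 4 * L k tau)) * pcoef 0 k tau z).
  have m : measurable_fun setT (fun p : Z * MR => heat t z (iota p.1) * pcoef 0 k p.2 (iota p.1)).
    apply: measurable_funM; first by apply: (measurableT_comp (L1_meas iH)); exact: measurable_fst.
    have h : measurable_fun setT (fun p : Z * MR => (p.2, p.1)).
      by apply: measurable_fun_pair; [exact: measurable_snd|exact: measurable_fst].
    exact: (measurableT_comp (measurable_pcoef 0 k) h).
  have iJ := L1Z (D * k.+1%:R ^- 2) (@L1_jap R).
  have B v tau : `|heat t z (iota v) * pcoef 0 k tau (iota v)| <= heat t z (iota v) * (D * k.+1%:R ^- 2 * jap tau).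
    by rewrite normrM (ger0_norm (heat_ge0 _ _ t0)) ler_wpM2l ?heat_ge0.
  have e v : heat t z (iota v) * \int[lam]_tau pcoef 0 k tau (iota v) =
      \int[lam]_tau (heat t z (iota v) * pcoef 0 k tau (iota v)) by rewrite intZ//; exact: L1_pcoef.
  split.
    apply: L1_ext (@L1_int _ _ _ _ _ (@zleb R d) lam _ _ _ m iH iJ B) => v; by rewrite /= e.
  rewrite (int_ext mu e) (@int_swap _ _ _ _ _ (@zleb R d) lam _ _ _ m iH iJ B).
  apply: int_ext => tau; rewrite /= /pcoef [RHS]mulrCA -int_heat_acoef//.
  have i2 : L1 mu (fun v => heat t z (iota v) * pcoef 0 k tau (iota v)).
    exact: (@L1_inner2 _ _ _ _ _ (@zleb R d) _ _ _ m iH B tau).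
  rewrite -intZ; first by apply: int_ext => v; rewrite mulrCA.
  apply: L1_ext (L1Z (L k tau `^ sg)^-1 i2) => v; rewrite /pcoef mulrCA mulKf//.
  by rewrite gt_eqF// powR_gt0.
have E2 n : \int[mu]_v (heat t z (iota v) * hpart n (iota v)) = \sum_(0 <= k < n) (2 * pi)^-1 *
    \int[lam]_tau (expR (- (t ^+ 2 / 4 * L k tau)) * pcoef 0 k tau z).
  have e v : heat t z (iota v) * hpart n (iota v) =
      \sum_(0 <= k < n) (2 * pi)^-1 * (heat t z (iota v) * \int[lam]_tau pcoef 0 k tau (iota v)).
    by rewrite /hpart mulr_sumr; apply: eq_bigr => k _; rewrite mulrCA.
  rewrite (int_ext mu e) int_sum; last by move=> k _; apply: L1Z; exact: (E k).1.
  by apply: eq_bigr => k _; rewrite intZ ?(E k).2//; exact: (E k).1.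
by under eq_fun do rewrite -E2.
Qed.

Lemma measurable_exp_lamb t k : measurable_fun [set: R] (fun tau : R => expR (- (t ^+ 2 / 4 * L k tau))).
Proof.
apply: (measurableT_comp (@measurable_expR R)); apply: measurableT_comp => //.
by apply: measurable_funM; [exact: measurable_cst|exact: measurable_lamb].
Qed.

Lemma acoefE s k tau z : acoef u s k tau z = L k tau `^ (- sg) * pcoef s k tau z.
Proof. by rewrite powRN mulKf// gt_eqF// powR_gt0. Qed.

Lemma lamb_pow_le1 k tau : 0 <= L k tau `^ (- sg) <= 1.
Proof.
rewrite powR_ge0 /= powRN invf_le1 ?powR_gt0// -[leLHS](powRr0 (L k tau)).
by rewrite ler_powR// lamb_ge1.
Qed.

Lemma L1_acoef s k z : L1 lam (fun tau => acoef u s k tau z).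
Proof.
have [C C0 hC] := weighted_sum_bound.
have h tau : `|L k tau `^ (- sg)| <= 1 by rewrite ger0_norm ?powR_ge0//; case/andP: (lamb_pow_le1 k tau).
have [i _] := hC _ _ s k z (measurable_lamb_pow k (- sg)) h.
by apply: L1_ext i => tau; rewrite acoefE.
Qed.

(** Spectral inversion by an Abel-type argument. With the heat factor inserted, the series equals
    the heat kernel applied to [u]; as t tends to 0, [tannery] gives the limit of the series and
    [heat_approx] that of the kernel. *)
Lemma series_acoef_cvg z :
  (fun n => \sum_(0 <= k < n) (2 * pi)^-1 * \int[lam]_tau acoef u 0 k tau z) @ \oo --> u z.
Proof.
have [C C0 hC] := weighted_sum_bound.
have mw n k : measurable_fun [set: R] (fun tau : R => expR (- (tn n ^+ 2 / 4 * L k tau)) * L k tau `^ (- sg)).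
  by apply: measurable_funM; [exact: measurable_exp_lamb|exact: measurable_lamb_pow].
have el1 n k tau : expR (- (tn n ^+ 2 / 4 * L k tau)) <= 1 :> R.
  rewrite -[leRHS]expR0 ler_expR oppr_le0; apply: mulr_ge0; last exact: ltW.
  by rewrite divr_ge0 ?sqr_ge0.
have gw n k tau : `|expR (- (tn n ^+ 2 / 4 * L k tau)) * L k tau `^ (- sg)| <= 1.
  by rewrite ger0_norm ?mulr_ge0 ?expR_ge0 ?powR_ge0// mulr_ile1 ?expR_ge0 ?powR_ge0//; case/andP: (lamb_pow_le1 k tau).
have iA k := L1_acoef 0 k z.
have ub n k : `|(2 * pi)^-1 * \int[lam]_tau (expR (- (tn n ^+ 2 / 4 * L k tau)) * acoef u 0 k tau z)| <= C * k.+1%:R ^- 2.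
  have [_] := hC _ _ 0 k z (mw n k) (gw n k); rewrite mul1r; apply: le_trans.
  by rewrite le_eqVlt; apply/orP; left; apply/eqP; congr (`|_ * _|); apply: int_ext => tau; rewrite acoefE mulrA.
have lm k : (fun n => (2 * pi)^-1 * \int[lam]_tau (expR (- (tn n ^+ 2 / 4 * L k tau)) * acoef u 0 k tau z)) @ \oo -->
    (2 * pi)^-1 * \int[lam]_tau acoef u 0 k tau z.
  apply: cvgM; first exact: cvg_cst.
  have [||||//] := @dominated_convergence_L1 _ _ _ lam (fun n tau => expR (- (tn n ^+ 2 / 4 * L k tau)) * acoef u 0 k tau z)
    (fun tau => acoef u 0 k tau z) (fun tau => `|acoef u 0 k tau z|) _ _ _ _.
  - by move=> n; apply: measurable_funM; [exact: measurable_exp_lamb|exact: (L1_meas (iA k))].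
  - move=> tau; rewrite -[X in _ --> X]mul1r; apply: cvgM; last exact: cvg_cst.
    have := @tn_expR_cvg R (4 / L k tau); apply: cvg_trans; apply: near_eq_cvg; apply: nearW => n.
    by congr expR; congr (- _); rewrite invf_div mulrA mulrAC.
  - exact: L1_norm.
  - by move=> n tau; rewrite normrM ler_piMl// ger0_norm ?expR_ge0.
have [cv cl] := tannery ub (cvg_series_inv_sq C0) lm.
have [Lc Lc0 hL] := smooth_lipschitz su bu.
have ha := @heat_approx R d u z Lc (measurable_bump su).
have {}ha := ha (fun w => _); have {}ha : (fun n => \int[mu]_v (heat (tn n) z (iota v) * u (iota v))) @ \oo --> u z.
  apply: ha => w; rewrite distrC; have := hL w (z - w); by rewrite [w + _]addrC subrK.
have e n : limn (series (fun k => (2 * pi)^-1 * \int[lam]_tau (expR (- (tn n ^+ 2 / 4 * L k tau)) * acoef u 0 k tau z))) =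
    \int[mu]_v (heat (tn n) z (iota v) * u (iota v)).
  have h := @series_exp_acoef R d u su bu (tn n) z (tn_gt0 n).
  exact: (cvg_lim (@norm_hausdorff _ _) h).
have {}cl : (fun n => \int[mu]_v (heat (tn n) z (iota v) * u (iota v))) @ \oo -->
  limn (series (fun k => (2 * pi)^-1 * \int[lam]_tau acoef u 0 k tau z)).
  by under eq_fun do rewrite -e.
have <- : limn (series (fun k => (2 * pi)^-1 * \int[lam]_tau acoef u 0 k tau z)) = u z.
  by apply: (cvg_unique _ cl ha).
exact: cv.
Qed.

(** Integrated against the weight, each heat factor becomes [Kint al] times the power - al / 2 of
    the eigenvalue. This cancels the power inside [pcoef] and leaves the inversion series of [u]. *)
Lemma int_tw_heat_hlim al z : 0 < al -> sg = al / 2 ->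
  L1 lam (fun t => tw al t * \int[mu]_v (heat t z (iota v) * hlim (iota v))) /\
  \int[lam]_t (tw al t * \int[mu]_v (heat t z (iota v) * hlim (iota v))) = Kint al * u z.
Proof.
move=> al0 sgE; have [C C0 hC] := weighted_sum_bound; have [D D0 hD] := pcoef_decay.
pose T k (t : R) := \int[lam]_tau (expR (- (t ^+ 2 / 4 * L k tau)) * pcoef 0 k tau z).
have e4 t k tau : `|expR (- (t ^+ 2 / 4 * L k tau))| <= expR (- (t ^+ 2 / 4)).
  rewrite ger0_norm ?expR_ge0// ler_expR lerN2 ler_peMr ?lamb_ge1//.
  by rewrite divr_ge0// sqr_ge0.
have mE k : measurable_fun setT (fun p : MR * MR => expR (- (p.1 ^+ 2 / 4 * L k p.2)) * pcoef 0 k p.2 z).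
  apply: measurable_funM; last first.
    by apply: (measurableT_comp (measurable_pcoef1 0 k z)); exact: measurable_snd.
  apply: (measurableT_comp (@measurable_expR R)); apply: measurableT_comp => //.
  apply: measurable_funM; last by apply: (measurableT_comp (measurable_lamb k)); exact: measurable_snd.
  apply: measurable_funM; last exact: measurable_cst.
  by apply: measurable_funX; exact: measurable_fst.
have mT k : measurable_fun [set: R] (T k) by exact: (@measurable_param_int _ _ _ _ _ lam _ (mE k)).
have Tb k t : `|(2 * pi)^-1 * T k t| <= expR (- (t ^+ 2 / 4)) * (C * k.+1%:R ^- 2).
  by have [] := hC _ _ 0 k z (measurable_exp_lamb t k) (e4 t k).
have iTw := L1_tw_gauss al0.
have [||||i c] := @dominated_convergence_L1 _ _ _ lam (fun n t => tw al t * \sum_(0 <= k < n) (2 * pi)^-1 * T k t)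
  (fun t => tw al t * \int[mu]_v (heat t z (iota v) * hlim (iota v)))
  (fun t => C * 2 * (tw al t * expR (- (t ^+ 2 / 4)))) _ _ _ _.
- move=> n; apply: measurable_funM; first exact: measurable_tw.
  by apply: measurable_sum => k; apply: measurable_funM; [exact: measurable_cst|exact: mT].
- move=> t; have [t0|t0] := ltP 0 t.
    by apply: cvgM; [exact: cvg_cst|exact: series_heat_hlim].
  rewrite /tw ltNge t0/= mul0r; under eq_fun do rewrite mul0r.
  exact: cvg_cst.
- exact: L1Z.
- move=> n t; rewrite normrM ger0_norm ?tw_ge0// mulrCA ler_wpM2l ?tw_ge0//.
  rewrite (le_trans (ler_norm_sum _ _ _))// [leRHS]mulrC (@le_trans _ _ (\sum_(0 <= k < n) expR (- (t ^+ 2 / 4)) * (C * k.+1%:R ^- 2)))//.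
    by apply: ler_sum => k _; exact: Tb.
  by rewrite -mulr_sumr ler_wpM2l ?expR_ge0// sum_le2.
split => //.
have iTk k : L1 lam (fun t => tw al t * T k t) /\ \int[lam]_t (tw al t * T k t) = Kint al * \int[lam]_tau acoef u 0 k tau z.
  have m : measurable_fun setT (fun p : MR * MR => tw al p.1 * (expR (- (p.1 ^+ 2 / 4 * L k p.2)) * pcoef 0 k p.2 z)).
    by apply: measurable_funM; [apply: (measurableT_comp (@measurable_tw R al)); exact: measurable_fst|exact: mE].
  have iJ := L1Z (D * k.+1%:R ^- 2) (@L1_jap R).
  have B t tau : `|tw al t * (expR (- (t ^+ 2 / 4 * L k tau)) * pcoef 0 k tau z)| <=
      tw al t * expR (- (t ^+ 2 / 4)) * (D * k.+1%:R ^- 2 * jap tau).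
    rewrite normrM ger0_norm ?tw_ge0// -[leRHS]mulrA ler_wpM2l ?tw_ge0// normrM.
    by apply: ler_pM => //; exact: e4.
  have e t : tw al t * T k t = \int[lam]_tau (tw al t * (expR (- (t ^+ 2 / 4 * L k tau)) * pcoef 0 k tau z)).
    rewrite intZ//; apply: (hC _ _ 0 k z (measurable_exp_lamb t k) (e4 t k)).1.
  split; first by apply: L1_ext (@L1_int _ _ _ _ _ lam lam _ _ _ m iTw iJ B) => t; rewrite e.
  have iA := L1_acoef 0 k z.
  rewrite (int_ext lam e) (@int_swap _ _ _ _ _ lam lam _ _ _ m iTw iJ B) -intZ//.
  apply: int_ext => tau /=; have [j1 j2] := int_tw_gauss al0 (L_gt0 k tau).
  under eq_Rintegral do rewrite mulrA mulrC.
  rewrite intZ// j2 /pcoef sgE powRN; field; rewrite gt_eqF// powR_gt0//.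
have E n : \int[lam]_t (tw al t * \sum_(0 <= k < n) (2 * pi)^-1 * T k t) =
    Kint al * \sum_(0 <= k < n) (2 * pi)^-1 * \int[lam]_tau acoef u 0 k tau z.
  have e t : tw al t * \sum_(0 <= k < n) (2 * pi)^-1 * T k t = \sum_(0 <= k < n) (2 * pi)^-1 * (tw al t * T k t).
    by rewrite mulr_sumr; apply: eq_bigr => k _; rewrite mulrCA.
  rewrite (int_ext lam e) int_sum; last by move=> k _; apply: L1Z; exact: (iTk k).1.
  rewrite mulr_sumr; apply: eq_bigr => k _; rewrite intZ; last exact: (iTk k).1.
  by rewrite (iTk k).2 mulrCA.
have c2 : (fun n => \int[lam]_t (tw al t * \sum_(0 <= k < n) (2 * pi)^-1 * T k t)) @ \oo --> Kint al * u z.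
  under eq_fun do rewrite E; apply: cvgM; first exact: cvg_cst.
  exact: series_acoef_cvg.
by apply: (cvg_unique _ c c2).
Qed.

End fractional_power.

(** * The spectral definition in real form *)

Section spectral_formula.
Context {R : realType} {d : nat}.
Notation lam := (@lebesgue_measure R).
Notation MR := (measurableTypeR R).
Local Notation V := (R * 'rV[R]_d)%type.
Local Notation Z := (MR * d.-tuple MR)%type.
Local Notation mu := (@leb_prod R d).
Implicit Types (z w : V) (tau s : R) (k : nat).

Lemma sliceD (f g : 'rV[R]_d -> R) : slice f -> slice g -> slice (fun x => f x + g x).
Proof.
move=> [m1 [C1 C10 h1] [L1' l1]] [m2 [C2 C20 h2] [L2' l2]]; split.
- exact: measurable_funD.
- exists (C1 + C2); first exact: addr_ge0.
  by move=> x; rewrite (le_trans (ler_normD _ _))// mulrDl lerD.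
- exists (L1' + L2') => x y; rewrite opprD addrACA (le_trans (ler_normD _ _))// mulrDl lerD//.
Qed.

Lemma sliceZ c (f : 'rV[R]_d -> R) : slice f -> slice (fun x => c * f x).
Proof.
move=> [m [C C0 h] [L l]]; split.
- exact: measurable_funM.
- exists (`|c| * C); first exact: mulr_ge0.
  by move=> x; rewrite normrM -mulrA ler_wpM2l.
- by exists (`|c| * L) => x y; rewrite -mulrBr normrM -mulrA ler_wpM2l.
Qed.

Lemma L1_Kproj_slice k x (f : 'rV[R]_d -> R) : slice f ->
  L1 (leb d) (fun t => Kproj k x (row_of_tuple t) * f (row_of_tuple t)).
Proof.
move=> sf; apply: (L1_le _ (L1Z (KB d k) (L1_norm (slice_L1 sf)))) => [|t].
  by apply: measurable_funM; [exact: measurable_Kproj|exact: (L1_meas (slice_L1 sf))].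
rewrite normrM ler_wpM2r// (le_trans (Kproj_bound _ _ _))// ler_piMr ?KB_ge0//.
by rewrite mulr_ile1 ?Jap_ge0 ?Jap_le1.
Qed.

Lemma ProjD k x (f g : 'rV[R]_d -> R) : slice f -> slice g ->
  Proj k (fun y => f y + g y) x = Proj k f x + Proj k g x.
Proof.
by move=> sf sg; rewrite /Proj -intD; [apply: int_ext => t; rewrite mulrDr|exact: L1_Kproj_slice..].
Qed.

Lemma ProjZ k x c (f : 'rV[R]_d -> R) : slice f -> Proj k (fun y => c * f y) x = c * Proj k f x.
Proof.
by move=> sf; rewrite /Proj -intZ; [apply: int_ext => t; rewrite mulrCA|exact: L1_Kproj_slice].
Qed.

Lemma L1_bump_cos (u : V -> R) (x : 'rV[R]_d) s tau : smooth u -> bsupp u ->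
  L1 lam (fun q => cos (q * tau + s) * u (q, x)).
Proof.
move=> su bu; have [r [C C0 hC]] := bump_bound su bu; have [cu _] := su [::].
apply: (@L1_le _ _ _ lam _ (fun q => C * Phi0 x * bx r q)); last 1 first.
- by move=> q; rewrite normrM (le_trans (ler_piMl _ (cos_max _)))// hC.
- apply: measurable_funM; first exact: measurable_cos_lin.
  apply: continuous_measurable_fun => q.
  apply: (@continuous_comp _ _ _ (fun q => (q, x)) u); last exact: cu.
  exact: (cvg_pair cvg_id (cvg_cst _)).
- by apply: L1Z; exact: L1_bx.
Qed.

Lemma int_Kproj_cos (u : V -> R) s k tau x : smooth u -> bsupp u ->
  L1 mu (fun v => Kproj k x (iota v).2 * (cos (v.1 * tau + s) * u (iota v))) /\
  \int[mu]_v (Kproj k x (iota v).2 * (cos (v.1 * tau + s) * u (iota v))) =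
  Proj k (cost u s tau) x.
Proof.
move=> su bu; have [r [C C0 hC]] := bump_bound su bu.
have [C' C'0 hC'] := Phi_Jap (fun=> 0%N) (R := R) (d := d).
pose F (v : Z) := Kproj k x (iota v).2 * (cos (v.1 * tau + s) * u (iota v)).
have m : measurable_fun setT F.
  apply: measurable_funM.
    by apply: (measurableT_comp (measurable_Kproj k x)); exact: measurable_snd.
  apply: measurable_funM; last exact: measurable_bump.
  by apply: (measurableT_comp (measurable_cos_lin tau s)); exact: measurable_fst.
have ib : L1 (leb d) (fun t => KB d k * (C * (C' * Jap (row_of_tuple t)))).
  by do 3!apply: L1Z; exact: L1_Jap.
have B (q : MR) (t : d.-tuple MR) : `|F (q, t)| <= bx r q * (KB d k * (C * (C' * Jap (row_of_tuple t)))).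
  rewrite /F normrM mulrCA ler_pM//.
    rewrite (le_trans (Kproj_bound _ _ _))// ler_piMr ?KB_ge0//.
    by rewrite mulr_ile1 ?Jap_ge0 ?Jap_le1.
  rewrite normrM (le_trans (ler_piMl _ (cos_max _)))// (le_trans (hC _ _))// mulrC.
  rewrite ler_wpM2l ?bx_ge0// ler_wpM2l// (le_trans _ (hC' _))// ler_norm//.
split; first exact: (L1_prod m (@L1_bx R r) ib B).
rewrite (int_prod2 m (@L1_bx R r) ib B) /F /Proj.
have e (y : d.-tuple MR) : \int[lam]_q (Kproj k x (iota (q, y)).2 * (cos ((q, y).1 * tau + s) * u (iota (q, y)))) =
    Kproj k x (row_of_tuple y) * cost u s tau (row_of_tuple y).
  exact: (intZ (Kproj k x (row_of_tuple y)) (L1_bump_cos (row_of_tuple y) s tau su bu)).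
exact: (int_ext (leb d) e).
Qed.

Lemma acoef_phase (u : V -> R) s k tau z : smooth u -> bsupp u ->
  acoef u s k tau z = cos (z.1 * tau + s) * Proj k (cost u 0 tau) z.2 +
                      sin (z.1 * tau + s) * Proj k (cost u (- (pi / 2)) tau) z.2.
Proof.
move=> su bu; have [i1 <-] := int_Kproj_cos 0 k tau z.2 su bu.
have [i2 <-] := int_Kproj_cos (- (pi / 2)) k tau z.2 su bu.
rewrite -!intZ// -intD//; [|exact: L1Z..].
apply: int_ext => v; rewrite /eigenwave addr0 cosBpihalf.
have -> : (z.1 - (iota v).1) * tau + s = (z.1 * tau + s) - v.1 * tau by rewrite /=; ring.
by rewrite cosB; ring.
Qed.

Lemma int_odd (F : R -> R) : L1 lam F -> (forall x, F (- x) = - F x) -> \int[lam]_x F x = 0.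
Proof.
move=> i oF; have gen (I : R) : I = - I -> I = 0 by lra.
have h := mpres_int (@mpres_opp R) (L1_meas i).
have e := int_ext lam oF; have e2 := intN i.
suff : \int[lam]_x F x = - \int[lam]_x F x.
  exact: gen.
by rewrite -[LHS]h e e2.
Qed.

Lemma acoef_sin_odd (u : V -> R) k tau z : smooth u -> bsupp u ->
  acoef u (- (pi / 2)) k (- tau) z = - acoef u (- (pi / 2)) k tau z.
Proof.
move=> su bu.
have iE := L1_bsuppM (@euclid_prod R d) (@continuous_eigenwave R d (- (pi / 2)) tau k z) (let: conj c _ := su [::] in c) bu.
rewrite /acoef -intN//; apply: int_ext => v; rewrite /eigenwave !cosBpihalf mulrN sinN; ring.
Qed.

(** The sine coefficient is odd in tau while the eigenvalue is even. This removes the terms that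
    would couple the real and the imaginary part of a test function. *)
Lemma int_pcoef_sin (u : V -> R) sg k z : (0 < d)%N -> smooth u -> bsupp u ->
  \int[lam]_tau pcoef u sg (- (pi / 2)) k tau z = 0.
Proof.
move=> d0 su bu; apply: (int_odd (L1_pcoef sg d0 su bu (- (pi / 2)) k z)) => tau.
by rewrite /pcoef acoef_sin_odd// /lamb sqrrN mulrN.
Qed.

Section complex_bump.
Local Open Scope complex_scope.
Variables (f : V -> R[i]) (sg : R).
Let u z := complex.Re (f z).
Let v z := complex.Im (f z).
Hypotheses (d0 : (0 < d)%N) (tf : test_function f).

Lemma test_bsupp : [/\ smooth u, smooth v, bsupp u & bsupp v].
Proof.
have [[su sv] K] := tf.
have [M [_ hM]] := compact_bounded K.
have b z : M + 1 < `|z| -> f z = 0.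
  move=> zM; apply: contrapT => /eqP fz.
  have := hM (M + 1); rewrite ltrDl ltr01 => /(_ isT z).
  by move/(_ (@subset_closure _ [set z | f z != 0] _ fz)) => /=; rewrite leNgt zM.
by split => //; exists (M + 1) => z /b fz; rewrite /u /v fz.
Qed.

Let c0 := (Num.sqrt (2 * pi))^-1 : R.
Let P k g z := Proj k g z.2.

Lemma fourier_rhoE tau x : fourier_rho f tau x =
  (c0 * (cost u 0 tau x + cost v (- (pi / 2)) tau x)) +i*
  (c0 * (cost v 0 tau x - cost u (- (pi / 2)) tau x)).
Proof.
have [su sv bu bv] := test_bsupp.
rewrite /fourier_rho /cintegral -/c0.
have iu s := L1_bump_cos x s tau su bu; have iv s := L1_bump_cos x s tau sv bv.
have ReE q : complex.Re (cis (- (q * tau)) * f (q, x)) =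
    cos (q * tau + 0) * u (q, x) + cos (q * tau + - (pi / 2)) * v (q, x).
  rewrite /u /v; case: (f (q, x)) => a b /=; rewrite cosN sinN addr0 cosBpihalf; ring.
have ImE q : complex.Im (cis (- (q * tau)) * f (q, x)) =
    cos (q * tau + 0) * v (q, x) - cos (q * tau + - (pi / 2)) * u (q, x).
  rewrite /u /v; case: (f (q, x)) => a b /=; rewrite cosN sinN addr0 cosBpihalf; ring.
rewrite (int_ext lam ReE) (int_ext lam ImE) intD// intB//.
apply/eqP; rewrite eq_complex /= -/(cost u 0 tau x) -/(cost v 0 tau x).
by apply/andP; split; apply/eqP; rewrite /cost; ring.
Qed.

Lemma spectral_term k tau z :
  cis (z.1 * tau) * ((tau ^+ 2 + (2 * k + d)%:R) `^ sg)%:C *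
    spectral_proj k (fourier_rho f tau) z.2 =
  (c0 * (pcoef u sg 0 k tau z - pcoef v sg (- (pi / 2)) k tau z)) +i*
  (c0 * (pcoef v sg 0 k tau z + pcoef u sg (- (pi / 2)) k tau z)).
Proof.
have [su sv bu bv] := test_bsupp.
have su0 s := slice_cost s tau su bu; have sv0 s := slice_cost s tau sv bv.
have ReE : (fun x => complex.Re (fourier_rho f tau x)) =
    fun x => c0 * (cost u 0 tau x + cost v (- (pi / 2)) tau x).
  by apply/funext => x; rewrite fourier_rhoE.
have ImE : (fun x => complex.Im (fourier_rho f tau x)) =
    fun x => c0 * (cost v 0 tau x + (-1) * cost u (- (pi / 2)) tau x).
  by apply/funext => x; rewrite fourier_rhoE mulN1r.
have s1 := sliceD (su0 0) (sv0 (- (pi / 2))).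
have s2 := sliceD (sv0 0) (sliceZ (-1) (su0 (- (pi / 2)))).
rewrite spectral_projE; [|by rewrite ReE; exact: sliceZ|by rewrite ImE; exact: sliceZ].
have p1 := ProjZ k z.2 c0 s1; have p2 := ProjZ k z.2 c0 s2.
rewrite /cProj ReE ImE p1 p2 (ProjD _ _ (su0 0) (sv0 _)) (ProjD _ _ (sv0 0) (sliceZ (-1) (su0 _))).
rewrite (ProjZ k z.2 (-1) (su0 (- (pi / 2)))) /pcoef !acoef_phase// !addr0 !cosBpihalf !sinBpihalf.
have gen1 (c s l e a b a' b' : R) : (c * l - s * 0) * (e * (a + b')) - (c * 0 + s * l) * (e * (a' + -1 * b)) =
    e * (l * (c * a + s * b) - l * (s * a' + - c * b')) by ring.
have gen2 (c s l e a b a' b' : R) : (c * l - s * 0) * (e * (a' + -1 * b)) + (c * 0 + s * l) * (e * (a + b')) =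
    e * (l * (c * a' + s * b') + l * (s * a + - c * b)) by ring.
by apply/eqP; rewrite eq_complex /= /lamb gen1 gen2 !eqxx.
Qed.

Lemma Hpar_powE z : Hpar_pow sg f z = hlim u sg z +i* hlim v sg z.
Proof.
have [su sv bu bv] := test_bsupp.
have iu s k := L1_pcoef sg d0 su bu s k z; have iv s k := L1_pcoef sg d0 sv bv s k z.
(* One factor belongs to the Fourier transform, the other to its inverse. *)
have c00 : c0 * c0 = (2 * pi)^-1.
  by rewrite /c0 -invfM -expr2 sqr_sqrtr// mulr_ge0 ?pi_ge0.
have E k : c0%:C * cintegral lam (fun tau => cis (z.1 * tau) * ((tau ^+ 2 + (2 * k + d)%:R) `^ sg)%:C *
    spectral_proj k (fourier_rho f tau) z.2) =
    ((2 * pi)^-1 * \int[lam]_tau pcoef u sg 0 k tau z) +i* ((2 * pi)^-1 * \int[lam]_tau pcoef v sg 0 k tau z).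
  rewrite /cintegral.
  have ReE tau := congr1 (@complex.Re R) (spectral_term k tau z).
  have ImE tau := congr1 (@complex.Im R) (spectral_term k tau z).
  rewrite (int_ext lam ReE) (int_ext lam ImE) /= !intZ; [|exact: L1D|exact: L1B].
  rewrite (intB (iu 0 k) (iv (- (pi / 2)) k)) (intD (iv 0 k) (iu (- (pi / 2)) k)).
  rewrite (int_pcoef_sin sg k z d0 sv bv) (int_pcoef_sin sg k z d0 su bu) subr0 addr0 -c00.
  by apply/eqP; rewrite eq_complex /=; apply/andP; split; apply/eqP; ring.
have ReS n (F : nat -> R[i]) : complex.Re (\sum_(0 <= k < n) F k) = \sum_(0 <= k < n) complex.Re (F k).
  by elim: n => [|n IH]; rewrite ?big_nil// !big_nat_recr//= -IH; case: (\sum_(0 <= _ < n) _) (F n) => ? ? [].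
have ImS n (F : nat -> R[i]) : complex.Im (\sum_(0 <= k < n) F k) = \sum_(0 <= k < n) complex.Im (F k).
  by elim: n => [|n IH]; rewrite ?big_nil// !big_nat_recr//= -IH; case: (\sum_(0 <= _ < n) _) (F n) => ? ? [].
rewrite /Hpar_pow /climn /hlim /hpart; congr (_ +i* _)%C; congr (limn _); apply/funext => n.
  by rewrite ReS; apply: eq_bigr => k _; rewrite E.
by rewrite ImS; apply: eq_bigr => k _; rewrite E.
Qed.

End complex_bump.
End spectral_formula.

Section Tonelli.
Context {d1 d2 : measure_display} {T1 : measurableType d1} {T2 : measurableType d2} {R : realType}.
Variables (m1 : {sigma_finite_measure set T1 -> \bar R})
          (m2 : {sigma_finite_measure set T2 -> \bar R}).
Variable F : T1 * T2 -> R.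
Hypotheses (mF : measurable_fun setT F) (F0 : forall x, 0 <= F x).

Let mE : measurable_fun setT (EFin \o F). Proof. exact/measurable_EFinP. Qed.

Lemma tonelli_measurable : measurable_fun setT (fun x => \int[m2]_y (F (x, y))%:E)%E.
Proof. by apply: (measurable_fun_fubini_tonelli_F _ mE) => x; rewrite lee_fin. Qed.

Lemma tonelli_measurable2 : measurable_fun setT (fun y => \int[m1]_x (F (x, y))%:E)%E.
Proof. by apply: (measurable_fun_fubini_tonelli_G _ mE) => x; rewrite lee_fin. Qed.

Lemma tonelli_swap : (\int[m1]_x \int[m2]_y (F (x, y))%:E = \int[m2]_y \int[m1]_x (F (x, y))%:E)%E.
Proof. by apply: (@fubini_tonelli _ _ _ _ _ m1 m2 (EFin \o F)) => // x; rewrite lee_fin. Qed.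

Lemma tonelli_prod : (\int[m1 \x m2]_z (F z)%:E = \int[m1]_x \int[m2]_y (F (x, y))%:E)%E.
Proof. by apply: (@fubini_tonelli1 _ _ _ _ _ m1 m2 (EFin \o F)) => // x; rewrite lee_fin. Qed.

End Tonelli.

Section nonneg_integrals.
Context {dd : measure_display} {T : measurableType dd} {R : realType}.
Variable mu : {measure set T -> \bar R}.

Lemma ge0_integral_scale (F : T -> \bar R) (c : R) : measurable_fun setT F -> (forall x, 0 <= F x)%E -> 0 <= c ->
  (\int[mu]_x (c%:E * F x) = c%:E * \int[mu]_x F x)%E.
Proof. by move=> mF F0 c0; rewrite ge0_integralZl_EFin. Qed.

Lemma ge0_le_int (F G : T -> \bar R) : measurable_fun setT F -> measurable_fun setT G ->
  (forall x, 0 <= F x)%E -> (forall x, F x <= G x)%E -> (\int[mu]_x F x <= \int[mu]_x G x)%E.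
Proof.
move=> mF mG F0 FG; apply: ge0_le_integral => // x _; exact: le_trans (F0 x) (FG x).
Qed.

End nonneg_integrals.

(** * Riesz potentials and the Stein-Weiss inequality *)

Section kernel.
Context {R : realType} {d : nat}.
Notation lam := (@lebesgue_measure R).
Notation MR := (measurableTypeR R).
Local Notation V := (R * 'rV[R]_d)%type.
Local Notation Z := (MR * d.-tuple MR)%type.
Local Notation mu := (@leb_prod R d).
Implicit Types (z w : V) (v : Z) (t s : R).
Local Notation n := (d.+1%:R : R).

Definition zsq w := w.1 ^+ 2 + sqnorm w.2.
(** The Euclidean norm, set to 1 at the origin: its real powers are then positive everywhere, as the
    weights in Hoelder's inequality have to be, and the origin is negligible. *)
Definition znorm1 w := if 0 < zsq w then znorm w else 1.
Definition kern al t w := tw al t * Gam t w.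

Lemma zsq_ge0 w : 0 <= zsq w.
Proof. by rewrite addr_ge0 ?sqr_ge0// sumr_ge0// => j _; rewrite sqr_ge0. Qed.

Lemma znorm1_gt0 w : 0 < znorm1 w.
Proof. by rewrite /znorm1; case: ifP => // h; rewrite sqrtr_gt0. Qed.

Lemma zsq_gt0 w : (0 < zsq w) = (w != 0).
Proof.
rewrite lt_def zsq_ge0 andbT; congr (~~ _); apply/eqP/eqP => [|->]; last first.
  by rewrite /zsq /sqnorm expr0n/= add0r big1// => j _; rewrite mxE expr0n.
case: w => a b /= /eqP; rewrite /zsq paddr_eq0 ?sqr_ge0//=; last by rewrite sumr_ge0// => j _; rewrite sqr_ge0.
rewrite sqrf_eq0 => /andP[/eqP-> /eqP h]; congr pair; apply/rowP => j; rewrite mxE.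
have /eqP := @psumr_eq0P _ _ predT (fun j => b 0 j ^+ 2) (fun j _ => sqr_ge0 (b 0 j)) h j isT.
by rewrite sqrf_eq0 => /eqP.
Qed.

Lemma GamE t w : Gam t w = (Num.sqrt pi * t) ^- d.+1 * expR (- zsq w / t ^+ 2).
Proof.
rewrite /Gam gaussE (eq_bigr _ (fun j _ => gaussE t (w.2 0 j))) big_split/= prodr_const card_ord.
rewrite -(big_morph _ (@expRD R) (@expR0 R)) mulrACA -expRD -exprS; congr (_ * expR _); last first.
  by rewrite -mulr_suml -mulrDl /zsq opprD /sqnorm sumrN.
by rewrite exprVn.
Qed.

Lemma kern_ge0 al t w : 0 <= kern al t w.
Proof.
rewrite /kern /tw; case: ifP => [t0|_]; last by rewrite mul0r.
by rewrite mulr_ge0 ?powR_ge0 ?Gam_ge0.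
Qed.

Lemma kern_le0 al t w : t <= 0 -> kern al t w = 0.
Proof. by move=> t0; rewrite /kern /tw ltNge t0 mul0r. Qed.

(* the powers t^-1 and powR t (-1) differ for negative t, where the kernel vanishes *)
Lemma kernE al t w : kern al t w =
  tw al t * ((Num.sqrt pi)^-1 * t `^ (-1)) ^+ d.+1 * expR (- zsq w * (t `^ (-1)) ^+ 2).
Proof.
rewrite /kern -mulrA /tw; case: ifP => t0; last by rewrite !mul0r.
by rewrite GamE powR_inv1 ?(ltW t0)// -invfM exprVn exprVn.
Qed.

Lemma measurable_kern {dd} {T : measurableType dd} al (f : T -> R) (g : T -> V) :
  measurable_fun setT f -> measurable_fun setT (fun x => zsq (g x)) ->
  measurable_fun setT (fun x => kern al (f x) (g x)).
Proof.
move=> mf mg; under eq_fun do rewrite kernE.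
have mp : measurable_fun setT (fun x => f x `^ (-1)) by exact: (measurableT_comp (measurable_powR_l (-1)) mf).
apply: measurable_funM.
  apply: measurable_funM; first exact: (measurableT_comp (@measurable_tw R al) mf).
  by apply: measurable_funX; apply: measurable_funM.
apply: (measurableT_comp (@measurable_expR R)); apply: measurable_funM; last exact: measurable_funX.
by apply: measurableT_comp.
Qed.

Lemma measurable_zsq_sub {dd} {T : measurableType dd} (g h : T -> Z) :
  measurable_fun setT g -> measurable_fun setT h ->
  measurable_fun setT (fun x => zsq (iota (g x) - iota (h x))).
Proof.
move=> mg mh; rewrite /zsq /sqnorm; apply: measurable_funD.
  apply: measurable_funX; apply: measurable_funB.
    by apply: (measurableT_comp _ mg); exact: measurable_fst.
  by apply: (measurableT_comp _ mh); exact: measurable_fst.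
apply: measurable_sum => j; apply: measurable_funX.
rewrite (_ : (fun _ => _) = fun x => (tnth (g x).2 j : R) - tnth (h x).2 j); last first.
  by apply/funext => x; rewrite !mxE.
apply: measurable_funB.
  apply: (measurableT_comp (measurable_tnth j)); apply: (measurableT_comp _ mg); exact: measurable_snd.
apply: (measurableT_comp (measurable_tnth j)); apply: (measurableT_comp _ mh); exact: measurable_snd.
Qed.

Definition ozero : Z := (0 : R, [tuple (0 : R) | j < d]).

Lemma iota_ozero : iota ozero = 0.
Proof. by congr pair; apply/rowP => j; rewrite !mxE tnth_mktuple. Qed.

Lemma measurable_zsq {dd} {T : measurableType dd} (g : T -> Z) :
  measurable_fun setT g -> measurable_fun setT (fun x => zsq (iota (g x))).
Proof.
move=> mg; have := measurable_zsq_sub mg (measurable_cst ozero).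
by under eq_fun do rewrite iota_ozero subr0.
Qed.

Lemma measurable_znorm1 : measurable_fun setT (fun v => znorm1 (iota v)).
Proof.
have mz := measurable_zsq (@measurable_id _ Z setT).
apply: measurable_fun_ifT.
- by apply: measurable_fun_ltr => //; exact: measurable_cst.
- apply: (measurableT_comp _ mz); apply: continuous_measurable_fun; exact: sqrt_continuous.
- exact: measurable_cst.
Qed.

Lemma zsq_e0 : zsq (e0 : V) = 1.
Proof. by rewrite /zsq /sqnorm /= expr1n big1 ?addr0// => j _; rewrite mxE expr0n. Qed.

Lemma Gam_radial t w : 0 < zsq w -> 0 < t ->
  Gam (znorm w * t) w = znorm w ^- d.+1 * Gam t (e0 : V).
Proof.
move=> w0 t0; have r0 : 0 < znorm w by rewrite sqrtr_gt0.
rewrite !GamE zsq_e0 [_ * t]mulrC mulrA exprMn invfM -mulrA mulrCA; congr (_ * (_ * expR _)).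
rewrite exprMn sqr_sqrtr ?(ltW w0)// -/(zsq w); field.
by rewrite !gt_eqF ?exprn_gt0.
Qed.

Lemma exp_inv_le m t : 0 < t -> t <= 1 -> expR (- t ^- 2) <= m`!%:R * t ^+ m.
Proof.
move=> t0 t1; have i0 : 0 <= t ^- 2 by rewrite invr_ge0 sqr_ge0.
have h := exprn_le_expR m i0.
rewrite expRN -[leLHS]mul1r ler_pdivrMr ?expR_gt0//.
apply: (@le_trans _ _ (t ^+ m * (m`!%:R * expR (t ^- 2)))); last by rewrite mulrCA mulrA.
apply: (le_trans _ (ler_wpM2l _ h)); last by rewrite exprn_ge0// ltW.
rewrite -exprMn expr2 invfM mulrA divff ?mul1r ?gt_eqF// -[leLHS](expr1n _ m).
by rewrite lerXn2r ?nnegrE ?invr_ge0 ?(ltW t0)// invf_ge1.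
Qed.

(** The integral of the Gaussians at a unit vector; rotation invariance and homogeneity reduce every
    other nonzero vector to it. *)
Definition cker ga := \int[lam]_t kern ga t (e0 : V).

(** Near 0 the factor exp(- 1 / t^2) absorbs the singular power t^(- d - 1). At infinity the
    integrand decays like t^(ga - d - 2), which is integrable because ga < d + 1. *)
Lemma L1_kern_e0 ga : 0 < ga -> ga < n -> L1 lam (fun t => kern ga t (e0 : V)).
Proof.
move=> g0 gn.
pose C := d.+1`!%:R : R; have C0 : 0 <= C by [].
have m : measurable_fun [set: R] (fun t => kern ga t (e0 : V)).
  by apply: measurable_kern; [exact: measurable_id|exact: measurable_cst].
pose c := (Num.sqrt pi) ^- d.+1 : R.
have c0 : 0 <= c by rewrite invr_ge0 exprn_ge0// sqrtr_ge0.
have E t : 0 < t -> kern ga t (e0 : V) = t `^ (ga - 1) * (c * t ^- d.+1 * expR (- t ^- 2)).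
  by move=> t0; rewrite /kern /tw t0 GamE zsq_e0 exprMn invfM mulN1r.
apply: (@L1_two_powers _ _ (c * C + c) ga (n - ga)) => //.
- by rewrite subr_gt0.
- by rewrite addr_ge0// mulr_ge0.
- by move=> t t0; rewrite kern_le0.
- move=> t /andP[t0 t1]; rewrite ger0_norm ?kern_ge0// E// mulrC ler_wpM2r ?powR_ge0//.
  apply: (@le_trans _ _ (c * C)); last by rewrite lerDl.
  rewrite -mulrA ler_wpM2l// mulrC ler_pdivrMr ?exprn_gt0//; exact: exp_inv_le.
- move=> t t1; have t0 : 0 < t by exact: lt_le_trans t1.
  rewrite ger0_norm ?kern_ge0// E//.
  have -> : - (n - ga) - 1 = (ga - 1) + - n by ring.
  rewrite (powRDp (ga - 1) (- n) t0) powR_invn ?(ltW t0)// [leRHS]mulrCA; apply: ler_wpM2l; first exact: powR_ge0.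
  rewrite mulrAC; apply: ler_wpM2r; first by rewrite invr_ge0 exprn_ge0// ltW.
  apply: (@le_trans _ _ c); last by rewrite lerDr mulr_ge0.
  by rewrite ler_piMr// -[leRHS]expR0 ler_expR oppr_le0 invr_ge0 sqr_ge0.
Qed.

Lemma cker_gt0 ga : 0 < ga -> ga < n -> 0 < cker ga.
Proof.
move=> g0 gn; pose N := `|ga - 1|.
pose e := 2 `^ (- N) * ((Num.sqrt pi * 2) ^- d.+1 * expR (-1)) : R.
have sp : 0 < Num.sqrt pi :> R by rewrite sqrtr_gt0 pi_gt0.
have ep : 0 < e by rewrite mulr_gt0 ?powR_gt0// mulr_gt0 ?expR_gt0// invr_gt0 exprn_gt0// mulr_gt0.
have [i1 i2] := @int_bx R 2^-1 (3 / 2) (ltac:(by [])).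
have h t : e * bx 2^-1 (t - 3 / 2) <= kern ga t (e0 : V).
  have [ht|ht] := leP `|t - 3 / 2| 2^-1; last first.
    rewrite /bx indicE memNset ?mulr0 ?kern_ge0//=.
    by rewrite in_itv/= -ler_norml; apply/negP; rewrite -ltNge.
  rewrite bx1// mulr1; move: ht; rewrite ler_norml => /andP[h1 h2].
  have t1 : 1 <= t by lra.
  have t2 : t <= 2 by lra.
  have t0 : 0 < t by lra.
  rewrite /kern GamE zsq_e0 /tw t0; apply: ler_pM.
  - exact: powR_ge0.
  - by rewrite mulr_ge0 ?expR_ge0// invr_ge0 exprn_ge0// mulr_ge0 ?sqrtr_ge0.
  - apply: (@le_trans _ _ (t `^ (- N))).
      rewrite !powRN lef_pV2 ?posrE ?powR_gt0//.
      apply: (ge0_ler_powR (normr_ge0 (ga - 1))) => //; rewrite nnegrE; exact: ltW.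
    apply: ler_powR => //; rewrite lerNl /N -normrN; exact: ler_norm.
  - apply: ler_pM; rewrite ?expR_ge0 ?invr_ge0 ?exprn_ge0 ?mulr_ge0 ?sqrtr_ge0//.
      rewrite lef_pV2 ?posrE ?exprn_gt0 ?mulr_gt0//.
      by rewrite lerXn2r ?nnegrE ?mulr_ge0 ?(ltW t0) ?(ltW sp)// ler_wpM2l// ltW.
    rewrite ler_expR mulN1r lerN2 invf_le1 ?exprn_gt0//; nra.
have := int_le (L1Z e i1) (L1_kern_e0 g0 gn) h.
rewrite intZ// i2 => h'; apply: lt_le_trans h'.
by rewrite mulr_gt0// divff.
Qed.

Lemma int_kern ga w : 0 < ga -> ga < n -> 0 < zsq w ->
  (\int[lam]_t (kern ga t w)%:E = (cker ga * znorm1 w `^ (ga - n))%:E)%E.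
Proof.
move=> g0 gn w0; have r0 : 0 < znorm w by rewrite sqrtr_gt0.
pose r := znorm w.
have m : measurable_fun [set: R] (fun t => (kern ga t w)%:E).
  by apply/measurable_EFinP; apply: measurable_kern; [exact: measurable_id|exact: measurable_cst].
have p t : (0 <= (kern ga t w)%:E)%E by rewrite lee_fin kern_ge0.
have h := ge0_integral_affine 0 (lt0r_neq0 r0) m p.
have E t : kern ga (znorm w * t + 0) w = r `^ (ga - 1) * r ^- d.+1 * kern ga t e0.
  rewrite addr0; have [t0|t0] := ltP 0 t; last first.
    by rewrite !kern_le0 ?mulr0// mulr_ge0_le0// ltW.
  by rewrite /kern Gam_radial// tw_scale//; rewrite -/r; ring.
have i := L1_kern_e0 g0 gn.
have : (\int[lam]_t (kern ga (znorm w * t + 0) w)%:E = (r `^ (ga - 1) * r ^- d.+1 * cker ga)%:E)%E.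
  by under eq_integral do rewrite E; rewrite -(intE (L1Z _ i)) intZ.
rewrite h => h2; move: (congr1 (fun a => (r%:E * a)%E) h2).
rewrite muleA -EFinM gtr0_norm// divff ?gt_eqF// mul1e => ->; rewrite -EFinM; congr EFin.
rewrite /znorm1 w0 -/r [RHS]mulrC mulrA; congr (_ * _).
have -> : ga - n = 1 + (ga - 1) + - n by ring.
by rewrite (powRDp (1 + (ga - 1)) (- n) r0) (powRDp 1 (ga - 1) r0) powRr1 ?(ltW r0)// powR_invn ?(ltW r0)// mulrA.
Qed.

(** At the origin the Gaussian is largest, so the value at a unit vector is still a lower bound
    there. An inequality without exception at the origin lets a power of the norm be replaced by the
    kernel under the integral. *)
Lemma int_kern_ge ga w : 0 < ga -> ga < n ->
  ((cker ga * znorm1 w `^ (ga - n))%:E <= \int[lam]_t (kern ga t w)%:E)%E.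
Proof.
move=> g0 gn; have [w0|w0] := ltP 0 (zsq w); first by rewrite int_kern.
have -> : znorm1 w = znorm1 (e0 : V) by rewrite /znorm1 ltNge w0/= /znorm zsq_e0 ltr01 -[X in Num.sqrt X]/(zsq e0) zsq_e0 sqrtr1.
rewrite -int_kern ?zsq_e0//; apply: ge0_le_int.
- by apply/measurable_EFinP; apply: measurable_kern; [exact: measurable_id|exact: measurable_cst].
- by apply/measurable_EFinP; apply: measurable_kern; [exact: measurable_id|exact: measurable_cst].
- by move=> t; rewrite lee_fin kern_ge0.
move=> t; rewrite lee_fin; have [t0|t0] := ltP 0 t; last by rewrite !kern_le0.
rewrite /kern ler_wpM2l ?tw_ge0// !GamE ler_wpM2l ?invr_ge0 ?exprn_ge0 ?mulr_ge0 ?sqrtr_ge0 ?(ltW t0)//.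
rewrite ler_expR ler_wpM2r ?invr_ge0 ?sqr_ge0// lerN2 zsq_e0 (le_trans w0)//.
Qed.

Lemma Gam_conv s t w : 0 < s -> 0 < t ->
  (\int[mu]_v (Gam t (w - iota v) * Gam s (iota v))%:E = (Gam (Num.sqrt (s ^+ 2 + t ^+ 2)) w)%:E)%E.
Proof.
move=> s0 t0; have [g1 g2] := gauss_conv w.1 s0 t0.
have [p1 p2] := prod_coords (fun j : 'I_d => (gauss_conv (w.2 0 j) s0 t0).2).
have E v : Gam t (w - iota v) * Gam s (iota v) =
    (gauss t (w.1 - v.1) * gauss s v.1) * \prod_(j < d) (gauss t (w.2 0 j - tnth v.2 j) * gauss s (tnth v.2 j)).
  rewrite Gam_iota /Gam mulrACA -big_split/=; congr (_ * _).
  by apply: eq_bigr => j _; rewrite mxE.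
under eq_integral do rewrite E.
rewrite -(intE (L1_tensor g2 p1)) (int_tensor g2 p1) g1 p2; congr EFin.
by rewrite /Gam; congr (_ * _); apply: eq_bigr => j _; have [] := gauss_conv (w.2 0 j) s0 t0.
Qed.

End kernel.

Lemma poweR_homo {R : realType} (r : R) (x y : \bar R) : 0 <= r -> (0 <= x)%E -> (x <= y)%E ->
  (x `^ r <= y `^ r)%E.
Proof.
move=> r0 x0 xy; apply: gt0_ler_poweR => //; rewrite in_itv/= ?x0 ?(le_trans x0 xy)/= leey//.
Qed.

Lemma mule_inv_inj {R : realType} (t : R) (a b : \bar R) : 0 < t ->
  ((t^-1)%:E * a = (`|t|^-1)%:E * b)%E -> b = a.
Proof.
move=> t0; rewrite gtr0_norm// => h; have := congr1 (fun a => (t%:E * a)%E) h.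
by rewrite !muleA -EFinM divff ?gt_eqF// !mul1e => ->.
Qed.

(** * Weighted Hoelder inequality and composition of Riesz potentials *)

Section weighted_hoelder.
Context {dd : measure_display} {T : measurableType dd} {R : realType}.
Variable mu : {measure set T -> \bar R}.
Variables (k m g : T -> R) (p : R).
Hypotheses (p1 : 1 < p) (mk : measurable_fun setT k) (mm : measurable_fun setT m) (mg : measurable_fun setT g).
Hypotheses (k0 : forall x, 0 <= k x) (m0 : forall x, 0 < m x) (g0 : forall x, 0 <= g x).

(** Hoelder with exponents q = p / (p - 1) and p, after the splitting of k g into (k m)^(1/q) and
    k^(1/p) m^(-1/q) g. This is the pointwise half of a Schur test with weight [m]. *)
Lemma hoelder_weight : ((\int[mu]_x (k x * g x)%:E) `^ p <=
  (\int[mu]_x (k x * m x)%:E) `^ (p - 1) * \int[mu]_x (k x * (m x `^ (1 - p) * g x `^ p))%:E)%E.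
Proof.
have p0 : 0 < p := lt_trans ltr01 p1.
have p10 : 0 < p - 1 by rewrite subr_gt0.
pose q := p / (p - 1); have q0 : 0 < q by rewrite divr_gt0.
have qV : q^-1 = 1 - p^-1 by rewrite /q invf_div mulrBl divff ?gt_eqF// mul1r.
pose f1 x := (k x * m x) `^ q^-1.
pose f2 x := k x `^ p^-1 * m x `^ (- q^-1) * g x.
have mp (f : T -> R) c : measurable_fun setT f -> measurable_fun setT (fun x => f x `^ c).
  by move=> mf; exact: (measurableT_comp (measurable_powR_l c) mf).
have m1 : measurable_fun setT f1 by apply: mp; exact: measurable_funM.
have m2 : measurable_fun setT f2.
  by apply: measurable_funM => //; apply: measurable_funM; exact: mp.
have pq : q^-1 + p^-1 = 1 by rewrite qV subrK.
have := hoelder mu m1 m2 q0 p0 pq; rewrite Lnorm1.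
have E x : `|((f1 \* f2)%R x)%:E|%E = (k x * g x)%:E.
  rewrite /= ger0_norm; last by rewrite !mulr_ge0 ?powR_ge0.
  congr EFin; rewrite /f1 /f2 powRM ?(ltW (m0 x))// mulrACA !mulrA.
  have [kx|kx] := eqVneq (k x) 0.
    by rewrite kx powR0 ?mul0r// invr_eq0 gt_eqF.
  have kp : 0 < k x by rewrite lt_def kx k0.
  have e1 : k x `^ q^-1 * k x `^ p^-1 = k x by rewrite -powRDp// pq powRr1.
  have e2 : m x `^ (- q^-1) * m x `^ q^-1 = 1 by rewrite -powRDp// addNr powRr0.
  by rewrite e1 -[k x * _ * _]mulrA e2 mulr1.
under eq_integral do rewrite E.
move=> H; have := poweR_homo (ltW p0) (integral_ge0 _ _) H.
rewrite poweRM ?Lnorm_ge0// poweR_Lnorm ?gt_eqF//.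
have -> : (Lnorm mu q%:E (EFin \o f1) `^ p = (\int[mu]_x (k x * m x)%:E) `^ (p - 1))%E.
  have {1}-> : p = q * (p - 1) by rewrite /q divfK// gt_eqF.
  rewrite poweRrM poweR_Lnorm ?gt_eqF//; congr (_ `^ _)%E; apply: eq_integral => x _ /=.
  rewrite ger0_norm ?powR_ge0// /f1 -powRrM mulVf ?gt_eqF// powRr1//.
  by rewrite mulr_ge0// ltW.
have -> : (\int[mu]_x (`|(EFin \o f2) x| `^ p) = \int[mu]_x (k x * (m x `^ (1 - p) * g x `^ p))%:E)%E.
  apply: eq_integral => x _ /=.
  rewrite ger0_norm ?mulr_ge0 ?powR_ge0// /f2 !powRM ?mulr_ge0 ?powR_ge0//.
  rewrite -!powRrM mulVf ?gt_eqF// powRr1// -mulrA; congr ((_ * (_ `^ _ * _))%:E).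
  rewrite qV; field; rewrite gt_eqF//.
by apply => x _; rewrite lee_fin mulr_ge0.
Qed.

End weighted_hoelder.

Section potential.
Context {R : realType} {d : nat}.
Notation lam := (@lebesgue_measure R).
Notation MR := (measurableTypeR R).
Local Notation V := (R * 'rV[R]_d)%type.
Local Notation Z := (MR * d.-tuple MR)%type.
Local Notation mu := (@leb_prod R d).
Local Notation n := (d.+1%:R : R).
Implicit Types (x v : Z) (t s : R).

Lemma measurable_znorm1_pow c : measurable_fun setT (fun v => znorm1 (iota v) `^ c).
Proof. exact: (measurableT_comp (measurable_powR_l c) (@measurable_znorm1 R d)). Qed.

Section composition.
Variables (al e : R).
Hypotheses (al0 : 0 < al) (ale : al < e) (en : e < n).
(** The order for which the power - e of the norm is, up to [cker ga], an integral of Gaussians. *)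
Let ga := n - e.
Let g0 : 0 < ga. Proof. by rewrite subr_gt0. Qed.
Let gn : ga < n. Proof. by rewrite ltrBlDr ltrDl (lt_trans al0). Qed.
Let ag0 : 0 < al + ga. Proof. exact: addr_gt0. Qed.
Let agn : al + ga < n. Proof. by rewrite addrCA gtrDl subr_lt0. Qed.

Let th s := Num.sqrt (1 + s ^+ 2).
Let th_gt0 s : 0 < th s. Proof. by rewrite sqrtr_gt0 ltr_pwDl// sqr_ge0. Qed.
Let th_powE s c : th s `^ c = (1 + s ^+ 2) `^ (c / 2).
Proof. by rewrite /th -powR12_sqrt ?addr_ge0 ?sqr_ge0// -powRrM mulrC. Qed.

Let measurable_th c : measurable_fun [set: R] (fun s => th s `^ c).
Proof.
under eq_fun do rewrite th_powE.
apply: (measurableT_comp (measurable_powR_l _)).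
by apply: measurable_funD; [exact: measurable_cst|exact: measurable_funX].
Qed.

(** The integrand of a Beta integral, of value B(ga / 2, al / 2) / 2: integrable near 0 because ga >
    0, and at infinity because al > 0. *)
Let w s := tw ga s * th s `^ (- (al + ga)).
Let L1_w : L1 lam w.
Proof.
apply: (@L1_two_powers _ w 1 ga al) => //.
- by apply: measurable_funM; [exact: measurable_tw|exact: measurable_th].
- by move=> t t0; rewrite /w /tw ltNge t0 mul0r.
- move=> t /andP[t0 _]; rewrite /w /tw t0 ger0_norm ?mulr_ge0 ?powR_ge0// mul1r ler_piMr ?powR_ge0//.
  rewrite powRN invf_le1 ?powR_gt0// -[leLHS](powRr0 (th t)); apply: ler_powR; last exact: ltW.
  by rewrite -[leLHS]sqrtr1 ler_sqrt ?lerDl ?sqr_ge0// addr_ge0// sqr_ge0.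
- move=> t t1; have t0 : 0 < t by exact: lt_le_trans t1.
  rewrite /w /tw t0 ger0_norm ?mulr_ge0 ?powR_ge0// mul1r.
  have -> : - al - 1 = (ga - 1) + - (al + ga) by ring.
  rewrite (powRDp (ga - 1) (- (al + ga)) t0) ler_wpM2l ?powR_ge0// !powRN lef_pV2 ?posrE ?powR_gt0//.
  apply: (ge0_ler_powR (ltW ag0)); rewrite ?nnegrE ?(ltW t0) ?(ltW (th_gt0 t))//.
  by rewrite -[leLHS](ger0_norm (ltW t0)) -sqrtr_sqr ler_sqrt ?lerDr// addr_ge0// sqr_ge0.
Qed.

Section at_point.
Variable x : Z.
Hypothesis x0 : 0 < zsq (iota x : V).
Let K t s v := kern al t (iota x - iota v) * kern ga s (iota v : V).

Let K0 t s v : 0 <= K t s v. Proof. by rewrite mulr_ge0 ?kern_ge0. Qed.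

Let mK : measurable_fun setT (fun p : (MR * Z) * MR => K p.1.1 p.2 p.1.2).
Proof.
have m1 : measurable_fun setT (fun p : (MR * Z) * MR => p.1.1).
  by apply: (measurableT_comp (measurable_fst : measurable_fun setT (fst : MR * Z -> MR))); exact: measurable_fst.
have m2 : measurable_fun setT (fun p : (MR * Z) * MR => p.1.2).
  by apply: (measurableT_comp (measurable_snd : measurable_fun setT (snd : MR * Z -> Z))); exact: measurable_fst.
apply: measurable_funM.
  by apply: measurable_kern => //; apply: measurable_zsq_sub => //; exact: measurable_cst.
by apply: measurable_kern; [exact: measurable_snd|exact: measurable_zsq].
Qed.

Let mK2 t : measurable_fun setT (fun p : Z * MR => K t p.2 p.1).
Proof.
have h : measurable_fun setT (fun p : Z * MR => ((t : MR, p.1), p.2)).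
  apply: measurable_fun_pair; last exact: measurable_snd.
  by apply: measurable_fun_pair; [exact: measurable_cst|exact: measurable_fst].
exact: (measurableT_comp mK h).
Qed.

Let intK t s : (\int[mu]_v (K t s v)%:E = (tw al t * tw ga s * Gam (Num.sqrt (s ^+ 2 + t ^+ 2)) (iota x : V))%:E)%E.
Proof.
have [t0|t0] := ltP 0 t; last first.
  rewrite (_ : tw al t = 0) ?mul0r; last by rewrite /tw ltNge t0.
  by rewrite integral0_eq// => v _; rewrite /K kern_le0// mul0r.
have [s0|s0] := ltP 0 s; last first.
  rewrite (_ : tw ga s = 0) ?mulr0 ?mul0r; last by rewrite /tw ltNge s0.
  by rewrite integral0_eq// => v _; rewrite /K [kern ga _ _]kern_le0// mulr0.
have mG : measurable_fun setT (fun v : Z => (Gam t (iota x - iota v) * Gam s (iota v : V))%:E).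
  have e1 v : Gam t (iota x - iota v) * Gam s (iota v : V) = (tw al t)^-1 * (tw ga s)^-1 * K t s v.
    by rewrite /K /kern /tw t0 s0; field; rewrite !gt_eqF ?powR_gt0.
  under eq_fun do rewrite e1; apply/measurable_EFinP; apply: measurable_funM; first exact: measurable_cst.
  have h : measurable_fun setT (fun v : Z => (v, s : MR)) by apply: measurable_fun_pair; [exact: measurable_id|exact: measurable_cst].
  exact: (measurableT_comp (mK2 t) h).
transitivity (\int[mu]_v ((tw al t * tw ga s)%:E * (Gam t (iota x - iota v) * Gam s (iota v : V))%:E))%E.
  by apply: eq_integral => v _; rewrite -EFinM /K /kern mulrACA.
rewrite ge0_integral_scale ?mulr_ge0 ?tw_ge0//; last by move=> v; rewrite lee_fin mulr_ge0 ?Gam_ge0.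
by rewrite Gam_conv// -EFinM.
Qed.

Let G t s := tw ga s * th s `^ (1 - (al + ga)) * kern (al + ga) (th s * t) (iota x : V).
Let G0 t s : 0 <= G t s.
Proof. by rewrite /G mulr_ge0 ?kern_ge0// mulr_ge0 ?powR_ge0// tw_ge0. Qed.

Let mG : measurable_fun setT (fun p : MR * MR => G p.1 p.2).
Proof.
apply: measurable_funM.
  have h : measurable_fun [set: R] (fun s => tw ga s * th s `^ (1 - (al + ga))).
    by apply: measurable_funM; [exact: measurable_tw|exact: measurable_th].
  exact: (measurableT_comp h (measurable_snd : measurable_fun setT (snd : MR * MR -> MR))).
apply: measurable_kern; last exact: measurable_cst.
apply: measurable_funM; last exact: measurable_fst.
have h := measurableT_comp (measurable_th 1) (measurable_snd : measurable_fun setT (snd : MR * MR -> MR)).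
by move: h; congr measurable_fun; apply/funext => s /=; rewrite powRr1// ltW.
Qed.

(* the substitution s = t * s' makes the two scales comparable *)
Let int_KG t : (\int[lam]_s \int[mu]_v (K t s v)%:E = \int[lam]_s (G t s)%:E)%E.
Proof.
under eq_integral do rewrite intK.
have [t0|t0] := ltP 0 t; last first.
  rewrite !integral0_eq// => s _.
    by rewrite /G kern_le0 ?mulr0// mulr_ge0_le0// ltW.
  by rewrite /tw ltNge t0 !mul0r.
have mF : measurable_fun [set: R] (fun s => (tw al t * tw ga s * Gam (Num.sqrt (s ^+ 2 + t ^+ 2)) (iota x : V))%:E).
  have := @tonelli_measurable2 _ _ _ _ _ (@zleb R d) (fun p : Z * MR => K t p.2 p.1) (mK2 t) (fun p => K0 t p.2 p.1).
  by congr measurable_fun; apply/funext => s /=; exact: intK.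
have F0 s : (0 <= (tw al t * tw ga s * Gam (Num.sqrt (s ^+ 2 + t ^+ 2)) (iota x : V))%:E)%E.
  have q0 : 0 < Num.sqrt (s ^+ 2 + t ^+ 2) by rewrite sqrtr_gt0 ltr_wpDl ?sqr_ge0 ?exprn_gt0.
  by rewrite lee_fin mulr_ge0 ?Gam_ge0// mulr_ge0 ?tw_ge0.
have h := ge0_integral_affine 0 (lt0r_neq0 t0) mF F0.
have E s : ((tw al t * tw ga (t * s + 0) * Gam (Num.sqrt ((t * s + 0) ^+ 2 + t ^+ 2)) (iota x : V))%:E =
    (t^-1)%:E * (G t s)%:E)%E.
  rewrite addr0 -EFinM; congr EFin; rewrite tw_scale//.
  have -> : Num.sqrt ((t * s) ^+ 2 + t ^+ 2) = th s * t.
    have -> : (t * s) ^+ 2 + t ^+ 2 = (1 + s ^+ 2) * t ^+ 2 by ring.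
    by rewrite sqrtrM ?addr_ge0 ?sqr_ge0// sqrtr_sqr gtr0_norm.
  have p := th_gt0 s; have q : 0 < th s `^ (al + ga - 1) by rewrite powR_gt0.
  rewrite /G /kern tw_scale// {1 4}/tw t0.
  have -> : 1 - (al + ga) = - (al + ga - 1) by ring.
  rewrite powRN.
  have -> : al + ga - 1 = 1 + (al - 1) + (ga - 1) by ring.
  rewrite (powRDp (1 + (al - 1)) (ga - 1) t0) (powRDp 1 (al - 1) t0) powRr1 ?(ltW t0)//.
  have q' : 0 < th s `^ (1 + (al - 1) + (ga - 1)) by rewrite powR_gt0.
  by field; rewrite !gt_eqF.
have e1 : (\int[lam]_s ((t^-1)%:E * (G t s)%:E) = \int[lam]_s (tw al t * tw ga (t * s + 0) *
    Gam (Num.sqrt ((t * s + 0) ^+ 2 + t ^+ 2)) (iota x : V))%:E)%E by apply: eq_integral => s _; rewrite E.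
have mt : measurable_fun setT (fun s : MR => (t : MR, s)).
  by apply: measurable_fun_pair; [exact: measurable_cst|exact: measurable_id].
have mGt : measurable_fun setT (fun s : MR => (G t s)%:E).
  by apply/measurable_EFinP; exact: (measurableT_comp mG mt).
have ti0 : 0 <= t^-1 by rewrite invr_ge0 ltW.
have Gt0 s : (0 <= (G t s)%:E)%E by rewrite lee_fin.
exact: (mule_inv_inj t0 (etrans (esym (@ge0_integral_scale _ _ _ lam _ _ mGt Gt0 ti0)) (etrans e1 h))).
Qed.

Let int_G s : (\int[lam]_t (G t s)%:E = (w s * (@cker R d (al + ga) * znorm1 (iota x : V) `^ (al - e)))%:E)%E.
Proof.
have p := th_gt0 s.
have mF : measurable_fun [set: R] (fun t => (kern (al + ga) t (iota x : V))%:E).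
  by apply/measurable_EFinP; apply: measurable_kern; [exact: measurable_id|exact: measurable_cst].
have h := ge0_integral_affine 0 (lt0r_neq0 p) mF (fun t => kern_ge0 _ _ _).
have c0 : 0 <= tw ga s * th s `^ (1 - (al + ga)) by rewrite mulr_ge0 ?tw_ge0 ?powR_ge0.
transitivity (\int[lam]_t ((tw ga s * th s `^ (1 - (al + ga)))%:E * (kern (al + ga) (th s * t + 0) (iota x : V))%:E))%E.
  by apply: eq_integral => t _; rewrite -EFinM addr0.
rewrite ge0_integral_scale//; last 2 first.
- apply/measurable_EFinP; apply: measurable_kern; last exact: measurable_cst.
  exact: measurable_affine.
- by move=> t; rewrite lee_fin kern_ge0.
rewrite h int_kern// gtr0_norm// -!EFinM; congr EFin.
have -> : al + ga - n = al - e by rewrite /ga; ring.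
rewrite (powRDp 1 (- (al + ga)) p) powRr1 ?(ltW p)// /w; field; rewrite gt_eqF//.
Qed.

(** The composition law with the two widths integrated last. After rescaling, the convolution of the
    Gaussians has width (1 + s^2)^(1/2) t; substituting it for t separates the two integrals. *)
Lemma int_kern_comp :
  (\int[lam]_t \int[mu]_v \int[lam]_s (K t s v)%:E =
   ((\int[lam]_s w s) * (@cker R d (al + ga) * znorm1 (iota x : V) `^ (al - e)))%:E)%E.
Proof.
transitivity (\int[lam]_t \int[lam]_s (G t s)%:E)%E.
  apply: eq_integral => t _; rewrite -int_KG.
  exact: (@tonelli_swap _ _ _ _ _ (@zleb R d) lam (fun p : Z * MR => K t p.2 p.1) (mK2 t) (fun p => K0 t p.2 p.1)).
rewrite (@tonelli_swap _ _ _ _ _ lam lam (fun p : MR * MR => G p.1 p.2) mG (fun p => G0 p.1 p.2)) /=.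
under eq_integral do rewrite int_G mulrC.
by rewrite -(intE (L1Z _ L1_w)) intZ// mulrC.
Qed.

Lemma kern_potential_at :
  ((@cker R d ga)%:E * \int[lam]_t \int[mu]_v (kern al t (iota x - iota v) * znorm1 (iota v : V) `^ (- e))%:E <=
   ((\int[lam]_s w s) * (@cker R d (al + ga) * znorm1 (iota x : V) `^ (al - e)))%:E)%E.
Proof.
rewrite -int_kern_comp.
have mh : measurable_fun setT (fun p : MR * Z => kern al p.1 (iota x - iota p.2) * znorm1 (iota p.2 : V) `^ (- e)).
  apply: measurable_funM.
    by apply: measurable_kern; [exact: measurable_fst|apply: measurable_zsq_sub; [exact: measurable_cst|exact: measurable_snd]].
  by apply: (measurableT_comp (measurable_znorm1_pow (- e))); exact: measurable_snd.
have h0 (p : MR * Z) : 0 <= kern al p.1 (iota x - iota p.2) * znorm1 (iota p.2 : V) `^ (- e).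
  by rewrite mulr_ge0 ?kern_ge0 ?powR_ge0.
have c0 := ltW (@cker_gt0 R d _ g0 gn).
have mI := @tonelli_measurable _ _ _ _ _ (@zleb R d) _ mh h0.
have I0 t : (0 <= \int[mu]_v (kern al t (iota x - iota v) * znorm1 (iota v : V) `^ (- e))%:E)%E.
  by apply: integral_ge0 => v _; rewrite lee_fin; exact: (h0 (t, v)).
have mS := @tonelli_measurable _ _ _ _ _ lam _ mK (fun p => K0 p.1.1 p.2 p.1.2).
have S0 (p : MR * Z) : (0 <= \int[lam]_s (K p.1 s p.2)%:E)%E by apply: integral_ge0 => s _; rewrite lee_fin.
rewrite -ge0_integral_scale//; apply: ge0_le_int.
- exact: measurable_funeM.
- by apply: (@measurable_fun_fubini_tonelli_F _ _ _ _ _ (@zleb R d) (fun p : MR * Z => \int[lam]_s (K p.1 s p.2)%:E)%E).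
- by move=> t; rewrite mule_ge0.
move=> t; have mv : measurable_fun setT (fun v : Z => (t : MR, v)).
  by apply: measurable_fun_pair; [exact: measurable_cst|exact: measurable_id].
have mhv : measurable_fun setT (fun v : Z => (kern al t (iota x - iota v) * znorm1 (iota v : V) `^ (- e))%:E).
  by apply/measurable_EFinP; exact: (measurableT_comp mh mv).
rewrite -ge0_integral_scale//; last by move=> v; rewrite lee_fin; exact: (h0 (t, v)).
apply: ge0_le_int.
- exact: measurable_funeM.
- exact: (measurableT_comp mS mv).
- by move=> v; rewrite mule_ge0// lee_fin; exact: (h0 (t, v)).
move=> v; rewrite -EFinM mulrCA.
have -> : (\int[lam]_s (K t s v)%:E = (kern al t (iota x - iota v))%:E * \int[lam]_s (kern ga s (iota v : V))%:E)%E.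
  rewrite -ge0_integral_scale ?kern_ge0//; last by move=> s; rewrite lee_fin kern_ge0.
  by apply/measurable_EFinP; apply: measurable_kern; [exact: measurable_id|exact: measurable_cst].
rewrite EFinM lee_wpmul2l ?lee_fin ?kern_ge0//.
have := int_kern_ge (iota v : V) g0 gn; rewrite (_ : ga - n = - e)// /ga; ring.
Qed.

End at_point.
End composition.
End potential.

Lemma tonelli_scale {d1 d2 : measure_display} {T1 : measurableType d1} {T2 : measurableType d2} {R : realType}
    (m1 : {measure set T1 -> \bar R}) (m2 : {sigma_finite_measure set T2 -> \bar R}) (F : T1 * T2 -> R) (c : R) :
  measurable_fun setT F -> (forall q, 0 <= F q) -> 0 <= c ->
  (\int[m1]_x \int[m2]_y (c * F (x, y))%:E = c%:E * \int[m1]_x \int[m2]_y (F (x, y))%:E)%E.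
Proof.
move=> mF F0 c0; rewrite -ge0_integral_scale//; last 2 first.
- exact: tonelli_measurable.
- by move=> x; apply: integral_ge0 => y _; rewrite lee_fin.
apply: eq_integral => x _; rewrite -ge0_integral_scale//; last by move=> y; rewrite lee_fin.
have h : measurable_fun setT (fun y : T2 => (x, y)).
  by apply: measurable_fun_pair; [exact: measurable_cst|exact: measurable_id].
by apply/measurable_EFinP; exact: (measurableT_comp mF h).
Qed.

(** * The Stein-Weiss inequality *)

Section Stein_Weiss.
Context {R : realType} {d : nat}.
Notation lam := (@lebesgue_measure R).
Notation MR := (measurableTypeR R).
Local Notation V := (R * 'rV[R]_d)%type.
Local Notation Z := (MR * d.-tuple MR)%type.
Local Notation mu := (@leb_prod R d).
Local Notation n := (d.+1%:R : R).
Implicit Types (x v : Z) (t s : R).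

Lemma kern_potential (al e : R) : 0 < al -> al < e -> e < n ->
  exists2 A : R, 0 < A & forall x, 0 < zsq (iota x : V) ->
  (\int[lam]_t \int[mu]_v (kern al t (iota x - iota v) * znorm1 (iota v : V) `^ (- e))%:E <=
   (A * znorm1 (iota x : V) `^ (al - e))%:E)%E.
Proof.
move=> al0 ale en; pose ga := n - e.
have g0 : 0 < ga by rewrite subr_gt0.
have gn : ga < n by rewrite ltrBlDr ltrDl (lt_trans al0).
have c0 := @cker_gt0 R d _ g0 gn.
pose B := (\int[lam]_s (tw ga s * Num.sqrt (1 + s ^+ 2) `^ (- (al + ga)))) * @cker R d (al + ga).
(* The absolute value and the added 1 make the constant positive without computing [B]. *)
exists ((@cker R d ga)^-1 * `|B| + 1); first by rewrite ltr_wpDl// mulr_ge0// invr_ge0 ltW.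
move=> x x0; have := kern_potential_at al0 ale en x0; rewrite -/ga mulrA -/B.
set I := (X in (_ * X <= _)%E) => h.
have I0 : (0 <= I)%E.
  apply: integral_ge0 => t _; apply: integral_ge0 => v _.
  by rewrite lee_fin mulr_ge0 ?kern_ge0 ?powR_ge0.
rewrite -(@lee_pmul2l _ (@cker R d ga)%:E) ?lte_fin//.
apply: (le_trans h); rewrite -EFinM lee_fin mulrA ler_wpM2r ?powR_ge0//.
rewrite mulrDr mulr1 mulVKf ?gt_eqF//; rewrite (le_trans (ler_norm B))// lerDl ltW//.
Qed.

Lemma measurable_kern_at al x : measurable_fun setT (fun p : MR * Z => kern al p.1 (iota x - iota p.2)).
Proof.
by apply: measurable_kern; [exact: measurable_fst|apply: measurable_zsq_sub; [exact: measurable_cst|exact: measurable_snd]].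
Qed.

Lemma negligible_origin : {ae mu, forall v, 0 < zsq (iota v : V)}.
Proof.
exists ([set 0 : MR] `*` setT); split.
- by apply: measurableX => //; exact: measurable_set1.
- have h := @product_measure1E _ _ _ _ _ lam (tuple_measure lam d) [set 0] setT (measurable_set1 _) measurableT.
  have l0 : lam [set 0] = 0%E by exact: lebesgue_measure_set1.
  by apply: (etrans h); rewrite /= l0 mul0e.
- move=> v /= h; split => //=; apply: contrapT => v1; apply: h.
  by rewrite ltr_pwDl// ?exprn_even_gt0//=; [apply/eqP|rewrite sumr_ge0// => j _; rewrite sqr_ge0].
Qed.

Section weighted.
Variables (p al c : R).
Hypotheses (p1 : 1 < p) (al0 : 0 < al) (alc : al < c) (cn : c < n) (c2 : al + c * (p - 1) < n).
(** The Schur test uses the weight |v|^(- c) in Hoelder's inequality and, once the integrals are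
    exchanged, the potential of |x|^(- e2). Both exponents have to lie strictly between al and d + 1
    for [kern_potential] to apply. *)
Let e2 := al + c * (p - 1).
Let p0 : 0 < p. Proof. exact: lt_trans p1. Qed.
Let p10 : 0 < p - 1. Proof. by rewrite subr_gt0. Qed.
Let c0 : 0 < c. Proof. exact: lt_trans alc. Qed.
Let ale2 : al < e2. Proof. by rewrite ltrDl mulr_gt0. Qed.

Variables (U g : Z -> R).
Hypotheses (mU : measurable_fun setT U) (mg : measurable_fun setT g).
Hypotheses (U0 : forall x, 0 <= U x) (g0 : forall x, 0 <= g x).
Hypothesis Ug : forall x, ((U x)%:E <= \int[lam]_t \int[mu]_v (kern al t (iota x - iota v) * g v)%:E)%E.

Let N v := znorm1 (iota v : V).
Let W v := N v `^ (c * (p - 1)) * g v `^ p.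
Let mpow (f : Z -> R) a : measurable_fun setT f -> measurable_fun setT (fun v => f v `^ a).
Proof. by move=> mf; exact: (measurableT_comp (measurable_powR_l a) mf). Qed.
Let mN a : measurable_fun setT (fun v => N v `^ a). Proof. exact: measurable_znorm1_pow. Qed.
Let mW : measurable_fun setT W. Proof. by apply: measurable_funM => //; exact: mpow. Qed.
Let W0 v : 0 <= W v. Proof. by rewrite mulr_ge0 ?powR_ge0. Qed.

(** Hoelder's inequality is applied on the product of widths and positions at once, with [kern] as
    the density, so that the Riesz kernel need not be formed first. The powers of |x| combine to the
    exponent - e2. *)
Let pointwise A x : 0 <= A -> 0 < zsq (iota x : V) ->
  (\int[lam]_t \int[mu]_v (kern al t (iota x - iota v) * N v `^ (- c))%:E <= (A * N x `^ (al - c))%:E)%E ->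
  (((N x `^ (- al) * U x) `^ p)%:E <=
  (A `^ (p - 1) * N x `^ (- e2))%:E * \int[lam]_t \int[mu]_v (kern al t (iota x - iota v) * W v)%:E)%E.
Proof.
move=> A0 x0 hA; have Np : 0 < N x by exact: znorm1_gt0.
pose k (q : MR * Z) := kern al q.1 (iota x - iota q.2).
have mk : measurable_fun setT k by exact: measurable_kern_at.
have k0 q : 0 <= k q by exact: kern_ge0.
have m2 (f : Z -> R) : measurable_fun setT f -> measurable_fun setT (fun q : MR * Z => f q.2).
  by move=> mf; apply: (measurableT_comp mf); exact: measurable_snd.
have tp (f : Z -> R) : measurable_fun setT f -> (forall v, 0 <= f v) ->
    (\int[lam \x @zleb R d]_q (k q * f q.2)%:E = \int[lam]_t \int[mu]_v (kern al t (iota x - iota v) * f v)%:E)%E.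
  move=> mf f0; apply: (@tonelli_prod _ _ _ _ _ lam (@zleb R d) (fun q : MR * Z => k q * f q.2)).
    by apply: measurable_funM => //; exact: m2.
  by move=> q; rewrite mulr_ge0.
have mp0 v : 0 < N v `^ (- c) by rewrite powR_gt0// znorm1_gt0.
have h := @hoelder_weight _ _ _ (lam \x @zleb R d)%E k (fun q : MR * Z => N q.2 `^ (- c)) (fun q : MR * Z => g q.2) p
  p1 mk (m2 _ (mN _)) (m2 _ mg) k0 (fun q => mp0 q.2) (fun q => g0 q.2).
have e3 : (\int[lam \x @zleb R d]_q (k q * ((N q.2 `^ (- c)) `^ (1 - p) * g q.2 `^ p))%:E =
    \int[lam]_t \int[mu]_v (kern al t (iota x - iota v) * W v)%:E)%E.
  rewrite -(tp W mW W0); apply: eq_integral => q _; rewrite -powRrM /W.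
  by congr ((_ * (_ `^ _ * _))%:E); ring.
rewrite e3 (tp g mg g0) (tp (fun v => N v `^ (- c)) (mN _) (fun v => powR_ge0 _ _)) in h.
set I := (X in (_ <= _ * X)%E) in h *.
have I0 : (0 <= I)%E.
  apply: integral_ge0 => t _; apply: integral_ge0 => v _.
  by rewrite lee_fin mulr_ge0 ?kern_ge0.
have hU : ((U x `^ p)%:E <= ((A * N x `^ (al - c)) `^ (p - 1))%:E * I)%E.
  rewrite -poweR_EFin; apply: (le_trans (poweR_homo (ltW p0) _ (Ug x))); first by rewrite lee_fin.
  apply: (le_trans h); apply: lee_wpmul2r => //; rewrite -poweR_EFin.
  apply: poweR_homo; [exact: ltW| |exact: hA].
  apply: integral_ge0 => t _; apply: integral_ge0 => v _.
  by rewrite lee_fin mulr_ge0 ?kern_ge0 ?powR_ge0.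
rewrite powRM ?powR_ge0// EFinM.
apply: (@le_trans _ _ (((N x `^ (- al)) `^ p)%:E * (((A * N x `^ (al - c)) `^ (p - 1))%:E * I))%E).
  by apply: lee_wpmul2l => //; rewrite lee_fin powR_ge0.
rewrite muleA -EFinM powRM ?powR_ge0// -!powRrM mulrCA -powRDp//.
have -> : - al * p + (al - c) * (p - 1) = - e2 by rewrite /e2; ring.
by [].
Qed.

Let H x t v := N x `^ (- e2) * (kern al t (iota x - iota v) * W v).
Let H0 x t v : 0 <= H x t v.
Proof. by rewrite mulr_ge0 ?powR_ge0// mulr_ge0 ?kern_ge0. Qed.
Let mH {dd} {T : measurableType dd} (a : T -> Z) (b : T -> MR) (f : T -> Z) :
  measurable_fun setT a -> measurable_fun setT b -> measurable_fun setT f ->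
  measurable_fun setT (fun q => H (a q) (b q) (f q)).
Proof.
move=> ma mb mf; apply: measurable_funM; first exact: (measurableT_comp (mN (- e2)) ma).
apply: measurable_funM; last exact: (measurableT_comp mW mf).
by apply: measurable_kern => //; exact: measurable_zsq_sub.
Qed.
Let m11 {a b c'} {T1 : measurableType a} {T2 : measurableType b} {T3 : measurableType c'} :
  measurable_fun setT (fun q : (T1 * T2) * T3 => q.1.1).
Proof. by apply: (measurableT_comp (measurable_fst : measurable_fun setT (fst : T1 * T2 -> T1))); exact: measurable_fst. Qed.
Let m12 {a b c'} {T1 : measurableType a} {T2 : measurableType b} {T3 : measurableType c'} :
  measurable_fun setT (fun q : (T1 * T2) * T3 => q.1.2).
Proof. by apply: (measurableT_comp (measurable_snd : measurable_fun setT (snd : T1 * T2 -> T2))); exact: measurable_fst. Qed.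

Let f1 (q : Z * MR) := (\int[mu]_v (H q.1 q.2 v)%:E)%E.
Let f2 (q : MR * Z) := (\int[mu]_x (H x q.1 q.2)%:E)%E.
Let mf1 : measurable_fun setT f1.
Proof.
exact: (@tonelli_measurable _ _ _ _ _ (@zleb R d) (fun q : (Z * MR) * Z => H q.1.1 q.1.2 q.2)
  (mH m11 m12 measurable_snd) (fun q => H0 _ _ _)).
Qed.
Let mf2 : measurable_fun setT f2.
Proof.
exact: (@tonelli_measurable _ _ _ _ _ (@zleb R d) (fun q : (MR * Z) * Z => H q.2 q.1.1 q.1.2)
  (mH measurable_snd m11 m12) (fun q => H0 _ _ _)).
Qed.
Let f10 q : (0 <= f1 q)%E. Proof. by apply: integral_ge0 => v _; rewrite lee_fin. Qed.
Let f20 q : (0 <= f2 q)%E. Proof. by apply: integral_ge0 => v _; rewrite lee_fin. Qed.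

Let swap_all : (\int[mu]_x \int[lam]_t \int[mu]_v (H x t v)%:E =
  \int[mu]_v \int[lam]_t \int[mu]_x (H x t v)%:E)%E.
Proof.
transitivity (\int[lam]_t \int[mu]_x f1 (x, t))%E.
  exact: (@fubini_tonelli _ _ _ _ _ (@zleb R d) lam f1 mf1 f10).
transitivity (\int[lam]_t \int[mu]_v f2 (t, v))%E; last first.
  exact: (@fubini_tonelli _ _ _ _ _ lam (@zleb R d) f2 mf2 f20).
apply: eq_integral => t _.
exact: (@tonelli_swap _ _ _ _ _ (@zleb R d) (@zleb R d) (fun q : Z * Z => H q.1 t q.2)
  (mH measurable_fst (measurable_cst _) measurable_snd) (fun q => H0 _ _ _)).
Qed.

(** The second half of the Schur test: the pointwise bound is integrated in x, the integral in x is
    moved innermost, and the bound for the exponent [e2] is used there. *)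
Lemma Stein_Weiss_weighted A1 A2 : 0 <= A1 -> 0 <= A2 ->
  (forall x, 0 < zsq (iota x : V) ->
    (\int[lam]_t \int[mu]_v (kern al t (iota x - iota v) * N v `^ (- c))%:E <= (A1 * N x `^ (al - c))%:E)%E) ->
  (forall x, 0 < zsq (iota x : V) ->
    (\int[lam]_t \int[mu]_v (kern al t (iota x - iota v) * N v `^ (- e2))%:E <= (A2 * N x `^ (al - e2))%:E)%E) ->
  (\int[mu]_x ((znorm (iota x : V) `^ (- al) * U x) `^ p)%:E <=
   (A1 `^ (p - 1) * A2)%:E * \int[mu]_v (g v `^ p)%:E)%E.
Proof.
move=> A10 A20 h1 h2.
have mF : measurable_fun setT (fun x => \int[lam]_t \int[mu]_v (H x t v)%:E)%E.
  exact: (@measurable_fun_fubini_tonelli_F _ _ _ _ _ lam f1 mf1 f10).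
have F0 x : (0 <= \int[lam]_t \int[mu]_v (H x t v)%:E)%E.
  by apply: integral_ge0 => t _; exact: (f10 (x, t)).
have mL : measurable_fun setT (fun x => ((znorm (iota x : V) `^ (- al) * U x) `^ p)%:E).
  have ms : measurable_fun [set: R] (@Num.sqrt R) by apply: continuous_measurable_fun; exact: sqrt_continuous.
  have mz : measurable_fun setT (fun x : Z => znorm (iota x : V)).
    exact: (measurableT_comp ms (measurable_zsq (@measurable_id _ Z setT))).
  apply/measurable_EFinP; exact: (mpow p (measurable_funM (mpow (- al) mz) mU)).
have q0 : 0 <= A1 `^ (p - 1) := powR_ge0 _ _.
apply: (@le_trans _ _ ((A1 `^ (p - 1))%:E * \int[mu]_x \int[lam]_t \int[mu]_v (H x t v)%:E)%E).
  rewrite -(ge0_integral_scale mu mF F0 q0); apply: ge0_le_int.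
  - exact: mL.
  - exact: measurable_funeM.
  - by move=> x; rewrite lee_fin powR_ge0.
  (* At the origin the norm is 0 and a negative real power of 0 is 0 by convention, so the left side
     vanishes. *)
  move=> x; have [x0|x0] := ltP 0 (zsq (iota x : V)); last first.
    have -> : znorm (iota x : V) = 0.
      by rewrite /znorm -/(zsq (iota x : V)) (le_anti (introT andP (conj x0 (zsq_ge0 _)))) sqrtr0.
    have nal : - al != 0 by rewrite oppr_eq0 gt_eqF.
    have pn0 : p != 0 by rewrite gt_eqF.
    by rewrite (powR0 nal) mul0r (powR0 pn0); apply: mule_ge0; [rewrite lee_fin|exact: F0].
  have -> : znorm (iota x : V) = N x by rewrite /N /znorm1 x0.
  apply: (le_trans (pointwise A10 x0 (h1 x x0))); rewrite EFinM -muleA.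
  apply: lee_wpmul2l; first by rewrite lee_fin.
  have mk1 : measurable_fun setT (fun q : MR * Z => kern al q.1 (iota x - iota q.2) * W q.2).
    apply: measurable_funM; first exact: measurable_kern_at.
    by apply: (measurableT_comp mW); exact: measurable_snd.
  have k10 (q : MR * Z) : 0 <= kern al q.1 (iota x - iota q.2) * W q.2 by rewrite mulr_ge0 ?kern_ge0.
  have h := @tonelli_scale _ _ _ _ _ lam (@zleb R d) _ (N x `^ (- e2)) mk1 k10 (powR_ge0 _ _).
  by rewrite le_eqVlt; apply/orP; left; apply/eqP; exact: (esym h).
rewrite swap_all EFinM -muleA; apply: lee_wpmul2l; first by rewrite lee_fin.
have mgp : measurable_fun setT (fun v => (g v `^ p)%:E) by apply/measurable_EFinP; exact: mpow.
have gp0 v : (0 <= (g v `^ p)%:E)%E by rewrite lee_fin powR_ge0.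
rewrite -(ge0_integral_scale mu mgp gp0 A20); apply: ae_ge0_le_integral.
- exact: measurableT.
- by move=> v _; apply: integral_ge0 => t _; exact: (f20 (t, v)).
- exact: (@measurable_fun_fubini_tonelli_G _ _ _ _ _ lam f2 mf2 f20).
- by move=> v _; apply: mule_ge0; rewrite lee_fin ?powR_ge0.
- exact: measurable_funeM.
apply: filterS (negligible_origin) => v v0 _.
have mk2 : measurable_fun setT (fun q : MR * Z => kern al q.1 (iota v - iota q.2) * N q.2 `^ (- e2)).
  apply: measurable_funM; first exact: measurable_kern_at.
  by apply: (measurableT_comp (mN (- e2))); exact: measurable_snd.
have k20 (q : MR * Z) : 0 <= kern al q.1 (iota v - iota q.2) * N q.2 `^ (- e2) by rewrite mulr_ge0 ?kern_ge0 ?powR_ge0.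
(* The Gaussian is even, so integrating in [x] gives a potential evaluated at [v]. *)
have -> : (\int[lam]_t \int[mu]_x (H x t v)%:E =
    (W v)%:E * \int[lam]_t \int[mu]_x (kern al t (iota v - iota x) * N x `^ (- e2))%:E)%E.
  have h := @tonelli_scale _ _ _ _ _ lam (@zleb R d) _ (W v) mk2 k20 (W0 v).
  apply: etrans h; apply: eq_integral => t _.
  apply: eq_integral => x _; rewrite /H /kern -(GamN t (iota x - iota v)) opprB.
  by congr EFin; ring.
apply: (@le_trans _ _ ((W v)%:E * (A2 * N v `^ (al - e2))%:E)%E).
  by apply: lee_wpmul2l; [rewrite lee_fin|exact: h2].
rewrite -!EFinM lee_fin /W.
(* The choice of [e2] makes the powers of |v| cancel exactly. *)
have E : N v `^ (c * (p - 1)) * N v `^ (al - e2) = 1.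
  rewrite -(powRDp _ _ (znorm1_gt0 (iota v : V))) -[RHS](powRr0 (N v)); congr (_ `^ _).
  by rewrite /e2; ring.
have -> : N v `^ (c * (p - 1)) * g v `^ p * (A2 * N v `^ (al - e2)) =
    (N v `^ (c * (p - 1)) * N v `^ (al - e2)) * (A2 * g v `^ p) by ring.
by rewrite E mul1r.
Qed.

End weighted.

Lemma Stein_Weiss (p al : R) : 1 < p -> 0 < al -> al < n / p -> exists2 C : R, 0 < C &
  forall U g : Z -> R, measurable_fun setT U -> measurable_fun setT g ->
  (forall x, 0 <= U x) -> (forall x, 0 <= g x) ->
  (forall x, ((U x)%:E <= \int[lam]_t \int[mu]_v (kern al t (iota x - iota v) * g v)%:E)%E) ->
  (\int[mu]_x ((znorm (iota x : V) `^ (- al) * U x) `^ p)%:E <= C%:E * \int[mu]_v (g v `^ p)%:E)%E.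
Proof.
move=> p1 al0 aln; have p0 : 0 < p := lt_trans ltr01 p1; have p10 : 0 < p - 1 by rewrite subr_gt0.
have alpn : al * p < n by rewrite -ltr_pdivlMr.
(* The conditions c < d + 1 and al + c (p - 1) < d + 1 together say c < b. Since al < b amounts to
   al p < d + 1, the midpoint of al and b is admissible. *)
pose b := Num.min n ((n - al) / (p - 1)).
have alb : al < b.
  rewrite /b lt_min ltr_pdivlMr//; apply/andP; split; last by rewrite mulrBr mulr1 ltrD2r.
  by rewrite (lt_trans _ alpn)// ltr_pMr.
pose c := (al + b) / 2; have alc : al < c by rewrite midf_lt.
have cb : c < b by rewrite midf_lt.
have cn : c < n by rewrite (lt_le_trans cb)// ge_min lexx.
have c2 : al + c * (p - 1) < n.
  rewrite addrC -ltrBrDr -ltr_pdivlMr// (lt_le_trans cb)// ge_min lexx orbT//.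
have ale2 : al < al + c * (p - 1) by rewrite ltrDl mulr_gt0// (lt_trans al0).
have [A1 A10 h1] := kern_potential al0 alc cn.
have [A2 A20 h2] := kern_potential al0 ale2 c2.
exists (A1 `^ (p - 1) * A2); first by rewrite mulr_gt0// powR_gt0.
move=> U g mU mg U0 g0 Ug.
by apply: (@Stein_Weiss_weighted p al c) => //; exact: ltW.
Qed.

End Stein_Weiss.

(** * Hardy inequalities *)

Section ray_representation.
Context {R : realType} {d : nat}.
Notation lam := (@lebesgue_measure R).
Notation MR := (measurableTypeR R).
Local Notation V := (R * 'rV[R]_d)%type.
Local Notation Z := (MR * d.-tuple MR)%type.
Local Notation mu := (@leb_prod R d).
Implicit Types (x v : Z) (t s : R).

Definition zaff (s : R) (b v : Z) : Z := (s * v.1 + b.1 : R, taff s b.2 v.2).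

Lemma iota_zaff s b v : iota (zaff s b v) = iota b + s *: iota v :> V.
Proof.
congr pair; first by rewrite addrC.
by apply/rowP => j; rewrite !mxE tnth_mktuple addrC.
Qed.

Lemma measurable_zaff b : measurable_fun setT (fun q : Z * MR => zaff q.2 b q.1).
Proof.
have m1 : measurable_fun setT (fun q : Z * MR => q.1.1).
  by apply: (measurableT_comp (measurable_fst : measurable_fun setT (fst : Z -> MR))); exact: measurable_fst.
have m2 : measurable_fun setT (fun q : Z * MR => q.1.2).
  by apply: (measurableT_comp (measurable_snd : measurable_fun setT (snd : Z -> d.-tuple MR))); exact: measurable_fst.
apply: measurable_fun_pair.
  apply: measurable_funD; last exact: measurable_cst.
  by apply: measurable_funM; [exact: measurable_snd|exact: m1].
apply/measurable_fun_tnthP => i.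
rewrite (_ : _ \o _ = fun q : Z * MR => q.2 * (tnth q.1.2 i : R) + tnth b.2 i); last first.
  by apply/funext => q /=; rewrite tnth_mktuple.
apply: measurable_funD; last exact: measurable_cst.
apply: measurable_funM; first exact: measurable_snd.
by apply: (measurableT_comp (measurable_tnth i)).
Qed.

Lemma ge0_integral_zaff s b (F : Z -> \bar R) : s != 0 -> measurable_fun setT F -> (forall v, 0 <= F v)%E ->
  (\int[mu]_v F (zaff s b v) = (`|s| ^- d.+1)%:E * \int[mu]_v F v)%E.
Proof.
move=> s0 mF F0.
have mz : measurable_fun setT (zaff s b).
  have h : measurable_fun setT (fun v : Z => (v, s : MR)) by apply: measurable_fun_pair; [exact: measurable_id|exact: measurable_cst].
  exact: (measurableT_comp (measurable_zaff b) h).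
have p1 : measurable_fun setT (fun v => F (zaff s b v)) by exact: (measurableT_comp mF mz).
pose I q := (\int[tuple_measure lam d]_t F (q, t))%E.
have mI : measurable_fun setT (I : MR -> \bar R) by exact: (@measurable_fun_fubini_tonelli_F _ _ _ _ _ (tuple_measure lam d) F mF F0).
have I0 q : (0 <= I q)%E by apply: integral_ge0.
have a0 : 0 <= `|s| ^- d by rewrite invr_ge0 exprn_ge0.
have e1 := @fubini_tonelli1 _ _ _ _ _ lam (tuple_measure lam d) _ p1 (fun v => F0 _).
have e2 := @fubini_tonelli1 _ _ _ _ _ lam (tuple_measure lam d) _ mF F0.
apply: (etrans e1); rewrite [X in (_ * X)%E](e2).
transitivity (\int[lam]_q ((`|s| ^- d)%:E * I (s * q + b.1)%R))%E.
  apply: eq_integral => q _.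
  have mp : measurable_fun setT (fun t : d.-tuple MR => (s * q + b.1 : MR, t)).
    by apply: measurable_fun_pair; [exact: measurable_cst|exact: measurable_id].
  have h := @ge0_integral_taff R d s b.2 (fun y : d.-tuple MR => F (s * q + b.1 : R, y)) s0 (measurableT_comp mF mp) (fun y => F0 _).
  exact: h.
rewrite ge0_integral_scale//; last by apply: (measurableT_comp mI); exact: measurable_affine.
rewrite (ge0_integral_affine _ s0 mI I0) muleA -EFinM; congr (_%:E * _)%E.
by rewrite exprS invfM mulrC.
Qed.

Variable u : V -> R.
Hypotheses (su : smooth u) (bu : bsupp u).

Definition gradl1 (y : V) := `|'D_e0 u y| + \sum_(j < d) `|'D_(ev j) u y|.

Lemma gradl1_ge0 y : 0 <= gradl1 y.
Proof. by rewrite addr_ge0// sumr_ge0. Qed.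

Lemma measurable_gradl1 : measurable_fun setT (gradl1 \o @iota R d).
Proof.
have m w : measurable_fun setT (fun v : Z => `|'D_w u (iota v)|).
  by apply: measurableT_comp => //; exact: (measurable_bump (smooth_derive w su)).
by apply: measurable_funD => //; apply: measurable_sum => j.
Qed.

Lemma derive_gradl1 w y : `|'D_w u y| <= cnorm w * gradl1 y.
Proof.
rewrite smooth_deriveE// /cnorm /gradl1 mulrDl (le_trans (ler_normD _ _))// normrM lerD//.
  by rewrite ler_wpM2l// lerDl sumr_ge0.
rewrite (le_trans (ler_norm_sum _ _ _))// mulr_suml; apply: ler_sum => j _.
rewrite normrM ler_wpM2l// -[leLHS]add0r lerD//.
by rewrite (bigD1 j)//= lerDl sumr_ge0.
Qed.

(** The weight [tw 1] is the indicator of positive lengths, chosen so that the ray integral already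
    has the form of a kernel of order 1. *)
Lemma ray_bound (z w : V) : w != 0 ->
  ((`|u z|)%:E <= \int[lam]_s (tw 1 s * (cnorm w * gradl1 (z + s *: w)))%:E)%E.
Proof.
move=> w0; have [r hr] := bu; have wp : 0 < `|w| by rewrite normr_gt0.
have [cu du] := su [::]; have [cDu dDu] := su [:: w].
(* A length at which the ray has left the ball that contains the support. *)
pose S : R := (`|r| + `|z| + 1) / `|w|.
have S0 : 0 < S by rewrite divr_gt0// ltr_wpDl// addr_ge0.
have uS : u (z + S *: w) = 0.
  apply: hr; rewrite addrC; apply: (@lt_le_trans _ _ (`|S *: w| - `|z|)); last exact: lerB_normD.
  rewrite normrZ gtr0_norm// divfK ?gt_eqF// addrAC addrK (le_lt_trans (ler_norm r))//.
  by rewrite ltrDl.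
have dl (s : R) : is_derive s 1 (fun s : R => u (z + s *: w)) ('D_w u (z + s *: w)).
  by apply: is_derive_line; exact: du.
have cl (f : V -> R) : continuous f -> continuous (fun s : R => f (z + s *: w)).
  move=> cf s; apply: (@continuous_comp _ _ _ (fun s : R => z + s *: w) f); last exact: cf.
  by apply: cvgD; [exact: cvg_cst|apply: cvgZr_tmp; exact: cvg_id].
have mcl (f : V -> R) : continuous f -> measurable_fun [set: R] (fun s : R => `|f (z + s *: w)|).
  move=> cf; have h := continuous_measurable_fun (cl f cf).
  exact: (measurableT_comp (@normr_measurable R setT) h).
have mDu : measurable_fun [set: R] (fun s : R => 'D_w u (z + s *: w)).
  by apply: continuous_measurable_fun; exact: (cl ('D_w u) cDu).
have F : (\int[lam]_(s in `[0%R, S]) ('D_w u (z + s *: w))%:E = (- u z)%:E)%E.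
  rewrite (@continuous_FTC2 _ _ (fun s : R => u (z + s *: w)))//.
  - by rewrite uS scale0r addr0 -EFinB sub0r.
  - by apply: continuous_subspaceT; exact: (cl ('D_w u) cDu).
  - split.
    + by move=> s _; have := dl s => h; exact: ex_derive.
    + by apply: cvg_at_right_filter; exact: (cl u cu).
    + by apply: cvg_at_left_filter; exact: (cl u cu).
  - by move=> s _; rewrite derive1E; have := dl s => h; rewrite derive_val.
have -> : ((`|u z|)%:E = `| \int[lam]_(s in `[0%R, S]) ('D_w u (z + s *: w))%:E |)%E.
  by rewrite F /= normrN.
have mE : measurable_fun [set: R] (fun s : R => ('D_w u (z + s *: w))%:E) by exact/measurable_EFinP.
apply: (le_trans (le_abse_integral _ _ _)) => //; first exact: measurable_funTS.
rewrite -integral_itv_obnd_cbnd; last by apply: measurable_funTS; exact: measurableT_comp.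
rewrite integral_mkcond; apply: ge0_le_int.
- apply/(measurable_restrictT _ _).1 => //; apply: measurable_funTS; exact: measurableT_comp.
- apply/measurable_EFinP; apply: measurable_funM; first exact: measurable_tw.
  apply: measurable_funM; first exact: measurable_cst.
  apply: measurable_funD; first by have [c _] := su [:: e0]; exact: (mcl _ c).
  by apply: measurable_sum => j; have [c _] := su [:: ev j]; exact: (mcl _ c).
- by move=> s; rewrite patchE; case: ifP.
move=> s; rewrite patchE; case: ifPn => [|_]; last first.
  by rewrite lee_fin mulr_ge0 ?tw_ge0// mulr_ge0 ?gradl1_ge0// addr_ge0// sumr_ge0.
rewrite inE/= in_itv/= => /andP[s0 _].
by rewrite lee_fin /tw s0 subrr powRr0 mul1r derive_gradl1.
Qed.

Lemma Gam_scale c t (w : V) : 0 < c -> 0 < t -> Gam (c * t) (c *: w) = c ^- d.+1 * Gam t w.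
Proof.
move=> c0 t0; rewrite !GamE [_ * (c * t)]mulrCA exprMn invfM -!mulrA; congr (_ * (_ * expR _)).
have -> : zsq (c *: w) = c ^+ 2 * zsq w.
  rewrite /zsq mulrDr -exprMn /sqnorm mulr_sumr; congr (_ + _).
  by apply: eq_bigr => j _; rewrite mxE exprMn.
by field; rewrite !gt_eqF.
Qed.

(** The constants of [Gam_moment] at t = 1: [M] is its factor and [a] the widening of the
    Gaussian. *)
Let M : R := d.+1%:R * Num.sqrt 2 ^+ d.+1.
Let M0 : 0 <= M. Proof. by rewrite mulr_ge0// exprn_ge0// sqrtr_ge0. Qed.
Let a : R := Num.sqrt 2.
Let a0 : 0 < a. Proof. by rewrite sqrtr_gt0. Qed.

Let mGam t : 0 < t -> measurable_fun setT (fun v : Z => Gam t (iota v : V)).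
Proof.
move=> t0; have [i _] := int_Gam (0 : V) t0; have := L1_meas i.
by congr measurable_fun; apply/funext => v; rewrite sub0r GamN.
Qed.

Section at_point.
Variable x : Z.
Let H w s := tw 1 s * (M * (Gam a (iota w : V) * gradl1 (iota (zaff s x w)))).
Let H0 w s : 0 <= H w s.
Proof. by rewrite mulr_ge0 ?tw_ge0// mulr_ge0// mulr_ge0 ?gradl1_ge0 ?Gam_ge0. Qed.
Let mH : measurable_fun setT (fun q : Z * MR => H q.1 q.2).
Proof.
apply: measurable_funM.
  by apply: (measurableT_comp (@measurable_tw R 1)); exact: measurable_snd.
apply: measurable_funM; first exact: measurable_cst.
apply: measurable_funM; first by apply: (measurableT_comp (mGam a0)); exact: measurable_fst.
exact: (measurableT_comp measurable_gradl1 (measurable_zaff x)).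
Qed.

Let F t := (\int[mu]_v (kern 1 t (iota x - iota v) * (M * gradl1 (iota v)))%:E)%E.
Let mk : measurable_fun setT (fun q : MR * Z => kern 1 q.1 (iota x - iota q.2) * (M * gradl1 (iota q.2))).
Proof.
apply: measurable_funM; first exact: measurable_kern_at.
apply: measurable_funM; first exact: measurable_cst.
by apply: (measurableT_comp measurable_gradl1); exact: measurable_snd.
Qed.
Let k0 (q : MR * Z) : 0 <= kern 1 q.1 (iota x - iota q.2) * (M * gradl1 (iota q.2)).
Proof. by rewrite mulr_ge0 ?kern_ge0// mulr_ge0 ?gradl1_ge0. Qed.
Let mF : measurable_fun setT (F : MR -> \bar R).
Proof. exact: (@tonelli_measurable _ _ _ _ _ (@zleb R d) _ mk k0). Qed.
Let F0 t : (0 <= F t)%E.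
Proof. by apply: integral_ge0 => v _; rewrite lee_fin; exact: (k0 (t, v)). Qed.

(** Under v = x + s w the Jacobian cancels the dilation factor of the Gaussian, so no power of s
    remains and the length s becomes the width a s. *)
Let int_HF s : (\int[mu]_w (H w s)%:E = F (a * s + 0))%E.
Proof.
rewrite addr0; have [s0|s0] := ltP 0 s; last first.
  rewrite /F !integral0_eq// => v _.
    by rewrite kern_le0 ?mul0r// mulr_ge0_le0// ltW.
  by rewrite /H /tw ltNge s0 mul0r.
have as0 : 0 < a * s by rewrite mulr_gt0.
have mv : measurable_fun setT (fun v : Z => (a * s : MR, v)).
  by apply: measurable_fun_pair; [exact: measurable_cst|exact: measurable_id].
have mK : measurable_fun setT (fun v : Z => (kern 1 (a * s) (iota x - iota v) * (M * gradl1 (iota v)))%:E).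
  by apply/measurable_EFinP; exact: (measurableT_comp mk mv).
have h := ge0_integral_zaff x (lt0r_neq0 s0) mK (fun v => k0 (a * s, v)).
have E w : kern 1 (a * s) (iota x - iota (zaff s x w)) * (M * gradl1 (iota (zaff s x w))) = s ^- d.+1 * H w s.
  rewrite {1}iota_zaff opprD addrA subrr sub0r /kern GamN [a * s]mulrC Gam_scale//.
  by rewrite /H /tw mulr_gt0// s0 subrr !powRr0; ring.
move: h; rewrite gtr0_norm// => h.
have sn0 : 0 < s ^- d.+1 by rewrite invr_gt0 exprn_gt0.
have mHs : measurable_fun setT (fun w : Z => (H w s)%:E).
  have mw : measurable_fun setT (fun w : Z => (w, s : MR)).
    by apply: measurable_fun_pair; [exact: measurable_id|exact: measurable_cst].
  by apply/measurable_EFinP; exact: (measurableT_comp mH mw).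
have Hs0 w : (0 <= (H w s)%:E)%E by rewrite lee_fin.
have h2 : ((s ^- d.+1)%:E * \int[mu]_w (H w s)%:E = (s ^- d.+1)%:E * F (a * s))%E.
  rewrite -(ge0_integral_scale mu mHs Hs0 (ltW sn0)) -h.
  by apply: eq_integral => w _; rewrite E.
have i0 : 0 < s ^+ d.+1 by rewrite exprn_gt0.
apply: (mule_inv_inj i0 _); rewrite gtr0_norm//; exact: (esym h2).
Qed.

(** The ray bound is averaged over directions [w] with the density [Gam 1]. The factor [cnorm w]
    that it carries is absorbed by widening this Gaussian, which costs [M] and replaces the width 1
    by [a]. *)
Lemma grad_representation_at : ((`|u (iota x)|)%:E <=
  \int[lam]_t \int[mu]_v (kern 1 t (iota x - iota v) * (M * gradl1 (iota v)))%:E)%E.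
Proof.
have [i e] := int_Gam (0 : V) (@ltr01 R).
have mI := @tonelli_measurable _ _ _ _ _ lam _ mH (fun q => H0 q.1 q.2).
apply: (@le_trans _ _ (\int[mu]_w (`|u (iota x)| * Gam 1 (0 - iota w))%:E)%E).
  by rewrite -(intE (L1Z _ i)) intZ// e mulr1.
apply: (@le_trans _ _ (\int[mu]_w \int[lam]_s (H w s)%:E)%E).
  apply: ae_ge0_le_integral.
  - exact: measurableT.
  - by move=> w _; rewrite lee_fin mulr_ge0 ?Gam_ge0.
  - by apply/measurable_EFinP; exact: (L1_meas (L1Z _ i)).
  - by move=> w _; apply: integral_ge0 => s _; rewrite lee_fin.
  - exact: mI.
  apply: filterS (@negligible_origin R d) => w; rewrite zsq_gt0 => w0 _.
  have g0 : 0 <= Gam 1 (0 - iota w : V) by rewrite Gam_ge0.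
  have ms : measurable_fun [set: R] (fun s => tw 1 s * gradl1 (iota x + s *: iota w)).
    have mw : measurable_fun setT (fun s : MR => (w, s)).
      by apply: measurable_fun_pair; [exact: measurable_cst|exact: measurable_id].
    have h := measurableT_comp measurable_gradl1 (measurableT_comp (measurable_zaff x) mw).
    apply: measurable_funM; first exact: measurable_tw.
    by move: h; congr measurable_fun; apply/funext => s /=; rewrite iota_zaff.
  have mc c : measurable_fun [set: R] (fun s => (tw 1 s * (c * gradl1 (iota x + s *: iota w)))%:E).
    by apply/measurable_EFinP; under eq_fun do rewrite mulrCA; apply: measurable_funM.
  have c0 : 0 <= cnorm (iota w : V) by rewrite addr_ge0// sumr_ge0.
  have p0 s c : 0 <= c -> (0 <= (tw 1 s * (c * gradl1 (iota x + s *: iota w)))%:E)%E.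
    by move=> cc; rewrite lee_fin mulr_ge0 ?tw_ge0// mulr_ge0 ?gradl1_ge0.
  apply: (@le_trans _ _ ((Gam 1 (0 - iota w : V))%:E *
      \int[lam]_s (tw 1 s * (cnorm (iota w : V) * gradl1 (iota x + s *: iota w)))%:E)%E).
    by rewrite mulrC EFinM; apply: lee_wpmul2l; [rewrite lee_fin|exact: ray_bound].
  rewrite -(ge0_integral_scale lam (mc _) (fun s => p0 s _ c0) g0); apply: ge0_le_int.
  - by apply: measurable_funeM; exact: mc.
  - have mw : measurable_fun setT (fun s : MR => (w, s)).
      by apply: measurable_fun_pair; [exact: measurable_cst|exact: measurable_id].
    by apply/measurable_EFinP; exact: (measurableT_comp mH mw).
  - by move=> s; apply: mule_ge0; [rewrite lee_fin|exact: p0].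
  move=> s; rewrite -EFinM lee_fin /H iota_zaff mulrCA; apply: ler_wpM2l; first exact: tw_ge0.
  rewrite [leLHS]mulrA [leRHS]mulrA; apply: ler_wpM2r; first exact: gradl1_ge0.
  have := Gam_moment (iota w : V) (@ltr01 R); rewrite !mulr1 -/M -/a sub0r GamN mulrC //.
rewrite (@tonelli_swap _ _ _ _ _ (@zleb R d) lam _ mH (fun q => H0 q.1 q.2)) /=.
under eq_integral do rewrite int_HF.
rewrite (ge0_integral_affine 0 (lt0r_neq0 a0) mF F0) -[leRHS]mul1e.
apply: lee_wpmul2r; first by apply: integral_ge0.
(* The substitution a s for the width produces the factor 1 / a, which is at most 1 and is
   dropped. *)
rewrite lee_fin gtr0_norm// invf_le1// -[leLHS]sqrtr1 ler_sqrt//; lra.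
Qed.

End at_point.

End ray_representation.

Section power_sums.
Context {R : realType}.
Variable p : R.
Hypothesis p1 : 1 <= p.
Let p0 : 0 <= p. Proof. exact: le_trans p1. Qed.

Lemma powR_add_le (a b : R) : 0 <= a -> 0 <= b -> (a + b) `^ p <= 2 `^ p * (a `^ p + b `^ p).
Proof.
move=> a0 b0; wlog ab : a b a0 b0 / a <= b => [h|].
  have [/h|/ltW /h] := leP a b; first exact.
  by rewrite addrC [b `^ p + _]addrC; exact.
apply: (@le_trans _ _ ((2 * b) `^ p)).
  by apply: ge0_ler_powR => //; rewrite ?nnegrE ?addr_ge0 ?mulr_ge0//; lra.
by rewrite powRM// ler_wpM2l ?powR_ge0// lerDr powR_ge0.
Qed.

Lemma powR_sum_le I (s : seq I) (a : I -> R) : (forall i, 0 <= a i) ->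
  (\sum_(i <- s) a i) `^ p <= (2 `^ p) ^+ size s * \sum_(i <- s) a i `^ p.
Proof.
move=> a0; have c1 : 1 <= 2 `^ p :> R.
  by rewrite -[leLHS](powRr0 2); apply: ler_powR => //; rewrite ler1n.
elim: s => [|i s IH].
  by rewrite !big_nil powR0 ?mulr0// gt_eqF// (lt_le_trans ltr01).
rewrite !big_cons /= exprS -mulrA.
apply: (le_trans (powR_add_le (a0 i) (sumr_ge0 _ (fun i _ => a0 i)))).
rewrite ler_wpM2l ?powR_ge0// mulrDr lerD//.
by rewrite ler_peMl ?powR_ge0// exprn_ege1.
Qed.

Lemma poweR_sum_le I (s : seq I) (b : I -> \bar R) : (forall i, 0 <= b i)%E ->
  (\sum_(i <- s) b i `^ p <= (size s)%:R%:E * (\sum_(i <- s) b i) `^ p)%E.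
Proof.
move=> b0; elim: s => [|i s IH]; first by rewrite !big_nil mul0e.
have S0 : (0 <= \sum_(i <- s) b i)%E by exact: sume_ge0.
rewrite !big_cons /= -natr1 EFinD ge0_muleDl ?lee_fin// mul1e [leRHS]addeC.
apply: leeD.
  by apply: poweR_homo => //; rewrite leeDl.
apply: (le_trans IH); apply: lee_wpmul2l; first by rewrite lee_fin.
by apply: poweR_homo => //; rewrite leeDr.
Qed.

End power_sums.

(** * From potentials to L^p norms *)

Section Lp_estimates.
Context {R : realType} {d : nat}.
Notation lam := (@lebesgue_measure R).
Notation MR := (measurableTypeR R).
Local Notation V := (R * 'rV[R]_d)%type.
Local Notation Z := (MR * d.-tuple MR)%type.
Local Notation mu := (@leb_prod R d).
Local Open Scope complex_scope.

Lemma cmod_ge0 (z : R[i]) : 0 <= cmod z.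
Proof. by rewrite cmodE sqrtr_ge0. Qed.

Lemma Re_le_cmod (z : R[i]) : `|complex.Re z| <= cmod z.
Proof. by rewrite cmodE -sqrtr_sqr ler_sqrt ?lerDl ?sqr_ge0// addr_ge0// sqr_ge0. Qed.

Lemma Im_le_cmod (z : R[i]) : `|complex.Im z| <= cmod z.
Proof. by rewrite cmodE -sqrtr_sqr ler_sqrt ?lerDr ?sqr_ge0// addr_ge0// sqr_ge0. Qed.

Lemma cmod_le (z : R[i]) : cmod z <= `|complex.Re z| + `|complex.Im z|.
Proof.
rewrite cmodE -[leRHS]ger0_norm ?addr_ge0// -sqrtr_sqr ler_sqrt ?sqr_ge0//.
rewrite sqrrD !real_normK ?num_real// -addrA lerD2l lerDr mulrn_wge0// mulr_ge0//.
Qed.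

Lemma cmodM_real (c : R) (z : R[i]) : 0 <= c -> cmod (c%:C * z) = c * cmod z.
Proof.
move=> c0; rewrite !cmodE; case: z => a b /=.
have -> : (c * a - 0 * b) ^+ 2 + (c * b + 0 * a) ^+ 2 = c ^+ 2 * (a ^+ 2 + b ^+ 2) by ring.
by rewrite sqrtrM ?sqr_ge0// sqrtr_sqr ger0_norm.
Qed.

Lemma measurable_cmod (F : Z -> R[i]) : measurable_fun setT (fun v => complex.Re (F v)) ->
  measurable_fun setT (fun v => complex.Im (F v)) -> measurable_fun setT (fun v => cmod (F v)).
Proof.
move=> m1 m2; under eq_fun do rewrite cmodE.
have ms : measurable_fun [set: R] (@Num.sqrt R) by apply: continuous_measurable_fun; exact: sqrt_continuous.
by apply: (measurableT_comp ms); apply: measurable_funD; exact: measurable_funX.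
Qed.

Variable p : R.
Hypothesis p1 : 1 < p.
Let p0 : 0 < p. Proof. exact: lt_trans p1. Qed.

Lemma LpE (F : V -> R[i]) : Lp p F = ((\int[mu]_v (cmod (F (iota v)) `^ p)%:E) `^ p^-1)%E.
Proof.
rewrite /Lp unlock; congr (_ `^ _)%E; apply: eq_integral => v _ /=.
by rewrite ger0_norm ?cmod_ge0.
Qed.

Lemma Lp_ge0 (F : V -> R[i]) : (0 <= Lp p F)%E. Proof. exact: Lnorm_ge0. Qed.

Lemma Lp_powR (F : V -> R[i]) : (Lp p F `^ p = \int[mu]_v (cmod (F (iota v)) `^ p)%:E)%E.
Proof.
rewrite LpE -poweRrM mulVf ?gt_eqF// poweRe1//.
by apply: integral_ge0 => v _; rewrite lee_fin powR_ge0.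
Qed.

(** The p-th power of a sum and the sum of the p-th powers are compared once in each direction,
    pointwise and then for the norms; the price depends only on p and on the number of terms. *)
Lemma Lp_dominated I (s : seq I) (K : R) (F : V -> R[i]) (G : I -> V -> R[i]) : 0 <= K ->
  (forall i, measurable_fun setT (fun v : Z => cmod (G i (iota v)))) ->
  (\int[mu]_v (cmod (F (iota v)) `^ p)%:E <=
    K%:E * \int[mu]_v ((\sum_(i <- s) cmod (G i (iota v))) `^ p)%:E)%E ->
  (Lp p F <= ((K * ((2 `^ p) ^+ size s * (size s)%:R)) `^ p^-1)%:E * \sum_(i <- s) Lp p (G i))%E.
Proof.
move=> K0 mG FG.
have mGp i : measurable_fun setT (fun v : Z => (cmod (G i (iota v)) `^ p)%:E).
  by apply/measurable_EFinP; exact: (measurableT_comp (measurable_powR_l p) (mG i)).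
have Gp0 i (v : Z) : (0 <= (cmod (G i (iota v)) `^ p)%:E)%E by rewrite lee_fin powR_ge0.
pose C : R := (2 `^ p) ^+ size s.
have C0 : 0 <= C by rewrite exprn_ge0// powR_ge0.
have S0 : (0 <= \sum_(i <- s) Lp p (G i))%E by apply: sume_ge0 => i _; exact: Lp_ge0.
have h : (\int[mu]_v ((\sum_(i <- s) cmod (G i (iota v))) `^ p)%:E <=
    C%:E * ((size s)%:R%:E * (\sum_(i <- s) Lp p (G i)) `^ p))%E.
  apply: (@le_trans _ _ (\int[mu]_v (C%:E * \sum_(i <- s) (cmod (G i (iota v)) `^ p)%:E))%E).
    apply: ge0_le_int.
    - apply/measurable_EFinP; apply: (measurableT_comp (measurable_powR_l p)).
      by apply: measurable_sum => i; exact: mG.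
    - by apply: measurable_funeM; apply: emeasurable_sum => i; exact: mGp.
    - by move=> v; rewrite lee_fin powR_ge0.
    - move=> v; rewrite sumEFin -EFinM lee_fin; apply: powR_sum_le; first exact: ltW.
      by move=> i; exact: cmod_ge0.
  rewrite ge0_integral_scale//; last 2 first.
  - by apply: emeasurable_sum => i; exact: mGp.
  - by move=> v; apply: sume_ge0 => i _; exact: Gp0.
  apply: lee_wpmul2l; first by rewrite lee_fin.
  rewrite ge0_integral_sum//.
  under eq_bigr do rewrite -Lp_powR.
  by apply: poweR_sum_le; [exact: ltW|move=> i; exact: Lp_ge0].
rewrite LpE; apply: (le_trans (poweR_homo _ _ (le_trans FG (lee_wpmul2l _ h)))).
- by rewrite invr_ge0 ltW.
- by apply: integral_ge0 => v _; rewrite lee_fin powR_ge0.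
- by rewrite lee_fin.
rewrite !muleA -!EFinM poweRM ?poweR_ge0//; last by rewrite lee_fin !mulr_ge0.
by rewrite -poweRrM mulfV ?gt_eqF// poweRe1// poweR_EFin mulrA.
Qed.

Section Hardy.
Variable al : R.
Hypotheses (al0 : 0 < al) (aln : al < d.+1%:R / p).

(** The common final step of both inequalities. The family [G] is either the single fractional power
    of the oscillator or the 2 d + 1 components of the gradient; [D] compares it with the majorants
    [a] and [b] of the real and the imaginary part. *)
Lemma Stein_Weiss_Lp : exists2 C : R, 0 < C &
  forall I (s : seq I) (f : V -> R[i]) (a b : Z -> R) (G : I -> V -> R[i]) (D : R), 0 <= D ->
  test_function f ->
  measurable_fun setT a -> measurable_fun setT b -> (forall v, 0 <= a v) -> (forall v, 0 <= b v) ->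
  (forall x, ((`|complex.Re (f (iota x))|)%:E <= \int[lam]_t \int[mu]_v (kern al t (iota x - iota v) * a v)%:E)%E) ->
  (forall x, ((`|complex.Im (f (iota x))|)%:E <= \int[lam]_t \int[mu]_v (kern al t (iota x - iota v) * b v)%:E)%E) ->
  (forall i, measurable_fun setT (fun v : Z => cmod (G i (iota v)))) ->
  (forall v, a v + b v <= D * \sum_(i <- s) cmod (G i (iota v))) ->
  (Lp p (fun z => (znorm z `^ (- al))%:C * f z)%R <=
   ((C * D `^ p * ((2 `^ p) ^+ size s * (size s)%:R)) `^ p^-1)%:E * \sum_(i <- s) Lp p (G i))%E.
Proof.
have [C C0 hC] := @Stein_Weiss R d p al p1 al0 aln; exists C => // I s f a b G D D0 tf ma mb a0 b0 ha hb mG abG.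
have [su sv bu bv] := test_bsupp tf.
pose U (x : Z) := `|complex.Re (f (iota x))| + `|complex.Im (f (iota x))|.
have mRe := measurable_bump su; have mIm := measurable_bump sv.
have mU : measurable_fun setT U by apply: measurable_funD; apply: measurableT_comp.
have U0 x : 0 <= U x by rewrite addr_ge0.
have mk c (x : Z) : measurable_fun setT c -> measurable_fun setT (fun q : MR * Z => kern al q.1 (iota x - iota q.2) * c q.2).
  move=> mc; apply: measurable_funM; first exact: measurable_kern_at.
  by apply: (measurableT_comp mc); exact: measurable_snd.
have mks c (x : Z) (t : R) : measurable_fun setT c -> measurable_fun setT (fun v : Z => (kern al t (iota x - iota v) * c v)%:E).
  move=> mc; have mv : measurable_fun setT (fun v : Z => (t : MR, v)).
    by apply: measurable_fun_pair; [exact: measurable_cst|exact: measurable_id].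
  by apply/measurable_EFinP; exact: (measurableT_comp (mk c x mc) mv).
have k0 (c : Z -> R) (x : Z) (t : R) v : (forall v, 0 <= c v) -> (0 <= (kern al t (iota x - iota v) * c v)%:E)%E.
  by move=> c0; rewrite lee_fin mulr_ge0 ?kern_ge0.
have UI x : ((U x)%:E <= \int[lam]_t \int[mu]_v (kern al t (iota x - iota v) * (a v + b v))%:E)%E.
  apply: (@le_trans _ _ (\int[lam]_t \int[mu]_v (kern al t (iota x - iota v) * a v)%:E +
      \int[lam]_t \int[mu]_v (kern al t (iota x - iota v) * b v)%:E)%E).
    by rewrite EFinD leeD.
  rewrite -ge0_integralD//; last 4 first.
  - by move=> t _; apply: integral_ge0 => v _; exact: k0.
  - by apply: (@tonelli_measurable _ _ _ _ _ (@zleb R d) _ (mk a x ma)) => q; rewrite mulr_ge0 ?kern_ge0.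
  - by move=> t _; apply: integral_ge0 => v _; exact: k0.
  - by apply: (@tonelli_measurable _ _ _ _ _ (@zleb R d) _ (mk b x mb)) => q; rewrite mulr_ge0 ?kern_ge0.
  rewrite le_eqVlt; apply/orP; left; apply/eqP; apply: eq_integral => t _.
  rewrite -ge0_integralD//; [|by move=> v _; exact: k0|exact: mks|by move=> v _; exact: k0|exact: mks].
  by apply: eq_integral => v _; rewrite -EFinD mulrDr.
have ab0 v : 0 <= a v + b v by rewrite addr_ge0.
have h := hC U (fun v => a v + b v) mU (measurable_funD ma mb) U0 ab0 UI.
apply: Lp_dominated => //; first by rewrite mulr_ge0 ?powR_ge0// ltW.
have ms : measurable_fun [set: R] (@Num.sqrt R) by apply: continuous_measurable_fun; exact: sqrt_continuous.
have mz : measurable_fun setT (fun x : Z => znorm (iota x : V)).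
  exact: (measurableT_comp ms (measurable_zsq (@measurable_id _ Z setT))).
have mw : measurable_fun setT (fun x : Z => znorm (iota x : V) `^ (- al)).
  exact: (measurableT_comp (measurable_powR_l _) mz).
have mS : measurable_fun setT (fun v : Z => \sum_(i <- s) cmod (G i (iota v))).
  by apply: measurable_sum => i; exact: mG.
apply: (@le_trans _ _ (\int[mu]_x ((znorm (iota x : V) `^ (- al) * U x) `^ p)%:E)%E).
  apply: ge0_le_int.
  - apply/measurable_EFinP; apply: (measurableT_comp (measurable_powR_l p)).
    under eq_fun do rewrite cmodM_real ?powR_ge0//.
    by apply: measurable_funM => //; apply: measurable_cmod.
  - apply/measurable_EFinP; apply: (measurableT_comp (measurable_powR_l p)).
    exact: measurable_funM.
  - by move=> v; rewrite lee_fin powR_ge0.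
  - move=> v; rewrite lee_fin cmodM_real ?powR_ge0//.
    apply: ge0_ler_powR; rewrite ?nnegrE ?mulr_ge0 ?powR_ge0 ?cmod_ge0 ?(ltW p0)//.
    by rewrite ler_wpM2l ?powR_ge0// cmod_le.
apply: (le_trans h); rewrite EFinM -muleA; apply: lee_wpmul2l; first by rewrite lee_fin ltW.
have mSp : measurable_fun setT (fun v : Z => ((\sum_(i <- s) cmod (G i (iota v))) `^ p)%:E).
  by apply/measurable_EFinP; exact: (measurableT_comp (measurable_powR_l p) mS).
have Sp0 (v : Z) : (0 <= ((\sum_(i <- s) cmod (G i (iota v))) `^ p)%:E)%E by rewrite lee_fin powR_ge0.
rewrite -(ge0_integral_scale mu mSp Sp0 (powR_ge0 D p)); apply: ge0_le_int.
- by apply/measurable_EFinP; apply: (measurableT_comp (measurable_powR_l p)); exact: measurable_funD.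
- exact: measurable_funeM.
- by move=> v; rewrite lee_fin powR_ge0.
have Sg0 (v : Z) : 0 <= \sum_(i <- s) cmod (G i (iota v)) by apply: sumr_ge0 => i _; exact: cmod_ge0.
move=> v; rewrite -EFinM lee_fin -powRM//.
by apply: ge0_ler_powR; rewrite ?nnegrE ?(ltW p0)// mulr_ge0.
Qed.

End Hardy.
End Lp_estimates.

Section Hardy_inequalities.
Context {R : realType} {d : nat}.
Notation lam := (@lebesgue_measure R).
Notation MR := (measurableTypeR R).
Local Notation V := (R * 'rV[R]_d)%type.
Local Notation Z := (MR * d.-tuple MR)%type.
Local Notation mu := (@leb_prod R d).

(** The reproducing formula divided by [Kint al]. Absolute values are taken inside, and for each t >
    0 the positive heat kernel gives way to its Gaussian majorant. *)
Lemma fractional_representation (u : V -> R) (al : R) (x : Z) : (0 < d)%N -> smooth u -> bsupp u -> 0 < al ->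
  ((`|u (iota x)|)%:E <= \int[lam]_t \int[mu]_v (kern al t (iota x - iota v) *
    ((Kint al)^-1 * `|hlim u (al / 2) (iota v)|))%:E)%E.
Proof.
move=> d0 su bu al0; have K0 := Kint_gt0 al0; pose z : V := iota x.
have sg0 : 0 <= al / 2 by rewrite divr_ge0// ltW.
have [i e] := int_tw_heat_hlim d0 su bu sg0 z al0 erefl.
have mh := measurable_hlim (al / 2) d0 su bu.
have [C C0 hC] := hlim_bound (al / 2) d0 su bu.
have mha : measurable_fun setT (fun v : Z => (Kint al)^-1 * `|hlim u (al / 2) (iota v)|).
  by apply: measurable_funM; [exact: measurable_cst|exact: measurableT_comp].
have ha0 (v : Z) : 0 <= (Kint al)^-1 * `|hlim u (al / 2) (iota v)|.
  by rewrite mulr_ge0// invr_ge0 ltW.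
have mk : measurable_fun setT (fun q : MR * Z => kern al q.1 (iota x - iota q.2) * ((Kint al)^-1 * `|hlim u (al / 2) (iota q.2)|)).
  apply: measurable_funM; first exact: measurable_kern_at.
  by apply: (measurableT_comp mha); exact: measurable_snd.
have iK := L1Z (Kint al)^-1 (L1_norm i).
have eu : `|u z| <= \int[lam]_t ((Kint al)^-1 * `|tw al t * \int[mu]_v (heat t z (iota v) * hlim u (al / 2) (iota v))|).
  rewrite intZ; last exact: L1_norm.
  rewrite mulrC ler_pdivlMr// mulrC -[Kint al]gtr0_norm// -normrM -e.
  by apply: int_abs_le; [exact: (L1_meas i)|exact: L1_norm|].
apply: (@le_trans _ _ (\int[lam]_t ((Kint al)^-1 * `|tw al t * \int[mu]_v (heat t z (iota v) * hlim u (al / 2) (iota v))|)%:E)%E).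
  by rewrite -(intE iK) lee_fin.
apply: ge0_le_int.
- by apply/measurable_EFinP; exact: (L1_meas iK).
- by apply: (@tonelli_measurable _ _ _ _ _ (@zleb R d) _ mk) => q; rewrite mulr_ge0 ?kern_ge0.
- by move=> t; rewrite lee_fin mulr_ge0// invr_ge0 ltW.
move=> t; have [t0|t0] := ltP 0 t; last first.
  rewrite /tw ltNge t0 mul0r normr0 mulr0; apply: integral_ge0 => v _.
  by rewrite lee_fin mulr_ge0 ?kern_ge0.
have [iG _] := int_Gam z t0; have iH := L1_heat z t0.
have mG : measurable_fun setT (fun v : Z => Gam t (z - iota v) * `|hlim u (al / 2) (iota v)|).
  by apply: measurable_funM; [exact: (L1_meas iG)|exact: measurableT_comp].
have iGh : L1 mu (fun v => Gam t (z - iota v) * `|hlim u (al / 2) (iota v)|).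
  apply: (L1_le mG (L1Z C iG)) => v.
  by rewrite normrM normr_id (ger0_norm (Gam_ge0 _ t0)) mulrC ler_wpM2r ?Gam_ge0.
have E v : kern al t (iota x - iota v) * ((Kint al)^-1 * `|hlim u (al / 2) (iota v)|) =
    tw al t * (Kint al)^-1 * (Gam t (z - iota v) * `|hlim u (al / 2) (iota v)|).
  by rewrite /kern; ring.
under eq_integral do rewrite E.
rewrite -(intE (L1Z _ iGh)) lee_fin intZ// normrM (ger0_norm (tw_ge0 _ _)) mulrCA [leRHS]mulrAC -[leRHS]mulrA.
rewrite ler_wpM2l ?tw_ge0// [leRHS]mulrC ler_wpM2l ?invr_ge0 ?(ltW K0)//.
apply: int_abs_le => //.
  by apply: measurable_funM => //; exact: (L1_meas iH).
move=> v; rewrite normrM ler_wpM2r// ger0_norm ?heat_ge0//; exact: heat_le.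
Qed.

Local Open Scope complex_scope.
Variable p : R.
Hypothesis p1 : 1 < p.

Lemma Hardy_fractional (al : R) : (0 < d)%N -> 0 < al -> al < d.+1%:R / p ->
  exists C : R, 0 < C /\ forall f : V -> R[i], test_function f ->
    (Lp p (fun z => (znorm z `^ (- al))%:C * f z)%R <= C%:E * Lp p (Hpar_pow (al / 2)%R f))%E.
Proof.
move=> d0 al0 aln; have [C C0 hC] := @Stein_Weiss_Lp R d p p1 al al0 aln.
(* The factor 2 pays for bounding both the real and the imaginary part by the modulus. *)
have K0 := Kint_gt0 al0; pose D := 2 * (Kint al)^-1.
have D0 : 0 < D by rewrite mulr_gt0// invr_gt0.
exists ((C * D `^ p * ((2 `^ p) ^+ 1 * 1%:R)) `^ p^-1); split.
  by rewrite powR_gt0// mulr_gt0 ?mulr_gt0 ?powR_gt0// exprn_gt0// powR_gt0.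
move=> f tf; have [su sv bu bv] := test_bsupp tf.
have HE := Hpar_powE (al / 2) d0 tf.
have mu_ := measurable_hlim (al / 2) d0 su bu.
have mv_ := measurable_hlim (al / 2) d0 sv bv.
pose a (w : V -> R) (v : Z) := (Kint al)^-1 * `|hlim w (al / 2) (iota v)|.
have ma w : measurable_fun setT (hlim w (al / 2) \o @iota R d) -> measurable_fun setT (a w).
  by move=> mw; apply: measurable_funM; [exact: measurable_cst|exact: measurableT_comp].
have a0 w v : 0 <= a w v by rewrite mulr_ge0// invr_ge0 ltW.
have := hC unit [:: tt] f (a (fun z => complex.Re (f z))) (a (fun z => complex.Im (f z)))
  (fun _ => Hpar_pow (al / 2) f) D (ltW D0) tf (ma _ mu_) (ma _ mv_) (a0 _) (a0 _)
  (fun x => fractional_representation x d0 su bu al0) (fun x => fractional_representation x d0 sv bv al0).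
rewrite big_seq1; apply.
  have HF : (fun w : Z => cmod (Hpar_pow (al / 2) f (iota w))) =
      fun w => cmod (hlim (fun z => complex.Re (f z)) (al / 2) (iota w) +i* hlim (fun z => complex.Im (f z)) (al / 2) (iota w)).
    by apply/funext => w; rewrite HE.
  by move=> _; rewrite HF; exact: (@measurable_cmod R d (fun w => hlim (fun z => complex.Re (f z)) (al / 2) (iota w) +i*
    hlim (fun z => complex.Im (f z)) (al / 2) (iota w)) mu_ mv_).
move=> v; rewrite big_seq1 /a -mulrDr /D mulrAC [leRHS]mulrC ler_wpM2l ?invr_ge0 ?(ltW K0)//.
rewrite HE mulr_natl mulr2n; apply: lerD.
  exact: (Re_le_cmod (hlim _ _ (iota v) +i* hlim _ _ (iota v))).
exact: (Im_le_cmod (hlim _ _ (iota v) +i* hlim _ _ (iota v))).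
Qed.

Lemma Hardy_gradient : p < d.+1%:R ->
  exists C : R, 0 < C /\ forall f : V -> R[i], test_function f ->
    (Lp p (fun z => ((znorm z)^-1)%:C * f z)%R <= C%:E * Lp_grad p f)%E.
Proof.
move=> pn; have p0 : 0 < p := lt_trans ltr01 p1.
have aln : 1 < d.+1%:R / p by rewrite ltr_pdivlMr// mul1r.
have [C C0 hC] := @Stein_Weiss_Lp R d p p1 1 ltr01 aln.
pose M : R := d.+1%:R * Num.sqrt 2 ^+ d.+1.
have M0 : 0 < M by rewrite mulr_gt0// exprn_gt0// sqrtr_gt0.
(* Indices of the gradient: [None] for A_0, the boolean false for A_j and true for A_-j. *)
pose s : seq (option (bool * 'I_d)) := None :: [seq Some (false, j) | j <- index_enum 'I_d] ++
  [seq Some (true, j) | j <- index_enum 'I_d].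
pose D := 2 * M; have D0 : 0 < D by rewrite mulr_gt0.
exists ((C * D `^ p * ((2 `^ p) ^+ size s * (size s)%:R)) `^ p^-1); split.
  by rewrite powR_gt0// mulr_gt0 ?mulr_gt0 ?powR_gt0// ?exprn_gt0 ?powR_gt0// ltr0n.
move=> f tf; have [su sv bu bv] := test_bsupp tf.
pose u z := complex.Re (f z); pose v z := complex.Im (f z).
pose G (i : option (bool * 'I_d)) : V -> R[i] :=
  match i with None => A_zero f | Some (b, j) => if b then A_minus j f else A_plus j f end.
pose a (w : V -> R) (q : Z) := M * gradl1 w (iota q).
have ma w : smooth w -> measurable_fun setT (a w).
  by move=> sw; apply: measurable_funM; [exact: measurable_cst|exact: (measurable_gradl1 sw)].
have a0 w q : 0 <= a w q by rewrite mulr_ge0 ?gradl1_ge0// ltW.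
have mD w e : smooth w -> measurable_fun setT (fun q : Z => 'D_e w (iota q)).
  by move=> sw; exact: (measurable_bump (smooth_derive e sw)).
have mx j : measurable_fun setT (fun q : Z => (iota q : V).2 0 j).
  have := measurable_tnth_comp j (@measurable_id _ R setT).
  by congr measurable_fun; apply/funext => q; rewrite mxE.
have ReE b j z : complex.Re (G (Some (b, j)) z) = (-1) ^+ (~~ b) * 'D_(ev j) u z + z.2 0 j * u z.
  case: b => /=; rewrite /A_minus /A_plus /cderive /u; case: (f z) => x y /=; rewrite ?expr1 ?expr0; ring.
have ImE b j z : complex.Im (G (Some (b, j)) z) = (-1) ^+ (~~ b) * 'D_(ev j) v z + z.2 0 j * v z.
  case: b => /=; rewrite /A_minus /A_plus /cderive /v; case: (f z) => x y /=; rewrite ?expr1 ?expr0; ring.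
have mG i : measurable_fun setT (fun q : Z => cmod (G i (iota q))).
  case: i => [[b j]|]; apply: measurable_cmod.
  - under eq_fun do rewrite ReE; apply: measurable_funD; apply: measurable_funM => //.
      exact: mD.
    exact: (measurable_bump su).
  - under eq_fun do rewrite ImE; apply: measurable_funD; apply: measurable_funM => //.
      exact: mD.
    exact: (measurable_bump sv).
  - by apply: measurableT_comp => //; exact: (mD u e0 su).
  - by apply: measurableT_comp => //; exact: (mD v e0 sv).
have sumE (T : nmodType) (h : option (bool * 'I_d) -> T) : \sum_(i <- s) h i =
    h None + \sum_(j < d) h (Some (false, j)) + \sum_(j < d) h (Some (true, j)).
  by rewrite big_cons big_cat !big_map addrA.
have := hC _ s f (a u) (a v) G D (ltW D0) tf (ma u su) (ma v sv) (a0 u) (a0 v)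
  (fun x => grad_representation_at su bu x) (fun x => grad_representation_at sv bv x) mG.
rewrite sumE /Lp_grad /=.
(* The two weights also agree at the origin, where both are 0 by convention. *)
rewrite (_ : (fun z => (znorm z `^ (- 1))%:C * f z) = fun z => ((znorm z)^-1)%:C * f z); last first.
  by apply/funext => z; rewrite powR_inv1// sqrtr_ge0.
move=> H; apply: H => q; rewrite sumE /a -mulrDr /D.
set X := (X in _ <= _ * X); have -> : 2 * M * X = M * (2 * X) by ring.
rewrite ler_wpM2l ?(ltW M0)// /X.
have g (w : V -> R) : (forall i, `|(if i is Some (b, j) then (-1) ^+ (~~ b) * 'D_(ev j) w (iota q) + (iota q).2 0 j * w (iota q)
    else - 'D_e0 w (iota q))| <= cmod (G i (iota q))) -> gradl1 w (iota q) <= cmod (G None (iota q)) +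
    \sum_(j < d) cmod (G (Some (false, j)) (iota q)) + \sum_(j < d) cmod (G (Some (true, j)) (iota q)).
  move=> h; rewrite /gradl1 -addrA lerD//.
    by have := h None; rewrite normrN.
  rewrite -big_split; apply: ler_sum => j _ /=.
  have := h (Some (false, j)); have := h (Some (true, j)); rewrite /= expr0 expr1 mul1r mulN1r.
  set D1 := 'D_(ev j) w _; set Y := _ * _; move=> h1 h2.
  (* The derivative along x_j is half the difference of A_-j and A_j, in which the multiplication by
     x_j cancels. *)
  have gen (a1 b1 : R) : 2 * `|a1| <= `|a1 + b1| + `|- a1 + b1|.
    have -> : 2 * `|a1| = `|(a1 + b1) - (- a1 + b1)|.
      by rewrite -[2]ger0_norm// -normrM; congr `|_|; ring.
    exact: ler_normB.
  have := gen D1 Y.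
  have := normr_ge0 (D1 + Y); have := normr_ge0 (- D1 + Y); lra.
rewrite mulr_natl mulr2n; apply: lerD; apply: g.
- move=> [[b j]|]; first by rewrite -ReE Re_le_cmod.
  exact: (Re_le_cmod (A_zero f (iota q))).
- move=> [[b j]|]; first by rewrite -ImE Im_le_cmod.
  exact: (Im_le_cmod (A_zero f (iota q))).
Qed.

End Hardy_inequalities.
Local Open Scope complex_scope.

Theorem theorem5p6 (R : realType) (d : nat) (p : R)
    (d_ge1 : (1 <= d)%N) (p_gt1 : 1 < p) :
  (forall alpha : R, 0 < alpha -> alpha < d.+1%:R / p ->
    exists C : R, 0 < C /\
      forall f : R * 'rV[R]_d -> R[i], test_function f ->
        (Lp p (fun z => (znorm z `^ (- alpha))%:C * f z)%R
          <= C%:E * Lp p (Hpar_pow (alpha / 2)%R f))%E) /\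
  (p < d.+1%:R ->
    exists C : R, 0 < C /\
      forall f : R * 'rV[R]_d -> R[i], test_function f ->
        (Lp p (fun z => ((znorm z)^-1)%:C * f z)%R
          <= C%:E * Lp_grad p f)%E).
Proof.
split; last exact: Hardy_gradient.
by move=> alpha alpha0 alphan; exact: Hardy_fractional.
Qed.
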